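(* Let $e\in L^\infty(\Omega)$ satisfy $\int_\Omega e\,\varphi_1\,dx=0$. Assume that $g\in C^1(\mathbb R)$ satisfies $$u\,g(u)>0\quad\text{for all }u\in\mathbb R\setminus\{0\},\qquad g'(u)\le\gamma<\lambda_2-\lambda_1\quad\text{for all }u\in\mathbb R,$$ for some constant $\gamma$. Consider the problem, for the unknown pair $(u,\mu_1)$, $$\Delta u+\lambda_1u+g(u)=\mu_1\varphi_1+e(x)\ \text{ in }\Omega,\qquad u=0\ \text{ on }\partial\Omega. \qquad ( * )$$ Then there is a continuous curve $\xi_1\mapsto(u(\xi_1),\mu_1(\xi_1))$, $-\infty<\xi_1<\infty$, of solutions of $( * )$ with $u(\xi_1)\in H^2(\Omega)\cap H^1_0(\Omega)$, $\mu_1(\xi_1)\in\mathbb R$ and $\int_\Omega u(\xi_1)\varphi_1\,dx=\xi_1$, and this curve exhausts the solution set of $( * )$. The continuous function $\mu_1(\xi_1)$ is positive for all sufficiently large $\xi_1>0$, and negative for all $\xi_1<0$ with $|\xi_1|$ sufficiently large. In particular, $\mu_1(\xi_1^0)=0$ for some $\xi_1^0\in\mathbb R$, i.e. the problem $\Delta u+\lambda_1u+g(u)=e(x)$ in $\Omega$, $u=0$ on $\partial\Omega$, has a solution.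
   Context: $\Omega\subset\mathbb R^m$ is a smooth bounded domain. $0<\lambda_1<\lambda_2\le\lambda_3\le\dots\to\infty$ are the eigenvalues of $-\Delta$ on $\Omega$ with zero Dirichlet boundary condition, repeated according to multiplicity, and $\varphi_1,\varphi_2,\dots$ are corresponding eigenfunctions forming an orthonormal basis of $L^2(\Omega)$, with $\varphi_1>0$ in $\Omega$. Solutions are in $H^2(\Omega)\cap H^1_0(\Omega)$, with equations understood almost everywhere; the curve is continuous in $H^2(\Omega)\times\mathbb R$. *)

(* Defs.v *)
(* Points of R^m are row vectors 'rV[R]_m. *)
From HB Require Import structures.
From mathcomp Require Import all_boot all_order all_algebra.
From mathcomp Require Import all_classical all_reals all_analysis.
Set Implicit Arguments.
Unset Strict Implicit.
Unset Printing Implicit Defensive.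
Import Order.TTheory GRing.Theory Num.Theory.
Import numFieldNormedType.Exports.
Local Open Scope classical_set_scope.
Local Open Scope ring_scope.

(* The sigma-algebra on R^n generated by the coordinate maps, i.e. the Borel
   sigma-algebra (same construction as the library's one on n.-tuple T). *)
Definition rV_display : measure_display. Proof. exact: default_measure_display. Qed.

Section measurable_rV.
Context {R : realType} {n : nat}.

Definition rV_coord (i : 'I_n) (x : 'rV[R]_n) : measurableTypeR R := x ord0 i.

Let rV_set0 : g_sigma_preimage rV_coord set0.
Proof. exact: sigma_algebra0. Qed.

Let rV_setC A : g_sigma_preimage rV_coord A -> g_sigma_preimage rV_coord (~` A).
Proof. exact: sigma_algebraC. Qed.

Let rV_bigcup (F : _^nat) : (forall i, g_sigma_preimage rV_coord (F i)) ->
  g_sigma_preimage rV_coord (\bigcup_i (F i)).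
Proof. exact: sigma_algebra_bigcup. Qed.

HB.instance Definition _ := @isMeasurable.Build rV_display
  'rV[R]_n (g_sigma_preimage rV_coord) rV_set0 rV_setC rV_bigcup.

End measurable_rV.

Section measurable_rV_lemmas.
Context {R : realType}.

Lemma measurable_rV_coord n (i : 'I_n) :
  measurable_fun setT (@rV_coord R n i).
Proof.
move=> _ Y mY; rewrite setTI; apply: sub_sigma_algebra => /=.
rewrite -bigcup_seq/=; exists i => /=; first by rewrite mem_index_enum.
by exists Y => //; rewrite setTI.
Qed.

Lemma measurable_fun_rV d (T : measurableType d) n (f : T -> 'rV[R]_n) :
  (forall i, measurable_fun setT (rV_coord i \o f)) -> measurable_fun setT f.
Proof.
move=> mf; apply: (@measurability _ _ _ _ _ _
  (\big[setU/set0]_(i < n) preimage_set_system setT (@rV_coord R n i) measurable)) => //.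
move=> _ [B + <-]; rewrite -bigcup_seq => -[i _ [C mC <-]].
by rewrite setTI -comp_preimage; exact: mf.
Qed.

Definition rV_cons n (p : measurableTypeR R * 'rV[R]_n) : 'rV[R]_n.+1 :=
  \row_i oapp (p.2 ord0) p.1 (unlift ord0 i).

Definition rV_uncons n (x : 'rV[R]_n.+1) : measurableTypeR R * 'rV[R]_n :=
  (x ord0 ord0, \row_j x ord0 (lift ord0 j)).

Lemma rV_consK n : cancel (@rV_cons n) (@rV_uncons n).
Proof.
move=> [a v]; rewrite /rV_uncons !mxE unlift_none; congr pair.
by apply/rowP => j; rewrite !mxE liftK.
Qed.

Lemma measurable_rV_cons n : measurable_fun setT (@rV_cons n).
Proof.
apply: measurable_fun_rV => i.
rewrite [X in measurable_fun _ X](_ : _ = fun p =>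
  oapp (fun j => rV_coord j p.2) p.1 (unlift ord0 i)); last first.
  by apply/funext => p; rewrite /= /rV_coord mxE; case: (unlift _ _).
case: (unlift ord0 i) => [j|] /=; last exact: measurable_fst.
exact: (measurableT_comp (measurable_rV_coord j) measurable_snd).
Qed.

Lemma measurable_rV_uncons n : measurable_fun setT (@rV_uncons n).
Proof.
apply: measurable_fun_pair; first exact: (measurable_rV_coord ord0).
apply: measurable_fun_rV => j.
rewrite [X in measurable_fun _ X](_ : _ = rV_coord (lift ord0 j)).
  exact: measurable_rV_coord.
by apply/funext => x; rewrite /= /rV_coord mxE.
Qed.

End measurable_rV_lemmas.

Section lebesgue_rV_step.
Context {R : realType} (n : nat).
Variable mu : {sigma_finite_measure set 'rV[R]_n -> \bar R}.

Let leb1 : {sigma_finite_measure set (measurableTypeR R) -> \bar R} :=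
  @lebesgue_measure R.

Definition lebesgue_rV_step : set 'rV[R]_n.+1 -> \bar R :=
  pushforward (leb1 \x mu)%E (@rV_cons R n).

HB.instance Definition _ := Measure.copy lebesgue_rV_step
  (measure_function_pushforward__canonical__measure_function_Measure
     (leb1 \x mu)%E (@measurable_rV_cons R n)).

Let step_sigma_finite : sigma_finite setT lebesgue_rV_step.
Proof.
have /sigma_finiteP[F [TF ndF mF]] := sigma_finiteT leb1.
have /sigma_finiteP[G [TG ndG mG]] := sigma_finiteT mu.
exists (fun k => @rV_uncons R n @^-1` (F k `*` G k)).
  rewrite -preimage_bigcup (_ : \bigcup_k _ = setT) ?preimage_setT//.
  rewrite -subTset => -[x y] _.
  have [i _ Fx] : (\bigcup_i F i) x by rewrite -TF.
  have [j _ Gy] : (\bigcup_i G i) y by rewrite -TG.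
  exists (maxn i j) => //; split => /=.
    by move: x Fx; exact/subsetPset/ndF/leq_maxl.
  by move: y Gy; exact/subsetPset/ndG/leq_maxr.
move=> k; have [mFk Fk] := mF k; have [mGk Gk] := mG k; split.
  rewrite -[X in measurable X]setTI; apply: measurable_rV_uncons => //.
  exact: measurableX.
rewrite /lebesgue_rV_step /pushforward -comp_preimage.
rewrite (_ : _ \o _ = id); last by rewrite funeqE => p /=; rewrite rV_consK.
by rewrite /= product_measure1E// lte_mul_pinfty// ge0_fin_numE.
Qed.

HB.instance Definition _ := @Measure_isSigmaFinite.Build _ _ _
  lebesgue_rV_step step_sigma_finite.

End lebesgue_rV_step.

(* Lebesgue measure on the Borel sets of R^n, as an n-fold product measure. *)
Fixpoint lebesgue_rV (R : realType) (n : nat) :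
    {sigma_finite_measure set 'rV[R]_n -> \bar R} :=
  match n with
  | 0%N => \d_(0 : 'rV[R]_0)
  | k.+1 => lebesgue_rV_step (lebesgue_rV R k)
  end.

Section sobolev.
Context {R : realType} {m : nat}.
Implicit Types (Omega : set 'rV[R]_m) (u v f : 'rV[R]_m -> R).

Definition basis_vec (i : 'I_m) : 'rV[R]_m := delta_mx ord0 i.

Definition pderiv (i : 'I_m) f : 'rV[R]_m -> R := fun x => 'D_(basis_vec i) f x.

(* Classical iterated partial derivative; the multi-index is given as the list
   of the directions of differentiation. *)
Definition pderivs (s : seq 'I_m) f : 'rV[R]_m -> R := foldr pderiv f s.

Definition smooth f : Prop :=
  forall s : seq 'I_m, continuous (pderivs s f) /\
    forall i x, derivable (pderivs s f) x (basis_vec i).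

(* Near each boundary point, after relabeling and reorienting the axes, Omega
   is the strict epigraph of a smooth function h of the coordinates other than
   x_i. *)
Definition smooth_boundary Omega : Prop :=
  forall x0, (closure Omega `\` Omega°) x0 ->
  exists (i : 'I_m) (sg : bool) (h : 'rV[R]_m -> R),
    [/\ smooth h,
        forall x t, h (x + t *: basis_vec i) = h x &
        \forall x \near x0, Omega x <-> h x < (-1) ^+ sg * x ord0 i].

Definition smooth_bounded_domain Omega : Prop :=
  [/\ open Omega, connected Omega, Omega !=set0, bounded_set Omega &
      smooth_boundary Omega].

(* C_c^oo(Omega) *)
Definition test_function Omega f : Prop :=
  smooth f /\ exists K : set 'rV[R]_m,
    [/\ compact K, K `<=` Omega & forall x, ~ K x -> f x = 0].

(* As everywhere below, functions on Omega are represented by functions on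
   R^m whose values outside Omega are irrelevant. *)
Definition L2 Omega u : Prop :=
  measurable_fun Omega u /\
  (lebesgue_rV R m).-integrable Omega (fun x => (u x ^+ 2)%:E).

Definition Linfty Omega u : Prop :=
  measurable_fun Omega u /\
  exists M : R, \forall x \ae lebesgue_rV R m, Omega x -> `|u x| <= M.

Definition dotL2 Omega u v : R :=
  (\int[lebesgue_rV R m]_(x in Omega) (u x * v x))%R.

Definition normL2 Omega u : R := Num.sqrt (dotL2 Omega u u).

Definition is_weak_deriv Omega (s : seq 'I_m) u v : Prop :=
  forall f, test_function Omega f ->
    dotL2 Omega u (pderivs s f) = (-1) ^+ size s * dotL2 Omega v f.

(* The weak derivative (unique up to a null set) as a total operator: it
   is 0 if u has no weak derivative in L^2. *)
Definition weak_deriv Omega (s : seq 'I_m) u : 'rV[R]_m -> R :=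
  xget (cst 0) [set v | L2 Omega v /\ is_weak_deriv Omega s u v].

(* H^k(Omega) = W^{k,2}(Omega) *)
Definition sobolevH Omega (k : nat) u : Prop :=
  L2 Omega u /\ forall s : seq 'I_m, (size s <= k)%N ->
    exists v, L2 Omega v /\ is_weak_deriv Omega s u v.

Definition normH Omega (k : nat) u : R :=
  Num.sqrt (\sum_(j < k.+1) \sum_(s : j.-tuple 'I_m)
    normL2 Omega (weak_deriv Omega s u) ^+ 2).

(* H^1_0(Omega): closure of C_c^oo(Omega) in H^1(Omega). *)
Definition sobolevH10 Omega u : Prop :=
  sobolevH Omega 1 u /\ forall eps : R, 0 < eps ->
    exists2 f, test_function Omega f & normH Omega 1 (u \- f) < eps.

Definition laplacian Omega u : 'rV[R]_m -> R :=
  fun x => \sum_(i < m) weak_deriv Omega [:: i; i] u x.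

(* lambda_1, lambda_2, ... are lam 0, lam 1, ..., and likewise for phi. Since
   the eigenfunctions phi k form a basis, every eigenvalue is listed, with its
   multiplicity. *)
Record dirichlet_eigensystem Omega
    (lam : nat -> R) (phi : nat -> 'rV[R]_m -> R) : Prop := {
  eig_H2 : forall k, sobolevH Omega 2 (phi k) ;
  eig_H10 : forall k, sobolevH10 Omega (phi k) ;
  eig_eqn : forall k, \forall x \ae lebesgue_rV R m, Omega x ->
    - laplacian Omega (phi k) x = lam k * phi k x ;
  eig_orthonormal : forall j k, dotL2 Omega (phi j) (phi k) = (j == k)%:R ;
  eig_basis : forall f, L2 Omega f ->
    normL2 Omega (f \- (fun x =>
      \sum_(k < n) dotL2 Omega f (phi k) * phi k x)) @[n --> \oo] --> (0 : R) ;
  eig_gt0 : 0 < lam 0%N ;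
  eig_simple : lam 0%N < lam 1%N ;
  eig_mono : forall j k, (j <= k)%N -> lam j <= lam k ;
  eig_unbounded : lam @ \oo --> +oo ;
  eig_phi1_gt0 : \forall x \ae lebesgue_rV R m, Omega x -> 0 < phi 0%N x }.

Definition C1 (g : R -> R) : Prop :=
  (forall t, derivable g t 1) /\ continuous (derive1 g).

(* u in H^2 with zero boundary values solves  Lap u + a u + g(u) = h  a.e. *)
Definition dirichlet_solution Omega (a : R) (g : R -> R)
    (h u : 'rV[R]_m -> R) : Prop :=
  [/\ sobolevH Omega 2 u, sobolevH10 Omega u &
      \forall x \ae lebesgue_rV R m, Omega x ->
        laplacian Omega u x + a * u x + g (u x) = h x].

End sobolev.

(* Main.v *)
Require Import Defs.
From mathcomp Require Import all_boot all_order all_algebra.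
From mathcomp Require Import all_classical all_reals all_analysis.
From mathcomp Require Import measurable_realfun ring lra.
Import Order.TTheory GRing.Theory Num.Theory.
Import numFieldNormedType.Exports.
Set Implicit Arguments.
Unset Strict Implicit.
Unset Printing Implicit Defensive.
Local Open Scope classical_set_scope.
Local Open Scope ring_scope.

(* Write u = xi phi_0 + U with U orthogonal to phi_0 (indices start at 0). Since
   h t = gamma t - g t is nondecreasing and gamma < lam_1 - lam_0, the equation for U at a
   fixed xi is strongly monotone: it has a unique solution (by Yosida regularization of h),
   continuous in xi, and mu_1 is then read off the phi_0 coefficient.

   The bound of all second derivatives by the Laplacian for u in H^2 with zero trace comes
   from the identity
   u_jj u_kk - u_jk^2 = (u_j u_kk)_j - (u_j u_jk)_k, localized near the boundary with
   tangential vector fields, where its quadratic second-order terms cancel. Density of test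
   functions and uniqueness of weak derivatives come from the completeness of the
   eigenfunctions.

   Sign of mu_1 for large xi: if mu_1 <= 0 then U is bounded in L^2 uniformly in xi. Let z
   solve Lap z + lam_0 z = e with z orthogonal to phi_0. A Hopf type bound gives
   z >= - K phi_0, so y = u - z - K phi_0 lies below u; testing its equation with y^- and
   using the spectral gap forces y^- = 0 when xi is large. Hence u >= 0, and
   mu_1 = int g(u) phi_0 > 0, a contradiction. The case xi -> - oo follows by the symmetry
   (g, e) -> (- g(- .), - e).

   The Hopf type bound combines: mean value inequalities for the superharmonic phi_0 (bounded
   below on compact sets) and for the subsolution z^- (bounded above, by Kato's inequality up to
   the boundary), and a barrier made of squares of local defining functions of the boundary. *)

(** * Lebesgue measure on R^m *)

Section lebesgue_rV_theory.
Context {R : realType}.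

(** The hypotheses bound [g'] from above only, so [g] need not be Lipschitz and the equation itself
    is not a contraction problem; combined with the sign condition they do give
    [|g t| <= gamma |t|], which makes [u |-> g(u)] a continuous operator on L^2. Beyond that, only
    the sign of [g] and the monotonicity of [h] enter. Since [g] may decay at infinity, the sign of
    [mu_1] cannot be read off limits of [g]: it requires [u >= 0] almost everywhere, whereas [U] is
    bounded in L^2 only. The function [z], which depends on [e] and not on [xi], carries the
    pointwise information; in the difference [u - z] the source has cancelled, and its negative part
    can be treated by energy estimates alone. Functions of class H^2 are produced by multiplying the
    eigenfunction coefficients of an L^2 function: partial sums and their Laplacians converge in
    L^2, and the bound of second derivatives by the Laplacian turns this into convergence in H^2. *)

Lemma lebesgue_measure_shift (a : R) (A : set (measurableTypeR R)) :
  measurable A ->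
  lebesgue_measure ((fun x : measurableTypeR R => x + a) @^-1` A) = lebesgue_measure A.
Proof.
move=> mA.
have ms : measurable_fun setT (fun x : measurableTypeR R => x + a : measurableTypeR R).
  by apply: measurable_funD.
apply/esym.
apply: (lebesgue_measure_unique (mu := pushforward lebesgue_measure
   (fun x : measurableTypeR R => x + a : measurableTypeR R))) => //.
move=> _ [[x y]] _ <-; rewrite /= /pushforward.
rewrite (_ : _ @^-1` _ = `]x - a, y - a]%classic); last first.
  by apply/seteqP; split => z /=; rewrite !in_itv/= ltrBlDr lerBrDr.
have E (c d : R) := @lebesgue_measure_itv R `]c, d]; rewrite /= in E.
rewrite !E !lte_fin ltrD2r -!EFinD.
by case: ifP => // _; congr EFin; lra.
Qed.

Definition rV_shift n (v x : 'rV[R]_n) : 'rV[R]_n := x + v.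

Lemma measurable_rV_shift n (v : 'rV[R]_n) : measurable_fun setT (rV_shift v).
Proof.
apply: measurable_fun_rV => i.
rewrite [X in measurable_fun _ X](_ : _ = fun x => rV_coord i x + v ord0 i).
  by apply: measurable_funD => //; exact: measurable_rV_coord.
by apply/funext => x; rewrite /= /rV_coord mxE.
Qed.

(** Induction on the dimension: the shifted product measure has the product values on measurable
    rectangles, and these determine it. *)
Lemma lebesgue_rV_shift n (v : 'rV[R]_n) (A : set 'rV[R]_n) :
  measurable A -> lebesgue_rV R n (rV_shift v @^-1` A) = lebesgue_rV R n A.
Proof.
elim: n v A => [|n IH] v A mA.
  by congr (_ _); apply/seteqP; split => x /=; rewrite /rV_shift;
     rewrite (_ : x + v = x)//; apply/rowP => -[].
have mc := @measurable_rV_cons R n.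
pose m1 : {sigma_finite_measure set (measurableTypeR R) -> \bar R} := @lebesgue_measure R.
pose S := fun p : measurableTypeR R * 'rV[R]_n =>
  (p.1 + v ord0 ord0 : measurableTypeR R, rV_shift (\row_j v ord0 (lift ord0 j)) p.2).
have mS : measurable_fun setT S.
  apply: measurable_fun_pair.
    by apply: measurable_funD => //; exact: measurable_fst.
  by apply: measurableT_comp (measurable_rV_shift _) _; exact: measurable_snd.
have mcA : measurable (@rV_cons R n @^-1` A) by rewrite -[X in measurable X]setTI; exact: mc.
rewrite /= /lebesgue_rV_step /pushforward.
rewrite [LHS](_ : _ = pushforward (m1 \x lebesgue_rV R n)%E S (@rV_cons R n @^-1` A)); last first.
  rewrite /pushforward; congr (_ _); apply/seteqP; split => -[a w] /=;
    rewrite (_ : rV_shift v _ = rV_cons (S (a, w))) //;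
    by apply/rowP => i; rewrite !mxE /=; case: unliftP => [j|] ->/=; rewrite ?mxE.
apply/esym.
pose mp : {measure set (measurableTypeR R * 'rV[R]_n) -> \bar R} :=
  measure_function_pushforward__canonical__measure_function_Measure (m1 \x lebesgue_rV R n)%E mS.
rewrite -[RHS]/(mp _).
apply: product_measure_unique => // B C mB mC.
rewrite /mp /= /pushforward.
rewrite (_ : S @^-1` _ = ((fun x : measurableTypeR R => x + v ord0 ord0) @^-1` B) `*`
   (rV_shift (\row_j v ord0 (lift ord0 j)) @^-1` C)) //.
rewrite product_measure1E; first by rewrite IH// /m1 /= (lebesgue_measure_shift _ mB).
  rewrite -[X in measurable X]setTI.
  have : measurable_fun setT (@idfun (measurableTypeR R) \+ cst (v ord0 ord0)).
    by apply: measurable_funD; [exact: measurable_id|exact: measurable_cst].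
  exact.
by rewrite -[X in measurable X]setTI; exact: measurable_rV_shift.
Qed.

Definition rV_box n (a b : R) : set 'rV[R]_n := [set x | forall i, a < x ord0 i < b].

Lemma measurable_rV_box n (a b : R) : measurable (@rV_box n a b).
Proof.
rewrite (_ : rV_box _ _ = \bigcap_(i in [set: 'I_n]) (rV_coord i @^-1` `]a, b[)); last first.
  by apply/seteqP; split => x /= H i; [move=> _|]; have := H i; rewrite /= in_itv //= => /(_ I).
apply: fin_bigcap_measurable => // i _.
by rewrite -[X in measurable X]setTI; exact: measurable_rV_coord.
Qed.

Lemma lebesgue_rV_box n (a b : R) : a <= b -> lebesgue_rV R n (rV_box a b) = ((b - a) ^+ n)%:E.
Proof.
move=> ab; elim: n => [|n IH].
  by rewrite /= diracE mem_set// => -[].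
rewrite /= /lebesgue_rV_step /pushforward.
rewrite (_ : _ @^-1` _ = `]a, b[%classic `*` rV_box a b); last first.
  apply/seteqP; split => -[x w] /=.
    move=> H; split; first by have := H ord0; rewrite /= mxE unlift_none in_itv.
    by move=> j; have := H (lift ord0 j); rewrite mxE liftK.
  move=> [+ H] i; rewrite in_itv /= => Hx; rewrite mxE.
  by case: (unlift ord0 i) => [j|] //=; exact: H.
rewrite product_measure1E//; last exact: measurable_rV_box.
rewrite IH; have := @lebesgue_measure_itv R `]a, b[; rewrite /= => ->.
rewrite lte_fin exprS EFinM.
case: ltP => // ba; have -> : a = b by apply/eqP; rewrite eq_le ab ba.
by rewrite subrr.
Qed.

Lemma norm_rV_ltP n (x : 'rV[R]_n) (r : R) : 0 < r ->
  (`|x| < r <-> forall i, `|x ord0 i| < r).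
Proof.
move=> r0; rewrite [`|x|]mx_normrE; split.
  by move=> /bigmax_ltP [_ H] i; exact: (H (ord0, i)).
by move=> H; apply/bigmax_ltP; split => // -[i j] _ /=; rewrite ord1.
Qed.

Lemma norm_rV_leP n (x : 'rV[R]_n) (r : R) : 0 <= r ->
  (`|x| <= r <-> forall i, `|x ord0 i| <= r).
Proof.
move=> r0; rewrite [`|x|]mx_normrE; split.
  by move=> /bigmax_leP [_ H] i; exact: (H (ord0, i)).
by move=> H; apply/bigmax_leP; split => // -[i j] _ /=; rewrite ord1.
Qed.

Lemma coord_le_norm n (x : 'rV[R]_n) i : `|x ord0 i| <= `|x|.
Proof. by have /(norm_rV_leP x (normr_ge0 x)) := lexx `|x|; exact. Qed.

(** The norm of row vectors is the sup norm, so balls are cubes; this gives their measure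
    exactly. *)
Lemma ball_rV_box n (x : 'rV[R]_n) (r : R) : 0 < r ->
  ball x r = rV_shift (- x) @^-1` (rV_box (- r) r).
Proof.
move=> r0; rewrite -ball_normE; apply/seteqP; split => y /=.
  by rewrite distrC => /(norm_rV_ltP _ r0) H i; have := H i; rewrite ltr_norml.
move=> H; rewrite distrC; apply/(norm_rV_ltP _ r0) => i; rewrite ltr_norml; exact: H.
Qed.

Lemma measurable_ball_rV n (x : 'rV[R]_n) (r : R) : 0 < r -> measurable (ball x r).
Proof.
move=> r0; rewrite ball_rV_box// -[X in measurable X]setTI.
by apply: measurable_rV_shift => //; exact: measurable_rV_box.
Qed.

Lemma lebesgue_rV_ball n (x : 'rV[R]_n) (r : R) : 0 < r ->
  lebesgue_rV R n (ball x r) = ((2 * r) ^+ n)%:E.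
Proof.
move=> r0; rewrite ball_rV_box// lebesgue_rV_shift; last exact: measurable_rV_box.
by rewrite lebesgue_rV_box ?opprK -?mulr2n ?mulr_natl//; lra.
Qed.

Lemma measurable_bounded_rV_lty n (A : set 'rV[R]_n) : measurable A ->
  bounded_set A -> (lebesgue_rV R n A < +oo)%E.
Proof.
move=> mA [M [_ /(_ (`|M| + 1))]] /=.
rewrite (le_lt_trans (ler_norm M)) ?ltrDl// => /(_ isT) HA.
have r0 : 0 < `|M| + 2 by rewrite ltr_wpDl.
apply: (@le_lt_trans _ _ (lebesgue_rV R n (ball 0 (`|M| + 2)))).
  apply: le_measure; rewrite ?inE//; first exact: measurable_ball_rV.
  move=> x Ax; rewrite -ball_normE /= sub0r normrN.
  by apply: (le_lt_trans (HA _ Ax)); lra.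
by rewrite lebesgue_rV_ball// ltry.
Qed.

(* Rational balls form a countable base. *)
Lemma measurable_open_rV n (A : set 'rV[R]_n) : open A -> measurable A.
Proof.
move=> oA.
pose c (p : {ffun 'I_n -> rat} * nat) : 'rV[R]_n := \row_i ratr (p.1 i).
pose B (p : {ffun 'I_n -> rat} * nat) := ball (c p) (p.2.+1%:R^-1 : R).
rewrite (_ : A = \bigcup_(p in [set p | B p `<=` A]) B p).
  rewrite bigcup_mkcond; apply: countable_bigcupT_measurable => [//|p].
  case: ifP => // _.
  by apply: measurable_ball_rV; rewrite invr_gt0 ltr0n.
apply/seteqP; split; last by move=> x [p /= pA px]; exact: pA.
move=> x Ax.
have /nbhs_ballP[e /= e0 eA] : nbhs x A by exact: open_nbhs_nbhs.
have [k _ /(_ k (leqnn k)) ke] : \forall k \near \oo, k.+1%:R^-1 < e / 2 :> R.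
  by apply: near_infty_natSinv_lt (PosNum (divr_gt0 e0 (ltr0Sn _ 1))).
have k0 : 0 < k.+1%:R^-1 :> R by rewrite invr_gt0 ltr0n.
have Hq i : exists q : rat, `|x ord0 i - ratr q| < k.+1%:R^-1 :> R.
  have /rat_in_itvoo[q] : x ord0 i < x ord0 i + k.+1%:R^-1 by rewrite ltrDl.
  by rewrite in_itv /= => /andP[h1 h2]; exists q; rewrite ltr_norml; apply/andP; split;
    move: h1 h2 k0; move: (ratr q) (x ord0 i) (k.+1%:R^-1) => u v w *; lra.
have [f Hf] := choice Hq.
exists ([ffun i => f i], k).
  move=> y; rewrite /B /= -ball_normE => /= cy; apply: eA; rewrite -ball_normE /=.
  apply: (@le_lt_trans _ _ (`|x - c ([ffun i => f i], k)| + `|c ([ffun i => f i], k) - y|)).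
    by rewrite (le_trans _ (ler_normD _ _))// addrA subrK.
  have : `|x - c ([ffun i => f i], k)| < k.+1%:R^-1.
    by apply/(norm_rV_ltP _ k0) => i; rewrite !mxE /= ffunE.
  by move: cy ke => /=; move: (k.+1%:R^-1) => w; lra.
rewrite /B -ball_normE /= distrC; apply/(norm_rV_ltP _ k0) => i.
by rewrite !mxE /= ffunE; exact: Hf.
Qed.

Lemma measurable_closed_rV n (A : set 'rV[R]_n) : closed A -> measurable A.
Proof. by move=> cA; rewrite -[A]setCK; apply: measurableC; apply: measurable_open_rV; exact: closed_openC. Qed.

Lemma measurable_compact_rV n (A : set 'rV[R]_n) : compact A -> measurable A.
Proof. by move=> cA; apply: measurable_closed_rV; exact: compact_closed (@norm_hausdorff _ _) cA. Qed.

Lemma continuous_measurable_rV n (f : 'rV[R]_n -> R) : continuous f -> measurable_fun setT f.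
Proof.
move=> /continuousP cf.
apply: (measurability _ (RGenOInfty.measurableE R)).
move=> /= _ [_ [a ->] <-]; rewrite setTI.
have oa : open `]a, +oo[%classic by rewrite set_itvoy; exact: open_gt.
exact: (measurable_open_rV (cf _ oa)).
Qed.

End lebesgue_rV_theory.

(** * The space L^2 *)

Section L2_theory.
Context {R : realType} {m : nat}.
Local Notation mu := (lebesgue_rV R m).
Local Notation rV := 'rV[R]_m.
Implicit Types (D : set rV) (f g h : rV -> R).

Definition itg D f := mu.-integrable D (EFin \o f).

Section domain.
Variables (D : set rV) (mD : measurable D).

Lemma itg_meas f : itg D f -> measurable_fun D f.
Proof. by move=> /integrableP[/measurable_EFinP]. Qed.

Lemma itgD f g : itg D f -> itg D g -> itg D (fun x => f x + g x).
Proof.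
move=> If Ig; rewrite /itg (_ : _ \o _ = (EFin \o f) \+ (EFin \o g))%E; last exact/funext.
exact: integrableD.
Qed.

Lemma itgZ (c : R) f : itg D f -> itg D (fun x => c * f x).
Proof. by move=> If; have := integrableZl mD c If; apply: eq_integrable. Qed.

Lemma itgN f : itg D f -> itg D (fun x => - f x).
Proof. by move=> /(itgZ (-1)); rewrite /itg; apply: eq_integrable => // x _ /=; rewrite mulN1r. Qed.

Lemma itgB f g : itg D f -> itg D g -> itg D (fun x => f x - g x).
Proof. by move=> If Ig; apply: itgD => //; exact: itgN. Qed.

Lemma itg_sum I (s : seq I) (F : I -> rV -> R) : (forall i, itg D (F i)) ->
  itg D (fun x => \sum_(i <- s) F i x).
Proof.
move=> IF; elim: s => [|i s IH].
  by rewrite /itg; apply: eq_integrable (integrable0 mu D) => // x _ /=; rewrite big_nil.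
by have := itgD (IF i) IH; apply: eq_integrable => // x _ /=; rewrite big_cons.
Qed.

Lemma itg_le f g : measurable_fun D f -> (forall x, D x -> `|f x| <= g x) -> itg D g -> itg D f.
Proof.
move=> mf fg Ig; apply: le_integrable Ig => //; first exact/measurable_EFinP.
by move=> x Dx; rewrite lee_fin (le_trans (fg x Dx))// ler_norm.
Qed.

Lemma itg_abs f : itg D f -> itg D (fun x => `|f x|).
Proof.
move=> If; apply: (integrable_norm If).
Qed.

Lemma eq_itg f g : (forall x, D x -> f x = g x) -> itg D f -> itg D g.
Proof. by move=> fg; apply: eq_integrable => // x /set_mem Dx /=; rewrite fg. Qed.

Lemma eq_intg f g : (forall x, D x -> f x = g x) ->
  (\int[mu]_(x in D) f x = \int[mu]_(x in D) g x)%R.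
Proof. by move=> fg; apply: eq_Rintegral => x /set_mem; exact: fg. Qed.

Lemma intg_sum I (s : seq I) (F : I -> rV -> R) : (forall i, itg D (F i)) ->
  (\int[mu]_(x in D) (\sum_(i <- s) F i x) = \sum_(i <- s) \int[mu]_(x in D) F i x)%R.
Proof.
move=> IF; elim: s => [|i s IH].
  rewrite big_nil (_ : (fun _ => _) = cst 0); last by apply/funext => x; rewrite big_nil.
  by rewrite Rintegral_cst// mul0r.
rewrite big_cons -IH -RintegralD//; [|exact: IF|exact: itg_sum].
by apply: eq_intg => x _; rewrite big_cons.
Qed.

Lemma intgN f : itg D f -> (\int[mu]_(x in D) (- f x) = - \int[mu]_(x in D) f x)%R.
Proof.
move=> If; rewrite -mulN1r -RintegralZl//.
by apply: eq_intg => x _; rewrite mulN1r.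
Qed.

Lemma ae_eq_intg f g : measurable_fun D f -> measurable_fun D g ->
  (\forall x \ae mu, D x -> f x = g x) ->
  (\int[mu]_(x in D) f x = \int[mu]_(x in D) g x)%R.
Proof.
move=> mf mg fg; congr fine; apply: ae_eq_integral => //; [exact/measurable_EFinP..|].
by apply: filterS fg => x H Dx; rewrite H.
Qed.

Lemma ae_le_intg f g : itg D f -> itg D g ->
  (\forall x \ae mu, D x -> f x <= g x) ->
  (\int[mu]_(x in D) f x <= \int[mu]_(x in D) g x)%R.
Proof.
move=> If Ig fg.
have mf := itg_meas If; have mg := itg_meas Ig.
(* Replacing [g] by the maximum of [f] and [g] makes the inequality hold everywhere on [D] and
   leaves the integral on the right unchanged. *)
have mM : measurable_fun D (fun x => Num.max (f x) (g x)) by exact: measurable_maxr.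
have IM : itg D (fun x => Num.max (f x) (g x)).
  apply: (@itg_le _ (fun x => `|f x| + `|g x|)) => //; last by apply: itgD; exact: itg_abs.
  by move=> x _; have [_|_] := leP (f x) (g x); [rewrite lerDr|rewrite lerDl]; exact: normr_ge0.
rewrite [leRHS](_ : _ = \int[mu]_(x in D) Num.max (f x) (g x))%R.
  by apply: le_Rintegral => // x Dx; rewrite le_max lexx.
apply: ae_eq_intg => //.
by apply: filterS fg => x H Dx; rewrite max_r// H.
Qed.

Lemma itg_bounded f (M : R) : (mu D < +oo)%E -> measurable_fun D f ->
  (forall x, D x -> `|f x| <= M) -> itg D f.
Proof.
move=> Dfin mf fM; apply: (@itg_le _ (cst M)) => //.
by apply: measurable_bounded_integrable => //; exact: bounded_cst.
Qed.

Lemma intg_eq0 f : itg D f -> (forall x, D x -> 0 <= f x) ->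
  (\int[mu]_(x in D) f x)%R = 0 -> \forall x \ae mu, D x -> f x = 0.
Proof.
move=> If f0 H.
have mf := itg_meas If.
have : (\int[mu]_(x in D) `|(f x)%:E| = 0)%E.
  rewrite (eq_integral (fun x => (f x)%:E)); last first.
    by move=> x /set_mem Dx; rewrite gee0_abs// lee_fin f0.
  rewrite -[LHS]fineK; last exact: (integrable_fin_num mD If).
  by rewrite -[fine _]/(Rintegral mu D f) H.
move=> /(@ae_eq_integral_abs _ _ _ mu D mD (EFin \o f)) H0.
have {}H0 := H0 (measurable_int _ If).
by apply: filterS H0 => x Hx Dx; have [] := Hx Dx.
Qed.

Lemma L2_meas f : L2 D f -> measurable_fun D f. Proof. by case. Qed.

Lemma L2_itg2 f : L2 D f -> itg D (fun x => f x ^+ 2). Proof. by case. Qed.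

Lemma L2_itgM f g : L2 D f -> L2 D g -> itg D (fun x => f x * g x).
Proof.
move=> [mf If] [mg Ig]; apply: (@itg_le _ (fun x => f x ^+ 2 + g x ^+ 2)) => //.
- exact: measurable_funM.
- move=> x _; rewrite normrM -(real_normK (num_real (f x))) -(real_normK (num_real (g x))).
  have := sqr_ge0 (`|f x| - `|g x|); have := normr_ge0 (f x); have := normr_ge0 (g x); nra.
- exact: itgD.
Qed.

Lemma L2_le f g : measurable_fun D f -> (forall x, D x -> `|f x| <= `|g x|) -> L2 D g -> L2 D f.
Proof.
move=> mf fg [mg Ig]; split => //; apply: (@itg_le _ (fun x => g x ^+ 2)) => //.
  exact: measurable_funX.
move=> x Dx; rewrite normrX -(real_normK (num_real (g x))).
by rewrite ler_sqr ?nnegrE//; exact: fg.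
Qed.

Lemma L2D f g : L2 D f -> L2 D g -> L2 D (fun x => f x + g x).
Proof.
move=> L2f L2g; split; first by apply: measurable_funD; exact: L2_meas.
have := itgD (itgD (L2_itg2 L2f) (L2_itg2 L2g)) (itgZ 2 (L2_itgM L2f L2g)).
by apply: eq_itg => x _; rewrite sqrrD; ring.
Qed.

Lemma L2Z (c : R) f : L2 D f -> L2 D (fun x => c * f x).
Proof.
move=> L2f; split; first by apply: measurable_funM => //; exact: L2_meas.
by have := itgZ (c ^+ 2) (L2_itg2 L2f); apply: eq_itg => x _; rewrite exprMn.
Qed.

Lemma L2N f : L2 D f -> L2 D (fun x => - f x).
Proof. by move=> /(L2Z (-1)); congr L2; apply/funext => x; rewrite mulN1r. Qed.

Lemma L2B f g : L2 D f -> L2 D g -> L2 D (fun x => f x - g x).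
Proof. by move=> L2f L2g; apply: L2D => //; exact: L2N. Qed.

Lemma L20 : L2 D (cst 0).
Proof.
split => //; apply: eq_integrable (integrable0 mu D) => // x _ /=.
by rewrite expr0n.
Qed.

Lemma L2_sum I (s : seq I) (F : I -> rV -> R) : (forall i, L2 D (F i)) ->
  L2 D (fun x => \sum_(i <- s) F i x).
Proof.
move=> IF; elim: s => [|i s IH].
  by rewrite (_ : (fun _ => _) = cst 0); [exact: L20|apply/funext => x; rewrite big_nil].
rewrite (_ : (fun _ => _) = (fun x => F i x + \sum_(i <- s) F i x)).
  exact: L2D.
by apply/funext => x; rewrite big_cons.
Qed.

Lemma L2_bddM (c f : rV -> R) (M : R) : measurable_fun D c ->
  (forall x, D x -> `|c x| <= M) -> L2 D f -> L2 D (fun x => c x * f x).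
Proof.
move=> mc cM L2f; apply: (@L2_le _ (fun x => M * f x)); last exact: L2Z.
  by apply: measurable_funM => //; exact: L2_meas.
move=> x Dx; rewrite !normrM ler_wpM2r//.
by rewrite (le_trans (cM _ Dx))// ler_norm.
Qed.

Lemma L2_bounded f (M : R) : (mu D < +oo)%E -> measurable_fun D f ->
  (forall x, D x -> `|f x| <= M) -> L2 D f.
Proof.
move=> Dfin mf fM; split => //; apply: (@itg_bounded _ (M ^+ 2)) => //.
  exact: measurable_funX.
by move=> x Dx; rewrite normrX lerXn2r// ?nnegrE// (le_trans _ (fM x Dx)).
Qed.

Lemma L2_itg f : (mu D < +oo)%E -> L2 D f -> itg D f.
Proof.
move=> Dfin L2f.
have L21 : L2 D (cst 1) by apply: (@L2_bounded _ 1) => // x _; rewrite normr1.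
by have := L2_itgM L2f L21; apply: eq_itg => x _; rewrite /= mulr1.
Qed.

Lemma dotC f g : dotL2 D f g = dotL2 D g f.
Proof. by apply: eq_intg => x _; rewrite mulrC. Qed.

Lemma eq_dot f g f' g' : (forall x, D x -> f x = f' x) -> (forall x, D x -> g x = g' x) ->
  dotL2 D f g = dotL2 D f' g'.
Proof. by move=> H1 H2; apply: eq_intg => x Dx; rewrite H1// H2. Qed.

Lemma dotDl f g h : L2 D f -> L2 D g -> L2 D h ->
  dotL2 D (fun x => f x + g x) h = dotL2 D f h + dotL2 D g h.
Proof.
move=> Lf Lg Lh; rewrite /dotL2 -RintegralD//; [|exact: L2_itgM..].
by apply: eq_intg => x _; rewrite mulrDl.
Qed.

Lemma dotZl (c : R) f h : L2 D f -> L2 D h ->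
  dotL2 D (fun x => c * f x) h = c * dotL2 D f h.
Proof.
move=> Lf Lh; rewrite /dotL2 -RintegralZl//; last exact: L2_itgM.
by apply: eq_intg => x _; rewrite mulrA.
Qed.

Lemma dotNl f h : L2 D f -> L2 D h -> dotL2 D (fun x => - f x) h = - dotL2 D f h.
Proof.
by move=> Lf Lh; rewrite -mulN1r -dotZl//; apply: eq_dot => // x _; rewrite mulN1r.
Qed.

Lemma dotBl f g h : L2 D f -> L2 D g -> L2 D h ->
  dotL2 D (fun x => f x - g x) h = dotL2 D f h - dotL2 D g h.
Proof. by move=> Lf Lg Lh; rewrite dotDl ?dotNl//; exact: L2N. Qed.

Lemma dotDr f g h : L2 D f -> L2 D g -> L2 D h ->
  dotL2 D h (fun x => f x + g x) = dotL2 D h f + dotL2 D h g.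
Proof. by move=> *; rewrite dotC dotDl// dotC [dotL2 D g h]dotC. Qed.

Lemma dotBr f g h : L2 D f -> L2 D g -> L2 D h ->
  dotL2 D h (fun x => f x - g x) = dotL2 D h f - dotL2 D h g.
Proof. by move=> *; rewrite dotC dotBl// dotC [dotL2 D g h]dotC. Qed.

Lemma dotZr (c : R) f h : L2 D f -> L2 D h ->
  dotL2 D h (fun x => c * f x) = c * dotL2 D h f.
Proof. by move=> *; rewrite dotC dotZl// dotC. Qed.

Lemma dot_suml I (s : seq I) (F : I -> rV -> R) h : (forall i, L2 D (F i)) -> L2 D h ->
  dotL2 D (fun x => \sum_(i <- s) F i x) h = \sum_(i <- s) dotL2 D (F i) h.
Proof.
move=> LF Lh; rewrite /dotL2 -intg_sum; last by move=> i; exact: L2_itgM.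
by apply: eq_intg => x _; rewrite mulr_suml.
Qed.

Lemma dot_ae f g f' g' : L2 D f -> L2 D g -> L2 D f' -> L2 D g' ->
  (\forall x \ae mu, D x -> f x = f' x) -> (\forall x \ae mu, D x -> g x = g' x) ->
  dotL2 D f g = dotL2 D f' g'.
Proof.
move=> Lf Lg Lf' Lg' H1 H2; apply: ae_eq_intg.
- by apply: measurable_funM; exact: L2_meas.
- by apply: measurable_funM; exact: L2_meas.
- by apply: filterS2 H1 H2 => x h1 h2 Dx; rewrite h1// h2.
Qed.

Lemma dot_ge0 f : 0 <= dotL2 D f f.
Proof. by apply: Rintegral_ge0 => x _; rewrite -expr2 sqr_ge0. Qed.

Lemma normL2_ge0 f : 0 <= normL2 D f. Proof. exact: sqrtr_ge0. Qed.

Lemma normL2_sqr f : normL2 D f ^+ 2 = dotL2 D f f.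
Proof. by rewrite sqr_sqrtr// dot_ge0. Qed.

Lemma dot_CS2 f g : L2 D f -> L2 D g -> dotL2 D f g ^+ 2 <= dotL2 D f f * dotL2 D g g.
Proof.
move=> Lf Lg.
have H (t : R) : 0 <= dotL2 D f f * t ^+ 2 + 2 * t * dotL2 D f g + dotL2 D g g.
  have Lt : L2 D (fun x => t * f x) by exact: L2Z.
  have Ltg := L2D Lt Lg.
  have := dot_ge0 (fun x => t * f x + g x).
  rewrite (dotDl Lt Lg Ltg) (dotDr Lt Lg Lt) (dotDr Lt Lg Lg) !(dotZl t Lf) // (dotZr t Lf) // (dotZr t Lf) // (dotC g f).
  by congr (0 <= _); ring.
have := dot_ge0 f; rewrite le_eqVlt => /predU1P[/esym f0|f0].
  suff -> : dotL2 D f g = 0 by rewrite expr0n f0 mul0r.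
  apply/eqP; apply/negPn/negP => fg0.
  (* The quadratic term is absent here, and at this [t] the affine function in [H] equals -1. *)
  have := H (- (dotL2 D g g + 1) / (2 * dotL2 D f g)); rewrite f0 mul0r add0r.
  rewrite [X in X + _](_ : _ = - (dotL2 D g g + 1)); last by field.
  by rewrite opprD addrAC addNr add0r lerNr oppr0 ler10.
have := H (- dotL2 D f g / dotL2 D f f).
rewrite [X in 0 <= X](_ : _ = dotL2 D g g - dotL2 D f g ^+ 2 / dotL2 D f f); last first.
  by field; rewrite gt_eqF.
by rewrite subr_ge0 ler_pdivrMr// mulrC.
Qed.

Lemma dot_CS f g : L2 D f -> L2 D g -> `|dotL2 D f g| <= normL2 D f * normL2 D g.
Proof.
move=> Lf Lg; rewrite -(@ler_pXn2r _ 2) ?nnegrE// ?mulr_ge0 ?normL2_ge0//.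
by rewrite exprMn !normL2_sqr real_normK ?num_real//; exact: dot_CS2.
Qed.

Lemma normL2_tri f g : L2 D f -> L2 D g ->
  normL2 D (fun x => f x + g x) <= normL2 D f + normL2 D g.
Proof.
move=> Lf Lg; rewrite -(@ler_pXn2r _ 2) ?nnegrE ?addr_ge0 ?normL2_ge0//.
rewrite normL2_sqr dotDl// ?dotDr//; last exact: L2D.
rewrite sqrrD !normL2_sqr (dotC g f).
by have := dot_CS Lf Lg; move=> /ler_normlP[_ H]; lra.
Qed.

Lemma normL2Z c f : L2 D f -> normL2 D (fun x => c * f x) = `|c| * normL2 D f.
Proof.
move=> Lf; rewrite /normL2 dotZl// ?dotZr//; last exact: L2Z.
by rewrite mulrA -expr2 sqrtrM ?sqr_ge0// sqrtr_sqr.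
Qed.

Lemma normL2N f : normL2 D (fun x => - f x) = normL2 D f.
Proof. by congr Num.sqrt; apply: eq_intg => x _; rewrite mulrNN. Qed.

Lemma normL2BC f g : normL2 D (fun x => f x - g x) = normL2 D (fun x => g x - f x).
Proof. by rewrite -normL2N; congr normL2; apply/funext => x; rewrite opprB. Qed.

Lemma normL2_triB f g : L2 D f -> L2 D g ->
  normL2 D (fun x => f x - g x) <= normL2 D f + normL2 D g.
Proof. by move=> Lf Lg; rewrite -(normL2N g); apply: normL2_tri => //; exact: L2N. Qed.

Lemma normL2_le f g : L2 D f -> L2 D g -> (\forall x \ae mu, D x -> `|f x| <= `|g x|) ->
  normL2 D f <= normL2 D g.
Proof.
move=> Lf Lg fg; rewrite ler_wsqrtr//; apply: ae_le_intg => //; [exact: L2_itgM..|].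
apply: filterS fg => x H Dx; rewrite -!expr2 -(real_normK (num_real (f x))).
by rewrite -(real_normK (num_real (g x))) lerXn2r ?nnegrE// H.
Qed.

Lemma normL2_ae f g : L2 D f -> L2 D g -> (\forall x \ae mu, D x -> f x = g x) ->
  normL2 D f = normL2 D g.
Proof. by move=> Lf Lg H; congr Num.sqrt; apply: dot_ae. Qed.

Lemma normL2_eq0 f : L2 D f -> normL2 D f = 0 -> \forall x \ae mu, D x -> f x = 0.
Proof.
move=> Lf H; have : dotL2 D f f = 0 by rewrite -normL2_sqr H expr0n.
move=> /(intg_eq0 (L2_itgM Lf Lf)) H0.
have {}H0 := H0 (fun x _ => _); apply: filterS (H0 _).
  by move=> x Hx Dx; have /eqP := Hx Dx; rewrite mulf_eq0 orbb => /eqP.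
by move=> x; rewrite -expr2 sqr_ge0.
Qed.

Lemma dct (f_ : nat -> rV -> R) f g : (forall n, measurable_fun D (f_ n)) ->
  measurable_fun D f -> itg D g ->
  (\forall x \ae mu, D x -> f_ ^~ x @ \oo --> f x) ->
  (\forall x \ae mu, forall n, D x -> `|f_ n x| <= g x) ->
  itg D f /\ ((\int[mu]_(x in D) f_ n x)%R @[n --> \oo] --> (\int[mu]_(x in D) f x)%R).
Proof.
move=> mf_ mf Ig cf bf.
have [] := @dominated_convergence _ _ _ mu D mD (fun n x => (f_ n x)%:E)
  (EFin \o f) (EFin \o g).
- by move=> n; exact/measurable_EFinP.
- exact/measurable_EFinP.
- by apply: filterS cf => x H Dx; apply: cvg_EFin; [exact: nearW|exact: H].
- exact: Ig.
- by apply: filterS bf => x H n Dx; rewrite lee_fin; exact: H.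
move=> If _ H.
split; first exact: If.
by apply: fine_cvg; rewrite fineK//; exact: (integrable_fin_num mD If).
Qed.

Lemma dct_L2 (f_ : nat -> rV -> R) f g : (forall n, measurable_fun D (f_ n)) ->
  measurable_fun D f -> L2 D g ->
  (\forall x \ae mu, D x -> f_ ^~ x @ \oo --> f x) ->
  (\forall x \ae mu, forall n, D x -> `|f_ n x| <= g x) ->
  L2 D f /\ (normL2 D (fun x => f_ n x - f x) @[n --> \oo] --> (0 : R)).
Proof.
move=> mf_ mf Lg cf bf.
have bfl : \forall x \ae mu, D x -> `|f x| <= g x.
  apply: filterS2 cf bf => x cx bx Dx.
  have : (fun n => `|f_ n x|) @ \oo --> `|f x| by apply: cvg_norm; exact: cx.
  move=> H; rewrite -(cvg_lim _ H)//; apply: limr_le; first exact: cvgP H.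
  by apply: nearW => n; exact: bx.
have Lf : L2 D f.
  split => //; have [] := @dct (fun n x => f_ n x ^+ 2) (fun x => f x ^+ 2) (fun x => g x ^+ 2) => //.
  - by move=> n; exact: measurable_funX.
  - exact: measurable_funX.
  - exact: L2_itg2.
  - by apply: filterS cf => x cx Dx; rewrite expr2; under eq_fun do rewrite expr2; apply: cvgM; exact: cx.
  - apply: filterS bf => x bx n Dx; rewrite normrX lerXn2r ?nnegrE// ?bx//.
    by rewrite (le_trans _ (bx n Dx)).
split => //.
rewrite -[X in _ --> X](@sqrtr0 R); apply: continuous_cvg; first exact: sqrt_continuous.
have <- : dotL2 D (cst 0) (cst 0) = 0 by rewrite /dotL2 /cst mulr0 Rintegral_cst// mul0r.
have L2g : L2 D (fun x => 2 * g x) by exact: L2Z.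
apply: (@dct _ _ _ _ _ (L2_itgM L2g L2g) _ _).2.
- by move=> n; apply: measurable_funM; apply: measurable_funB.
- exact: measurable_funM.
- apply: filterS cf => x cx Dx.
  have H : f_ n x - f x @[n --> \oo] --> (0 : R).
    by rewrite -(subrr (f x)); apply: cvgB; [exact: cx|exact: cvg_cst].
  by rewrite /cst; apply: cvgM.
- apply: filterS2 bf bfl => x bx bxl n Dx; rewrite normrM.
  have H : `|f_ n x - f x| <= 2 * g x.
    by rewrite (le_trans (ler_normB _ _))// mulr_natl mulr2n lerD ?bx ?bxl.
  by rewrite ler_pM.
Qed.

Definition cauchyL2 (f : nat -> rV -> R) : Prop :=
  forall e, 0 < e -> exists N, forall p q, (N <= p)%N -> (N <= q)%N ->
    normL2 D (fun x => f p x - f q x) <= e.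

(** Riesz-Fischer. Along a subsequence with geometrically small increments, the sum of the absolute
    increments has an integrable square by monotone convergence; it dominates the subsequence, which
    converges wherever this sum is finite. *)
Lemma L2_complete (f : nat -> rV -> R) : (forall n, L2 D (f n)) -> cauchyL2 f ->
  exists2 h, L2 D h & normL2 D (fun x => f n x - h x) @[n --> \oo] --> (0 : R).
Proof.
move=> Lf cf.
have he k : 0 < (2^-1 : R) ^+ k by rewrite exprn_gt0// invr_gt0.
have [N HN] := choice (fun k => cf _ (he k)).
(* Summing [(N j).+1] makes [s] nondecreasing and at least both [N k] and [k]. *)
pose s k := (\sum_(j < k.+1) (N j).+1)%N.
have sN k : (N k <= s k)%N by rewrite /s big_ord_recr /= (leq_trans (leqnSn _))// leq_addl.
have sS k : (s k <= s k.+1)%N by rewrite /s [in X in (_ <= X)%N]big_ord_recr leq_addr.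
have s_ge j k : (j <= k)%N -> (s j <= s k)%N by move=> jk; apply: (@homo_leq _ s leq) => //; exact: leq_trans.
pose u k := f (s k).
have Lu k : L2 D (u k) by exact: Lf.
pose d k x := `|u k.+1 x - u k x|.
have Ld k : L2 D (d k).
  apply: (@L2_le _ (fun x => u k.+1 x - u k x)); last exact: L2B.
    by apply: measurableT_comp => //; apply: measurable_funB; exact: L2_meas.
  by move=> x Dx; rewrite normr_id.
have Nd k : normL2 D (d k) <= (2^-1 : R) ^+ k.
  rewrite (le_trans _ (HN k (s k.+1) (s k) _ _))//; last by rewrite (leq_trans (sN k)).
  by apply: normL2_le => //; [exact: L2B|apply: nearW => x _; rewrite normr_id].
pose G n x := \sum_(k < n) d k x.
have LG n : L2 D (G n) by exact: L2_sum.
have G0 n x : 0 <= G n x by apply: sumr_ge0 => k _; exact: normr_ge0.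
have GSE n x : G n.+1 x = G n x + d n x by rewrite /G big_ord_recr.
have GS n x : G n x <= G n.+1 x by rewrite /G big_ord_recr lerDl normr_ge0.
have NG n : normL2 D (G n) <= 2 - 2 * (2^-1 : R) ^+ n.
  elim: n => [|n IH].
    rewrite expr0 mulr1 subrr (_ : G 0%N = (fun x => 0 * G 0%N x)) ?normL2Z ?normr0 ?mul0r//.
    by apply/funext => x; rewrite /G big_ord0 mul0r.
  rewrite (_ : G n.+1 = (fun x => G n x + d n x)); last by apply/funext => x; rewrite /G big_ord_recr.
  rewrite (le_trans (normL2_tri (LG n) (Ld n)))// exprS.
  by move: IH (Nd n); lra.
pose GE n x := (G n x ^+ 2)%:E.
pose GI x := limn (GE ^~ x).
have ndG x : {homo (GE ^~ x) : n k / (n <= k)%N >-> (n <= k)%E}.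
  move=> n k nk; rewrite lee_fin ler_sqr ?nnegrE//.
  by apply: (@homo_leq _ (G ^~ x) (fun a b => a <= b)) => // a b c; exact: le_trans.
have mGE n : measurable_fun D (GE n).
  by apply/measurable_EFinP; apply: measurable_funX; exact: L2_meas.
have cG x : GE ^~ x @ \oo --> GI x by apply: ereal_nondecreasing_is_cvgn; exact: ndG.
have mGI : measurable_fun D GI by apply: (emeasurable_fun_cvg GE) => // x _; exact: cG.
have GI_ge n x : (GE n x <= GI x)%E.
  apply: lime_ge; first by apply: ereal_nondecreasing_is_cvgn; exact: ndG.
  by exists n => // k nk; exact: ndG.
have IGI : mu.-integrable D GI.
  apply/integrableP; split => //.
  rewrite (eq_integral GI); last first.
    by move=> x _; rewrite gee0_abs// (le_trans _ (GI_ge 0%N x))// lee_fin sqr_ge0.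
  rewrite monotone_convergence//.
    apply: (@le_lt_trans _ _ (4%:E)); last exact: ltry.
    apply: lime_le.
      apply: ereal_nondecreasing_is_cvgn => a b ab; apply: ge0_le_integral => //.
      - by move=> x _; rewrite lee_fin sqr_ge0.
      - by move=> x _; exact: ndG.
    apply: nearW => n.
    have -> : (\int[mu]_(x in D) GE n x = (dotL2 D (G n) (G n))%:E)%E.
      rewrite /dotL2 /Rintegral fineK; last exact: (integrable_fin_num mD (L2_itgM (LG n) (LG n))).
      by apply: eq_integral => x _; rewrite /GE expr2.
    rewrite lee_fin -normL2_sqr (_ : 4 = 2 ^+ 2); last by rewrite expr2; ring.
    rewrite ler_sqr ?nnegrE ?normL2_ge0// (le_trans (NG n))// lerBlDr lerDl mulr_ge0//.
  by move=> n x _; rewrite lee_fin sqr_ge0.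
pose A := D `&` [set x | GI x \is a fin_num].
have mA : measurable A by exact: emeasurable_fin_num.
have aeA : \forall x \ae mu, D x -> A x.
  by apply: filterS (integrable_ae mD IGI) => x H Dx; split => //; exact: H.
have GIE x n : A x -> G n x <= Num.sqrt (fine (GI x)).
  move=> [Dx /= fx]; rewrite -[leLHS]ger0_norm// -sqrtr_sqr ler_wsqrtr// -lee_fin fineK//; exact: GI_ge.
have ub n k x : (n <= k)%N -> `|u k x - u n x| <= G k x - G n x.
  move=> nk; rewrite -(subnKC nk); elim: (k - n)%N => [|j IH]; first by rewrite addn0 !subrr normr0.
  rewrite addnS (_ : u _ x - _ = (u (n + j).+1 x - u (n + j)%N x) + (u (n + j)%N x - u n x)); last by ring.
  by rewrite (le_trans (ler_normD _ _))// GSE addrAC addrC lerD.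
have cu x : A x -> cvgn (u ^~ x).
  move=> Ax; apply/cauchy_cvgP; apply: cauchy_exP => e e0.
  have ndGx : nondecreasing_seq (G ^~ x) by apply/nondecreasing_seqP => n; exact: GS.
  have cGx : cvgn (G ^~ x).
    by apply: nondecreasing_is_cvgn => //; exists (Num.sqrt (fine (GI x))) => _ [n _ <-]; exact: GIE.
  have Gle n := nondecreasing_cvgn_le ndGx cGx n.
  have /cvgrPdist_lt/(_ e e0)[n _ /(_ n (leqnn n)) /= Hn] := cGx.
  exists (u n x); exists n => // k /= nk; rewrite -ball_normE /= distrC.
  rewrite (le_lt_trans (ub _ _ _ nk))// (le_lt_trans _ Hn)//.
  by rewrite (le_trans _ (ler_norm _))// lerB.
(* Setting the sequence to 0 off [A] makes it converge at every point, so that the limit is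
   measurable. *)
pose c n := u n \_ A.
have mc n : measurable_fun D (c n).
  apply: (measurable_restrict _ mA mD).1.
  by apply: measurable_funS (L2_meas (Lu n)) => // x [].
pose h x := lim (c ^~ x @ \oo).
have ch x : c ^~ x @ \oo --> h x.
  rewrite /h (_ : c ^~ x = fun n => if x \in A then u n x else point); last first.
    by apply/funext => n; rewrite /c patchE.
  case: (boolP (x \in A)) => [/set_mem Ax|_]; first exact: cu.
  by rewrite lim_cst//; exact: cvg_cst.
have mh : measurable_fun D h by apply: (measurable_fun_cvg (h := c)) => // x _; exact: ch.
pose q := (fun x => Num.sqrt (fine (GI x))) \_ A.
have mq : measurable_fun D q.
  apply: (measurable_restrict _ mA mD).1.
  apply: (measurableT_comp (f := @Num.sqrt R)); first exact: continuous_measurable_fun (@sqrt_continuous R).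
  by apply: measurableT_comp => //; apply: measurable_funS mGI => // x [].
have Lq : L2 D q.
  split => //; apply: le_integrable IGI => //; first by apply/measurable_EFinP; exact: measurable_funX.
  move=> x Dx; rewrite /q patchE; case: (boolP (x \in A)) => [/set_mem [_ /= fx]|_].
    rewrite sqr_sqrtr; last by rewrite fine_ge0// (le_trans _ (GI_ge 0%N x))// lee_fin sqr_ge0.
    by move: fx; case: (GI x) => [r||].
  by rewrite expr0n /= normr0 abse_ge0.
have Lu0 : L2 D (fun x => `|u 0%N x|).
  apply: (@L2_le _ (u 0%N)) => //; last by move=> x _; rewrite normr_id.
  by apply: measurableT_comp => //; exact: L2_meas.
have [Lh Nh] : L2 D h /\ (normL2 D (fun x => c n x - h x) @[n --> \oo] --> (0 : R)).
  apply: (@dct_L2 _ _ (fun x => `|u 0%N x| + q x)) => //; first exact: L2D.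
    by apply: nearW => x _; exact: ch.
  apply: nearW => x n Dx; rewrite /c /q !patchE.
  case: (boolP (x \in A)) => [/set_mem Ax|_]; last by rewrite normr0 addr0.
  rewrite -[X in `|X|](subrK (u 0%N x)) addrC (le_trans (ler_normD _ _))// lerD2l.
  rewrite (le_trans (ub 0%N n x _))// (le_trans _ (GIE x n Ax))//.
  by rewrite lerBlDr lerDl.
exists h => //.
have cE n : normL2 D (fun x => c n x - h x) = normL2 D (fun x => u n x - h x).
  apply: normL2_ae; [apply: L2B => //|exact: L2B|].
    by apply: (@L2_le _ (u n)) => // x _; rewrite /c patchE; case: ifP => //; rewrite normr0.
  by apply: filterS aeA => x H Dx; rewrite /c patchE mem_set//; exact: H.
apply/cvgrPdist_le => e e0.
have e2 : 0 < e / 2 by rewrite divr_gt0.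
have [K HK] := cf _ e2.
move/cvgrPdist_le/(_ _ e2) : Nh => [J _ HJ].
exists K => // n /= Kn; rewrite sub0r normrN ger0_norm ?normL2_ge0//.
have sge k : (k <= s k)%N.
  elim: k => // k IH; rewrite /s big_ord_recr /= (leq_trans (_ : (k.+1 <= s k + 1)%N)) ?addn1//.
  by rewrite -addn1 leq_add2l.
pose k := maxn J K.
have -> : (fun x => f n x - h x) = (fun x => (f n x - u k x) + (u k x - h x)).
  by apply/funext => x; rewrite addrA subrK.
have H1 : normL2 D (fun x => f n x - u k x) <= e / 2.
  by apply: HK => //; rewrite (leq_trans _ (sge k))// leq_maxr.
have H2 : normL2 D (fun x => u k x - h x) <= e / 2.
  by have := HJ k (leq_maxl _ _); rewrite /= sub0r normrN ger0_norm ?normL2_ge0// cE.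
rewrite (le_trans (normL2_tri _ _))//; [exact: L2B|exact: L2B|].
by move: H1 H2; lra.
Qed.

Lemma cvg_dotl (f : nat -> rV -> R) g h : (forall n, L2 D (f n)) -> L2 D g -> L2 D h ->
  normL2 D (fun x => f n x - g x) @[n --> \oo] --> (0 : R) ->
  dotL2 D (f n) h @[n --> \oo] --> dotL2 D g h.
Proof.
move=> Lf Lg Lh H; apply/subr_cvg0; apply: norm_cvg0.
have {}H : normL2 D (fun x => f n x - g x) * normL2 D h @[n --> \oo] --> (0 : R).
  by rewrite -(mul0r (normL2 D h)); apply: cvgMl.
apply: (squeeze_cvgr _ (cvg_cst 0) H); apply: nearW => n.
by rewrite normr_ge0 -dotBl//= dot_CS//; exact: L2B.
Qed.

Lemma cvg_normL2 (f : nat -> rV -> R) g : (forall n, L2 D (f n)) -> L2 D g ->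
  normL2 D (fun x => f n x - g x) @[n --> \oo] --> (0 : R) ->
  normL2 D (f n) @[n --> \oo] --> normL2 D g.
Proof.
move=> Lf Lg H; apply/subr_cvg0; apply: norm_cvg0.
apply: (squeeze_cvgr _ (cvg_cst 0) H); apply: nearW => n.
rewrite normr_ge0 /= ler_norml.
have := normL2_tri (L2B (Lf n) Lg) Lg; rewrite (_ : (fun x => _ + _) = f n); last by apply/funext => x; rewrite subrK.
have := normL2_tri (L2B Lg (Lf n)) (Lf n); rewrite (_ : (fun x => _ + _) = g); last by apply/funext => x; rewrite subrK.
by rewrite normL2BC => H1 H2; apply/andP; split; lra.
Qed.

End domain.
End L2_theory.

(** * Smooth functions *)

Section smooth_theory.
Context {R : realType}.

(** A directional derivative is the derivative at 0 along a line; the chain rule and affine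
    substitutions below are reduced to one variable in this way. *)
Lemma is_derive_line (V : normedModType R) (f : V -> R) (x v : V) (df : R) :
  is_derive x v f df <-> is_derive (0 : R) 1 (fun t : R => f (t *: v + x)) df.
Proof.
have E : (fun h : R => h^-1 *: ((f \o shift x) (h *: v) - f x)) =
  (fun h : R => h^-1 *: (((fun t : R => f (t *: v + x)) \o shift 0) (h *: 1) - (fun t : R => f (t *: v + x)) 0)).
  by apply/funext => h /=; rewrite scale0r add0r addr0 [_ *: 1]mulr1.
by split => -[H1 H2]; constructor; move: H1 H2; rewrite /derivable /derive E.
Qed.

Lemma is_derive_comp (V : normedModType R) (F : R -> R) (f : V -> R) (x v : V) (df dF : R) :
  is_derive x v f df -> is_derive (f x) 1 F dF -> is_derive x v (F \o f) (dF * df).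
Proof.
move=> /is_derive_line Hf HF; apply/is_derive_line.
have HF' : is_derive ((fun t : R => f (t *: v + x)) 0) 1 F dF by rewrite scale0r add0r.
have := @is_derive1_comp R F (fun t : R => f (t *: v + x)) 0 dF df HF' Hf.
by [].
Qed.

(** All derivatives are supplied as an explicit sequence, so a function given by formulas, such as
    [expinv], is smooth without any computation of iterated derivatives. *)
Definition smooth1 (F : R -> R) := exists D : nat -> R -> R,
  D 0%N = F /\ forall n t, is_derive (t : R) (1 : R) (D n) (D n.+1 t).

Lemma smooth1_deriv F : smooth1 F -> exists2 G, smooth1 G & forall t, is_derive (t : R) (1 : R) F (G t).
Proof.
move=> [D [<- H]]; exists (D 1%N); last exact: H.
by exists (fun n => D n.+1); split => // n t; exact: H.
Qed.

Lemma smooth1_cont F : smooth1 F -> continuous F.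
Proof.
move=> /smooth1_deriv[G _ H] t; apply: differentiable_continuous.
by apply/derivable1_diffP; have [] := H t.
Qed.

Context {m : nat}.
Local Notation rV := 'rV[R]_m.
Implicit Types f g : rV -> R.

Lemma pderivs_rcons s i f : pderivs (rcons s i) f = pderivs s (pderiv i f).
Proof. by rewrite /pderivs foldr_rcons. Qed.

(* A wrapper that keeps unification from unfolding [smooth]. *)
Variant is_smooth f : Prop := IsSmooth of smooth f.

Lemma smooth_pderiv i f : is_smooth f -> is_smooth (pderiv i f).
Proof. by case=> sf; split => s; rewrite -pderivs_rcons; exact: sf. Qed.

Lemma smooth_continuous f : is_smooth f -> continuous f.
Proof. by case=> /(_ [::])[]. Qed.

Lemma smooth_derivable f i x : is_smooth f -> derivable f x (basis_vec i).
Proof. by case=> /(_ [::])[_]; exact. Qed.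

Lemma is_pderiv f i x : is_smooth f -> is_derive x (basis_vec i) f (pderiv i f x).
Proof. by move=> sf; apply: DeriveDef => //; exact: smooth_derivable. Qed.

(** A class of expressions closed under partial derivatives ([smooth_alg_step]). Smoothness of
    products and compositions then follows by induction on the multi-index, with no Leibniz or Faa
    di Bruno formula. *)
Inductive smooth_alg : (rV -> R) -> Prop :=
| sm_base f : is_smooth f -> smooth_alg f
| sm_cst c : smooth_alg (cst c)
| sm_coord i : smooth_alg (fun x => x ord0 i)
| sm_add f g : smooth_alg f -> smooth_alg g -> smooth_alg (fun x => f x + g x)
| sm_mul f g : smooth_alg f -> smooth_alg g -> smooth_alg (fun x => f x * g x)
| sm_comp F f : smooth1 F -> smooth_alg f -> smooth_alg (fun x => F (f x))
| sm_affine f (a : R) v : smooth_alg f -> smooth_alg (fun x => f (a *: x + v)).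

Lemma is_derive_affine f (a : R) (v e x : rV) df :
  is_derive (a *: x + v) e f df -> is_derive x e (fun x => f (a *: x + v)) (a * df).
Proof.
move=> /is_derive_line H; apply/is_derive_line.
have -> : (fun t : R => f (a *: (t *: e + x) + v)) =
   (fun t : R => f (t *: e + (a *: x + v))) \o (fun t => a * t).
  by apply/funext => t /=; rewrite scalerDr scalerA addrA.
rewrite mulrC; apply: is_derive_comp; last by rewrite mulr0.
have := @is_deriveZ R _ _ (@idfun R) a (0 : R) (1 : R) 1 (is_derive_id _ _).
by rewrite /GRing.scale /= mulr1.
Qed.

Lemma is_derive_coord (i j : 'I_m) (x : rV) :
  is_derive x (basis_vec j) (fun x : rV => x ord0 i) (i == j)%:R.
Proof.
apply/is_derive_line.
have -> : (fun t : R => (t *: basis_vec j + x) ord0 i) = (fun t : R => t * (i == j)%:R + x ord0 i).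
  by apply/funext => t; rewrite !mxE eqxx.
rewrite (_ : (fun t : R => _) = (@idfun R * cst (i == j)%:R + cst (x ord0 i))%R) //.
apply: is_derive_eq.
by rewrite /GRing.scale /= mulr0 add0r mulr1 addr0.
Qed.

Lemma smooth_alg_step f : smooth_alg f -> continuous f /\
  forall i, exists2 g, smooth_alg g & forall x, is_derive x (basis_vec i) f (g x).
Proof.
elim => {f}.
- move=> f sf; split; first exact: smooth_continuous.
  by move=> i; exists (pderiv i f); [exact/sm_base/smooth_pderiv|move=> x; exact: is_pderiv].
- move=> c; split; first exact: cst_continuous.
  by move=> i; exists (cst 0); [exact: sm_cst|move=> x; exact: is_derive_cst].
- move=> i; split; first exact: coord_continuous.
  by move=> j; exists (cst (i == j)%:R); [exact: sm_cst|move=> x; exact: is_derive_coord].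
- move=> f g af [cf Hf] ag [cg Hg]; split; first by move=> x; exact: (cvgD (cf x) (cg x)).
  move=> i; have [f' af' Hf'] := Hf i; have [g' ag' Hg'] := Hg i.
  by exists (fun x => f' x + g' x); [exact: sm_add|move=> x; exact: is_deriveD].
- move=> f g af [cf Hf] ag [cg Hg]; split; first by move=> x; exact: (cvgM (cf x) (cg x)).
  move=> i; have [f' af' Hf'] := Hf i; have [g' ag' Hg'] := Hg i.
  exists (fun x => f x * g' x + g x * f' x).
    by apply: sm_add; exact: sm_mul.
  by move=> x; exact: is_deriveM.
- move=> F f sF af [cf Hf]; split.
    by move=> x; apply: continuous_comp; [exact: cf|exact: smooth1_cont].
  move=> i; have [f' af' Hf'] := Hf i; have [G sG HG] := smooth1_deriv sF.
  exists (fun x => G (f x) * f' x); first by apply: sm_mul => //; exact: sm_comp.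
  by move=> x; exact: is_derive_comp.
- move=> f a v af [cf Hf]; split.
    move=> x; apply: (@continuous_comp _ _ _ (fun x : rV => a *: x + v) f); last exact: cf.
    exact: (cvgD (@scaler_continuous _ _ a x) (@cst_continuous _ _ v x)).
  move=> i; have [f' af' Hf'] := Hf i.
  exists (fun x => a * f' (a *: x + v)).
    by apply: sm_mul; [exact: sm_cst|exact: sm_affine].
  by move=> x; exact: is_derive_affine.
Qed.

Lemma smooth_algE f : smooth_alg f -> is_smooth f.
Proof.
move=> af; have H s : smooth_alg (pderivs s f).
  elim: s => // i s IH /=.
  have [_ /(_ i)[g ag Hg]] := smooth_alg_step IH.
  rewrite (_ : pderiv i _ = g)//; apply/funext => x.
  by have := Hg x => -[_ <-].
split=> s; have [cf Hf] := smooth_alg_step (H s); split => // i x.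
by have [g _ Hg] := Hf i; have [] := Hg x.
Qed.

Lemma smooth_cst c : is_smooth (cst c : rV -> R). Proof. exact/smooth_algE/sm_cst. Qed.
Lemma smooth_coord i : is_smooth (fun x : rV => x ord0 i). Proof. exact/smooth_algE/sm_coord. Qed.
Lemma smoothD f g : is_smooth f -> is_smooth g -> is_smooth (fun x => f x + g x).
Proof. by move=> sf sg; apply/smooth_algE/sm_add; exact: sm_base. Qed.
Lemma smoothM f g : is_smooth f -> is_smooth g -> is_smooth (fun x => f x * g x).
Proof. by move=> sf sg; apply/smooth_algE/sm_mul; exact: sm_base. Qed.
Lemma smooth_comp F f : smooth1 F -> is_smooth f -> is_smooth (fun x => F (f x)).
Proof. by move=> sF sf; apply/smooth_algE/sm_comp => //; exact: sm_base. Qed.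
Lemma smooth_affine f a v : is_smooth f -> is_smooth (fun x => f (a *: x + v)).
Proof. by move=> sf; apply/smooth_algE/sm_affine; exact: sm_base. Qed.
Lemma smoothZ c f : is_smooth f -> is_smooth (fun x => c * f x).
Proof. by move=> sf; apply: smoothM => //; exact: smooth_cst. Qed.
Lemma smoothN f : is_smooth f -> is_smooth (fun x => - f x).
Proof. by move=> /(smoothZ (-1)); congr is_smooth; apply/funext => x; rewrite mulN1r. Qed.
Lemma smoothB f g : is_smooth f -> is_smooth g -> is_smooth (fun x => f x - g x).
Proof. by move=> sf sg; apply: smoothD => //; exact: smoothN. Qed.
Lemma smooth_shift f v : is_smooth f -> is_smooth (fun x => f (x + v)).
Proof. by move=> /(smooth_affine 1 v); congr is_smooth; apply/funext => x; rewrite scale1r. Qed.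
Lemma smooth_sum I (s : seq I) (F : I -> rV -> R) : (forall i, is_smooth (F i)) ->
  is_smooth (fun x => \sum_(i <- s) F i x).
Proof.
move=> sF; elim: s => [|i s IH].
  by rewrite (_ : (fun _ => _) = cst 0); [exact: smooth_cst|apply/funext => x; rewrite big_nil].
by rewrite (_ : (fun _ => _) = fun x => F i x + \sum_(i <- s) F i x); [exact: smoothD|apply/funext => x; rewrite big_cons].
Qed.

Lemma pderivE f i x df : is_derive x (basis_vec i) f df -> pderiv i f x = df.
Proof. by case. Qed.

Lemma pderiv_cst i c x : pderiv i (cst c : rV -> R) x = 0.
Proof. by apply: pderivE; exact: is_derive_cst. Qed.
Lemma pderiv_coord i j x : pderiv j (fun x : rV => x ord0 i) x = (i == j)%:R.
Proof. exact/pderivE/is_derive_coord. Qed.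
Lemma pderivD i f g x : is_smooth f -> is_smooth g ->
  pderiv i (fun x => f x + g x) x = pderiv i f x + pderiv i g x.
Proof. by move=> sf sg; apply/pderivE; apply: is_deriveD; exact: is_pderiv. Qed.
Lemma pderivM i f g x : is_smooth f -> is_smooth g ->
  pderiv i (fun x => f x * g x) x = f x * pderiv i g x + g x * pderiv i f x.
Proof. by move=> sf sg; apply/pderivE; apply: is_deriveM; exact: is_pderiv. Qed.
Lemma pderivZ i c f x : is_smooth f -> pderiv i (fun x => c * f x) x = c * pderiv i f x.
Proof. by move=> sf; rewrite pderivM// ?pderiv_cst ?mulr0 ?addr0//; exact: smooth_cst. Qed.
Lemma pderivN i f x : is_smooth f -> pderiv i (fun x => - f x) x = - pderiv i f x.
Proof. by move=> sf; apply/pderivE; apply: is_deriveN; exact: is_pderiv. Qed.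
Lemma pderivB i f g x : is_smooth f -> is_smooth g ->
  pderiv i (fun x => f x - g x) x = pderiv i f x - pderiv i g x.
Proof. by move=> sf sg; rewrite pderivD// ?pderivN//; exact: smoothN. Qed.
Lemma pderiv_comp i F dF f x : is_smooth f -> is_derive (f x) 1 F dF ->
  pderiv i (fun x => F (f x)) x = dF * pderiv i f x.
Proof. by move=> sf HF; apply/pderivE; apply: is_derive_comp => //; exact: is_pderiv. Qed.
Lemma pderiv_affine i f a v x : is_smooth f ->
  pderiv i (fun x => f (a *: x + v)) x = a * pderiv i f (a *: x + v).
Proof. by move=> sf; apply/pderivE/is_derive_affine/is_pderiv. Qed.
Lemma pderiv_shift i f v x : is_smooth f -> pderiv i (fun x => f (x + v)) x = pderiv i f (x + v).
Proof.
move=> sf; have := pderiv_affine i 1 v x sf; rewrite mul1r scale1r => <-.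
by congr (pderiv i _ x); apply/funext => y; rewrite scale1r.
Qed.
Lemma pderiv_sum I (s : seq I) (F : I -> rV -> R) i x : (forall j, is_smooth (F j)) ->
  pderiv i (fun x => \sum_(j <- s) F j x) x = \sum_(j <- s) pderiv i (F j) x.
Proof.
move=> sF; elim: s => [|j s IH].
  rewrite big_nil (_ : (fun _ => _) = cst 0); [exact: pderiv_cst|].
  by apply/funext => y; rewrite big_nil.
rewrite big_cons -IH -pderivD//; last exact: smooth_sum.
by congr (pderiv i _ x); apply/funext => y; rewrite big_cons.
Qed.

(* E(s) = exp(-1/s) for s > 0, extended by 0; its derivatives are p(1/s) exp(-1/s). *)
Definition expinv (p : {poly R}) (s : R) : R := if 0 < s then p.[s^-1] * expR (- s^-1) else 0.

Lemma expinv0 p s : s <= 0 -> expinv p s = 0.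
Proof. by move=> s0; rewrite /expinv ltNge s0. Qed.

Lemma expinvE p s : 0 < s -> expinv p s = p.[s^-1] * expR (- s^-1).
Proof. by move=> s0; rewrite /expinv s0. Qed.

(** The derivative of [p(1/s) exp(-1/s)] is [s^-2 (p - p')(1/s) exp(-1/s)]. *)
Definition expinv_next (p : {poly R}) : {poly R} := 'X^2 * (p - p^`()).

Lemma expR_ge_pow n (t : R) : 0 <= t -> t ^+ n <= n`!%:R * expR t.
Proof.
move=> t0; case: n => [|n]; first by rewrite expr0 fact0 mul1r -[1]expR0 ler_expR.
have := expR_ge1Dxn n t0; rewrite -ler_pdivrMl ?ltr0n ?fact_gt0// mulrC => H.
by apply: le_trans H; rewrite mulrC lerDr.
Qed.

Lemma poly_bound (p : {poly R}) : exists n (C : R), 0 <= C /\ forall t, 1 <= t -> `|p.[t]| <= C * t ^+ n.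
Proof.
elim/poly_ind: p => [|p c [n [C [C0 H]]]].
  by exists 0%N, 0; split => // t _; rewrite horner0 normr0 mul0r.
exists n.+1, (C + `|c|); split; first by rewrite addr_ge0.
move=> t t1; rewrite hornerMXaddC (le_trans (ler_normD _ _))// mulrDl.
have t0 : 0 <= t by rewrite (le_trans _ t1).
apply: lerD; first by rewrite normrM (ger0_norm t0) exprSr mulrA ler_wpM2r// H.
by rewrite ler_peMr// exprn_ege1.
Qed.

(* exp beats every power, so p(1/s) exp(-1/s) = O(s^2) at 0+ *)
Lemma expinv_le_sqr p : exists2 C : R, 0 <= C & forall s, s <= 1 -> `|expinv p s| <= C * s ^+ 2.
Proof.
have [n [C [C0 HC]]] := poly_bound p.
exists (C * n.+2`!%:R); first by rewrite mulr_ge0.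
move=> s s1; have [s0|s0] := ltP 0 s; last by rewrite expinv0// normr0 mulr_ge0 ?sqr_ge0 ?mulr_ge0.
rewrite expinvE// normrM (gtr0_norm (expR_gt0 _)).
have is1 : 1 <= s^-1 by rewrite invf_ge1.
rewrite (le_trans (ler_wpM2r (ltW (expR_gt0 _)) (HC _ is1)))// -!mulrA ler_wpM2l//.
rewrite expRN ler_pdivrMr ?expR_gt0//.
have := @expR_ge_pow n.+2 s^-1 (le_trans ler01 is1).
rewrite !exprS mulrA -expr2 exprVn => H.
rewrite -(@ler_pM2l _ (s^-1 ^+ 2)) ?exprn_gt0 ?invr_gt0// exprVn (le_trans H)// le_eqVlt; apply/orP; left; apply/eqP.
by field; rewrite gt_eqF.
Qed.

Lemma is_derive_expinv p s : is_derive (s : R) (1 : R) (expinv p) (expinv (expinv_next p) s).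
Proof.
have [s0|s0|->] := ltgtP s 0.
- rewrite [expinv _ s]expinv0 ?(ltW s0)//.
  apply: (near_eq_is_derive (f := @cst R R 0)).
  by near=> x; rewrite expinv0//; apply: ltW; near: x; exact: lt_nbhsl.
- rewrite expinvE//.
  apply: (@near_eq_is_derive R R R (fun s : R => p.[s^-1] * expR (- s^-1) : R)).
    near=> x; rewrite expinvE//; near: x; exact: lt_nbhsr.
  have Hi : is_derive s 1 (fun x : R => x^-1) (- s ^- 2).
    have H := @is_deriveV R (@id R) s 1 1 (lt0r_neq0 s0) (is_derive_id _ _).
    by apply: (is_derive_eq H); rewrite /GRing.scale /= mulr1.
  have Hp : is_derive s 1 (horner p \o (fun x : R => x^-1)) (p^`().[s^-1] * - s ^- 2).
    by apply: is_derive_comp.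
  have He : is_derive s 1 (expR \o (fun x : R => - x^-1)) (expR (- s^-1) * s ^- 2).
    have Hn : is_derive s 1 (fun x : R => - x^-1) (s ^- 2) by have := is_deriveN Hi; rewrite opprK.
    exact: (is_derive_comp Hn (is_derive_expR _)).
  have := is_deriveM Hp He => /is_derive_eq; apply.
  rewrite /expinv_next hornerM hornerXn hornerD hornerN /GRing.scale /= exprVn; ring.
(* At 0 the quadratic bound makes the difference quotient of size at most [C |h|], so the derivative
   is 0. *)
- rewrite expinv0//; have [C C0 HC] := expinv_le_sqr p.
  have N1 : \forall h \near (0 : R)^', h <= 1.
    exists 1 => //= h /=; rewrite distrC subr0 => /ltW h1 _.
    exact: le_trans (ler_norm _) h1.
  have H : h^-1 *: ((expinv p \o shift 0) (h *: 1) - expinv p 0) @[h --> (0 : R)^'] --> (0 : R).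
    apply: norm_cvg0; apply: (@squeeze_cvgr _ _ _ _ (cst 0) (fun h => C * `|h|)); last first.
    - rewrite -[X in _ --> X](mulr0 C) -[in X in _ --> X](normr0 R); apply: cvgM; first exact: cvg_cst.
      by apply: cvg_norm; apply: cvg_within_filter; exact: cvg_id.
    - exact: cvg_cst.
    near=> h; rewrite normr_ge0 /= addr0 (expinv0 _ (lexx 0)) subr0 [_ *: 1]mulr1.
    rewrite /GRing.scale /= normrM normfV ler_pdivrMl ?normr_gt0; last by near: h; exact: nbhs_dnbhs_neq.
    rewrite mulrCA -expr2 real_normK ?num_real// HC//.
    by near: h.
  by apply: DeriveDef; [exact: cvgP H|exact: cvg_lim H].
Unshelve. all: by end_near.
Qed.

Lemma smooth1_expinv p : smooth1 (expinv p).
Proof.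
exists (fun n => expinv (iter n expinv_next p)); split => // n t.
by rewrite iterS; exact: is_derive_expinv.
Qed.

End smooth_theory.

(** * Test functions *)

Section integral_shift.
Context {R : realType} {m : nat}.
Local Notation mu := (lebesgue_rV R m).
Local Notation rV := 'rV[R]_m.

Lemma ge0_integral_shift (f : rV -> \bar R) (v : rV) : measurable_fun setT f ->
  (forall x, (0 <= f x)%E) -> (\int[mu]_x f (x + v)%R = \int[mu]_x f x)%E.
Proof.
move=> mf f0; have := @ge0_integral_pushforward _ _ _ _ R _ (measurable_rV_shift v) mu setT f measurableT mf.
rewrite preimage_setT => <- //.
apply: eq_measure_integral; first exact: measurable_rV_shift.
by move=> mv A mA _; exact: lebesgue_rV_shift.
Qed.

Lemma itg_shift (f : rV -> R) (v : rV) : itg setT f -> itg setT (fun x => f (x + v)).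
Proof.
move=> /integrableP[mf If]; apply/integrableP; split.
  by apply: (measurableT_comp (f := EFin \o f) (g := rV_shift v)) => //; exact: measurable_rV_shift.
rewrite (ge0_integral_shift (f := fun x => `|(f x)%:E|%E))//.
exact: measurableT_comp.
Qed.

Lemma intg_shift (f : rV -> R) (v : rV) : itg setT f ->
  (\int[mu]_x f (x + v) = \int[mu]_x f x)%R.
Proof.
move=> If; congr fine.
have mf : measurable_fun setT (EFin \o f) by case/integrableP : If.
have := @integral_pushforward _ _ _ _ R _ (measurable_rV_shift v) mu setT (EFin \o f) mf.
rewrite preimage_setT => <- //; last exact: itg_shift.
apply: eq_measure_integral; first exact: measurable_rV_shift.
by move=> mv A mA _; exact: lebesgue_rV_shift.
Qed.

Lemma intg_supp (D : set rV) (f : rV -> R) : (forall x, ~ D x -> f x = 0) ->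
  (\int[mu]_(x in D) f x = \int[mu]_x f x)%R.
Proof.
move=> f0; rewrite Rintegral_mkcond; apply: eq_intg => x _; rewrite patchE.
by case: ifPn => // /negP xD; rewrite f0// => Dx; apply: xD; rewrite inE.
Qed.

Lemma itg_supp (D : set rV) (f : rV -> R) : measurable D -> (forall x, ~ D x -> f x = 0) ->
  itg D f <-> itg setT f.
Proof.
move=> mD f0; rewrite /itg integrable_mkcond//.
suff -> : (EFin \o f) \_ D = EFin \o f by [].
apply/funext => x; rewrite patchE; case: ifPn => // /negP xD.
by rewrite /= f0// => Dx; apply: xD; rewrite inE.
Qed.

Lemma itg_restrict (D : set rV) (f : rV -> R) : measurable D ->
  itg D f <-> itg setT (f \_ D).
Proof.
move=> mD; rewrite /itg integrable_mkcond//.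
suff -> : (EFin \o f) \_ D = EFin \o (f \_ D) by [].
by apply/funext => x; rewrite /= !patchE; case: ifP.
Qed.

Lemma L2_restrict (D : set rV) (f : rV -> R) : measurable D -> L2 D f <-> L2 setT (f \_ D).
Proof.
move=> mD; rewrite /L2.
rewrite -(measurable_restrictT f mD) -/(itg D (fun x => f x ^+ 2)) itg_restrict// /itg.
suff -> : (fun x : rV => ((f \_ D) x ^+ 2)%:E) = EFin \o ((fun x => f x ^+ 2) \_ D) by [].
by apply/funext => x; rewrite /= !patchE; case: ifP => //; rewrite expr0n.
Qed.

Lemma dot_restrict (D : set rV) (f g : rV -> R) : measurable D ->
  dotL2 D f g = dotL2 setT (f \_ D) (g \_ D).
Proof.
move=> mD; rewrite /dotL2 Rintegral_mkcond; apply: eq_intg => x _; rewrite !patchE.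
by case: ifP => // _; rewrite mulr0.
Qed.

Lemma L2_sub (D D' : set rV) (f : rV -> R) : measurable D -> measurable D' -> D' `<=` D ->
  L2 D f -> L2 D' f.
Proof.
move=> mD mD' sD [mf If]; split; first exact: measurable_funS mf.
exact: integrableS If.
Qed.

Lemma L2_shift (f : rV -> R) v : L2 setT f -> L2 setT (fun x => f (x + v)).
Proof.
move=> [mf If]; split.
  by apply: (measurableT_comp (f := f) (g := rV_shift v)) => //; exact: measurable_rV_shift.
exact: (@itg_shift (fun x => f x ^+ 2)).
Qed.

Lemma dot_shift (f g : rV -> R) v : L2 setT f -> L2 setT g ->
  dotL2 setT (fun x => f (x + v)) (fun x => g (x + v)) = dotL2 setT f g.
Proof.
move=> Lf Lg; rewrite /dotL2; apply: (@intg_shift (fun x => f x * g x)).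
exact: L2_itgM.
Qed.

Lemma normL2_shift (f : rV -> R) v : L2 setT f ->
  normL2 setT (fun x => f (x + v)) = normL2 setT f.
Proof. by move=> Lf; rewrite /normL2 dot_shift. Qed.

End integral_shift.

Section test_functions.
Context {R : realType} {m : nat}.
Local Notation mu := (lebesgue_rV R m).
Local Notation rV := 'rV[R]_m.
Implicit Types (D K : set rV) (f g : rV -> R).

Record testf D f : Prop := TestF {
  testf_smooth : is_smooth f ;
  testf_supp : exists K, [/\ compact K, K `<=` D & forall x, ~ K x -> f x = 0] }.

Lemma testfP D f : testf D f <-> test_function D f.
Proof. by split => [[[sf] H]|[sf H]]; split. Qed.

Lemma pderiv_near0 i f x : (\forall y \near x, f y = 0) -> pderiv i f x = 0.
Proof.
move=> f0; rewrite /pderiv -(derive_cst (0 : R) x (basis_vec i)).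
by apply: near_eq_derive; apply: filterS f0 => y ->.
Qed.

Lemma pderiv_out K i f : closed K -> (forall x, ~ K x -> f x = 0) ->
  forall x, ~ K x -> pderiv i f x = 0.
Proof.
move=> cK f0 x Kx; apply: pderiv_near0.
have : nbhs x (~` K) by apply: open_nbhs_nbhs; split => //; exact: closed_openC.
by apply: filterS.
Qed.

Lemma compact_closed_rV K : compact K -> closed K.
Proof. exact: compact_closed (@norm_hausdorff _ _). Qed.

Lemma testf_pderiv D i f : testf D f -> testf D (pderiv i f).
Proof.
move=> [sf [K [cK KD f0]]]; split; first exact: smooth_pderiv.
by exists K; split => //; apply: pderiv_out => //; exact: compact_closed_rV.
Qed.

Lemma testfMl D c f : is_smooth c -> testf D f -> testf D (fun x => c x * f x).
Proof.
move=> sc [sf [K [cK KD f0]]]; split; first exact: smoothM.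
by exists K; split => // x Kx; rewrite f0// mulr0.
Qed.

Lemma testfMr D c f : is_smooth c -> testf D f -> testf D (fun x => f x * c x).
Proof. by move=> sc /(testfMl sc); congr testf; apply/funext => x; rewrite mulrC. Qed.

Lemma testfD D f g : testf D f -> testf D g -> testf D (fun x => f x + g x).
Proof.
move=> [sf [K [cK KD f0]]] [sg [L [cL LD g0]]]; split; first exact: smoothD.
exists (K `|` L); split; first exact: compactU.
  by move=> x [/KD|/LD].
by move=> x H; rewrite f0 ?g0 ?addr0// => ?; apply: H; [right|left].
Qed.

Lemma testfZ D c f : testf D f -> testf D (fun x => c * f x).
Proof. by apply: testfMl; exact: smooth_cst. Qed.

Lemma testfN D f : testf D f -> testf D (fun x => - f x).
Proof. by move=> /(testfZ (-1)); congr testf; apply/funext => x; rewrite mulN1r. Qed.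

Lemma testfB D f g : testf D f -> testf D g -> testf D (fun x => f x - g x).
Proof. by move=> tf tg; apply: testfD => //; exact: testfN. Qed.

Lemma testf0 D : testf D (cst 0).
Proof.
split; first exact: smooth_cst.
by exists set0; split => //; exact: compact0.
Qed.

Lemma testf_sum D I (s : seq I) (F : I -> rV -> R) : (forall i, testf D (F i)) ->
  testf D (fun x => \sum_(i <- s) F i x).
Proof.
move=> sF; elim: s => [|i s IH].
  by rewrite (_ : (fun _ => _) = cst 0); [exact: testf0|apply/funext => x; rewrite big_nil].
by rewrite (_ : (fun _ => _) = fun x => F i x + \sum_(i <- s) F i x); [exact: testfD|apply/funext => x; rewrite big_cons].
Qed.

Lemma testf_sub D D' f : D `<=` D' -> testf D f -> testf D' f.
Proof. by move=> sD [sf [K [cK KD f0]]]; split => //; exists K; split => // x /KD /sD. Qed.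

Lemma testfT D f : testf D f -> testf setT f. Proof. exact: testf_sub. Qed.

Lemma testf_out D f x : testf D f -> ~ D x -> f x = 0.
Proof. by move=> [sf [K [cK KD f0]]] Dx; apply: f0 => /KD. Qed.

Lemma testf_shift f v : testf setT f -> testf setT (fun x => f (x + v)).
Proof.
move=> [sf [K [cK KD f0]]]; split; first exact: smooth_shift.
exists [set x - v | x in K]; split => //.
  apply: continuous_compact => //; apply: continuous_subspaceT => x.
  exact: (cvgD (@cvg_id _ _) (@cst_continuous _ _ (- v) x)).
by move=> x Kx; apply: f0 => Kxv; apply: Kx; exists (x + v); rewrite ?addrK.
Qed.

Lemma compact_norm_bound K : compact K -> exists2 r : R, 0 < r & forall x, K x -> `|x| < r.
Proof.
move=> /compact_bounded[M [_ HM]]; exists (`|M| + 2); first by rewrite ltr_wpDl.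
move=> x Kx; apply: (@le_lt_trans _ _ (`|M| + 1)); last by lra.
by apply: HM => //; rewrite (le_lt_trans (ler_norm M))// ltrDl.
Qed.

Lemma testf_bound D f : testf D f -> exists2 M : R, 0 <= M & forall x, `|f x| <= M.
Proof.
move=> [sf [K [cK KD f0]]].
have : compact [set f x | x in K].
  by apply: continuous_compact => //; apply: continuous_subspaceT; exact: smooth_continuous.
move=> /compact_bounded[M [_ HM]]; exists (`|M| + 1); first by rewrite addr_ge0.
move=> x; have [Kx|Kx] := pselect (K x); last by rewrite f0// normr0 addr_ge0.
by apply: (HM (`|M| + 1)); [rewrite (le_lt_trans (ler_norm M))// ltrDl|exists x].
Qed.

Lemma smooth_measurable D f : measurable D -> is_smooth f -> measurable_fun D f.
Proof.
move=> mD sf; apply: measurable_funS measurableT _ _ => //.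
by apply: continuous_measurable_rV; exact: smooth_continuous.
Qed.

Lemma smooth_bounded_on D f : bounded_set D -> is_smooth f ->
  exists2 M : R, 0 <= M & forall x, D x -> `|f x| <= M.
Proof.
move=> bD sf.
have cK : compact (closure D).
  apply: bounded_closed_compact; last exact: closed_closure.
  move: bD => [M [Mr HM]]; exists M; split => // r Mr' x Dx.
  have cl : closed [set x : rV | `|x| <= r].
    by apply: (@closed_comp _ _ (fun x : rV => `|x|) [set y | y <= r]); [move=> ? _; exact: norm_continuous|exact: closed_le].
  have := closure_subset (fun x => HM r Mr' x) Dx; rewrite -(closure_id _).1//.
have : compact [set f x | x in closure D].
  by apply: continuous_compact => //; apply: continuous_subspaceT; exact: smooth_continuous.
move=> /compact_bounded[M [_ HM]]; exists (`|M| + 1); first by rewrite addr_ge0.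
move=> x Dx; apply: (HM (`|M| + 1)); first by rewrite (le_lt_trans (ler_norm M))// ltrDl.
by exists x => //; exact: subset_closure.
Qed.

Lemma testf_itg f : testf setT f -> itg setT f.
Proof.
move=> tf; have [M M0 HM] := testf_bound tf.
have [sf [K [cK KD f0]]] := tf.
have mK := measurable_compact_rV cK.
apply/(itg_supp mK f0); apply: (@itg_bounded _ _ _ mK _ M) => //.
- by apply: measurable_bounded_rV_lty => //; exact: compact_bounded.
- exact: smooth_measurable.
Qed.

Lemma testfM D f g : testf D f -> testf D g -> testf D (fun x => f x * g x).
Proof. by move=> [sf _]; exact: testfMl. Qed.

Lemma testf_L2 D D' f : measurable D' -> testf D f -> L2 D' f.
Proof.
move=> mD' /testfT tf; apply: (@L2_sub _ _ setT) => //; split.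
  by apply: smooth_measurable => //; case: tf.
by have := testf_itg (testfM tf tf); apply: eq_itg => // x _; rewrite expr2.
Qed.

Lemma MVT_line f i (x : rV) (t : R) : is_smooth f ->
  exists2 c : R, `|c| <= `|t| & f (x + t *: basis_vec i) - f x = t * pderiv i f (x + c *: basis_vec i).
Proof.
move=> sf; pose F (s : R) := f (x + s *: basis_vec i).
have dF (s : R) : is_derive (s : R) (1 : R) F (pderiv i f (x + s *: basis_vec i)).
  have /is_derive_line := is_pderiv i (x + s *: basis_vec i) sf.
  move=> H; have H' : is_derive ((fun r : R => r - s) s) (1 : R)
     (fun r : R => f (r *: basis_vec i + (x + s *: basis_vec i))) (pderiv i f (x + s *: basis_vec i)).
    by rewrite subrr.
  have := @is_derive_comp R R _ (fun r : R => r - s) s 1 1 _ _ H'.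
  rewrite mulr1 (_ : _ \o _ = F); last first.
    by apply/funext => r; rewrite /F /= addrCA -scalerDl subrK.
  apply; apply: is_derive_eq; exact: subr0.
have cF (a b : R) : {within `[a, b], continuous F}.
  by apply: derivable_within_continuous => s _; have [] := dF s.
have [t0|t0] := leP 0 t.
  have [c /itvP Hc H] := @MVT_segment R F _ 0 t t0 (fun s _ => dF s) (cF _ _).
  exists c; first by rewrite !ger0_norm// ?Hc.
  by move: H; rewrite /F scale0r addr0 subr0 mulrC.
have [c /itvP Hc H] := @MVT_segment R F _ t 0 (ltW t0) (fun s _ => dF s) (cF _ _).
exists c; first by rewrite !ler0_norm ?lerN2 ?Hc// ltW.
by move: H; rewrite /F scale0r addr0 sub0r mulrN mulrC => /(congr1 -%R); rewrite opprB opprK.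
Qed.

Lemma norm_basis_vec (i : 'I_m) : `|basis_vec i : rV| <= 1.
Proof.
by apply/norm_rV_leP => // j; rewrite mxE; case: (_ && _); rewrite ?normr1 ?normr0.
Qed.

Lemma dist_half (a b c e : R) : `|a - c| < e / 2 -> `|b - c| < e / 2 -> `|a - b| <= e.
Proof. by rewrite !ltr_norml ler_norml => /andP[? ?] /andP[? ?]; apply/andP; split; lra. Qed.

(** The second difference over a square of side [t] does not depend on the order of the two
    directions, and equals [t ^+ 2] times either mixed derivative at some point within [2 t] of [x].
    Continuity of the mixed derivatives concludes as [t] tends to 0. *)
Lemma smooth_schwarz i j f x : is_smooth f ->
  pderiv i (pderiv j f) x = pderiv j (pderiv i f) x.
Proof.
move=> sf; have key (k l : 'I_m) (t : R) : t != 0 -> exists2 y : rV, `|y - x| <= 2 * `|t| &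
  f (x + t *: basis_vec k + t *: basis_vec l) - f (x + t *: basis_vec k) - f (x + t *: basis_vec l) + f x =
  t ^+ 2 * pderiv l (pderiv k f) y.
  move=> t0; pose g y := f (y + t *: basis_vec l) - f y.
  have sg : is_smooth g by apply: smoothB => //; exact: smooth_shift.
  have [c ct Hc] := MVT_line k x t sg.
  have : pderiv k g (x + c *: basis_vec k) = pderiv k f (x + c *: basis_vec k + t *: basis_vec l)
     - pderiv k f (x + c *: basis_vec k).
    by rewrite pderivB ?pderiv_shift//; exact: smooth_shift.
  have [d dt ->] := MVT_line l (x + c *: basis_vec k) t (smooth_pderiv k sf).
  move=> E; exists (x + c *: basis_vec k + d *: basis_vec l).
    rewrite -(addrA x) (addrC x) addrK (le_trans (ler_normD _ _))// mulr_natl mulr2n !normrZ.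
    by apply: lerD; rewrite -[leRHS]mulr1 ler_pM//; exact: norm_basis_vec.
  rewrite expr2 -mulrA -E -Hc /g; move: (f _) (f _) (f _) (f _) => a1 a2 a3 a4; ring.
apply/eqP; rewrite -subr_eq0 -normr_eq0 eq_le normr_ge0 andbT.
apply/ler_addgt0Pr => e e0; rewrite add0r.
have e2 : 0 < e / 2 by rewrite divr_gt0.
have c1 := smooth_continuous (smooth_pderiv i (smooth_pderiv j sf)).
have c2 := smooth_continuous (smooth_pderiv j (smooth_pderiv i sf)).
have /cvgrPdist_lt/(_ _ e2)/nbhs_ballP[d1 /= d10 H1] := c1 x.
have /cvgrPdist_lt/(_ _ e2)/nbhs_ballP[d2 /= d20 H2] := c2 x.
pose t := Num.min d1 d2 / 4.
have t0 : 0 < t by rewrite divr_gt0// lt_min d10.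
have [td1 td2] : 2 * t < d1 /\ 2 * t < d2.
  rewrite /t; case: (leP d1 d2) => H; split; lra.
have [y Hy Ey] := key j i t (lt0r_neq0 t0).
have [z Hz Ez] := key i j t (lt0r_neq0 t0).
have E : pderiv i (pderiv j f) y = pderiv j (pderiv i f) z.
  apply: (mulfI (_ : t ^+ 2 != 0)); first by rewrite expf_neq0// lt0r_neq0.
  refine (etrans (esym Ey) (etrans _ Ez)).
  by rewrite [x + t *: basis_vec j + _]addrAC; congr (_ + _); exact: addrAC.
rewrite (gtr0_norm t0) in Hy Hz.
have {}H1 : `|pderiv i (pderiv j f) x - pderiv i (pderiv j f) y| < e / 2.
  by apply: H1; rewrite -ball_normE /= distrC; apply: le_lt_trans Hy _.
have {}H2 : `|pderiv j (pderiv i f) x - pderiv j (pderiv i f) z| < e / 2.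
  by apply: H2; rewrite -ball_normE /= distrC; apply: le_lt_trans Hz _.
by apply: (dist_half H1); rewrite E.
Qed.

(** Difference quotients have integral 0 by translation invariance; the mean value theorem dominates
    them by a constant on a fixed ball, and the integral passes to the limit. *)
Lemma intg_pderiv0 i f : testf setT f -> (\int[mu]_x pderiv i f x = 0)%R.
Proof.
move=> tf; have [M M0 HM] := testf_bound (testf_pderiv i tf).
have [sf [K [cK _ f0]]] := tf.
have [r r0 Hr] := compact_norm_bound cK.
pose B : set rV := ball (0 : rV) (r + 1).
have mB : measurable B by apply: measurable_ball_rV; rewrite ltr_wpDl// ltW.
pose t n : R := n.+1%:R^-1.
have t0 n : 0 < t n by rewrite invr_gt0.
have t1 n : t n <= 1 by rewrite invf_le1// ler1n.
pose q n x := (t n)^-1 * (f (x + t n *: basis_vec i) - f x).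
have qM n x : `|q n x| <= M.
  rewrite /q; have [c _ ->] := MVT_line i x (t n) sf.
  by rewrite mulKf ?gt_eqF.
have Iq n : itg setT (q n).
  by apply: itgZ => //; apply: itgB => //; [apply: itg_shift|]; exact: testf_itg.
have q0 n : (\int[mu]_x q n x = 0)%R.
  rewrite /q RintegralZl//; last by apply: itgB => //; [apply: itg_shift|]; exact: testf_itg.
  rewrite RintegralB//; [|by apply: itg_shift; exact: testf_itg|exact: testf_itg].
  by rewrite intg_shift ?subrr ?mulr0//; exact: testf_itg.
have qB n x : ~ B x -> q n x = 0.
  rewrite /B -ball_normE /= sub0r normrN => /negP; rewrite -leNgt => Hx.
  rewrite /q !f0 ?subrr ?mulr0// => Kx.
    by have := Hr _ Kx; rewrite ltNge (le_trans _ Hx)// lerDl.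
  have : r + 1 <= `|x + t n *: basis_vec i| + 1.
    rewrite (le_trans Hx)// -[X in `|X|](addrK (t n *: basis_vec i)).
    rewrite (le_trans (ler_normB _ _))// lerD2l normrZ (gtr0_norm (t0 n)).
    by rewrite -[leRHS]mulr1 ler_pM// ?norm_basis_vec// ltW.
  by rewrite lerD2r leNgt Hr.
have IB : itg setT (fun x => M * \1_B x).
  apply/(itg_supp mB) => [x Bx|]; first by rewrite indicE memNset// mulr0.
  apply: (@itg_bounded _ _ _ mB _ M) => //.
  - by rewrite lebesgue_rV_ball ?ltry// ltr_wpDl// ltW.
  - by apply: measurable_funM => //; exact: measurable_indic.
  - by move=> x Bx; rewrite indicE mem_set// mulr1 ger0_norm.
have qle n (x : rV) : `|q n x| <= M * \1_B x.
  rewrite indicE; case: (boolP (x \in B)) => [_|/negP xB]; first by rewrite mulr1.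
  by rewrite qB ?normr0 ?mulr0// => Bx; apply: xB; rewrite inE.
have qc (x : rV) : q ^~ x @ \oo --> pderiv i f x.
  have [dfx <-] := is_pderiv i x sf.
  have /cvg_ex[l Hl] := dfx.
  have -> : 'D_(basis_vec i) f x = l by exact: cvg_lim Hl.
  have tc : (forall n, t n != 0) /\ t @ \oo --> (0 : R).
    by split; [move=> n; rewrite gt_eqF|exact: cvg_harmonic].
  have := (cvgr_dnbhsP _ _ _).1 Hl t tc; apply: cvg_trans; apply: near_eq_cvg; apply: nearW => n.
  by rewrite /q /= [t n *: _ + x]addrC.
have [_ H] := @dct _ _ setT measurableT q (pderiv i f) _ (fun n => itg_meas (Iq n))
  (smooth_measurable measurableT (smooth_pderiv i sf)) IB (nearW _ (fun x _ => qc x)) (nearW _ (fun x n _ => qle n x)).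
apply/esym; apply: cvg_unique H; first exact: norm_hausdorff.
rewrite (_ : (fun n => _) = cst 0); first exact: cvg_cst.
by apply/funext => n; exact: q0.
Qed.

End test_functions.

(** * Translations and difference quotients *)

Section translation.
Context {R : realType} {m : nat}.
Local Notation mu := (lebesgue_rV R m).
Local Notation rV := 'rV[R]_m.
Local Notation L2T := (@L2 R m setT).
Local Notation nrm := (@normL2 R m setT).
Local Notation dot := (@dotL2 R m setT).
Local Notation mT := (@measurableT _ rV).
Implicit Types (D K : set rV) (f g u v : rV -> R).

(** Reduces a statement about all small shifts to sequences, the form in which dominated convergence
    applies. *)
Lemma seq_near0 (P : rV -> Prop) :
  (forall w : nat -> rV, (forall n, `|w n| < n.+1%:R^-1) -> exists n, P (w n)) ->
  exists2 d : R, 0 < d & forall w, `|w| < d -> P w.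
Proof.
move=> H; apply: contrapT => Hn.
have {}Hn n : exists w : rV, `|w| < n.+1%:R^-1 /\ ~ P w.
  apply: contrapT => Hw; apply: Hn; exists n.+1%:R^-1; first by rewrite invr_gt0.
  by move=> w wn; apply: contrapT => Pw; apply: Hw; exists w.
have [w Hw] := choice Hn.
by have [n] := H w (fun n => (Hw n).1); exact: (Hw n).2.
Qed.

Lemma harmonic_cvg0 (w : nat -> rV) : (forall n, `|w n| < n.+1%:R^-1) -> w @ \oo --> (0 : rV).
Proof.
move=> Hw; apply: norm_cvg0; apply: (squeeze_cvgr _ (cvg_cst 0) (@cvg_harmonic R)).
by apply: nearW => n; rewrite normr_ge0 /= ltW.
Qed.

Lemma cvg_bound_ex (x : nat -> R) (e : R) : x @ \oo --> (0 : R) -> 0 < e -> exists n, x n <= e.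
Proof.
move=> /cvgrPdist_le H e0; have [n _ /(_ n (leqnn n))] := H e e0.
by rewrite /= sub0r normrN => Hn; exists n; exact: le_trans (ler_norm _) Hn.
Qed.

Lemma testf_bound_ball f : testf setT f -> exists B : set rV, exists M : R,
  [/\ measurable B, 0 <= M, L2T (fun x => M * \1_B x) &
     forall (w : rV) x, `|w| <= 1 -> `|f (x + w)| <= M * \1_B x].
Proof.
move=> tf; have [M M0 HM] := testf_bound tf.
have [sf [K [cK _ f0]]] := tf.
have [r r0 Hr] := compact_norm_bound cK.
have r10 : 0 < r + 1 by rewrite ltr_wpDl// ltW.
pose B : set rV := ball (0 : rV) (r + 1).
have mB : measurable B by exact: measurable_ball_rV.
exists B, M; split => //.
  have := @L2_bounded R m B mB (fun x => M * \1_B x) M.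
  rewrite lebesgue_rV_ball// ltry => /(_ isT) H.
  have mM : measurable_fun setT (fun x => M * \1_B x : R).
    by apply: measurable_funM => //; exact: measurable_indic.
  have /(L2_restrict _ mB) : L2 B (fun x => M * \1_B x).
    apply: H; first exact: measurable_funS mM.
    by move=> x Bx; rewrite indicE mem_set// mulr1 ger0_norm.
  congr L2; apply/funext => x; rewrite patchE indicE.
  by case: (boolP (x \in B)) => // _; rewrite mulr0.
move=> w x w1; rewrite indicE; case: (boolP (x \in B)) => [_|/negP xB]; first by rewrite mulr1.
rewrite f0 ?normr0 ?mulr0// => Kx; apply: xB; rewrite inE /B -ball_normE /= sub0r normrN.
rewrite -[X in `|X|](addrK w) (le_lt_trans (ler_normB _ _))// ltr_leD//; exact: Hr.
Qed.

Lemma test_shift_cvg f : testf setT f -> forall e, 0 < e -> exists2 d : R, 0 < d &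
  forall w, `|w| < d -> nrm (fun x => f (x + w) - f x) <= e.
Proof.
move=> tf e e0; apply: seq_near0 => w Hw.
have [B [M [mB M0 LB HB]]] := testf_bound_ball tf.
have w1 n : `|w n| <= 1.
  by rewrite (le_trans (ltW (Hw n)))// invf_le1// ler1n.
have sf := testf_smooth tf.
have cf (x : rV) : f (x + w n) @[n --> \oo] --> f x.
  have H : x + w n @[n --> \oo] --> x.
    by rewrite -[X in _ --> X]addr0; apply: cvgD; [exact: cvg_cst|exact: harmonic_cvg0].
  by apply: continuous_cvg; [exact: smooth_continuous|exact: H].
have [_ H] := @dct_L2 R m setT mT (fun n x => f (x + w n)) f (fun x => M * \1_B x)
  (fun n => smooth_measurable mT (smooth_shift (w n) sf)) (smooth_measurable mT sf) LB
  (nearW _ (fun x _ => cf x)) (nearW _ (fun x n _ => HB (w n) x (w1 n))).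
exact: cvg_bound_ex H e0.
Qed.

Lemma test_diffq_cvg i f : testf setT f -> forall e, 0 < e -> exists2 d : R, 0 < d &
  forall r, r != 0 -> `|r| < d ->
    nrm (fun x => r^-1 * (f (x + r *: basis_vec i) - f x) - pderiv i f x) <= e.
Proof.
move=> tf e e0.
have tdf := testf_pderiv i tf; have sf := testf_smooth tf; have sdf := testf_smooth tdf.
have [B [M [mB M0 LB HB]]] := testf_bound_ball tdf.
pose P (r : R) := r != 0 -> nrm (fun x => r^-1 * (f (x + r *: basis_vec i) - f x) - pderiv i f x) <= e.
suff [d d0 Hd] : exists2 d : R, 0 < d & forall r, `|r| < d -> P r.
  by exists d => // r r0 rd; exact: Hd.
apply: contrapT => Hn.
have {}Hn n : exists r : R, `|r| < n.+1%:R^-1 /\ ~ P r.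
  apply: contrapT => Hw; apply: Hn; exists n.+1%:R^-1; first by rewrite invr_gt0.
  by move=> w wn; apply: contrapT => Pw; apply: Hw; exists w.
have [r Hr] := choice Hn.
have r0 n : r n != 0 by apply/eqP => r0; apply: (Hr n).2; rewrite /P r0 eqxx.
have r1 n : `|r n| <= 1.
  by rewrite (le_trans (ltW (Hr n).1))// invf_le1// ler1n.
have rc : r @ \oo --> (0 : R).
  apply: norm_cvg0; apply: (squeeze_cvgr _ (cvg_cst 0) (@cvg_harmonic R)).
  by apply: nearW => n; rewrite normr_ge0 /= ltW// (Hr n).1.
pose q n (x : rV) := (r n)^-1 * (f (x + r n *: basis_vec i) - f x).
have cq x : q ^~ x @ \oo --> pderiv i f x.
  have [dfx <-] := is_pderiv i x sf.
  have /cvg_ex[l Hl] := dfx.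
  have -> : 'D_(basis_vec i) f x = l by exact: cvg_lim Hl.
  have := (cvgr_dnbhsP _ _ _).1 Hl r (conj r0 rc); apply: cvg_trans; apply: near_eq_cvg; apply: nearW => n.
  by rewrite /= [r n *: _ + x]addrC.
have bq x n : `|q n x| <= M * \1_B x.
  rewrite /q; have [c cr ->] := MVT_line i x (r n) sf.
  rewrite mulKf//; apply: HB; rewrite normrZ (le_trans _ (r1 n))// -[leRHS]mulr1.
  by rewrite ler_pM//; exact: norm_basis_vec.
have [_ H] := @dct_L2 R m setT mT q
  (pderiv i f) (fun x => M * \1_B x)
  (fun n => smooth_measurable mT (smoothZ _ (smoothB (smooth_shift _ sf) sf)))
  (smooth_measurable mT sdf) LB
  (nearW _ (fun x _ => cq x)) (nearW _ (fun x n _ => bq x n)).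
have [n Hle] := cvg_bound_ex H e0.
by apply: (Hr n).2 => _.
Qed.

Lemma normL2_avg n (F : nat -> rV -> R) (B : R) : (forall k, L2T (F k)) ->
  (forall k, nrm (F k) <= B) -> (0 < n)%N -> nrm (fun x => n%:R^-1 * \sum_(k < n) F k x) <= B.
Proof.
move=> LF FB n0; rewrite normL2Z//; last by apply: L2_sum => // k; exact: LF.
rewrite ger0_norm ?invr_ge0// ler_pdivrMl ?ltr0n// mulr_natl.
elim: n {n0} => [|n IH].
  rewrite mulr0n (_ : (fun _ => _) = (fun x => 0 * 0)); last by apply/funext => x; rewrite big_ord0 mulr0.
  by rewrite normL2Z ?normr0 ?mul0r//; exact: L20.
rewrite (_ : (fun _ => _) = (fun x => \sum_(k < n) F k x + F n x)); last first.
  by apply/funext => x; rewrite big_ord_recr.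
rewrite (le_trans (normL2_tri _ _ _))//; first by apply: L2_sum => // k; exact: LF.
by rewrite mulrSr lerD.
Qed.

(* [approx C a]: a is an L2 limit of elements of C. *)
Definition approx (C : (rV -> R) -> Prop) (a : rV -> R) : Prop :=
  L2T a /\ forall e, 0 < e -> exists2 f, C f & nrm (fun x => a x - f x) <= e.

(* Test functions whose translates by [s e_i], [|s| < d], are supported in T. *)
Definition Ctest (T : set rV) i (d : R) f : Prop :=
  testf setT f /\ forall s, `|s| < d -> testf T (fun x => f (x + s *: basis_vec i)).

(** All pairings are over the whole space, [u] and [v] being thought of as zero extensions; the
    domain enters only through the support of the test function. For [T = setT] the zero extension
    itself is weakly differentiable. *)
Definition wdT (T : set rV) i u v : Prop := forall f, testf T f ->
  dot u (pderiv i f) = - dot v f.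

Definition diffq i (s : R) f : rV -> R := fun x => s^-1 * (f (x + s *: basis_vec i) - f x).

Lemma L2_diffq i s f : L2T f -> L2T (diffq i s f).
Proof. by move=> Lf; apply: L2Z => //; apply: L2B => //; exact: L2_shift. Qed.

Lemma dot_diffq i s f g : L2T f -> L2T g -> dot f (diffq i s g) = - dot (diffq i (- s) f) g.
Proof.
move=> Lf Lg; rewrite /diffq dotZr//; last by apply: L2B => //; exact: L2_shift.
rewrite dotBr//; last exact: L2_shift.
rewrite dotZl//; last by apply: L2B => //; exact: L2_shift.
rewrite dotBl//; last exact: L2_shift.
rewrite -(dot_shift (f := fun x => f (x + - s *: basis_vec i)) (s *: basis_vec i) _ Lg); last exact: L2_shift.
rewrite (_ : (fun x => f (x + _ + _)) = f); last first.
  by apply/funext => x; rewrite scaleNr addrK.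
by rewrite invrN mulNr opprK.
Qed.

Lemma testf_L2T f D : testf D f -> L2T f. Proof. by move=> tf; exact: testf_L2 tf. Qed.

(** The difference quotient of [f] with step [- s] is the average of [n] translated quotients with
    step [- s / n]. For [n] large it is L^2 close to the partial derivative of [A], an average of
    translates of [f]; all these translates are test functions on [T], so testing with [A] brings in
    [v]. *)
Lemma diffq_bound T i d u v f s : L2T u -> L2T v -> wdT T i u v -> Ctest T i d f ->
  s != 0 -> `|s| < d -> `|dot f (diffq i s u)| <= nrm f * nrm v.
Proof.
move=> Lu Lv uv [tf Cf] s0 sd.
have Lf := testf_L2T tf.
rewrite dot_diffq// normrN.
apply/ler_addgt0Pr => e e0.
pose e' := e / (nrm u + 1).
have u1 : 0 < nrm u + 1 by rewrite ltr_wpDl// normL2_ge0.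
have e'0 : 0 < e' by rewrite divr_gt0.
have [d1 d10 Hd1] := test_diffq_cvg i tf e'0.
have [n n0 Hn] : exists2 n : nat, (0 < n)%N & `|- s / n%:R| < d1.
  have [N HN] : exists N : nat, `|s| / d1 < N%:R.
    by exists (Num.bound (`|s| / d1)); rewrite archi_boundP// divr_ge0// ltW.
  exists N.+1 => //; rewrite normrM normrN normfV [`|N.+1%:R|]ger0_norm// ltr_pdivrMr ?ltr0n//.
  move: HN; rewrite ltr_pdivrMr// => HN; rewrite (lt_trans HN)// mulrC ltr_pM2l// ltr_nat//.
set r := - s / n%:R in Hn.
have nn0 : n%:R != 0 :> R by rewrite pnatr_eq0 -lt0n.
have r0 : r != 0 by rewrite mulf_neq0 ?oppr_eq0// invr_eq0.
pose F k x := f (x + (k%:R * r) *: basis_vec i).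
pose A x := n%:R^-1 * \sum_(k < n) F k x.
have tF k : (k < n)%N -> testf T (F k).
  move=> kn; apply: Cf; rewrite (le_lt_trans _ sd)// /r mulrCA normrM normrN.
  rewrite ler_piMr// ger0_norm ?divr_ge0// ler_pdivrMr ?ltr0n// mul1r ler_nat ltnW//.
have tFT k : testf setT (F k) by exact: testf_shift.
have LF k : L2T (F k) := testf_L2T (tFT k).
have tA : testf T A.
  apply: testfZ; rewrite (_ : (fun _ => _) = (fun x => \sum_(k <- index_enum 'I_n) F k x))//.
  by apply: testf_sum => k; exact: tF.
have LA := testf_L2T tA.
have nF k : nrm (F k) = nrm f by rewrite normL2_shift.
have nA : nrm A <= nrm f by apply: normL2_avg => // k; rewrite nF.
have dA x : pderiv i A x = n%:R^-1 * \sum_(k < n) pderiv i f (x + (k%:R * r) *: basis_vec i).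
  have sF k : is_smooth (F k) by exact: testf_smooth (tFT k).
  rewrite pderivZ; last by apply: smooth_sum => k; exact: sF.
  congr (_ * _); rewrite pderiv_sum; last by move=> k; exact: sF.
  by apply: eq_bigr => k _; rewrite pderiv_shift//; exact: testf_smooth tf.
pose G k x := diffq i r f (x + (k%:R * r) *: basis_vec i) - pderiv i f (x + (k%:R * r) *: basis_vec i).
have Ltdf := testf_L2T (testf_pderiv i tf).
have LG0 : L2T (fun x => diffq i r f x - pderiv i f x) by apply: L2B => //; exact: L2_diffq.
have LG k : L2T (G k) by exact: (L2_shift _ LG0).
have nG k : nrm (G k) <= e'.
  by rewrite (normL2_shift _ LG0); exact: Hd1.
have E x : diffq i (- s) f x = pderiv i A x + n%:R^-1 * \sum_(k < n) G k x.
  rewrite dA -mulrDr -big_split /=.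
  have -> : \sum_(k < n) (pderiv i f (x + (k%:R * r) *: basis_vec i) + G k x) =
    \sum_(k < n) r^-1 * (F k.+1 x - F k x).
    apply: eq_bigr => k _; rewrite /G /diffq addrC subrK /F -addrA -scalerDl.
    by rewrite -natr1 mulrDl mul1r.
  rewrite -mulr_sumr -(big_mkord xpredT (fun k => F k.+1 x - F k x)) telescope_sumr// /F mul0r scale0r addr0.
  rewrite [n%:R * r]mulrC /r divfK// /diffq mulrA; congr (_ * _).
  by rewrite invfM invrK mulrCA mulVf// mulr1.
have LS : L2T (fun x => n%:R^-1 * \sum_(k < n) G k x) by apply: L2Z => //; apply: L2_sum => // k; exact: LG.
have LdA : L2T (pderiv i A) := testf_L2T (testf_pderiv i tA).
rewrite (_ : diffq i (- s) f = (fun x => pderiv i A x + n%:R^-1 * \sum_(k < n) G k x)); last exact/funext.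
rewrite dotDl// (le_trans (ler_normD _ _))//; apply: lerD.
  rewrite dotC uv// normrN dotC (le_trans (dot_CS _ _ _))//.
  by rewrite ler_wpM2r// normL2_ge0.
rewrite (le_trans (dot_CS _ _ _))//.
have nS : nrm (fun x => n%:R^-1 * \sum_(k < n) G k x) <= e' by apply: normL2_avg.
rewrite (le_trans (ler_wpM2r (normL2_ge0 _ _) nS))// /e' mulrAC ler_pdivrMr// ler_wpM2l ?(ltW e0)//.
by rewrite lerDl.
Qed.

Lemma diffq_cvg_test T i d u v f : L2T u -> L2T v -> wdT T i u v -> Ctest T i d f -> 0 < d ->
  forall e, 0 < e -> exists2 d' : R, 0 < d' & forall s, s != 0 -> `|s| < d' ->
    `|dot f (diffq i s u) - dot f v| <= e.
Proof.
move=> Lu Lv uv [tf Cf] d0 e e0.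
have u1 : 0 < nrm u + 1 by rewrite ltr_wpDl// normL2_ge0.
have e'0 : 0 < e / (nrm u + 1) by rewrite divr_gt0.
have [d1 d10 Hd1] := test_diffq_cvg i tf e'0.
exists d1 => // s s0 sd.
have Lf := testf_L2T tf; have Ldf := testf_L2T (testf_pderiv i tf).
have tfT : testf T f.
  by have := Cf 0; rewrite normr0 => /(_ d0); congr testf; apply/funext => x; rewrite scale0r addr0.
rewrite dot_diffq// [dot f v]dotC -[dot v f]opprK -uv// opprK.
rewrite dotC addrC -dotBr//; last exact: L2_diffq.
have Lr : L2T (diffq i (- s) f) by exact: L2_diffq.
rewrite (le_trans (dot_CS mT Lu (L2B mT Ldf Lr)))// normL2BC.
have := Hd1 (- s); rewrite oppr_eq0 normrN => /(_ s0 sd) H.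
rewrite (le_trans (ler_wpM2l (normL2_ge0 _ _) H))// mulrA ler_pdivrMr// mulrC ler_wpM2l ?(ltW e0)//.
by rewrite lerDl.
Qed.

Lemma CtestB T i d f g : Ctest T i d f -> Ctest T i d g -> Ctest T i d (fun x => f x - g x).
Proof. by move=> [tf Cf] [tg Cg]; split => [|s sd]; apply: testfB => //; [exact: Cf|exact: Cg]. Qed.

Lemma approxB T i d a f : approx (Ctest T i d) a -> Ctest T i d f ->
  approx (Ctest T i d) (fun x => a x - f x).
Proof.
move=> [La Ha] Cf; have Lf := testf_L2T Cf.1; split; first exact: L2B.
move=> e e0; have [g Cg Hg] := Ha e e0; exists (fun x => g x - f x); first exact: CtestB.
rewrite (_ : (fun x => _) = (fun x => a x - g x))//.
by apply/funext => x; rewrite opprB addrA subrK.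
Qed.

Lemma diffq_bound_approx T i d u v a s : L2T u -> L2T v -> wdT T i u v -> approx (Ctest T i d) a ->
  s != 0 -> `|s| < d -> `|dot a (diffq i s u)| <= nrm a * nrm v.
Proof.
move=> Lu Lv uv [La Ha] s0 sd.
have LD : L2T (diffq i s u) := L2_diffq i s Lu.
apply/ler_addgt0Pr => e e0.
have c1 : 0 < nrm v + nrm (diffq i s u) + 1 by rewrite ltr_wpDl// addr_ge0// normL2_ge0.
have [f Cf Hf] := Ha (e / (nrm v + nrm (diffq i s u) + 1)) (divr_gt0 e0 c1).
set e' := e / _ in Hf.
have Lf := testf_L2T Cf.1.
have -> : dot a (diffq i s u) = dot (fun x => a x - f x) (diffq i s u) + dot f (diffq i s u).
  by rewrite dotBl// subrK.
have nf : nrm f <= nrm a + e'.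
  rewrite (_ : f = (fun x => a x - (a x - f x))); last by apply/funext => x; rewrite subKr.
  by rewrite (le_trans (normL2_triB mT La (L2B mT La Lf)))// lerD2l.
have H1 := dot_CS mT (L2B mT La Lf) LD.
have H2 := diffq_bound Lu Lv uv Cf s0 sd.
have {}H1 := le_trans H1 (ler_wpM2r (normL2_ge0 _ _) Hf).
have {}H2 := le_trans H2 (ler_wpM2r (normL2_ge0 _ _) nf).
rewrite (le_trans (ler_normD _ _))// (le_trans (lerD H1 H2))//.
have Ee : e = e' * (nrm v + nrm (diffq i s u) + 1) by rewrite divfK// gt_eqF.
have e'0 : 0 <= e' by rewrite divr_ge0// ltW.
rewrite [leRHS](_ : _ = nrm a * nrm v + e' * (nrm v + nrm (diffq i s u) + 1)); last by rewrite -Ee.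
move: (nrm a) (nrm v) (nrm _) e'0 => A B C; clear; move: e' => E E0; lra.
Qed.

(** Known for test functions by [diffq_cvg_test]; the bound of [diffq_bound_approx], uniform in the
    step, carries it over to L^2 limits. *)
Lemma diffq_weak_cvg T i d u v a : L2T u -> L2T v -> wdT T i u v -> approx (Ctest T i d) a -> 0 < d ->
  forall e, 0 < e -> exists2 d' : R, 0 < d' & forall s, s != 0 -> `|s| < d' ->
    `|dot a (diffq i s u) - dot a v| <= e.
Proof.
move=> Lu Lv uv aa d0 e e0; have [La Ha] := aa.
have v1 : 0 < nrm v + 1 by rewrite ltr_wpDl// normL2_ge0.
pose e' := e / 3 / (nrm v + 1).
have e3 : 0 < e / 3 by rewrite divr_gt0.
have e'0 : 0 < e' by rewrite divr_gt0.
have [f Cf Hf] := Ha e' e'0.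
have Lf := testf_L2T Cf.1.
have [d1 d10 Hd1] := diffq_cvg_test Lu Lv uv Cf d0 e3.
exists (Num.min d d1); first by rewrite lt_min d0.
move=> s s0; rewrite lt_min => /andP[sd sd1].
have LD : L2T (diffq i s u) := L2_diffq i s Lu.
have La_f := L2B mT La Lf.
have e'v : e' * nrm v <= e / 3.
  by rewrite /e' mulrAC ler_pdivrMr// ler_wpM2l ?(ltW e3)// lerDl.
have H1 : `|dot a (diffq i s u) - dot f (diffq i s u)| <= e / 3.
  rewrite -dotBl// (le_trans (diffq_bound_approx Lu Lv uv (approxB aa Cf) s0 sd))//.
  exact: le_trans (ler_wpM2r (normL2_ge0 _ _) Hf) e'v.
have H2 : `|dot a v - dot f v| <= e / 3.
  rewrite -dotBl// (le_trans (dot_CS mT La_f Lv))//.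
  exact: le_trans (ler_wpM2r (normL2_ge0 _ _) Hf) e'v.
have H3 := Hd1 s s0 sd1.
move: (dot a (diffq i s u)) (dot f (diffq i s u)) (dot a v) (dot f v) H1 H2 H3 => A B C E.
clear; rewrite !ler_norml => /andP[? ?] /andP[? ?] /andP[? ?]; apply/andP; split; lra.
Qed.

Lemma add3_le (A A' X B C e : R) : A = A' -> X <= B + C -> B <= e / 3 -> C = A' -> A' <= e / 3 -> A + X <= e.
Proof. by move=> -> H1 H2 E H3; move: H1; rewrite E; lra. Qed.

Lemma approx_shift_cvg a : approx (testf setT) a -> forall e, 0 < e -> exists2 d : R, 0 < d &
  forall w, `|w| < d -> nrm (fun x => a (x + w) - a x) <= e.
Proof.
move=> [La Ha] e e0.
have e3 : 0 < e / 3 by rewrite divr_gt0.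
have [f tf Hf] := Ha _ e3; have Lf := testf_L2T tf.
have [d d0 Hd] := test_shift_cvg tf e3; exists d => // w wd.
have {Hd} := Hd w wd => Hd.
have Law := L2_shift w La; have Lfw := L2_shift w Lf.
have L1 : L2T (fun x => a (x + w) - f (x + w)) by exact: L2B.
have L2' : L2T (fun x => f (x + w) - f x) by exact: L2B.
have L3 : L2T (fun x => f x - a x) by exact: L2B.
rewrite (_ : (fun x => _) = (fun x => (a (x + w) - f (x + w)) + ((f (x + w) - f x) + (f x - a x)))); last first.
  by apply/funext => x; rewrite [X in _ = _ + X]addrA subrK addrA subrK.
rewrite (le_trans (normL2_tri mT L1 (L2D mT L2' L3)))//.
have H1 := normL2_tri mT L2' L3.
apply: (add3_le (normL2_shift w (L2B mT La Lf)) H1 Hd); last exact: Hf.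
by rewrite normL2BC.
Qed.

(** * Bump functions, coverings and cutoffs *)

Definition sqdist (x0 x : rV) : R := \sum_(k < m) (x ord0 k - x0 ord0 k) ^+ 2.

Lemma smooth_sqdist x0 : is_smooth (sqdist x0).
Proof.
apply: smooth_sum => k; have sk : is_smooth (fun x : rV => x ord0 k - x0 ord0 k).
  by apply: smoothB; [exact: smooth_coord|exact: smooth_cst].
exact: smoothM.
Qed.

Lemma sqdist_ge (x0 x : rV) (r : R) : 0 < r -> r <= `|x - x0| -> r ^+ 2 <= sqdist x0 x.
Proof.
move=> r0 rx; have [k Hk] : exists k, r <= `|(x - x0) ord0 k|.
  apply: contrapT => H; move: rx; rewrite leNgt => /negP; apply; apply/(norm_rV_ltP _ r0) => k.
  by rewrite ltNge; apply/negP => Hk; apply: H; exists k.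
rewrite /sqdist (bigD1 k)//= (@le_trans _ _ ((x ord0 k - x0 ord0 k) ^+ 2))//.
  by rewrite -[leRHS]real_normK ?num_real// lerXn2r ?nnegrE ?(ltW r0)//; move: Hk; rewrite !mxE.
by rewrite lerDl sumr_ge0// => ? _; rewrite sqr_ge0.
Qed.

Lemma sqdist_le (x0 x : rV) (r : R) : 0 <= r -> `|x - x0| <= r -> sqdist x0 x <= m%:R * r ^+ 2.
Proof.
move=> r0 /(norm_rV_leP _ r0) H; rewrite /sqdist mulr_natl -[in leRHS](card_ord m) -sumr_const.
apply: ler_sum => k _; rewrite -[leLHS]real_normK ?num_real// lerXn2r ?nnegrE//.
by have := H k; rewrite !mxE.
Qed.

(** Built on the squared Euclidean distance because the sup norm is not smooth; [sqdist_ge] and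
    [sqdist_le] compare the two. *)
Definition bumpf (x0 : rV) (r : R) : rV -> R := fun x => expinv 1 (r ^+ 2 - sqdist x0 x).

Lemma smooth_bump x0 r : is_smooth (bumpf x0 r).
Proof.
apply: smooth_comp; first exact: smooth1_expinv.
by apply: smoothB; [exact: smooth_cst|exact: smooth_sqdist].
Qed.

Lemma expinv1_ge0 (s : R) : 0 <= expinv 1 s.
Proof. by rewrite /expinv; case: ifP => // _; rewrite hornerC mul1r expR_ge0. Qed.

Lemma bump_ge0 x0 r x : 0 <= bumpf x0 r x. Proof. exact: expinv1_ge0. Qed.

Lemma bump_out x0 r x : 0 < r -> r <= `|x - x0| -> bumpf x0 r x = 0.
Proof. by move=> r0 H; rewrite /bumpf expinv0// subr_le0; exact: sqdist_ge. Qed.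

(** The factor [m.+1%:R] compares the norms: a point within [r / (m+1)] in sup norm has squared
    Euclidean distance at most [m (r / (m+1))^2], which is below [r^2]. *)
Lemma bump_gt0 x0 r x : 0 < r -> `|x - x0| <= r / m.+1%:R -> 0 < bumpf x0 r x.
Proof.
move=> r0 H; rewrite /bumpf expinvE ?hornerC ?mul1r ?expR_gt0// subr_gt0.
rewrite (le_lt_trans (sqdist_le _ H)) ?divr_ge0 ?(ltW r0)//.
rewrite exprMn mulrCA gtr_pMr ?exprn_gt0// exprVn ltr_pdivrMr ?exprn_gt0// mul1r -natrX ltr_nat.
by rewrite (leq_trans (ltnSn m))// -[X in (X <= _)%N]expn1 leq_pexp2l.
Qed.

Lemma compact_closed_ball (x : rV) (r : R) : compact [set y : rV | `|y - x| <= r].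
Proof.
apply: bounded_closed_compact.
  exists (`|x| + r); split; first exact: num_real.
  move=> M HM y /= Hy; rewrite -[y](subrK x) (le_trans (ler_normD _ _))// addrC.
  by rewrite (le_trans _ (ltW HM))// lerD2l.
apply: (@closed_comp _ _ (fun y : rV => `|y - x|) [set z | z <= r]); last exact: closed_le.
move=> y _; apply: (@continuous_comp _ _ _ (fun y : rV => y - x) (fun y => `|y|)); last exact: norm_continuous.
exact: (cvgD (@cvg_id _ _) (@cst_continuous _ _ (- x) y)).
Qed.

Lemma compact_pos_min K (z : rV -> R) : compact K -> continuous z -> (forall x, K x -> 0 < z x) ->
  exists2 c : R, 0 < c & forall x, K x -> c <= z x.
Proof.
move=> cK cz zK; have [->|/set0P[x0 Kx0]] := eqVneq K set0; first by exists 1.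
have {}cz : {within K, continuous z} by exact: continuous_subspaceT.
have K0 : K !=set0 by exists x0.
have [y yK Hy] := EVT_min_rV K0 cK cz.
by exists (z y) => [|x Kx]; [apply: zK; exact/set_mem|apply: Hy; exact/mem_set].
Qed.

Lemma compact_thick K D : compact K -> open D -> K `<=` D ->
  exists2 d : R, 0 < d & forall x w, K x -> `|w| < d -> D (x + w).
Proof.
move=> /compact_near_coveringP cK oD KD.
have : nbhs (0 : rV) (fun w => K `<=` (fun x => D (x + w))).
  have H0 := cK rV (nbhs (0 : rV)) (fun w x => D (x + w)) _; apply: H0 => x Kx.
  have /nbhs_ballP[r /= r0 rD] : nbhs x D by apply: open_nbhs_nbhs; split => //; exact: KD.
  have r2 : 0 < r / 2 by rewrite divr_gt0.
  exists (ball x (r / 2), ball (0 : rV) (r / 2)).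
    by split; exact: nbhsx_ballx.
  move=> [y w] [/= xy w0]; apply: rD; move: xy w0; rewrite -!ball_normE /= sub0r normrN => xy w0.
  rewrite opprD addrA (splitr r) (le_lt_trans (ler_normB _ _))//; exact: ltrD.
move=> /nbhs_ballP[d /= d0 Hd].
exists d => // x w Kx wd; apply: (Hd w) => //.
by rewrite -ball_normE /= sub0r normrN.
Qed.

Lemma bump_cover K (r : rV -> R) : compact K -> (forall x, K x -> 0 < r x) ->
  exists s : seq rV, (forall x, x \in s -> K x) /\
    forall x, K x -> exists2 y, y \in s & `|x - y| < r y.
Proof.
move=> cK r0; have := cK; rewrite compact_cover => /(_ rV K (fun x => ball x (if 0 < r x then r x else 1))).
case.
- move=> x Kx; exact: ball_open.
- by move=> x Kx; exists x => //; rewrite r0//; apply: ballxx; exact: r0.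
move=> F FK HF; exists (finmap.enum_fset F); split => [x xF|x Kx].
  by apply/set_mem; exact: FK.
have [y /= yF] := HF x Kx; rewrite -ball_normE /= => Hy.
exists y => //; rewrite distrC; move: Hy; rewrite r0//.
by apply/set_mem; exact: FK.
Qed.

Lemma cutoff K (d : R) : compact K -> 0 < d -> exists z : rV -> R, exists K' : set rV,
  [/\ is_smooth z, (forall x, 0 <= z x), (forall x, K x -> 0 < z x), compact K' &
     (forall x, ~ K' x -> z x = 0) /\ (forall x, K' x -> exists2 y, K y & `|x - y| <= d)].
Proof.
move=> cK d0; have d1 : 0 < d / m.+1%:R by rewrite divr_gt0.
have [s [sK Hs]] := bump_cover cK (fun x _ => d1).
exists (fun x => \sum_(y <- s) bumpf y d x), (\bigcup_(y in [set` s]) [set x : rV | `|x - y| <= d]).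
split.
- by apply: smooth_sum => y; exact: smooth_bump.
- by move=> x; apply: sumr_ge0 => y _; exact: bump_ge0.
- move=> x Kx; have [y ys Hy] := Hs x Kx.
  rewrite (big_rem y)//= ltr_pwDl//; first by apply: bump_gt0 => //; exact: ltW.
  by apply: sumr_ge0 => z _; exact: bump_ge0.
- rewrite bigcup_seq; apply: bigsetU_compact => y _; exact: compact_closed_ball.
- split.
    move=> x Hx; rewrite big1_seq// => y /andP[_ ys]; apply: bump_out => //.
    rewrite leNgt; apply/negP => /ltW Hy; apply: Hx; exists y => //.
  by move=> x [y /= ys Hy]; exists y => //; exact: sK.
Qed.

(** * Symmetry of mixed pairings of weak gradients, by difference quotients *)

Section dense.
Variables (D : set rV).
Hypotheses (oD : open D) (dens : forall f, L2 D f -> forall e, 0 < e ->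
  exists2 g, testf D g & normL2 D (fun x => f x - g x) <= e).

Let mD : measurable D := measurable_open_rV oD.

Lemma normL2_out f : (forall x, ~ D x -> f x = 0) -> normL2 D f = nrm f.
Proof. by move=> f0; rewrite /normL2 /dotL2 intg_supp// => x Dx; rewrite f0// mulr0. Qed.

Lemma approx_out a : L2T a -> (forall x, ~ D x -> a x = 0) -> approx (testf D) a.
Proof.
move=> La a0; split => // e e0.
have [g tg Hg] := dens (L2_sub measurableT mD (@subsetT _ _) La) e0.
exists g => //; rewrite -normL2_out// => x Dx.
by rewrite a0// (testf_out tg)// subrr.
Qed.

Lemma approx_outT a : L2T a -> (forall x, ~ D x -> a x = 0) -> approx (testf setT) a.
Proof.
by move=> La a0; have [_ H] := approx_out La a0; split => // e /H[f /testfT tf Hf]; exists f.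
Qed.

Lemma approx_diffq i s a : approx (testf setT) a -> approx (testf setT) (diffq i s a).
Proof.
move=> [La Ha]; split; first exact: L2_diffq.
move=> e e0; have c0 : 0 < 2 * `|s^-1| + 1 by rewrite ltr_wpDl// mulr_ge0.
have [f tf Hf] := Ha (e / (2 * `|s^-1| + 1)) (divr_gt0 e0 c0).
set e' := e / _ in Hf.
have Lf := testf_L2T tf; have Laf := L2B mT La Lf.
exists (diffq i s f); first by apply: testfZ; apply: testfB => //; exact: testf_shift.
have LS := L2_shift (s *: basis_vec i) Laf.
rewrite (_ : (fun x => _) = (fun x => s^-1 * ((a (x + s *: basis_vec i) - f (x + s *: basis_vec i)) - (a x - f x)))); last first.
  apply/funext => x; rewrite /diffq -mulrBr; congr (_ * _).
  move: (a _) (f _) (a x) (f x) => p q r t; clear; ring.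
rewrite normL2Z//; last exact: L2B.
have H := normL2_triB mT LS Laf; rewrite (normL2_shift _ Laf) in H.
have e'0 : 0 <= e' by rewrite divr_ge0// ltW.
have -> : e = (2 * `|s^-1| + 1) * e' by rewrite mulrC divfK// gt_eqF.
rewrite (le_trans (ler_wpM2l (normr_ge0 _) H))//.
by move: Hf e'0 (normr_ge0 s^-1); clear; move: (nrm _) (`|_|) e' => A B C; nra.
Qed.

(** Density alone gives approximants with uncontrolled support. Here [a] is divided by a cutoff [z]
    positive on [K], approximated, and multiplied by [z] again; all approximants are then supported
    in one compact set that stays in [D] under small shifts. *)
Lemma approx_Ctest K i a : compact K -> K `<=` D -> L2T a -> (forall x, ~ K x -> a x = 0) ->
  exists2 d : R, 0 < d & approx (Ctest D i d) a.
Proof.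
move=> cK KD La a0.
have [d0 d00 Hd0] := compact_thick cK oD KD.
pose d := d0 / 2; have d_gt0 : 0 < d by rewrite divr_gt0.
have [z [K' [sz z0 zK cK' [zK' K'K]]]] := cutoff cK d_gt0.
exists d => //; split => // e e0.
have [c c0 Hc] := compact_pos_min cK (smooth_continuous sz) zK.
(* A continuous bounded function that agrees with [1 / t] for [t >= c], hence with [1 / z] on
   [K]. *)
pose kap (t : R) := (Num.max t c)^-1.
have mxc t : 0 < Num.max t c by rewrite lt_max c0 orbT.
have ckap : continuous kap.
  move=> t; have cm : {for t, continuous (fun s : R => Num.max s c)}.
    by apply: (@continuous_max R R id (fun=> c)); [exact: cvg_id|exact: cvg_cst].
  by apply: (@continuousV R R (fun s => Num.max s c) t _ cm); rewrite gt_eqF.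
have bkap t : `|kap t| <= c^-1.
  by rewrite /kap ger0_norm ?invr_ge0 ?(ltW (mxc t))// lef_pV2 ?posrE// le_max lexx orbT.
have mkap : measurable_fun setT (fun x : rV => kap (z x)).
  apply: (measurableT_comp (f := kap)); first exact: continuous_measurable_fun.
  exact: smooth_measurable.
pose b x := kap (z x) * a x.
have Lb : L2T b by apply: (L2_bddM mT mkap (M := c^-1)).
have b0 x : ~ D x -> b x = 0 by move=> Dx; rewrite /b a0 ?mulr0// => /KD.
have [M M0 HM] : exists2 M : R, 0 <= M & forall x, `|z x| <= M.
  have tz : testf setT z by split => //; exists K'; split.
  exact: testf_bound tz.
have M1 : 0 < M + 1 by rewrite ltr_wpDl.
have [_ /(_ (e / (M + 1)) (divr_gt0 e0 M1))[f tf Hf]] := approx_out Lb b0.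
have Lf := testf_L2T tf.
exists (fun x => z x * f x); last first.
  have Lbf := L2B mT Lb Lf.
  have mz := smooth_measurable mT sz.
  have E x : a x - z x * f x = z x * (b x - f x).
    rewrite mulrBr; congr (_ - _); rewrite /b /kap.
    have [Kx|Kx] := pselect (K x); last by rewrite a0// !mulr0.
    by rewrite max_l ?Hc// mulrA mulfV ?mul1r// gt_eqF// zK.
  rewrite (_ : (fun x => _) = (fun x => z x * (b x - f x))); last exact/funext.
  have LM : L2T (fun x => M * (b x - f x)) by exact: L2Z.
  have Lz : L2T (fun x => z x * (b x - f x)) by apply: (L2_bddM mT mz (M := M)).
  apply: (@le_trans _ _ (nrm (fun x => M * (b x - f x)))).
    apply: normL2_le => //; apply: nearW => x _; rewrite !normrM ler_wpM2r//.
    by rewrite [`|M|]ger0_norm.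
  rewrite normL2Z// ger0_norm// (le_trans (ler_wpM2l M0 Hf))// mulrA ler_pdivrMr//.
  by rewrite mulrC ler_wpM2l ?(ltW e0)// lerDl.
have tzf : testf D (fun x => z x * f x) by exact: testfMl.
split; first exact: testfT tzf.
move=> s sd; split; first by exact: (smooth_shift (s *: basis_vec i) (testf_smooth tzf)).
exists [set x - s *: basis_vec i | x in K']; split.
- apply: continuous_compact => //; apply: continuous_subspaceT => x.
  exact: (cvgD (@cvg_id _ _) (@cst_continuous _ _ (- (s *: basis_vec i)) x)).
- move=> _ [y K'y <-]; have [x Kx xy] := K'K y K'y.
  rewrite (_ : y - _ = x + (y - x - s *: basis_vec i)); last by rewrite addrA subrKC.
  apply: Hd0 => //; rewrite (le_lt_trans (ler_normB _ _))// [ltRHS]splitr ler_ltD//.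
  rewrite normrZ (le_lt_trans _ sd)// -[leRHS]mulr1 ler_wpM2l//; exact: norm_basis_vec.
- move=> x Hx; rewrite zK' ?mul0r// => K'x; apply: Hx.
  by exists (x + s *: basis_vec i); rewrite ?addrK.
Qed.

Lemma Ctest_T i d f : testf setT f -> Ctest setT i d f.
Proof. by move=> tf; split => // s _; exact: testf_shift. Qed.

Lemma approx_CtestT i d a : approx (testf setT) a -> approx (Ctest setT i d) a.
Proof. by move=> [La Ha]; split => // e /Ha[f tf Hf]; exists f => //; exact: Ctest_T. Qed.

Lemma diffqC i j s r f : diffq i s (diffq j r f) = diffq j r (diffq i s f).
Proof.
apply/funext => x; rewrite /diffq [x + _ + _]addrAC -!mulrBr mulrCA; congr (_ * (_ * _)).
by rewrite !opprB addrACA [in RHS]addrACA; congr (_ + _); rewrite addrC.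
Qed.

(** Formally both sides are minus the pairing of [phi] with a mixed second derivative of [psi], but
    only first derivatives exist. Difference quotients in the two directions do commute; each side
    is reached by letting first the step in direction [j], then the one in direction [k], tend to
    0. *)
Lemma curl_compact K j k phi pj pk psi qj qk : compact K -> K `<=` D ->
  L2T phi -> L2T pj -> L2T pk -> L2T psi -> L2T qj -> L2T qk ->
  (forall x, ~ K x -> [/\ phi x = 0, pj x = 0 & pk x = 0]) ->
  (forall x, ~ D x -> [/\ psi x = 0, qj x = 0 & qk x = 0]) ->
  wdT setT j phi pj -> wdT setT k phi pk -> wdT D j psi qj -> wdT D k psi qk ->
  dot pj qk = dot pk qj.
Proof.
move=> cK KD Lphi Lpj Lpk Lpsi Lqj Lqk p0 q0 wpj wpk wqj wqk.
have [d1 d10 ap1] := approx_Ctest k cK KD Lpj (fun x Kx => let: And3 _ h _ := p0 x Kx in h).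
have aqj : approx (testf setT) qj by apply: approx_outT => // x /q0[].
have apsi : approx (testf setT) psi by apply: approx_outT => // x /q0[].
apply/eqP; rewrite -subr_eq0 -normr_eq0 eq_le normr_ge0 andbT.
apply/ler_addgt0Pr => e0 e00; rewrite add0r.
pose e := e0 / 4; have e_gt0 : 0 < e by rewrite divr_gt0.
have [d2 d20 H2] := diffq_weak_cvg Lpsi Lqk wqk ap1 d10 e_gt0.
have [d3 d30 H3] := diffq_weak_cvg Lphi Lpk wpk (approx_CtestT k 1 aqj) ltr01 e_gt0.
have [d4 d40 Hd4] := compact_thick cK oD KD.
pose s := Num.min (Num.min d2 d3) d4 / 2.
have s_gt0 : 0 < s by rewrite divr_gt0// !lt_min d20 d30.
have s0 : s != 0 by rewrite gt_eqF.
have [sd2 sd3 sd4] : [/\ `|s| < d2, `|- s| < d3 & `|s| < d4].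
  have : s < Num.min (Num.min d2 d3) d4 by rewrite ltr_pdivrMr// ltr_pMr ?ltr1n// !lt_min d20 d30.
  by rewrite normrN gtr0_norm// !lt_min => /andP[/andP[]].
have ns0 : - s != 0 by rewrite oppr_eq0.
have {}H2 := H2 s s0 sd2; have {}H3 := H3 (- s) ns0 sd3.
pose K2 := K `|` [set x + s *: basis_vec k | x in K].
have cK2 : compact K2.
  apply: compactU => //; apply: continuous_compact => //; apply: continuous_subspaceT => x.
  exact: (cvgD (@cvg_id _ _) (@cst_continuous _ _ (s *: basis_vec k) x)).
have K2D : K2 `<=` D.
  move=> x [/KD//|[y Ky <-]]; apply: Hd4 => //; rewrite normrZ (le_lt_trans _ sd4)//.
  by rewrite -[leRHS]mulr1 ler_wpM2l//; exact: norm_basis_vec.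
have LDphi : L2T (diffq k (- s) phi) := L2_diffq k (- s) Lphi.
have LDpsi : L2T (diffq k s psi) := L2_diffq k s Lpsi.
have Dphi0 x : ~ K2 x -> diffq k (- s) phi x = 0.
  move=> K2x; rewrite /diffq.
  have [-> _ _] : [/\ phi x = 0, pj x = 0 & pk x = 0] by apply: p0 => Kx; apply: K2x; left.
  have [-> _ _] : [/\ phi (x + - s *: basis_vec k) = 0, pj (x + - s *: basis_vec k) = 0 & pk (x + - s *: basis_vec k) = 0].
    apply: p0 => Kx; apply: K2x; right; exists (x + - s *: basis_vec k) => //.
    by rewrite scaleNr subrK.
  by rewrite subrr mulr0.
have [d5 d50 ap5] := approx_Ctest j cK2 K2D LDphi Dphi0.
have [d6 d60 H6] := diffq_weak_cvg Lpsi Lqj wqj ap5 d50 e_gt0.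
have [d7 d70 H7] := diffq_weak_cvg Lphi Lpj wpj (approx_CtestT j 1 (approx_diffq k s apsi)) ltr01 e_gt0.
(* The step [r] is chosen after [s], since the thresholds [d6] and [d7] depend on the quotients of
   step [s]. *)
pose r := Num.min d6 d7 / 2.
have r_gt0 : 0 < r by rewrite divr_gt0// lt_min d60.
have r0 : r != 0 by rewrite gt_eqF.
have [rd6 rd7] : `|- r| < d6 /\ `|r| < d7.
  have : r < Num.min d6 d7 by rewrite ltr_pdivrMr// ltr_pMr ?ltr1n// lt_min d60.
  by rewrite normrN gtr0_norm// lt_min => /andP[].
have nr0 : - r != 0 by rewrite oppr_eq0.
have {}H6 := H6 (- r) nr0 rd6; have {}H7 := H7 r r0 rd7.
have E : dot (diffq k s psi) (diffq j r phi) = dot (diffq k (- s) phi) (diffq j (- r) psi).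
  rewrite dot_diffq// diffqC dotC dot_diffq ?opprK//; exact: L2_diffq.
move: H2 H3 H6 H7; rewrite E [dot qj (diffq k (- s) phi)]dotC [dot qj pk]dotC [dot (diffq k s psi) pj]dotC.
rewrite (_ : e0 = 4 * e); last by rewrite mulrC divfK// gt_eqF.
move: (dot pj (diffq k s psi)) (dot pj qk) (dot _ qj) (dot pk qj) (dot _ _) => A B C F G; clear.
by move: e => e; rewrite !ler_norml => /andP[? ?] /andP[? ?] /andP[? ?] /andP[? ?]; apply/andP; split; lra.
Qed.

Lemma wdT_shift T i u v w : L2T u -> L2T v -> wdT setT i u v -> wdT T i (fun x => u (x + w)) (fun x => v (x + w)).
Proof.
move=> Lu Lv uv f /testfT tf.
have tfw := testf_shift (- w) tf.
have E g : (fun x : rV => g (x + w - w) : R) = g by apply/funext => x; rewrite addrK.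
have := uv _ tfw.
rewrite -(dot_shift w Lu (testf_L2T (testf_pderiv i tfw))) -(dot_shift w Lv (testf_L2T tfw)) E => <-.
congr dotL2; apply/funext => x; rewrite pderiv_shift ?addrK//; exact: testf_smooth tf.
Qed.

(* S, the support of phi, can be pushed into compact subsets of D along v. *)
Lemma curl_shift (S : set rV) (v : rV) (t0 : R) j k phi pj pk psi qj qk : 0 < t0 ->
  (forall t, 0 < t < t0 -> exists K, [/\ compact K, K `<=` D & forall x, S x -> K (x + t *: v)]) ->
  L2T phi -> L2T pj -> L2T pk -> L2T psi -> L2T qj -> L2T qk ->
  (forall x, ~ S x -> [/\ phi x = 0, pj x = 0 & pk x = 0]) -> S `<=` D ->
  (forall x, ~ D x -> [/\ psi x = 0, qj x = 0 & qk x = 0]) ->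
  wdT setT j phi pj -> wdT setT k phi pk -> wdT D j psi qj -> wdT D k psi qk ->
  dot pj qk = dot pk qj.
Proof.
move=> t00 HS Lphi Lpj Lpk Lpsi Lqj Lqk p0 SD q0 wpj wpk wqj wqk.
(* The translates along [v] are compactly supported in [D], where [curl_compact] applies; continuity
   of translations in L^2 then lets [t] tend to 0. *)
have key t : 0 < t < t0 -> dot (fun x => pj (x - t *: v)) qk = dot (fun x => pk (x - t *: v)) qj.
  move=> /HS[K [cK KD SK]].
  apply: (@curl_compact K j k (fun x => phi (x - t *: v)) _ _ psi _ _ cK KD) => //;
    try exact: L2_shift; try exact: wdT_shift.
  by move=> x Kx; apply: p0 => Sx; apply: Kx; rewrite -(subrK (t *: v) x); exact: SK.
have apj : approx (testf setT) pj by apply: approx_outT => // x Dx; have [] := p0 x (fun Sx => Dx (SD _ Sx)).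
have apk : approx (testf setT) pk by apply: approx_outT => // x Dx; have [] := p0 x (fun Sx => Dx (SD _ Sx)).
apply/eqP; rewrite -subr_eq0 -normr_eq0 eq_le normr_ge0 andbT.
apply/ler_addgt0Pr => e e0; rewrite add0r.
have c0 : 0 < nrm qj + nrm qk + 1 by rewrite ltr_wpDl// addr_ge0// normL2_ge0.
pose e' := e / (nrm qj + nrm qk + 1).
have e'0 : 0 < e' by rewrite divr_gt0.
have [d1 d10 H1] := approx_shift_cvg apj e'0.
have [d2 d20 H2] := approx_shift_cvg apk e'0.
have v1 : 0 < `|v| + 1 by rewrite ltr_wpDl.
pose t := Num.min t0 (Num.min d1 d2 / (`|v| + 1)) / 2.
have mpos : 0 < Num.min t0 (Num.min d1 d2 / (`|v| + 1)).
  by rewrite lt_min t00 divr_gt0// lt_min d10.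
have t_gt0 : 0 < t by rewrite divr_gt0.
have tm : t < Num.min t0 (Num.min d1 d2 / (`|v| + 1)) by rewrite ltr_pdivrMr// ltr_pMr ?ltr1n.
have [tt0 td] : t < t0 /\ t < Num.min d1 d2 / (`|v| + 1) by move: tm; rewrite lt_min => /andP.
have tv : `|- (t *: v)| < Num.min d1 d2.
  rewrite normrN normrZ gtr0_norm//; move: td; rewrite ltr_pdivlMr// => /(le_lt_trans _); apply.
  by rewrite ler_wpM2l ?(ltW t_gt0)// lerDl.
move: tv; rewrite lt_min => /andP[tv1 tv2].
have {}key := key t; rewrite t_gt0 tt0 in key; have {}key := key isT.
have {}H1 := H1 _ tv1; have {}H2 := H2 _ tv2.
have Lpjt := L2_shift (- (t *: v)) Lpj; have Lpkt := L2_shift (- (t *: v)) Lpk.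
have G1 := le_trans (dot_CS mT (L2B mT Lpjt Lpj) Lqk) (ler_wpM2r (normL2_ge0 _ _) H1).
have G2 := le_trans (dot_CS mT (L2B mT Lpkt Lpk) Lqj) (ler_wpM2r (normL2_ge0 _ _) H2).
rewrite !dotBl// key in G1 G2.
rewrite (_ : e = e' * nrm qj + e' * nrm qk + e'); last first.
  by rewrite -mulrDr -[X in _ + X]mulr1 -mulrDr divfK// gt_eqF.
move: G1 G2 (ltW e'0).
move: (e' * nrm qj) (e' * nrm qk) (dot _ _) (dot _ _) (dot _ _) => A B F G H.
clearbody e' t; clear -t; move: e' => C; clear.
by rewrite !ler_norml => /andP[? ?] /andP[? ?] ?; apply/andP; split; lra.
Qed.

End dense.

End translation.

(** * Weak derivatives *)

Section test_density.
Context {R : realType} {m : nat}.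
Local Notation mu := (lebesgue_rV R m).
Local Notation rV := 'rV[R]_m.
Implicit Types (D U : set rV) (f g q : rV -> R).

Lemma eq_cvgn (a b : nat -> R) (l : R) : (forall n, a n = b n) -> b @ \oo --> l -> a @ \oo --> l.
Proof. by move=> /funext ->. Qed.

Lemma measurable_rV_openE : @measurable _ rV = <<s [set A : set rV | open A] >>.
Proof.
apply/seteqP; split; last first.
  apply: smallest_sub; first exact: sigma_algebra_measurable.
  by move=> A; exact: measurable_open_rV.
apply: smallest_sub; first exact: smallest_sigma_algebra.
move=> A; rewrite -bigcup_seq => -[i _ [C mC <-]].
have H : measurable_fun setT
    (@rV_coord R m i : g_sigma_algebraType [set A : set rV | open A] -> measurableTypeR R).
  apply: (measurability _ (RGenOInfty.measurableE R)).
  move=> /= _ [_ [a ->] <-]; rewrite setTI.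
  apply: sub_sigma_algebra => /=.
  have oa : open `]a, +oo[%classic by rewrite set_itvoy; exact: open_gt.
  by move/continuousP: (@coord_continuous R 1 m ord0 i) => /(_ _ oa).
exact: H.
Qed.

Lemma closed_inner U (r : R) : closed [set x : rV | forall y, `|y - x| < r -> U y].
Proof.
rewrite -openC openE => x /= /existsNP[y] /not_implyP[yx Uy].
have c0 : 0 < r - `|y - x| by rewrite subr_gt0.
apply/nbhs_ballP; exists (r - `|y - x|) => //= x'; rewrite -ball_normE /= => xx' H.
apply: Uy; apply: H; rewrite -(subrK x y) -addrA.
by rewrite (le_lt_trans (ler_normD _ _))// -ltrBrDl.
Qed.

Lemma expinv1E (s : R) : 0 < s -> expinv 1 s = expR (- s^-1).
Proof. by move=> s0; rewrite expinvE// -[1]/(1%:P) hornerC mul1r. Qed.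

Lemma expinv1_le1 (s : R) : expinv 1 s <= 1.
Proof.
have [s0|s0] := leP s 0; first by rewrite expinv0.
by rewrite expinv1E// -[leRHS]expR0 ler_expR oppr_le0 invr_ge0 ltW.
Qed.

Lemma open_indic_approx U : open U -> exists f : nat -> rV -> R,
  [/\ forall n, testf U (f n), forall n x, 0 <= f n x <= 1 &
      forall x, U x -> f ^~ x @ \oo --> (1 : R)].
Proof.
move=> oU.
pose K n := [set x : rV | `|x - 0| <= n%:R] `&`
  [set x : rV | forall y, `|y - x| < n.+1%:R^-1 -> U y].
have cK n : compact (K n).
  by apply: compact_closedI; [exact: compact_closed_ball|exact: closed_inner].
have r0 n : 0 < n.+1%:R^-1 / 2 :> R by rewrite divr_gt0.
have Hf n : exists f, [/\ testf U f, forall x, 0 <= f x <= 1 & forall x, K n x -> `|1 - f x| <= n.+1%:R^-1].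
  have [z [K' [sz z0 zK cK' [zK' K'K]]]] := cutoff (cK n) (r0 n).
  have [c c0 Hc] := compact_pos_min (cK n) (smooth_continuous sz) zK.
  (* On [K n] the argument is at least [n+1], and [exp(-1/s)] is then within [1/(n+1)] of 1. *)
  exists (fun x => expinv 1 (n.+1%:R / c * z x)).
  have n0 : 0 < n.+1%:R / c by rewrite divr_gt0.
  split.
  - split; first by apply: smooth_comp; [exact: smooth1_expinv|exact: smoothZ].
    exists K'; split => // [x /K'K[y [_ Hy] xy]|x /zK' ->]; last by rewrite mulr0 expinv0.
    apply: Hy; apply: le_lt_trans xy _.
    by rewrite ltr_pdivrMr// ltr_pMr ?invr_gt0// ltr1n.
  - move=> x; rewrite expinv1_ge0; exact: expinv1_le1.
  - move=> x Kx; have s1 : n.+1%:R <= n.+1%:R / c * z x.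
      by rewrite -mulrA ler_peMr// mulrC ler_pdivlMr// mul1r; exact: Hc.
    have s0 : 0 < n.+1%:R / c * z x by apply: lt_le_trans s1.
    have H2 := expinv1_le1 (n.+1%:R / c * z x); rewrite expinv1E// in H2 *.
    set s := _ / c * _ in s0 s1 H2 *.
    have H1 := expR_ge1Dx (- s^-1).
    have H3 : s^-1 <= n.+1%:R^-1 by rewrite lef_pV2 ?posrE.
    rewrite ger0_norm ?subr_ge0//; apply: le_trans H3.
    by rewrite lerBlDr -lerBlDl.
have [f Hff] := choice Hf.
exists f; split => [n|n x|x Ux]; try by have [] := Hff n.
have /nbhs_ballP[e /= e0 eU] : nbhs x U by exact: open_nbhs_nbhs.
apply/cvgrPdist_le => eps eps0.
near=> n; apply: le_trans (_ : n.+1%:R^-1 <= eps).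
  have [_ _] := Hff n; apply; split => /=.
    rewrite subr0; near: n; exact: nbhs_infty_ger.
  move=> y yx; apply: eU; rewrite -ball_normE /= distrC; apply: lt_trans yx _.
  near: n; exact: (near_infty_natSinv_lt (PosNum e0)).
near: n; have H := near_infty_natSinv_lt (PosNum eps0).
by apply: filterS H => n /ltW.
Unshelve. all: by end_near. Qed.

(** The integral of [q] over every open set vanishes, by approximating the indicator with test
    functions. Open sets are stable under intersection and generate the sigma-algebra, so the
    integral over every measurable set vanishes. Uniqueness of weak derivatives rests on this. *)
Lemma test_orth_eq0 D q : open D -> (mu D < +oo)%E -> L2 D q ->
  (forall f, testf D f -> dotL2 D q f = 0) -> \forall x \ae mu, D x -> q x = 0.
Proof.
move=> oD fD Lq H; have mD := measurable_open_rV oD.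
have Iq := L2_itg mD fD Lq.
pose h := q \_ D; have Ih : itg setT h by apply/(itg_restrict q mD).
have mh := measurable_int mu Ih.
have Po (A : set rV) : open A -> (\int[mu]_(x in A) (EFin \o h) x = 0)%E.
  move=> oA; have mA := measurable_open_rV oA.
  have [f [tf f01 fcv]] := open_indic_approx (openI oA oD).
  have mf n : measurable_fun D (f n) by apply: smooth_measurable mD (testf_smooth (tf n)).
  have mI : measurable_fun D (\1_A : rV -> R) by exact: measurable_indic.
  have C1 : \forall x \ae mu, D x -> (fun n => q x * f n x) @ \oo --> q x * \1_A x.
    apply: aeW => x Dx; apply: cvgMr; rewrite indicE; have [xA|xA] := boolP (x \in A).
      by apply: fcv; split => //; exact/set_mem.
    rewrite (_ : f ^~ x = cst 0); first exact: cvg_cst.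
    by apply/funext => n; apply: (testf_out (tf n)) => -[Ax _]; move/mem_set: Ax; exact/negP.
  have C2 : \forall x \ae mu, forall n, D x -> `|q x * f n x| <= `|q x|.
    apply: aeW => x n Dx; rewrite normrM ler_piMr//; have /andP[f0 f1] := f01 n x.
    by rewrite ger0_norm.
  have [II LL] := @dct _ _ _ mD (fun n x => q x * f n x) (fun x => q x * \1_A x) (fun x => `|q x|)
    (fun n => measurable_funM (L2_meas Lq) (mf n))
    (measurable_funM (L2_meas Lq) mI) (itg_abs Iq) C1 C2.
  have E n : (\int[mu]_(x in D) (q x * f n x))%R = 0.
    by apply: H; apply: testf_sub (tf n) => x [].
  have L0 : (\int[mu]_(x in D) (q x * \1_A x))%R = 0.
    apply/esym; apply: cvg_unique LL => //.
    exact: (eq_cvgn E (cvg_cst _)).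
  have IhA : mu.-integrable A (EFin \o h) by apply: integrableS Ih.
  rewrite -(fineK (integrable_fin_num mA IhA)); congr EFin; rewrite -[RHS]L0.
  rewrite [LHS]Rintegral_mkcond [RHS]Rintegral_mkcond; apply: eq_intg => x _.
  by rewrite /h !patchE indicE; case: (x \in A); case: (x \in D); rewrite ?mulr1 ?mulr0.
have PT (A : set rV) : measurable A -> (\int[mu]_(x in A) (EFin \o h) x = 0)%E.
  rewrite measurable_rV_openE; apply: (@dynkin_induction _ _ [set A : set rV | open A]
    (fun A => \int[mu]_(x in A) (EFin \o h) x = 0)%E).
  - exact: measurable_rV_openE.
  - by move=> ? ? ? ?; exact: openI.
  - exact: (Po _ openT).
  - exact: Po.
  - move=> S mS PS.
    have := @integral_setU _ _ _ mu S (~` S) (EFin \o h) mS (measurableC mS).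
    rewrite setUv PS add0e (Po _ openT).
    by move=> <- //; apply/disj_setPCl.
  - move=> F mF tF HF; rewrite integral_bigcup//.
      by rewrite eseries0.
    by apply: integrableS Ih => //; exact: bigcupT_measurable.
have mz : measurable_fun D (cst 0%E : rV -> \bar R) by exact: measurable_cst.
have K : ae_eq mu D (EFin \o q) (cst 0%E).
  apply: (integral_ae_eq mD Iq mz) => A AD mA; rewrite [RHS]integral0 -(PT A mA).
  by apply: eq_integral => x xA /=; rewrite /h patchE (mem_set (AD _ (set_mem xA))).
by apply: filterS K => x Hx /Hx /= [].
Qed.

End test_density.

(** * The spaces H^1, H^1_0 and H^2 with explicit derivatives *)

Section sobolev_layer.
Context {R : realType} {m : nat}.
Local Notation mu := (lebesgue_rV R m).
Local Notation rV := 'rV[R]_m.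
Implicit Types (f g u v w c : rV -> R) (du dw : 'I_m -> rV -> R).

Definition wd (D : set rV) i u v : Prop :=
  forall f, testf D f -> dotL2 D u (pderiv i f) = - dotL2 D v f.

(** Derivatives are carried as data rather than through the operator [weak_deriv], so that sums,
    products and limits come with derivatives given by formulas instead of almost everywhere
    identities. *)
Record H1 D u du : Prop := IsH1 {
  H1_L2 : L2 D u ; H1_L2d : forall i, L2 D (du i) ; H1_wd : forall i, wd D i u (du i) }.

Record H10 D u du : Prop := IsH10 {
  H10_H1 : H1 D u du ;
  H10_approx : forall e, 0 < e -> exists f, [/\ testf D f,
    normL2 D (fun x => f x - u x) <= e & forall i, normL2 D (fun x => pderiv i f x - du i x) <= e] }.

Record H2 D u du ddu : Prop := IsH2 {
  H2_H1 : H1 D u du ; H2_H1d : forall i, H1 D (du i) (ddu i) }.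

Variables (D : set rV) (oD : open D) (bD : bounded_set D).
Let mD : measurable D := measurable_open_rV oD.
Let fD : (mu D < +oo)%E := measurable_bounded_rV_lty mD bD.

Lemma testf_L2D f : testf D f -> L2 D f. Proof. exact: testf_L2. Qed.

Lemma testf_L2d i f : testf D f -> L2 D (pderiv i f).
Proof. by move=> /(testf_pderiv i); exact: testf_L2. Qed.

Lemma smooth_L2 c : is_smooth c -> L2 D c.
Proof.
move=> sc; have [M _ HM] := smooth_bounded_on bD sc.
exact: L2_bounded (smooth_measurable mD sc) HM.
Qed.

Lemma L2_smoothM c u : is_smooth c -> L2 D u -> L2 D (fun x => c x * u x).
Proof.
move=> sc; have [M _ HM] := smooth_bounded_on bD sc.
exact: L2_bddM (smooth_measurable mD sc) HM.
Qed.

Lemma cvgL2_le (u_ : nat -> rV -> R) u : (forall n, normL2 D (fun x => u_ n x - u x) <= n.+1%:R^-1) ->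
  normL2 D (fun x => u_ n x - u x) @[n --> \oo] --> (0 : R).
Proof.
move=> H; apply: (@squeeze_cvgr _ _ _ _ (cst 0) (fun n => n.+1%:R^-1)).
- by near=> n; rewrite H andbT; exact: normL2_ge0.
- exact: cvg_cst.
- exact: cvg_harmonic.
Unshelve. all: by end_near. Qed.

Lemma wd_lim i (u_ v_ : nat -> rV -> R) u v :
  (forall n, L2 D (u_ n)) -> L2 D u -> (forall n, L2 D (v_ n)) -> L2 D v ->
  normL2 D (fun x => u_ n x - u x) @[n --> \oo] --> (0 : R) ->
  normL2 D (fun x => v_ n x - v x) @[n --> \oo] --> (0 : R) ->
  (forall n, wd D i (u_ n) (v_ n)) -> wd D i u v.
Proof.
move=> Lu_ Lu Lv_ Lv cu cv H f tf.
have A := cvg_dotl mD Lu_ Lu (testf_L2d i tf) cu.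
have B := cvgN (cvg_dotl mD Lv_ Lv (testf_L2D tf) cv).
apply: (cvg_unique _ A) => //.
by apply: (eq_cvgn _ (B _)) => n; exact: H.
Qed.

Lemma wd_smooth i c : is_smooth c -> wd D i c (pderiv i c).
Proof.
move=> sc f tf; have sf := testf_smooth tf.
have tcf : testf D (fun x => c x * f x) by exact: testfMl.
have Lc := smooth_L2 sc; have Lci := smooth_L2 (smooth_pderiv i sc).
have Lf := testf_L2D tf; have Lfi := testf_L2d i tf.
have H := intg_pderiv0 i (testfT tcf).
apply/eqP; rewrite -subr_eq0 opprK; apply/eqP; rewrite -[RHS]H -RintegralD//; try exact: L2_itgM.
rewrite -[RHS](intg_supp (D := D)); last by move=> x Dx; exact: testf_out (testf_pderiv i tcf) Dx.
by apply: eq_intg => x _; rewrite pderivM// [f x * _]mulrC.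
Qed.

Lemma H1_smooth c : is_smooth c -> H1 D c (fun i => pderiv i c).
Proof.
by move=> sc; split => [|i|i]; [exact: smooth_L2|exact/smooth_L2/smooth_pderiv|exact: wd_smooth].
Qed.

Lemma H1_test f : testf D f -> H1 D f (fun i => pderiv i f).
Proof. by move=> /testf_smooth; exact: H1_smooth. Qed.

Lemma normL2_subrr f : normL2 D (fun x => f x - f x) = 0.
Proof.
rewrite /normL2 (@eq_dot _ _ _ _ _ (cst 0) (cst 0)) => [|x _|x _]; rewrite ?subrr//.
by rewrite /dotL2 (@eq_intg _ _ _ _ (cst 0)) => [|x _]; rewrite ?Rintegral_cst ?mul0r ?sqrtr0 ?mulr0.
Qed.

Lemma H10_test f : testf D f -> H10 D f (fun i => pderiv i f).
Proof.
move=> tf; split; first exact: H1_test.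
by move=> e e0; exists f; split => // [|i]; rewrite normL2_subrr ltW.
Qed.

Lemma wdD i u v u' v' : L2 D u -> L2 D v -> L2 D u' -> L2 D v' ->
  wd D i u v -> wd D i u' v' -> wd D i (fun x => u x + u' x) (fun x => v x + v' x).
Proof.
move=> Lu Lv Lu' Lv' H H' f tf; have Lf := testf_L2D tf; have Lfi := testf_L2d i tf.
by rewrite !dotDl// H// H'// opprD.
Qed.

Lemma wdZ i (a : R) u v : L2 D u -> L2 D v -> wd D i u v -> wd D i (fun x => a * u x) (fun x => a * v x).
Proof.
move=> Lu Lv H f tf; have Lf := testf_L2D tf; have Lfi := testf_L2d i tf.
by rewrite !dotZl// H// mulrN.
Qed.

Lemma H1D u du v dv : H1 D u du -> H1 D v dv -> H1 D (fun x => u x + v x) (fun i x => du i x + dv i x).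
Proof.
move=> [Lu Lu' H] [Lv Lv' H']; split => [|i|i]; [exact: L2D|exact: L2D|exact: wdD].
Qed.

Lemma H1Z (a : R) u du : H1 D u du -> H1 D (fun x => a * u x) (fun i x => a * du i x).
Proof. by move=> [Lu Lu' H]; split => [|i|i]; [exact: L2Z|exact: L2Z|exact: wdZ]. Qed.

Lemma H1B u du v dv : H1 D u du -> H1 D v dv -> H1 D (fun x => u x - v x) (fun i x => du i x - dv i x).
Proof.
move=> Hu Hv; have := H1D Hu (H1Z (-1) Hv); congr H1.
  by apply/funext => x; rewrite mulN1r.
by apply/funext => i; apply/funext => x; rewrite mulN1r.
Qed.

Lemma H1_sum I (s : seq I) (U : I -> rV -> R) (dU : I -> 'I_m -> rV -> R) :
  (forall l, H1 D (U l) (dU l)) ->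
  H1 D (fun x => \sum_(l <- s) U l x) (fun i x => \sum_(l <- s) dU l i x).
Proof.
move=> H; elim: s => [|l s IH].
  have := H1_smooth (@smooth_cst R m 0); congr H1.
    by apply/funext => x; rewrite big_nil.
  by apply/funext => i; apply/funext => x; rewrite pderiv_cst big_nil.
have := H1D (H l) IH; congr H1; first by apply/funext => x; rewrite big_cons.
by apply/funext => i; apply/funext => x; rewrite big_cons.
Qed.

Lemma wd_smoothM c i u v : is_smooth c -> L2 D u -> L2 D v -> wd D i u v ->
  wd D i (fun x => c x * u x) (fun x => c x * v x + pderiv i c x * u x).
Proof.
move=> sc Lu Lv H f tf; have sf := testf_smooth tf.
have Lf := testf_L2D tf; have Lfi := testf_L2d i tf; have sci := smooth_pderiv i sc.
have tcf : testf D (fun x => c x * f x) by exact: testfMl.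
have Lcf := testf_L2D tcf; have Lcif := L2_smoothM sci Lf.
have Lcv := L2_smoothM sc Lv; have Lciu := L2_smoothM sci Lu.
have E : dotL2 D (fun x => c x * u x) (pderiv i f) =
    dotL2 D u (fun x => pderiv i (fun x => c x * f x) x - pderiv i c x * f x).
  by apply: eq_intg => x _; rewrite pderivM//; move: (c x) (u x) (f x) (pderiv _ _ _) (pderiv _ _ _) => *; ring.
have E2 : dotL2 D (fun x => c x * v x) f = dotL2 D v (fun x => c x * f x).
  by apply: eq_intg => x _; rewrite mulrA [v x * _]mulrC.
have E3 : dotL2 D (fun x => pderiv i c x * u x) f = dotL2 D u (fun x => pderiv i c x * f x).
  by apply: eq_intg => x _; rewrite mulrA [u x * _]mulrC.
by rewrite E dotBr ?(H _ tcf)//; [rewrite dotDl// E2 E3 opprD|exact: testf_L2d].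
Qed.

Lemma H1_smoothM c u du : is_smooth c -> H1 D u du ->
  H1 D (fun x => c x * u x) (fun i x => c x * du i x + pderiv i c x * u x).
Proof.
move=> sc [Lu Ldu Hu]; split => [|i|i]; first exact: L2_smoothM.
  by apply: L2D => //; apply: L2_smoothM => //; exact: smooth_pderiv.
exact: wd_smoothM.
Qed.

(** Approximation by test functions already makes [du] the weak gradient of [u], by passing to the
    limit in the defining identity. *)
Lemma H10P u du : L2 D u -> (forall i, L2 D (du i)) ->
  (forall e, 0 < e -> exists f, [/\ testf D f,
    normL2 D (fun x => f x - u x) <= e & forall i, normL2 D (fun x => pderiv i f x - du i x) <= e]) ->
  H10 D u du.
Proof.
move=> Lu Ldu H; split => //; split => // i.
have p n : 0 < n.+1%:R^-1 :> R by rewrite invr_gt0.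
have [f Hf] := choice (fun n => H n.+1%:R^-1 (p n)).
apply: (@wd_lim i f (fun n => pderiv i (f n))) => // [n|n|||n].
- by have [/testf_L2D] := Hf n.
- by have [/(testf_L2d i)] := Hf n.
- by apply: cvgL2_le => n; have [] := Hf n.
- by apply: cvgL2_le => n; have [] := Hf n.
- by have [/testf_smooth /(wd_smooth i)] := Hf n.
Qed.

Lemma H10_seq u du : H10 D u du -> exists f : nat -> rV -> R, [/\ forall n, testf D (f n),
  normL2 D (fun x => f n x - u x) @[n --> \oo] --> (0 : R) &
  forall i, normL2 D (fun x => pderiv i (f n) x - du i x) @[n --> \oo] --> (0 : R)].
Proof.
move=> [_ H]; have p n : 0 < n.+1%:R^-1 :> R by rewrite invr_gt0.
have [f Hf] := choice (fun n => H n.+1%:R^-1 (p n)).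
exists f; split => [n||i]; first by have [] := Hf n.
  by apply: cvgL2_le => n; have [] := Hf n.
by apply: cvgL2_le => n; have [] := Hf n.
Qed.

(** There is no boundary term because [u] is an H^1 limit of test functions; the boundary values of
    [w] are arbitrary. *)
Lemma H10_ibp i u du w dw : H10 D u du -> H1 D w dw -> dotL2 D u (dw i) = - dotL2 D (du i) w.
Proof.
move=> Hu [Lw Ldw Hw]; have [f [tf cf cdf]] := H10_seq Hu; have [[Lu Ldu _] _] := Hu.
have A := cvg_dotl mD (fun n => testf_L2D (tf n)) Lu (Ldw i) cf.
have B := cvgN (cvg_dotl mD (fun n => testf_L2d i (tf n)) (Ldu i) Lw (cdf i)).
apply: (cvg_unique _ A) => //.
have {}B : (fun n => - dotL2 D (pderiv i (f n)) w) @ \oo --> - dotL2 D (du i) w by exact: B.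
by apply: eq_cvgn B => n; rewrite dotC [in RHS]dotC (Hw _ _ (tf n)) opprK.
Qed.

Lemma cvg_bigsum I (s : seq I) (F : nat -> I -> R) (l : I -> R) :
  (forall i, F n i @[n --> \oo] --> l i) -> \sum_(i <- s) F n i @[n --> \oo] --> \sum_(i <- s) l i.
Proof.
move=> H; elim: s => [|i s IH].
  by under eq_fun do rewrite big_nil; rewrite big_nil; exact: cvg_cst.
by under eq_fun do rewrite big_cons; rewrite big_cons; exact: cvgD.
Qed.

Lemma H10_lim u du (u_ : nat -> rV -> R) (du_ : nat -> 'I_m -> rV -> R) :
  (forall n, H10 D (u_ n) (du_ n)) -> L2 D u -> (forall i, L2 D (du i)) ->
  normL2 D (fun x => u_ n x - u x) @[n --> \oo] --> (0 : R) ->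
  (forall i, normL2 D (fun x => du_ n i x - du i x) @[n --> \oo] --> (0 : R)) -> H10 D u du.
Proof.
move=> H Lu Ldu cu cdu; apply: H10P => // e e0; have e2 : 0 < e / 2 by rewrite divr_gt0.
have [n [Hn Hni]] : exists n, normL2 D (fun x => u_ n x - u x) <= e / 2 /\
    forall i, normL2 D (fun x => du_ n i x - du i x) <= e / 2.
  pose s n := normL2 D (fun x => u_ n x - u x) + \sum_i normL2 D (fun x => du_ n i x - du i x).
  have cs : s @ \oo --> (0 : R).
    rewrite -[X in _ --> X]addr0; apply: cvgD => //.
    rewrite [X in _ --> X](_ : _ = \sum_(i < m) (0 : R)); last by rewrite big1.
    exact: cvg_bigsum.
  have [n sn] := cvg_bound_ex cs e2; exists n; split => [|i]; apply: le_trans sn.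
    by rewrite lerDl sumr_ge0// => i _; exact: normL2_ge0.
  rewrite /s (bigD1 i)//= addrCA lerDl addr_ge0 ?normL2_ge0// sumr_ge0// => j _; exact: normL2_ge0.
have [[Lun Ldun _] /(_ _ e2)[f [tf Hf Hfi]]] := H n.
exists f; split => // [|i].
  have -> : (fun x => f x - u x) = (fun x => (f x - u_ n x) + (u_ n x - u x)) by apply/funext => x; rewrite subrKA.
  rewrite (splitr e) (le_trans (normL2_tri mD _ _)) ?lerD//; apply: L2B => //; exact: testf_L2D.
have -> : (fun x => pderiv i f x - du i x) = (fun x => (pderiv i f x - du_ n i x) + (du_ n i x - du i x)).
  by apply/funext => x; rewrite subrKA.
rewrite (splitr e) (le_trans (normL2_tri mD _ _)) ?lerD//; apply: L2B => //; exact: testf_L2d.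
Qed.

Lemma H10D u du v dv : H10 D u du -> H10 D v dv ->
  H10 D (fun x => u x + v x) (fun i x => du i x + dv i x).
Proof.
move=> [[Lu Ldu _] Hu] [[Lv Ldv _] Hv]; apply: H10P => [|i|e e0]; try exact: L2D.
have e2 : 0 < e / 2 by rewrite divr_gt0.
have [f [tf Hf Hfi]] := Hu _ e2; have [g [tg Hg Hgi]] := Hv _ e2.
have sf := testf_smooth tf; have sg := testf_smooth tg.
exists (fun x => f x + g x); split => [||i]; first exact: testfD.
  have -> : (fun x => f x + g x - (u x + v x)) = (fun x => (f x - u x) + (g x - v x)).
    by apply/funext => x; rewrite opprD addrACA.
  rewrite (splitr e) (le_trans (normL2_tri mD _ _)) ?lerD//; apply: L2B => //; exact: testf_L2D.
have -> : (fun x => pderiv i (fun x => f x + g x) x - (du i x + dv i x)) =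
    (fun x => (pderiv i f x - du i x) + (pderiv i g x - dv i x)).
  by apply/funext => x; rewrite pderivD// opprD addrACA.
rewrite (splitr e) (le_trans (normL2_tri mD _ _)) ?lerD//; apply: L2B => //; exact: testf_L2d.
Qed.

Lemma H10Z (a : R) u du : H10 D u du -> H10 D (fun x => a * u x) (fun i x => a * du i x).
Proof.
move=> [[Lu Ldu _] Hu]; apply: H10P => [|i|e e0]; try exact: L2Z.
have a1 : 0 < `|a| + 1 by rewrite ltr_wpDl.
have [f [tf Hf Hfi]] := Hu _ (divr_gt0 e0 a1); have sf := testf_smooth tf.
have K (x : R) : 0 <= x -> x <= e / (`|a| + 1) -> `|a| * x <= e.
  move=> x0; rewrite ler_pdivlMr// => H; apply: le_trans H.
  by rewrite mulrC ler_wpM2l// lerDl.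
exists (fun x => a * f x); split => [||i]; first exact: testfZ.
  have -> : (fun x => a * f x - a * u x) = (fun x => a * (f x - u x)) by apply/funext => x; rewrite mulrBr.
  rewrite normL2Z ?K ?normL2_ge0//; apply: L2B => //; exact: testf_L2D.
have -> : (fun x => pderiv i (fun x => a * f x) x - a * du i x) = (fun x => a * (pderiv i f x - du i x)).
  by apply/funext => x; rewrite pderivZ// mulrBr.
rewrite normL2Z ?K ?normL2_ge0//; apply: L2B => //; exact: testf_L2d.
Qed.

Lemma H10B u du v dv : H10 D u du -> H10 D v dv ->
  H10 D (fun x => u x - v x) (fun i x => du i x - dv i x).
Proof.
move=> Hu Hv; have := H10D Hu (H10Z (-1) Hv); congr H10.
  by apply/funext => x; rewrite mulN1r.
by apply/funext => i; apply/funext => x; rewrite mulN1r.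
Qed.

Lemma H10_sum I (s : seq I) (U : I -> rV -> R) (dU : I -> 'I_m -> rV -> R) :
  (forall l, H10 D (U l) (dU l)) ->
  H10 D (fun x => \sum_(l <- s) U l x) (fun i x => \sum_(l <- s) dU l i x).
Proof.
move=> H; elim: s => [|l s IH].
  have := H10_test (@testf0 R m D); congr H10.
    by apply/funext => x; rewrite big_nil.
  by apply/funext => i; apply/funext => x; rewrite pderiv_cst big_nil.
have := H10D (H l) IH; congr H10; first by apply/funext => x; rewrite big_cons.
by apply/funext => i; apply/funext => x; rewrite big_cons.
Qed.

Lemma H2D u du ddu v dv ddv : H2 D u du ddu -> H2 D v dv ddv ->
  H2 D (fun x => u x + v x) (fun i x => du i x + dv i x) (fun i j x => ddu i j x + ddv i j x).
Proof. by move=> [Hu Hu'] [Hv Hv']; split => [|i]; apply: H1D. Qed.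

Lemma H2Z (a : R) u du ddu : H2 D u du ddu ->
  H2 D (fun x => a * u x) (fun i x => a * du i x) (fun i j x => a * ddu i j x).
Proof. by move=> [Hu Hu']; split => [|i]; apply: H1Z. Qed.

Lemma H2B u du ddu v dv ddv : H2 D u du ddu -> H2 D v dv ddv ->
  H2 D (fun x => u x - v x) (fun i x => du i x - dv i x) (fun i j x => ddu i j x - ddv i j x).
Proof. by move=> [Hu Hu'] [Hv Hv']; split => [|i]; apply: H1B. Qed.

Lemma H2_sum I (s : seq I) (U : I -> rV -> R) (dU : I -> 'I_m -> rV -> R) ddU :
  (forall l, H2 D (U l) (dU l) (ddU l)) ->
  H2 D (fun x => \sum_(l <- s) U l x) (fun i x => \sum_(l <- s) dU l i x)
    (fun i j x => \sum_(l <- s) ddU l i j x).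
Proof. by move=> H; split => [|i]; apply: H1_sum => l; have [] := H l. Qed.

Lemma H2_smooth c : is_smooth c -> H2 D c (fun i => pderiv i c) (fun i j => pderiv j (pderiv i c)).
Proof. by move=> sc; split => [|i]; apply: H1_smooth => //; exact: smooth_pderiv. Qed.

Lemma H1_lim u du (u_ : nat -> rV -> R) (du_ : nat -> 'I_m -> rV -> R) :
  (forall n, H1 D (u_ n) (du_ n)) -> L2 D u -> (forall i, L2 D (du i)) ->
  normL2 D (fun x => u_ n x - u x) @[n --> \oo] --> (0 : R) ->
  (forall i, normL2 D (fun x => du_ n i x - du i x) @[n --> \oo] --> (0 : R)) -> H1 D u du.
Proof.
move=> H Lu Ldu cu cdu; split => // i.
apply: (@wd_lim i u_ (fun n => du_ n i)) => // n; by have [] := H n.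
Qed.

Lemma test_uniq v w : L2 D v -> L2 D w -> (forall f, testf D f -> dotL2 D v f = dotL2 D w f) ->
  \forall x \ae mu, D x -> v x = w x.
Proof.
move=> Lv Lw H.
have Z : \forall x \ae mu, D x -> v x - w x = 0.
  apply: test_orth_eq0 => //; first exact: L2B.
  by move=> f tf; rewrite dotBl ?H ?subrr//; exact: testf_L2D.
by apply: filterS Z => x Zx /Zx /eqP; rewrite subr_eq0 => /eqP.
Qed.

Lemma H2_sym u du ddu i j : H2 D u du ddu -> \forall x \ae mu, D x -> ddu i j x = ddu j i x.
Proof.
move=> [[Lu Ldu Hu] Hd].
have E k l f : testf D f -> dotL2 D (ddu k l) f = dotL2 D u (pderiv k (pderiv l f)).
  move=> tf; have [_ _ Hk] := Hd k.
  by apply: oppr_inj; rewrite -(Hk l f tf) (Hu k _ (testf_pderiv l tf)) opprK.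
have [_ Li _] := Hd i; have [_ Lj _] := Hd j.
apply: (test_uniq (Li j) (Lj i)) => f tf; rewrite (E _ _ _ tf) (E _ _ _ tf).
by apply: eq_intg => x _; rewrite (smooth_schwarz i j x (testf_smooth tf)).
Qed.

End sobolev_layer.

(** * Translation between explicit derivatives and the operator [weak_deriv] *)

Section sobolev_operators.
Context {R : realType} {m : nat}.
Local Notation mu := (lebesgue_rV R m).
Local Notation rV := 'rV[R]_m.
Implicit Types (f g u v w c : rV -> R).
Variables (D : set rV) (oD : open D) (bD : bounded_set D).
Let mD : measurable D := measurable_open_rV oD.

Lemma weak_derivP s u : (exists v, L2 D v /\ is_weak_deriv D s u v) ->
  L2 D (weak_deriv D s u) /\ is_weak_deriv D s u (weak_deriv D s u).
Proof. by move=> H; exact: (xgetPex (cst 0) H). Qed.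

Lemma is_weak_deriv0 u : is_weak_deriv D [::] u u.
Proof. by move=> f tf; rewrite expr0 mul1r. Qed.

Lemma is_weak_deriv1 i u v : is_weak_deriv D [:: i] u v <-> wd D i u v.
Proof.
by split=> H f tf; have := H f; rewrite /= expr1 mulN1r; apply; exact/testfP.
Qed.

Lemma weak_deriv_ae s u v : L2 D v -> is_weak_deriv D s u v ->
  L2 D (weak_deriv D s u) /\ \forall x \ae mu, D x -> weak_deriv D s u x = v x.
Proof.
move=> Lv Hv; have [Lw Hw] : L2 D (weak_deriv D s u) /\ is_weak_deriv D s u (weak_deriv D s u).
  by apply: weak_derivP; exists v.
split => //; apply: test_uniq => // f /testfP tf.
have s0 : (-1) ^+ size s != 0 :> R by rewrite signr_eq0.
by apply: (mulfI s0); rewrite -Hw// -Hv.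
Qed.

Lemma sobolevH_H1 u : sobolevH D 1 u -> H1 D u (fun i => weak_deriv D [:: i] u).
Proof.
move=> [Lu H]; split => // i; have [L W] := weak_derivP (H [:: i] isT); first exact: L.
exact/is_weak_deriv1.
Qed.

Lemma H1_sobolevH u du : H1 D u du -> sobolevH D 1 u.
Proof.
move=> [Lu Ldu Hu]; split => // -[|i [|//]] _; first by exists u; split => //; exact: is_weak_deriv0.
by exists (du i); split => //; exact/is_weak_deriv1.
Qed.

Lemma is_weak_deriv2 u du i j v : wd D i u du ->
  wd D j du v <-> is_weak_deriv D [:: i; j] u v.
Proof.
move=> Hu; split => H f tf.
  have tf' := (testfP D f).2 tf.
  by rewrite /= (Hu _ (testf_pderiv j tf')) H// opprK sqrrN expr1n mul1r.
have := H f ((testfP D f).1 tf); rewrite /= (Hu _ (testf_pderiv j tf)) sqrrN expr1n mul1r => <-.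
by rewrite opprK.
Qed.

Lemma sobolevH_le k l u : (k <= l)%N -> sobolevH D l u -> sobolevH D k u.
Proof. by move=> kl [Lu H]; split => // s sk; apply: H; exact: leq_trans kl. Qed.

Lemma sobolevH_H2 u : sobolevH D 2 u ->
  H2 D u (fun i => weak_deriv D [:: i] u) (fun i j => weak_deriv D [:: i; j] u).
Proof.
move=> Hu; have H := sobolevH_H1 (sobolevH_le (leqnSn 1) Hu); split => // i.
have [_ Ldu wdu] := H; split => // j; have [_ /(_ [:: i; j] isT) /weak_derivP[L W]] := Hu => //.
by apply/is_weak_deriv2.
Qed.

Lemma H2_sobolevH u du ddu : H2 D u du ddu -> sobolevH D 2 u.
Proof.
move=> [[Lu Ldu Hu] Hd]; split => // -[|i [|j [|//]]] _.
- by exists u; split => //; exact: is_weak_deriv0.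
- by exists (du i); split => //; exact/is_weak_deriv1.
- have [_ L W] := Hd i; exists (ddu i j); split => //; exact/(is_weak_deriv2 _ _ (Hu i)).
Qed.

Lemma weak_deriv0_ae u : L2 D u -> L2 D (weak_deriv D [::] u) /\
  \forall x \ae mu, D x -> weak_deriv D [::] u x = u x.
Proof. by move=> Lu; apply: weak_deriv_ae => //; exact: is_weak_deriv0. Qed.

Lemma weak_deriv1_ae u du i : H1 D u du -> L2 D (weak_deriv D [:: i] u) /\
  \forall x \ae mu, D x -> weak_deriv D [:: i] u x = du i x.
Proof. by move=> [_ L H]; apply: weak_deriv_ae => //; exact/is_weak_deriv1. Qed.

Lemma weak_deriv2_ae u du ddu i j : H2 D u du ddu -> L2 D (weak_deriv D [:: i; j] u) /\
  \forall x \ae mu, D x -> weak_deriv D [:: i; j] u x = ddu i j x.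
Proof.
move=> [[_ _ H] Hd]; have [_ L W] := Hd i.
apply: weak_deriv_ae => //; exact/(is_weak_deriv2 _ _ (H i)).
Qed.

Definition lap (ddu : 'I_m -> 'I_m -> rV -> R) : rV -> R := fun x => \sum_i ddu i i x.

Lemma L2_lap u du ddu : H2 D u du ddu -> L2 D (lap ddu).
Proof. by move=> [_ H]; apply: L2_sum => // i; have [] := H i. Qed.

Lemma laplacian_ae u du ddu : H2 D u du ddu -> \forall x \ae mu, D x -> laplacian D u x = lap ddu x.
Proof.
move=> H; have K i : \forall x \ae mu, D x -> weak_deriv D [:: i; i] u x = ddu i i x.
  by have [] := weak_deriv2_ae i i H.
have := filter_forall _ K.
by move/(_ _); apply: filterS => x Hx Dx; apply: eq_bigr => i _; exact: Hx.
Qed.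

Lemma normH_ge k s u : (size s <= k)%N -> normL2 D (weak_deriv D s u) <= normH D k u.
Proof.
move=> sk; rewrite -[leLHS]ger0_norm ?normL2_ge0// -sqrtr_sqr ler_wsqrtr//.
rewrite (bigD1 (Ordinal (sk : (size s < k.+1)%N)))//= (bigD1 (in_tuple s))//= -addrA lerDl.
by rewrite addr_ge0 ?sumr_ge0// => *; rewrite ?sumr_ge0// => *; exact: sqr_ge0.
Qed.

Lemma normH_le k : exists2 C : R, 0 <= C & forall u B, 0 <= B ->
  (forall s, (size s <= k)%N -> normL2 D (weak_deriv D s u) <= B) -> normH D k u <= C * B.
Proof.
exists (Num.sqrt (\sum_(j < k.+1) \sum_(s : j.-tuple 'I_m) 1)); first exact: sqrtr_ge0.
move=> u B B0 H; rewrite -[X in _ * X](ger0_norm B0) -sqrtr_sqr -sqrtrM; last first.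
  by rewrite sumr_ge0// => *; rewrite sumr_ge0.
rewrite ler_wsqrtr// mulr_suml ler_sum// => j _; rewrite mulr_suml ler_sum// => s _.
by rewrite mul1r ler_sqr ?nnegrE ?normL2_ge0// H// size_tuple -ltnS.
Qed.

Lemma sobolevH10_H10 u : sobolevH10 D u -> H10 D u (fun i => weak_deriv D [:: i] u).
Proof.
move=> [Hu Ha]; have HH := sobolevH_H1 Hu; split => // e e0.
have [f /testfP tf Hf] := Ha e e0.
have Hd := H1B oD HH (H1_test oD bD tf).
exists f; split => // [|i].
  rewrite normL2BC; apply: ltW; apply: le_lt_trans Hf.
  have [L W] := weak_deriv0_ae (H1_L2 Hd).
  by rewrite -(normL2_ae mD L (H1_L2 Hd) W); exact: (@normH_ge 1 [::]).
rewrite normL2BC; apply: ltW; apply: le_lt_trans Hf.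
have [L W] := weak_deriv1_ae i Hd.
by rewrite -(normL2_ae mD L (H1_L2d Hd i) W); exact: (@normH_ge 1 [:: i]).
Qed.

Lemma H10_sobolevH10 u du : H10 D u du -> sobolevH10 D u.
Proof.
move=> [Hu Ha]; split; first exact: H1_sobolevH Hu.
move=> e e0; have [C C0 HC] := normH_le 1.
have d0 : 0 < e / (C + 1) by rewrite divr_gt0// ltr_wpDl.
have [f [tf Hf Hfi]] := Ha _ d0; exists f; first exact/testfP.
have Hd := H1B oD Hu (H1_test oD bD tf).
apply: (@le_lt_trans _ _ (C * (e / (C + 1)))); last first.
  by rewrite mulrCA -[ltRHS]mulr1 ltr_pM2l// ltr_pdivrMr ?mul1r ?ltrDl ?ltr_wpDl.
apply: HC; first exact: ltW.
move=> [|i [|//]] _.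
  by have [L W] := weak_deriv0_ae (H1_L2 Hd); rewrite (normL2_ae mD L (H1_L2 Hd) W) normL2BC.
by have [L W] := weak_deriv1_ae i Hd; rewrite (normL2_ae mD L (H1_L2d Hd i) W) normL2BC.
Qed.

(** Each partial sum of the expansion of [f] lies in H^1_0, hence is an L^2 limit of test
    functions. *)
Lemma eigen_dense lam phi : dirichlet_eigensystem D lam phi -> forall f, L2 D f -> forall e, 0 < e ->
  exists2 g, testf D g & normL2 D (fun x => f x - g x) <= e.
Proof.
move=> [_ H _ _ bas _ _ _ _ _] f Lf e e0; have e2 : 0 < e / 2 by rewrite divr_gt0.
have [n Hn] := cvg_bound_ex (bas f Lf) e2.
have HS : H10 D (fun x => \sum_(k < n) dotL2 D f (phi k) * phi k x)
    (fun i x => \sum_(k < n) dotL2 D f (phi k) * weak_deriv D [:: i] (phi k) x).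
  by apply: H10_sum => // k; apply: H10Z => //; exact: sobolevH10_H10.
have [[LS _ _] /(_ _ e2)[g [tg Hg _]]] := HS.
exists g => //.
have -> : (fun x => f x - g x) = (fun x => (f x - \sum_(k < n) dotL2 D f (phi k) * phi k x) +
    (\sum_(k < n) dotL2 D f (phi k) * phi k x - g x)) by apply/funext => x; rewrite subrKA.
rewrite normL2BC in Hg.
rewrite (splitr e) (le_trans (normL2_tri mD _ _)) ?lerD//; apply: L2B => //; exact: testf_L2D.
Qed.

End sobolev_operators.

(** * The H^2 estimate *)

Section patch_estimate.
Context {R : realType} {m : nat}.
Local Notation mu := (lebesgue_rV R m).
Local Notation rV := 'rV[R]_m.
Implicit Types (f g u v w c F G : rV -> R) (du dw dG : 'I_m -> rV -> R).

Lemma patch_notin (D : set rV) f x : ~ D x -> (f \_ D) x = 0.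
Proof. by move=> Dx; rewrite patchE memNset. Qed.

Lemma patch_eq0 (D : set rV) f x : f x = 0 -> (f \_ D) x = 0.
Proof. by move=> f0; rewrite patchE f0; case: ifP. Qed.

Lemma dot_patchl (D : set rV) f g : dotL2 setT (f \_ D) g = dotL2 D f g.
Proof.
rewrite /dotL2 [RHS]Rintegral_mkcond; apply: eq_intg => x _.
by rewrite !patchE; case: ifP; rewrite ?mul0r.
Qed.

Lemma dot0l (D : set rV) f : dotL2 D (cst 0) f = 0.
Proof.
rewrite /dotL2 (@eq_intg _ _ _ _ (cst 0)) => [|x _]; last by rewrite mul0r.
by rewrite /Rintegral integral0.
Qed.

Lemma normL2_smoothM (D : set rV) c : measurable D -> bounded_set D -> is_smooth c ->
  exists2 M : R, 0 <= M & forall f, L2 D f ->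
    L2 D (fun x => c x * f x) /\ normL2 D (fun x => c x * f x) <= M * normL2 D f.
Proof.
move=> mD bD sc; have [M M0 HM] := smooth_bounded_on bD sc; exists M => // f Lf.
have L : L2 D (fun x => c x * f x) by apply: (L2_bddM mD (smooth_measurable mD sc) HM).
split => //; rewrite -[X in X * _](ger0_norm M0) -normL2Z//.
apply: normL2_le => //; first exact: L2Z.
by apply: aeW => x Dx; rewrite !normrM (ger0_norm M0) ler_wpM2r// HM.
Qed.

Lemma normL2_smoothM_fam (D : set rV) (I : finType) (c : I -> rV -> R) : measurable D -> bounded_set D ->
  (forall i, is_smooth (c i)) -> exists2 M : R, 0 <= M & forall i f, L2 D f ->
    L2 D (fun x => c i x * f x) /\ normL2 D (fun x => c i x * f x) <= M * normL2 D f.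
Proof.
move=> mD bD sc; have /choice[M HM] : forall i, exists M, 0 <= M /\ forall f, L2 D f ->
    L2 D (fun x => c i x * f x) /\ normL2 D (fun x => c i x * f x) <= M * normL2 D f.
  by move=> i; have [M M0 H] := normL2_smoothM mD bD (sc i); exists M.
exists (\sum_i M i) => [|i f Lf]; first by apply: sumr_ge0 => i _; have [] := HM i.
have [_ /(_ f Lf)[L H]] := HM i; split => //; apply: le_trans H _.
rewrite ler_wpM2r ?normL2_ge0// (bigD1 i)//= lerDl.
by apply: sumr_ge0 => k _; have [] := HM k.
Qed.

Lemma dot_perturb (D : set rV) (X y X' y' : rV -> R) (a b : R) : measurable D ->
  L2 D X -> L2 D y -> L2 D X' -> L2 D y' -> normL2 D X <= a -> normL2 D X' <= a ->
  normL2 D y <= b -> normL2 D y' <= b ->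
  `|dotL2 D (fun x => X x + y x) (fun x => X' x + y' x) - dotL2 D X X'| <= 2 * a * b + b * b.
Proof.
move=> mD LX Ly LX' Ly' HX HX' Hy Hy'.
rewrite dotDl//; last exact: L2D.
rewrite !dotDr//.
have B1 := le_trans (dot_CS mD LX Ly') (ler_pM (normL2_ge0 _ _) (normL2_ge0 _ _) HX Hy').
have B2 := le_trans (dot_CS mD Ly LX') (ler_pM (normL2_ge0 _ _) (normL2_ge0 _ _) Hy HX').
have B3 := le_trans (dot_CS mD Ly Ly') (ler_pM (normL2_ge0 _ _) (normL2_ge0 _ _) Hy Hy').
move: B1 B2 B3; clear.
move: (dotL2 _ _ _) (dotL2 _ _ _) (dotL2 _ _ _) (dotL2 _ _ _) => d1 d2 d3 d4.
rewrite [b * a]mulrC -[2 * a * b]mulrA; move: (a * b) (b * b) => A B; clear.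
rewrite !ler_norml => /andP[? ?] /andP[? ?] /andP[? ?].
by apply/andP; split; lra.
Qed.

Lemma pair_arith (p1 p2 a1 a2 m1 m2 x1 x2 y B : R) : `|p1 - x1| <= B -> `|p2 - x2| <= B ->
  `|a1 - y| <= B -> `|a2 - y| <= B -> p1 - m1 = p2 - m2 -> m1 - a1 = m2 - a2 -> `|x1 - x2| <= 4 * B.
Proof.
rewrite !ler_norml => /andP[? ?] /andP[? ?] /andP[? ?] /andP[? ?] ? ?.
by apply/andP; split; lra.
Qed.

Lemma pair_arith2 (M p q : R) : 0 <= M -> 0 <= p ->
  4 * (2 * (M * q) * (M * p) + M * p * (M * p)) <= 8 * (M * M) * (p * q + p * p).
Proof.
move=> M0 p0; have := mulr_ge0 (mulr_ge0 M0 M0) (mulr_ge0 p0 p0).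
rewrite (_ : 2 * (M * q) * (M * p) + M * p * (M * p) = (M * M) * (2 * (p * q) + p * p)); last by ring.
by move: (M * M) (p * q) (p * p) => a b c; nra.
Qed.

Variables (D : set rV) (oD : open D) (bD : bounded_set D).
Hypothesis dens : forall f, L2 D f -> forall e, 0 < e ->
  exists2 g, testf D g & normL2 D (fun x => f x - g x) <= e.
Let mD : measurable D := measurable_open_rV oD.
Let fD : (mu D < +oo)%E := measurable_bounded_rV_lty mD bD.

Variables (x0 : rV) (r : R) (i : 'I_m) (s : R) (h : rV -> R).
Hypotheses (ss : s * s = 1) (sh : is_smooth h)
  (hi : forall x t, h (x + t *: basis_vec i) = h x).
Let rho (x : rV) := s * x ord0 i - h x.
Let W := [set x : rV | `|x - x0| < r].
Hypothesis HD : forall x, W x -> (D x <-> 0 < rho x).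

Let pih : pderiv i h = cst 0.
Proof.
apply/funext => x; apply: pderivE; apply/is_derive_line.
by rewrite (_ : (fun t => _) = cst (h x)); [exact: is_derive_cst|apply/funext => t; rewrite addrC hi].
Qed.

Let pihj j : pderiv i (pderiv j h) = cst 0.
Proof. by apply/funext => x; rewrite smooth_schwarz// pih pderiv_cst. Qed.

Let pihjl j l : pderiv i (pderiv l (pderiv j h)) = cst 0.
Proof. by apply/funext => x; rewrite smooth_schwarz ?pihj ?pderiv_cst//; exact: smooth_pderiv. Qed.

Let srho : is_smooth rho.
Proof. by apply: smoothB => //; apply: smoothZ; exact: smooth_coord. Qed.

Let prho l x : pderiv l rho x = s * (i == l)%:R - pderiv l h x.
Proof. by rewrite pderivB ?pderivZ ?pderiv_coord//; [exact: smooth_coord|apply: smoothZ; exact: smooth_coord]. Qed.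

(** For [j != i] this is a vector field tangent to the level sets of [rho], and it is divergence
    free because [h] does not depend on the coordinate [i]. *)
Let Y j F x := pderiv j F x + s * pderiv j h x * pderiv i F x.

(** A cutoff that depends on [rho] alone, so that the tangential fields annihilate it. *)
Let chi (n : nat) x := expinv 1 (n.+1%:R * rho x - 1).

Let schi n : is_smooth (chi n).
Proof.
apply: smooth_comp; first exact: smooth1_expinv.
by apply: smoothB; [exact: smoothZ|exact: smooth_cst].
Qed.

Let Ychi n j x : j != i -> Y j (chi n) x = 0.
Proof.
move=> ji; have sa : is_smooth (fun x => n.+1%:R * rho x - 1).
  by apply: smoothB; [exact: smoothZ|exact: smooth_cst].
have E l : pderiv l (chi n) x = expinv (expinv_next 1) (n.+1%:R * rho x - 1) * (n.+1%:R * pderiv l rho x).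
  rewrite (pderiv_comp l sa (is_derive_expinv 1 _)).
  by rewrite pderivB ?pderivZ ?pderiv_cst ?subr0//; [exact: smoothZ|exact: smooth_cst].
rewrite /Y !E !prho eqxx eq_sym (negbTE ji) pih /= mulr0 mulr1 subr0 sub0r.
have aux (a b c : R) : a * (b * - c) + s * c * (a * (b * s)) = 0.
  by rewrite (_ : _ + _ = a * b * c * (s * s - 1)); [rewrite ss subrr mulr0|ring].
exact: aux.
Qed.

Let chi_cvg x : 0 < rho x -> chi ^~ x @ \oo --> (1 : R).
Proof.
move=> rx; apply/cvgrPdist_le => e e0; near=> n.
have H : 1 + e^-1 <= n.+1%:R * rho x.
  rewrite -ler_pdivrMr//; apply: (@le_trans _ _ n%:R); last by rewrite ler_nat.
  by near: n; exact: nbhs_infty_ger.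
have s0 : 0 < n.+1%:R * rho x - 1.
  by rewrite subr_gt0; apply: lt_le_trans H; rewrite ltrDl invr_gt0.
have L := expinv1_le1 (n.+1%:R * rho x - 1).
rewrite ger0_norm ?subr_ge0// /chi expinv1E//.
have := expR_ge1Dx (- (n.+1%:R * rho x - 1)^-1).
have : (n.+1%:R * rho x - 1)^-1 <= e.
  by rewrite -[leRHS]invrK lef_pV2 ?posrE ?invr_gt0// lerBrDl.
by move: (_^-1) (expR _) => p q; lra.
Unshelve. all: by end_near. Qed.

Let chi_test n F : testf W F -> testf D (fun x => chi n x * F x).
Proof.
move=> tF; split; first by apply: smoothM => //; exact: testf_smooth tF.
have [_ [K [cK KW F0]]] := tF.
exists (K `&` [set x | n.+1%:R^-1 <= rho x]); split.
- apply: compact_closedI => //; apply: (@closed_comp _ _ rho [set t | n.+1%:R^-1 <= t]).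
    by move=> x _; exact: smooth_continuous.
  exact: closed_ge.
- move=> x [Kx /= rx]; apply/HD; first exact: KW.
  by apply: lt_le_trans rx; rewrite invr_gt0.
- move=> x /not_andP[Kx|/= rx]; first by rewrite F0 ?mulr0.
  rewrite /chi expinv0 ?mul0r// subr_le0 mulrC -ler_pdivlMr// div1r.
  by move/negP: rx; rewrite -ltNge => /ltW.
Qed.

(* Y j is tangential to the boundary {rho = 0}, so the cut-off chi does not contribute. *)
Let tangent_ibp j G dG F : j != i -> H1 D G dG -> testf W F ->
  dotL2 D G (Y j F) = - dotL2 D (fun x => dG j x + s * pderiv j h x * dG i x) F.
Proof.
move=> ji [LG LdG HG] tF; have sF := testf_smooth tF.
have shj := smooth_pderiv j sh.
have sYF : is_smooth (Y j F).
  apply: smoothD; [exact: smooth_pderiv|apply: smoothM; [exact: smoothZ|exact: smooth_pderiv]].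
pose YG x := dG j x + s * pderiv j h x * dG i x.
have LYG : L2 D YG.
  by apply: L2D => //; apply: (L2_smoothM oD bD (c := fun x => s * pderiv j h x)) => //; exact: smoothZ.
have key n : dotL2 D (fun x => chi n x * Y j F x) G = - dotL2 D (fun x => chi n x * F x) YG.
  have t1 := chi_test n tF.
  have t2 : testf D (fun x => s * pderiv j h x * (chi n x * F x)).
    by apply: testfMl => //; exact: smoothZ.
  have E1 := HG j _ t1; have E2 := HG i _ t2.
  have L1 := testf_L2D oD t1; have L2' := testf_L2D oD t2.
  have L1d := testf_L2d oD j t1; have L2d := testf_L2d oD i t2.
  transitivity (dotL2 D G (pderiv j (fun x => chi n x * F x)) +
      dotL2 D G (pderiv i (fun x => s * pderiv j h x * (chi n x * F x)))).
    rewrite -dotDr// dotC; apply: eq_intg => x _.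
    have sc := schi n; have scF := smoothM sc sF.
    rewrite (pderivM i x (smoothZ s shj) scF) (pderivZ i s x shj)// pihj /= mulr0 mulr0 addr0.
    rewrite !pderivM//; have := Ychi n x ji; rewrite /Y.
    move: (pderiv j F x) (pderiv i F x) (pderiv j h x) (pderiv j (chi n) x) (pderiv i (chi n) x) (F x) (chi n x) (G x).
    move=> Fj Fi hj cj ci f c g /eqP; rewrite addr_eq0 => /eqP ->; ring.
  rewrite E1 E2 -opprD; congr (- _).
  transitivity (dotL2 D (dG j) (fun x => chi n x * F x) +
    dotL2 D (dG i) (fun x => s * pderiv j h x * (chi n x * F x))) => //.
  rewrite /dotL2 -RintegralD//; try exact: L2_itgM.
  by apply: eq_intg => x _; rewrite /YG; move: (dG j x) (dG i x) (chi n x) (F x) (pderiv j h x) => *; ring.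
have LF : L2 D F := smooth_L2 oD bD sF.
have LY : L2 D (Y j F) := smooth_L2 oD bD sYF.
have cut H : L2 D H -> (forall x, ~ W x -> H x = 0) -> (forall n, L2 D (fun x => chi n x * H x)) /\
    normL2 D (fun x => chi n x * H x - H x) @[n --> \oo] --> (0 : R).
  move=> LH H0; split => [n|]; first by apply: L2_smoothM.
  have C1 : \forall x \ae mu, D x -> (fun n x => chi n x * H x) ^~ x @ \oo --> H x.
    apply: aeW => x Dx; have [Wx|/H0 Hx] := pselect (W x).
      by rewrite -[X in _ --> X]mul1r; apply: cvgMl; apply: chi_cvg; exact/HD.
    have -> : (fun n x => chi n x * H x) ^~ x = cst 0 by apply/funext => n; rewrite Hx mulr0.
    by rewrite Hx; exact: cvg_cst.
  have C2 : \forall x \ae mu, forall n, D x -> `|chi n x * H x| <= `|H x|.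
    apply: aeW => x n _; rewrite normrM ler_piMl// ger0_norm ?expinv1_le1//; exact: expinv1_ge0.
  have mH : forall n, measurable_fun D (fun x => chi n x * H x).
    by move=> n; apply: measurable_funM; [exact: smooth_measurable mD (schi n)|exact: L2_meas].
  have La : L2 D (fun x => `|H x|).
    have mLH := L2_meas LH; apply: L2_le LH => //; last by move=> x _; rewrite normr_id.
    exact: measurableT_comp mLH.
  by have [] := dct_L2 mD mH (L2_meas LH) La C1 C2.
have F0 x : ~ W x -> F x = 0 by exact: testf_out tF.
have YF0 x : ~ W x -> Y j F x = 0.
  by move=> Wx; rewrite /Y !(testf_out (testf_pderiv _ tF) Wx) mulr0 addr0.
have [A1 A2] := cut _ LY YF0; have [B1 B2] := cut _ LF F0.
have A3 := cvg_dotl mD A1 LY LG A2.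
have B3 := cvg_dotl mD B1 LF LYG B2.
have {}B3 : (fun n => - dotL2 D (fun x => chi n x * F x) YG) @ \oo --> - dotL2 D F YG by exact: cvgN.
rewrite dotC [in RHS]dotC.
by apply: (cvg_unique _ A3) => //; apply: eq_cvgn B3.
Qed.

Let YD (du : 'I_m -> rV -> R) (ddu : 'I_m -> 'I_m -> rV -> R) j l x :=
  ddu j l x + s * pderiv j h x * ddu i l x + s * pderiv l (pderiv j h) x * du i x.

(** Says that the tangential derivative of [u] has zero trace: [F] is supported in the patch [W],
    not in [D], and yet no boundary term appears. The terms with [u] itself are integrated by parts
    because [u] is in H^1_0, the second derivatives by [tangent_ibp]. *)
Let vanish j l u du ddu F : j != i -> H2 D u du ddu -> H10 D u du -> testf W F ->
  dotL2 D (fun x => du j x + s * pderiv j h x * du i x) (pderiv l F) = - dotL2 D (YD du ddu j l) F.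
Proof.
move=> ji H2u H10u tF; have [[Lu Ldu _] Hd] := H2u.
have sF := testf_smooth tF; have shj := smooth_pderiv j sh; have shjl := smooth_pderiv l shj.
have sFl := smooth_pderiv l sF; have sFi := smooth_pderiv i sF; have sFj := smooth_pderiv j sF.
have sw1 : is_smooth (fun x => s * pderiv j h x * pderiv l F x) by apply: smoothM => //; exact: smoothZ.
have sw2 : is_smooth (fun x => s * pderiv l (pderiv j h) x * F x) by apply: smoothM => //; exact: smoothZ.
have sYF : is_smooth (Y j F) := smoothD sFj (smoothM (smoothZ s shj) sFi).
have LF := smooth_L2 oD bD sF.
have Ldd k k' : L2 D (ddu k k') by have [_ L _] := Hd k.
have Lw1 : L2 D (fun x => s * pderiv j h x * du i x).
  by apply: (L2_smoothM oD bD (c := fun x => s * pderiv j h x)) => //; exact: smoothZ.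
have Lw2 : L2 D (fun x => s * pderiv l (pderiv j h) x * du i x).
  by apply: (L2_smoothM oD bD (c := fun x => s * pderiv l (pderiv j h) x)) => //; exact: smoothZ.
have Lw3 k k' : L2 D (fun x => s * pderiv j h x * ddu k k' x).
  by apply: (L2_smoothM oD bD (c := fun x => s * pderiv j h x)) => //; exact: smoothZ.
have I1 := H10_ibp oD j H10u (H1_smooth oD bD sFl).
have I2 := H10_ibp oD i H10u (H1_smooth oD bD sw1).
have I3 := H10_ibp oD l H10u (H1_smooth oD bD sYF).
have I4 := H10_ibp oD i H10u (H1_smooth oD bD sw2).
have I5 := tangent_ibp ji (Hd l) tF.
have E1 : dotL2 D (fun x => s * pderiv j h x * du i x) (pderiv l F) =
    dotL2 D (du i) (fun x => s * pderiv j h x * pderiv l F x).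
  by apply: eq_intg => x _; rewrite mulrA [du i x * _]mulrC.
have E2 : dotL2 D u (pderiv j (pderiv l F)) + dotL2 D u (pderiv i (fun x => s * pderiv j h x * pderiv l F x)) =
    dotL2 D u (pderiv l (Y j F)) - dotL2 D u (pderiv i (fun x => s * pderiv l (pderiv j h) x * F x)).
  have La := smooth_L2 oD bD (smooth_pderiv j sFl); have Lb := smooth_L2 oD bD (smooth_pderiv i sw1).
  have Lc := smooth_L2 oD bD (smooth_pderiv l sYF); have Le := smooth_L2 oD bD (smooth_pderiv i sw2).
  apply: (etrans (esym (dotDr mD La Lb Lu))); apply: (etrans _ (dotBr mD Lc Le Lu)).
  apply: eq_dot => // x _.
  rewrite (pderivM i x (smoothZ s shj) sFl) (pderivM i x (smoothZ s shjl) sF).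
  rewrite (pderivZ i s x shj) (pderivZ i s x shjl) pihj pihjl /=.
  rewrite (pderivD l x sFj (smoothM (smoothZ s shj) sFi)) (pderivM l x (smoothZ s shj) sFi) (pderivZ l s x shj).
  rewrite (smooth_schwarz j l x sF) (smooth_schwarz i l x sF).
  move: (pderiv l (pderiv j F) x) (pderiv j h x) (pderiv l (pderiv i F) x) (pderiv i F x) (pderiv l _ x) (pderiv l F x) (F x).
  by move=> *; ring.
have E3 : dotL2 D (du i) (fun x => s * pderiv l (pderiv j h) x * F x) =
    dotL2 D (fun x => s * pderiv l (pderiv j h) x * du i x) F.
  by apply: eq_intg => x _; rewrite mulrA [du i x * _]mulrC.
have Lfl := smooth_L2 oD bD sFl.
have LA : L2 D (fun x => ddu l j x + s * pderiv j h x * ddu l i x) by apply: L2D.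
have E4 : dotL2 D (YD du ddu j l) F = dotL2 D (fun x => ddu l j x + s * pderiv j h x * ddu l i x) F +
    dotL2 D (fun x => s * pderiv l (pderiv j h) x * du i x) F.
  have LB : L2 D (fun x => ddu j l x + s * pderiv j h x * ddu i l x) by apply: L2D.
  rewrite -(dotDl mD LA Lw2 LF).
  apply: (dot_ae mD (L2D mD LB Lw2) LF (L2D mD LA Lw2) LF); last exact: aeW.
  have S1 := H2_sym oD bD j l H2u; have S2 := H2_sym oD bD i l H2u.
  by apply: filterS2 S1 S2 => x e1 e2 Dx; rewrite /YD e1// e2.
rewrite (dotDl mD (Ldu j) Lw1 Lfl) E1 E4.
rewrite -[X in X + _ = _]opprK -I1 -[X in _ + X = _]opprK -I2 -opprD E2 I3 I4 I5 E3.
by move: (dotL2 D _ F) (dotL2 D _ F) => p q; ring.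
Qed.

Variables (r' : R) (r'0 : 0 < r') (r'r : r' < r).
Let z := bumpf x0 r'.
Let sz : is_smooth z := smooth_bump x0 r'.

Let tz : testf W z.
Proof.
split => //; exists [set y : rV | `|y - x0| <= r']; split => [|x /= xr|x /negP].
- exact: compact_closed_ball.
- exact: le_lt_trans r'r.
- by rewrite -ltNge => /ltW; exact: bump_out.
Qed.

(** [N] is [s] times the gradient of [rho]. The gradient of [u] splits as [z u_j = T_j + z N_j u_i],
    where [T_j] is [z] times a tangential derivative for [j != i], and is 0 for [j = i]. *)
Let N j x := (j == i)%:R - s * pderiv j h x.
Let sN j : is_smooth (N j).
Proof. by apply: smoothB; [exact: smooth_cst|apply: smoothZ; exact: smooth_pderiv]. Qed.
Let szN j : is_smooth (fun x => z x * N j x). Proof. exact: smoothM. Qed.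

Let dP (du : 'I_m -> rV -> R) (ddu : 'I_m -> 'I_m -> rV -> R) j l x := z x * ddu j l x + pderiv l z x * du j x.
Let dA (du : 'I_m -> rV -> R) (ddu : 'I_m -> 'I_m -> rV -> R) j l x :=
  (z x * N j x) * ddu i l x + pderiv l (fun x => z x * N j x) x * du i x.
Let T (du : 'I_m -> rV -> R) j x := z x * du j x - (z x * N j x) * du i x.

Let HP u du ddu j : H2 D u du ddu -> H1 D (fun x => z x * du j x) (dP du ddu j).
Proof. by move=> [_ Hd]; apply: (H1_smoothM oD bD). Qed.

Let HA u du ddu j : H2 D u du ddu -> H1 D (fun x => (z x * N j x) * du i x) (dA du ddu j).
Proof. by move=> [_ Hd]; apply: (H1_smoothM oD bD (szN j)). Qed.

(** The zero extension of [T j] is weakly differentiable across the boundary: it is 0 or, by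
    [vanish], a cut-off function of zero trace. *)
Let HT u du ddu j l f : H2 D u du ddu -> H10 D u du -> testf setT f ->
  dotL2 D (T du j) (pderiv l f) = - dotL2 D (fun x => dP du ddu j l x - dA du ddu j l x) f.
Proof.
move=> H2u H10u tf; have sf := testf_smooth tf; have [[Lu Ldu _] Hd] := H2u.
have [ji|ji] := eqVneq j i.
  have Tz x : T du j x = 0 by rewrite /T /N ji eqxx pih /= mulr0 subr0 mulr1 subrr.
  have szN1 : (fun x => z x * N j x) = z by apply/funext => x; rewrite /N ji eqxx pih /= mulr0 subr0 mulr1.
  have dz x : dP du ddu j l x - dA du ddu j l x = 0.
    by rewrite /dA szN1 /N /dP ji eqxx pih /= mulr0 subr0 mulr1 subrr.
  rewrite (@eq_dot _ _ _ _ _ (cst 0) (pderiv l f))//.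
  rewrite (@eq_dot _ _ _ (fun x => dP du ddu j l x - _) _ (cst 0) f)//.
  by rewrite !dot0l oppr0.
have shj := smooth_pderiv j sh; have szl := smooth_pderiv l sz.
have tF : testf W (fun x => z x * f x) by exact: testfMr.
have V := vanish l ji H2u H10u tF.
pose v x := du j x + s * pderiv j h x * du i x.
have Lw1 : L2 D (fun x => s * pderiv j h x * du i x).
  by apply: (L2_smoothM oD bD (c := fun x => s * pderiv j h x)) => //; exact: smoothZ.
have Lv : L2 D v by exact: L2D.
have Lf := smooth_L2 oD bD sf.
have Lzf := smooth_L2 oD bD (smooth_pderiv l (smoothM sz sf)).
have Lzlf := smooth_L2 oD bD (smoothM szl sf).
have E : dotL2 D (T du j) (pderiv l f) = dotL2 D v (pderiv l (fun x => z x * f x)) - dotL2 D v (fun x => pderiv l z x * f x).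
  rewrite -dotBr//; apply: eq_intg => x _; rewrite pderivM// /T /v /N (negbTE ji) /=.
  move: (z x) (du j x) (du i x) (pderiv j h x) (pderiv l f x) (f x) (pderiv l z x) => *; ring.
have LYD : L2 D (YD du ddu j l).
  have Ldd k k' : L2 D (ddu k k') by have [_ L _] := Hd k.
  apply: L2D => //; first apply: L2D => //.
    by apply: (L2_smoothM oD bD (c := fun x => s * pderiv j h x)) => //; exact: smoothZ.
  apply: (L2_smoothM oD bD (c := fun x => s * pderiv l (pderiv j h) x)) => //; apply: smoothZ; exact: smooth_pderiv.
rewrite E V -opprD; congr (- _).
have Lzf' := smooth_L2 oD bD (smoothM sz sf).
rewrite /dotL2 -RintegralD//; try exact: L2_itgM.
apply: eq_intg => x _; rewrite /dP /dA pderivM//.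
rewrite (_ : pderiv l (N j) x = - (s * pderiv l (pderiv j h) x)); last first.
  by rewrite pderivB ?pderiv_cst ?sub0r ?pderivZ//; [exact: smooth_cst|exact: smoothZ].
rewrite /YD /v /N (negbTE ji) /=.
move: (z x) (du j x) (du i x) (pderiv j h x) (f x) (pderiv l z x) (ddu j l x) (ddu i l x) (pderiv l _ x) => *; ring.
Qed.

(** In [curl_shift] the zero boundary values are needed on one side only: [T j] has them, and [psi]
    is any function in H^1. *)
Let curl u du ddu j a b psi dpsi : H2 D u du ddu -> H10 D u du -> H1 D psi dpsi ->
  dotL2 D (fun x => dP du ddu j a x - dA du ddu j a x) (dpsi b) =
  dotL2 D (fun x => dP du ddu j b x - dA du ddu j b x) (dpsi a).
Proof.
move=> H2u H10u [Lpsi Ldpsi Hpsi].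
pose S := [set x : rV | D x /\ `|x - x0| <= r'].
pose dT l x := dP du ddu j l x - dA du ddu j l x.
have [[Lu Ldu _] Hd] := H2u.
have [LP LdP _] := HP j H2u; have [LA LdA _] := HA j H2u.
have LT : L2 D (T du j) := L2B mD LP LA.
have LdT l : L2 D (dT l) := L2B mD (LdP l) (LdA l).
have zS x : ~ S x -> D x -> (forall l, pderiv l z x = 0) /\ z x = 0.
  move=> nS Dx; have xr : r' < `|x - x0| by rewrite ltNge; apply/negP => ?; apply: nS.
  split=> [l|]; last by apply: bump_out => //; exact: ltW.
  apply: (pderiv_out (K := [set y : rV | `|y - x0| <= r'])) => [|y /= /negP|/=]; last by apply/negP; rewrite -ltNge.
    by apply: compact_closed_rV; exact: compact_closed_ball.
  by rewrite -ltNge => /ltW; exact: bump_out.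
have S0 x : ~ S x -> [/\ (T du j \_ D) x = 0, (dT a \_ D) x = 0 & (dT b \_ D) x = 0].
  move=> nS; have [Dx|Dx] := pselect (D x); last by split; exact: patch_notin.
  have [zl z0] := zS x nS Dx.
  have zN l : pderiv l (fun x => z x * N j x) x = 0 by rewrite (pderivM l x sz (sN j)) zl z0 mul0r mulr0 addr0.
  have Tx : T du j x = 0 by rewrite /T z0 !mul0r subrr.
  have dTx l : dT l x = 0 by rewrite /dT /dP /dA zN zl z0 !mul0r !addr0 subrr.
  by split; apply: patch_eq0; [exact: Tx|exact: dTx|exact: dTx].
have D0 x : ~ D x -> [/\ (psi \_ D) x = 0, (dpsi a \_ D) x = 0 & (dpsi b \_ D) x = 0].
  by move=> nD; split; exact: patch_notin.
have wT l : wdT setT l (T du j \_ D) (dT l \_ D).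
  move=> f tf; apply: (etrans (dot_patchl _ _ _)); apply: (etrans (HT j l H2u H10u tf)).
  by congr (- _); exact/esym/dot_patchl.
have wpsi l : wdT D l (psi \_ D) (dpsi l \_ D).
  by move=> f tf; rewrite !dot_patchl Hpsi.
have t0 : 0 < r - r' by rewrite subr_gt0.
(* Moving by [t] along [s e_i] raises [rho] by exactly [t], which pushes the support of [T] into the
   compact part [rho >= t] of the patch. *)
have HS t : 0 < t < r - r' -> exists K, [/\ compact K, K `<=` D & forall x, S x -> K (x + t *: (s *: basis_vec i))].
  move=> /andP[t_gt0 tr].
  have ht : r' + t < r by rewrite -ltrBrDl.
  exists ([set y : rV | `|y - x0| <= r' + t] `&` [set y | t <= rho y]); split.
  - apply: compact_closedI; first exact: compact_closed_ball.
    apply: (@closed_comp _ _ rho [set c | t <= c]); last exact: closed_ge.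
    by move=> x _; exact: smooth_continuous.
  - move=> y [/= yr ty]; apply/HD; last exact: lt_le_trans ty.
    exact: le_lt_trans ht.
  - move=> x [Dx xr]; have Wx : W x by apply: le_lt_trans r'r.
    have rx : 0 < rho x by exact/HD.
    have s1 : `|s| = 1.
      apply/eqP; rewrite -(@eqrXn2 _ 2) ?expr1n// real_normK ?num_real//; first by rewrite expr2 ss.
    split => /=.
      rewrite addrAC (le_trans (ler_normD _ _))// lerD// !normrZ s1 mul1r gtr0_norm//.
      by rewrite -[leRHS]mulr1 ler_wpM2l ?(ltW t_gt0)// norm_basis_vec.
    rewrite /rho scalerA hi !mxE !eqxx /= mulr1 mulrDr mulrCA ss mulr1.
    by move: rx; rewrite /rho; move: (s * _) (h x) => ? ? ?; lra.
have LT' := (L2_restrict (T du j) mD).1 LT.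
have LdT' l := (L2_restrict (dT l) mD).1 (LdT l).
have Lpsi' := (L2_restrict psi mD).1 Lpsi.
have Ldpsi' l := (L2_restrict (dpsi l) mD).1 (Ldpsi l).
have SD : S `<=` D by move=> x [].
have := curl_shift oD dens t0 HS LT' (LdT' a) (LdT' b) Lpsi' (Ldpsi' a) (Ldpsi' b) S0 SD D0 (wT a) (wT b) (wpsi a) (wpsi b).
by move=> E; apply: (etrans (dot_restrict _ _ mD)); apply: (etrans E); exact/esym/dot_restrict.
Qed.

(** Put [P_j = z u_j = T_j + A_j] with [A_j = z N_j u_i]. In the antisymmetric expression formed
    from the derivatives of [P_j] and [P_k], the curl identity removes first [T_j], then [T_k]. Only
    [A_j] and [A_k] remain, and their leading terms [z^2 N_j N_k u_ij u_ik] cancel. All other terms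
    contain a first derivative of [u], whence the bound by [p q + p^2]. *)
Lemma patch_pair : exists2 C : R, 0 <= C & forall u du ddu, H2 D u du ddu -> H10 D u du ->
  forall p q, (forall j, normL2 D (du j) <= p) -> (forall j k, normL2 D (ddu j k) <= q) -> forall j k,
  `|dotL2 D (fun x => z x * ddu j j x) (fun x => z x * ddu k k x) -
    dotL2 D (fun x => z x * ddu j k x) (fun x => z x * ddu k j x)| <= C * (p * q + p * p).
Proof.
have [M1 M10 B1] := normL2_smoothM mD bD sz.
have [M2 M20 B2] := normL2_smoothM_fam mD bD (fun l => smooth_pderiv l sz).
have [M3 M30 B3] := normL2_smoothM_fam mD bD szN.
have [M4 M40 B4] := normL2_smoothM_fam (c := fun (jl : 'I_m * 'I_m) => pderiv jl.2 (fun x => z x * N jl.1 x)) mD bD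
  (fun jl => smooth_pderiv jl.2 (szN jl.1)).
pose M := M1 + M2 + M3 + M4.
have M0 : 0 <= M by rewrite !addr_ge0.
(* Four scalar products are replaced by their leading parts, each with an error of at most
   [2 a b + b^2] for [a = M q] and [b = M p]. *)
exists (8 * (M * M)); first by rewrite !mulr_ge0.
move=> u du ddu H2u H10u p q Hp Hq j k; have [[Lu Ldu _] Hd] := H2u.
have Ldd a b : L2 D (ddu a b) by have [_ L _] := Hd a.
have le_M M' (t t' : R) : 0 <= M' -> M' <= M -> 0 <= t -> t <= t' -> M' * t <= M * t'.
  by move=> *; exact: ler_pM.
have X1 a b : L2 D (fun x => z x * ddu a b x) /\ normL2 D (fun x => z x * ddu a b x) <= M * q.
  have [L H] := B1 _ (Ldd a b); split => //; apply: le_trans H _.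
  by apply: le_M => //; [rewrite /M -!addrA lerDl !addr_ge0|exact: normL2_ge0].
have X2 a b : L2 D (fun x => pderiv b z x * du a x) /\ normL2 D (fun x => pderiv b z x * du a x) <= M * p.
  have [L H] := B2 b _ (Ldu a); split => //; apply: le_trans H _.
  by apply: le_M => //; [rewrite /M addrAC [M1 + _]addrC -!addrA lerDl !addr_ge0|exact: normL2_ge0].
have X3 a b : L2 D (fun x => z x * N a x * ddu i b x) /\ normL2 D (fun x => z x * N a x * ddu i b x) <= M * q.
  have [L H] := B3 a _ (Ldd i b); split => //; apply: le_trans H _.
  by apply: le_M => //; [rewrite /M addrAC lerDr !addr_ge0|exact: normL2_ge0].
have X4 a b : L2 D (fun x => pderiv b (fun x => z x * N a x) x * du i x) /\
    normL2 D (fun x => pderiv b (fun x => z x * N a x) x * du i x) <= M * p.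
  have [L H] := B4 (a, b) _ (Ldu i); split => //; apply: le_trans H _.
  by apply: le_M => //; [rewrite /M lerDr !addr_ge0|exact: normL2_ge0].
have P1 (a b c d : 'I_m) := dot_perturb mD (X1 a b).1 (X2 a b).1 (X1 c d).1 (X2 c d).1 (X1 a b).2 (X1 c d).2 (X2 a b).2 (X2 c d).2.
have P2 (a b c d : 'I_m) := dot_perturb mD (X3 a b).1 (X4 a b).1 (X3 c d).1 (X4 c d).1 (X3 a b).2 (X3 c d).2 (X4 a b).2 (X4 c d).2.
have Hj := HP j H2u; have Hk := HP k H2u; have Aj := HA j H2u; have Ak := HA k H2u.
have C1 := curl j j k H2u H10u Hk.
have C2 := curl k k j H2u H10u Aj.
have [_ LPj _] := Hj; have [_ LPk _] := Hk; have [_ LAj _] := Aj; have [_ LAk _] := Ak.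
(* The cancellation that makes the estimate work: the leading part for [A] is symmetric under
   exchanging the inner derivatives. *)
have E3 : dotL2 D (fun x => z x * N j x * ddu i j x) (fun x => z x * N k x * ddu i k x) =
    dotL2 D (fun x => z x * N j x * ddu i k x) (fun x => z x * N k x * ddu i j x).
  by apply: eq_intg => x _; rewrite mulrACA [RHS]mulrACA [ddu i k x * _]mulrC.
have Q1 := P1 j j k k; have Q2 := P1 j k k j; have Q3 := P2 j j k k; have Q4 := P2 j k k j.
have D1 := etrans (esym (dotBl mD (LPj j) (LAj j) (LPk k))) (etrans C1 (dotBl mD (LPj k) (LAj k) (LPk j))).
have D2 := etrans (esym (dotBl mD (LPk k) (LAk k) (LAj j))) (etrans C2 (dotBl mD (LPk j) (LAk j) (LAj k))).
have D3 : dotL2 D (dA du ddu j j) (dP du ddu k k) - dotL2 D (dA du ddu j j) (dA du ddu k k) =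
    dotL2 D (dA du ddu j k) (dP du ddu k j) - dotL2 D (dA du ddu j k) (dA du ddu k j).
  by apply: (etrans _ (etrans D2 _)); apply: (f_equal2 (fun a b => a - b)); exact: dotC.
rewrite -E3 in Q4.
apply: le_trans (pair_arith Q1 Q2 Q3 Q4 D1 D3) _.
exact: pair_arith2 M0 (le_trans (normL2_ge0 _ _) (Hp j)).
Qed.

End patch_estimate.

(** * From the patches to a global bound of second derivatives by the Laplacian *)

Section h2_estimate.
Context {R : realType} {m : nat}.
Local Notation mu := (lebesgue_rV R m).
Local Notation rV := 'rV[R]_m.
Implicit Types (f g u v w c : rV -> R).
Variables (D : set rV) (oD : open D) (bD : bounded_set D).
Hypothesis dens : forall f, L2 D f -> forall e, 0 < e ->
  exists2 g, testf D g & normL2 D (fun x => f x - g x) <= e.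
Hypotheses (m0 : (0 < m)%N) (sbD : smooth_boundary D).
Let mD : measurable D := measurable_open_rV oD.

Lemma compact_closure_bounded : compact (closure D).
Proof.
have [M [_ HM]] := bD; have H : D `<=` [set y : rV | `|y - 0| <= `|M| + 1].
  move=> x Dx /=; rewrite subr0; apply: HM => //.
  by rewrite (le_lt_trans (ler_norm M))// ltrDl.
apply: (subclosed_compact _ (@compact_closed_ball R m 0 (`|M| + 1))); first exact: closed_closure.
rewrite closureE; apply: bigcap_inf; split => //.
by apply: compact_closed_rV; exact: compact_closed_ball.
Qed.

Lemma patch_exists x0 : closure D x0 -> exists r i s h, [/\ 0 < r, s * s = 1, is_smooth h,
  (forall x t, h (x + t *: basis_vec i) = h x) &
  forall x : rV, `|x - x0| < r -> (D x <-> 0 < s * x ord0 i - h x)].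
Proof.
move=> cx0; have [Dx0|Dx0] := pselect (D x0).
  have /nbhs_ballP[r /= r0 rD] : nbhs x0 D by exact: open_nbhs_nbhs.
  (* An interior point gets a patch without boundary: the constant [h] lies below every coordinate
     on the ball, so [rho] is positive there. *)
  exists r, (Ordinal m0), 1, (cst (- (`|x0| + r))); split => //; first by rewrite mulr1.
    exact: smooth_cst.
  move=> x xr; split => _; last by apply: rD; rewrite -ball_normE /= distrC.
  rewrite mul1r opprK /=.
  have := coord_le_norm x (Ordinal m0); have : `|x| < `|x0| + r.
    have := ler_normD (x - x0) x0; rewrite subrK => H0.
    by rewrite (le_lt_trans H0)// addrC ltrD2l.
  rewrite ler_norml => H1 /andP[H2 _].
  by rewrite -(opprK (_ + r)) subr_gt0 (lt_le_trans _ H2)// ltrN2.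
have [|i [sg [h [sh hi]]]] := sbD (x0 := x0).
  by split => // /interior_subset.
move=> /nbhs_ballP[r /= r0 rD].
exists r, i, ((-1) ^+ sg), h; split => //; first by rewrite -expr2 sqrr_sign.
move=> x xr; rewrite subr_gt0; apply: rD; by rewrite -ball_normE /= distrC.
Qed.

Lemma grad_green u du ddu : H2 D u du ddu -> H10 D u du ->
  \sum_i dotL2 D (du i) (du i) = - dotL2 D u (lap ddu).
Proof.
move=> H2u H10u; have [[Lu _ _] Hd] := H2u.
rewrite dotC /lap dot_suml// => [|i]; last by have [_ L _] := Hd i.
rewrite -sumrN; apply: eq_bigr => i _.
by rewrite dotC (H10_ibp oD i H10u (Hd i)) opprK.
Qed.

Lemma grad_le u du ddu i : H2 D u du ddu -> H10 D u du ->
  normL2 D (du i) <= normL2 D u + normL2 D (lap ddu).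
Proof.
move=> H2u H10u; have [[Lu Ldu _] Hd] := H2u.
have N0 f := normL2_ge0 D f.
rewrite -ler_sqr ?nnegrE ?addr_ge0//.
apply: (@le_trans _ _ (normL2 D u * normL2 D (lap ddu))); last first.
  by move: (N0 u) (N0 (lap ddu)); move: (normL2 D u) (normL2 D (lap ddu)) => a b *; nra.
rewrite normL2_sqr; apply: le_trans (dot_CS mD Lu (L2_lap oD H2u)).
apply: (@le_trans _ _ (- dotL2 D u (lap ddu))); last by rewrite -normrN ler_norm.
by rewrite -(grad_green H2u H10u) (bigD1 i)//= lerDl sumr_ge0// => j _; exact: dot_ge0.
Qed.

(** Absorption: the unknown [q] occurs squared on the left and only linearly on the right. *)
Lemma quad_bound (C L p q : R) : 0 <= C -> 0 <= L -> 0 <= p -> q ^+ 2 <= C * (L ^+ 2 + (p * q + p * p)) ->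
  q <= (C + 1) * (L + p).
Proof.
move=> C0 L0 p0 H; rewrite leNgt; apply/negP => qb.
have b0 : 0 <= L + p by rewrite addr_ge0.
have q0 : 0 < q by apply: le_lt_trans qb; rewrite mulr_ge0 ?addr_ge0.
have bq : L + p <= q.
  by apply: ltW; apply: le_lt_trans qb; rewrite mulrDl mul1r lerDr mulr_ge0.
have h1 : (C + 1) * (L + p) * q < q * q by rewrite ltr_pM2r.
have h2 : C * L * L <= C * L * q.
  by rewrite ler_wpM2l ?mulr_ge0//; apply: le_trans bq; rewrite lerDl.
have h3 : (L + p) * ((C + 1) * (L + p)) <= (L + p) * q by rewrite ler_wpM2l// ltW.
have := mulr_ge0 C0 (mulr_ge0 L0 L0); have := mulr_ge0 C0 (mulr_ge0 L0 p0).
have := mulr_ge0 L0 L0; have := mulr_ge0 L0 p0; have := mulr_ge0 p0 p0.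
move: h1 h2 h3 H; rewrite !expr2; nra.
Qed.

(** Summed over [j] and [k], [patch_pair] compares the norm of [z Lap u] with the norms of all
    [z u_jk], the mixed derivatives being symmetric. The patches are then added; the sum of the
    squared cutoffs is bounded below on the closure of [D]. *)
Lemma h2_estimate : exists2 C : R, 0 <= C & forall u du ddu, H2 D u du ddu -> H10 D u du ->
  forall j k, normL2 D (ddu j k) <= C * (normL2 D u + normL2 D (lap ddu)).
Proof.
have cD := compact_closure_bounded.
have /choice[F HF] : forall x0, exists F : (R * 'I_m) * (R * (rV -> R)), closure D x0 ->
    [/\ 0 < F.1.1, F.2.1 * F.2.1 = 1, is_smooth F.2.2,
    (forall x t, F.2.2 (x + t *: basis_vec F.1.2) = F.2.2 x) &
    forall x : rV, `|x - x0| < F.1.1 -> (D x <-> 0 < F.2.1 * x ord0 F.1.2 - F.2.2 x)].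
  move=> x0; have [cx|cx] := pselect (closure D x0); last by exists ((0, Ordinal m0), (0, cst 0)).
  by have [r [i [s [h H]]]] := patch_exists cx; exists ((r, i), (s, h)).
pose rr x0 := (F x0).1.1 / 2.
have rr0 x0 : closure D x0 -> 0 < rr x0 by move=> /HF[r0 _ _ _ _]; rewrite divr_gt0.
pose z y := bumpf y (rr y).
have m1 : 0 < m.+1%:R :> R by [].
have [S [SD HS]] := bump_cover (r := fun x0 => rr x0 / m.+1%:R) cD (fun x cx => divr_gt0 (rr0 x cx) m1).
have /choice[C HC] : forall y, exists C, 0 <= C /\ (closure D y -> forall u du ddu, H2 D u du ddu -> H10 D u du ->
  forall p q, (forall j, normL2 D (du j) <= p) -> (forall j k, normL2 D (ddu j k) <= q) -> forall j k,
  `|dotL2 D (fun x => z y x * ddu j j x) (fun x => z y x * ddu k k x) -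
    dotL2 D (fun x => z y x * ddu j k x) (fun x => z y x * ddu k j x)| <= C * (p * q + p * p)).
  move=> y; have [cy|cy] := pselect (closure D y); last by exists 0.
  have [r0 ss sh hi HD] := HF y cy.
  have r'r : rr y < (F y).1.1 by rewrite ltr_pdivrMr// ltr_pMr// ltr1n.
  have [C C0 H] := patch_pair oD bD dens ss sh hi HD (rr0 y cy) r'r.
  by exists C.
have sz y : is_smooth (z y) by exact: smooth_bump.
have /choice[M HM] : forall y, exists M, 0 <= M /\ forall f, L2 D f ->
    L2 D (fun x => z y x * f x) /\ normL2 D (fun x => z y x * f x) <= M * normL2 D f.
  by move=> y; have [M M_0 H] := normL2_smoothM mD bD (sz y); exists M.
pose Z x := \sum_(y <- S) z y x ^+ 2.
have sZ : is_smooth Z.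
  apply: smooth_sum => y; rewrite (_ : (fun x => _) = (fun x => z y x * z y x)); first exact: smoothM.
  by apply/funext => x; rewrite expr2.
have Zpos x : closure D x -> 0 < Z x.
  move=> cx; have [y yS xy] := HS x cx.
  rewrite /Z (big_rem y)//= ltr_pwDl// ?sumr_ge0// => [|w _]; last exact: sqr_ge0.
  by apply: exprn_gt0; apply: bump_gt0; [apply: rr0; exact: SD|exact: ltW].
have [c c0 Hc] := compact_pos_min cD (smooth_continuous sZ) Zpos.
(* [M y] is the cost of multiplying the Laplacian by the cutoff, and [m ^+ 2] counts the index pairs
   contributing an error term. *)
pose A := \sum_(y <- S) (M y ^+ 2 + m%:R ^+ 2 * C y).
have A0 : 0 <= A.
  by apply: sumr_ge0 => y _; rewrite addr_ge0 ?sqr_ge0// mulr_ge0 ?sqr_ge0//; have [] := HC y.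
have key u du ddu : H2 D u du ddu -> H10 D u du ->
  forall p q, 0 <= p -> 0 <= q -> (forall j, normL2 D (du j) <= p) -> (forall j k, normL2 D (ddu j k) <= q) -> forall j k,
  c * normL2 D (ddu j k) ^+ 2 <= A * (normL2 D (lap ddu) ^+ 2 + (p * q + p * p)).
  move=> H2u H10u p q p0 q0 Hp Hq j k; have [[Lu Ldu _] Hd] := H2u.
  have Ldd a b : L2 D (ddu a b) by have [_ L _] := Hd a.
  have Lz y f : L2 D f -> L2 D (fun x => z y x * f x) by move=> Lf; have [_ /(_ f Lf)[]] := HM y.
  have L2l := L2_lap oD H2u.
  apply: (@le_trans _ _ (\sum_(y <- S) normL2 D (fun x => z y x * ddu j k x) ^+ 2)).
    rewrite normL2_sqr -(dotZl mD c (Ldd j k) (Ldd j k)) (eq_bigr (fun y => dotL2 D (fun x => z y x * ddu j k x) (fun x => z y x * ddu j k x))); last first.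
      by move=> y _; rewrite normL2_sqr.
    rewrite -(intg_sum mD) => [|y]; last exact: L2_itgM (Lz _ _ (Ldd j k)) (Lz _ _ (Ldd j k)).
    apply: (ae_le_intg mD); first exact: L2_itgM (L2Z mD _ (Ldd j k)) (Ldd j k).
      by apply: (itg_sum mD) => y; exact: L2_itgM (Lz _ _ (Ldd j k)) (Lz _ _ (Ldd j k)).
    apply: aeW => x Dx; rewrite (eq_bigr (fun y => z y x ^+ 2 * ddu j k x ^+ 2)); last first.
      by move=> y _; rewrite -expr2 exprMn.
    by rewrite -mulr_suml -mulrA -expr2 ler_wpM2r ?sqr_ge0// Hc//; exact: subset_closure.
  rewrite mulr_suml big_seq [leRHS]big_seq; apply: ler_sum => y yS.
  have [C0 /(_ (SD y yS) u du ddu H2u H10u p q Hp Hq) HCy] := HC y.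
  have [M_0 HMy] := HM y.
  have E1 : \sum_a \sum_b dotL2 D (fun x => z y x * ddu a a x) (fun x => z y x * ddu b b x) =
      normL2 D (fun x => z y x * lap ddu x) ^+ 2.
    have -> : (fun x => z y x * lap ddu x) = (fun x => \sum_a z y x * ddu a a x).
      by apply/funext => x; rewrite /lap mulr_sumr.
    have LS : L2 D (fun x => \sum_a z y x * ddu a a x) by apply: (L2_sum mD) => a; exact: Lz.
    rewrite normL2_sqr (@dot_suml _ _ _ mD _ _ _ _ _ LS) => [|a]; last exact: Lz.
    apply: eq_bigr => a _; rewrite dotC (@dot_suml _ _ _ mD _ _ _ _ _ (Lz y _ (Ldd a a))) => [|b]; last exact: Lz.
    by apply: eq_bigr => b _; exact: dotC.
  have E2 a b : dotL2 D (fun x => z y x * ddu a b x) (fun x => z y x * ddu b a x) =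
      normL2 D (fun x => z y x * ddu a b x) ^+ 2.
    rewrite normL2_sqr; apply: (dot_ae mD (Lz _ _ (Ldd _ _)) (Lz _ _ (Ldd _ _)) (Lz _ _ (Ldd _ _)) (Lz _ _ (Ldd _ _))); first exact: aeW.
    by have S1 := H2_sym oD bD b a H2u; apply: filterS S1 => x e Dx; rewrite e.
  apply: (@le_trans _ _ (\sum_a \sum_b normL2 D (fun x => z y x * ddu a b x) ^+ 2)).
    rewrite (bigD1 j)//= (bigD1 k)//= -addrA lerDl addr_ge0// ?sumr_ge0// => *; rewrite ?sqr_ge0// sumr_ge0// => *; exact: sqr_ge0.
  apply: (@le_trans _ _ (\sum_a \sum_b (dotL2 D (fun x => z y x * ddu a a x) (fun x => z y x * ddu b b x) + C y * (p * q + p * p)))).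
    apply: ler_sum => a _; apply: ler_sum => b _; rewrite -E2.
    have := HCy a b; rewrite ler_norml => /andP[+ _].
    by move: (dotL2 _ _ _) (dotL2 _ _ _) (C y * _) => d1 d2 d3; lra.
  under eq_bigr do rewrite big_split /=.
  have E4 (K : R) : \sum_(a < m) \sum_(b < m) K = m%:R ^+ 2 * K.
    by rewrite !sumr_const !card_ord -[LHS]mulr_natr -[X in X * _]mulr_natr -mulrA mulrC expr2.
  rewrite big_split /= E1 E4.
  have [_ HMl] := HMy _ L2l.
  have H2' : normL2 D (fun x => z y x * lap ddu x) ^+ 2 <= M y ^+ 2 * normL2 D (lap ddu) ^+ 2.
    by rewrite -exprMn ler_sqr ?nnegrE ?mulr_ge0 ?normL2_ge0.
  have X0 : 0 <= p * q + p * p by rewrite addr_ge0 ?mulr_ge0.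
  move: H2' (mulr_ge0 (sqr_ge0 (M y)) X0) (mulr_ge0 (mulr_ge0 (sqr_ge0 m%:R) C0) (sqr_ge0 (normL2 D (lap ddu)))).
  move: (M y ^+ 2) (m%:R ^+ 2) (normL2 D (lap ddu) ^+ 2) (normL2 D _ ^+ 2) (C y) (p * q + p * p) => a1 a2 a3 a4 a5 a6.
  by rewrite -!mulrA; nra.
exists ((A / c + 1) * 2) => [|u du ddu H2u H10u j k]; first by rewrite mulr_ge0// addr_ge0// divr_ge0// ltW.
have L0 := normL2_ge0 D (lap ddu); have u0 := normL2_ge0 D u.
(* Working with the largest second derivative lets its own norm serve as [q], which [quad_bound]
   then absorbs. *)
have [jk _ Hmax] := @arg_maxP _ _ _ (j, k) xpredT (fun jk : 'I_m * 'I_m => normL2 D (ddu jk.1 jk.2)) isT.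
apply: (le_trans (Hmax (j, k) isT)).
have p0 := addr_ge0 u0 L0.
have K := key u du ddu H2u H10u _ _ p0 (normL2_ge0 _ _) (fun i => grad_le i H2u H10u)
  (fun a b => Hmax (a, b) isT) jk.1 jk.2.
rewrite -ler_pdivlMl// mulrA [c^-1 * A]mulrC in K.
have Ac : 0 <= A / c by rewrite divr_ge0// ltW.
apply: le_trans (quad_bound Ac L0 p0 K) _.
rewrite -mulrA ler_wpM2l ?addr_ge0//.
by move: (normL2 D u) (normL2 D (lap _)) u0 => a b ?; lra.
Qed.

End h2_estimate.

(** * Spectral expansions *)

Section spectral.
Context {R : realType} {m : nat}.
Local Notation mu := (lebesgue_rV R m).
Local Notation rV := 'rV[R]_m.
Implicit Types (f g u v w c : rV -> R) (a b : nat -> R).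
Variables (D : set rV) (oD : open D) (bD : bounded_set D) (m0 : (0 < m)%N) (sbD : smooth_boundary D).
Variables (lam : nat -> R) (phi : nat -> rV -> R).
Hypothesis heig : dirichlet_eigensystem D lam phi.
Let mD : measurable D := measurable_open_rV oD.
Let dens := eigen_dense oD bD heig.

Definition dphi k i := weak_deriv D [:: i] (phi k).
Definition ddphi k i j := weak_deriv D [:: i; j] (phi k).

Lemma phi_H2 k : H2 D (phi k) (dphi k) (ddphi k).
Proof. by apply: sobolevH_H2 => //; exact: eig_H2 heig k. Qed.

Lemma phi_H10 k : H10 D (phi k) (dphi k).
Proof. by apply: sobolevH10_H10 => //; exact: eig_H10 heig k. Qed.

Lemma phi_L2 k : L2 D (phi k). Proof. by have [[]] := phi_H2 k. Qed.

Lemma phi_lap k : \forall x \ae mu, D x -> lap (ddphi k) x = - (lam k * phi k x).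
Proof.
apply: filterS2 (laplacian_ae oD bD (phi_H2 k)) (eig_eqn heig k) => x e1 e2 Dx.
by rewrite -e2// opprK e1.
Qed.

Definition cf f k := dotL2 D f (phi k).

Lemma cfD f g k : L2 D f -> L2 D g -> cf (fun x => f x + g x) k = cf f k + cf g k.
Proof. by move=> Lf Lg; rewrite /cf dotDl//; exact: phi_L2. Qed.

Lemma cfB f g k : L2 D f -> L2 D g -> cf (fun x => f x - g x) k = cf f k - cf g k.
Proof. by move=> Lf Lg; rewrite /cf dotBl//; exact: phi_L2. Qed.

Lemma cfZ (t : R) f k : L2 D f -> cf (fun x => t * f x) k = t * cf f k.
Proof. by move=> Lf; rewrite /cf dotZl//; exact: phi_L2. Qed.

Lemma cfN f k : L2 D f -> cf (fun x => - f x) k = - cf f k.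
Proof. by move=> Lf; rewrite /cf dotNl//; exact: phi_L2. Qed.

Lemma cf_ae f g k : L2 D f -> L2 D g -> (\forall x \ae mu, D x -> f x = g x) -> cf f k = cf g k.
Proof.
move=> Lf Lg fg; have Lp := phi_L2 k; apply: (dot_ae mD Lf Lp Lg Lp) => //; exact: aeW.
Qed.

Lemma cf_phi j k : cf (phi j) k = (j == k)%:R. Proof. exact: eig_orthonormal heig j k. Qed.

Lemma green u du ddu v dv ddv : H2 D u du ddu -> H10 D u du -> H2 D v dv ddv -> H10 D v dv ->
  dotL2 D (lap ddu) v = dotL2 D u (lap ddv).
Proof.
move=> H2u H10u H2v H10v; have [[Lu _ _] Hdu] := H2u; have [[Lv _ _] Hdv] := H2v.
rewrite [RHS]dotC /lap (@dot_suml _ _ _ mD) => [|i|]; [|by have [_ L _] := Hdu i|by []].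
rewrite (@dot_suml _ _ _ mD) => [|i|]; [|by have [_ L _] := Hdv i|by []].
apply: eq_bigr => i _; rewrite dotC (H10_ibp oD i H10v (Hdu i)) [in RHS]dotC (H10_ibp oD i H10u (Hdv i)).
by rewrite dotC.
Qed.

Lemma cf_lap u du ddu k : H2 D u du ddu -> H10 D u du -> cf (lap ddu) k = - (lam k * cf u k).
Proof.
move=> H2u H10u; have [[Lu _ _] _] := H2u; have Lp := phi_L2 k.
rewrite /cf (green H2u H10u (phi_H2 k) (phi_H10 k)).
transitivity (dotL2 D u (fun x => - lam k * phi k x)); last by rewrite dotZr// mulNr.
apply: (dot_ae mD Lu (L2_lap oD (phi_H2 k)) Lu (L2Z mD _ Lp)); first exact: aeW.
by apply: filterS (phi_lap k) => x e Dx; rewrite e// mulNr.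
Qed.

Definition comb b n : rV -> R := fun x => \sum_(k < n) b k * phi k x.

Lemma L2_comb b n : L2 D (comb b n).
Proof. by apply: (L2_sum mD) => k; apply: (L2Z mD); exact: phi_L2. Qed.

Lemma dot_comb b n f : L2 D f -> dotL2 D (comb b n) f = \sum_(k < n) b k * cf f k.
Proof.
move=> Lf; rewrite /comb (@dot_suml _ _ _ mD) => [|k|//]; last exact: L2Z (phi_L2 _).
by apply: eq_bigr => k _; rewrite dotZl ?[dotL2 _ (phi k) f]dotC//; exact: phi_L2.
Qed.

Lemma cf_comb b n k : cf (comb b n) k = if (k < n)%N then b k else 0.
Proof.
rewrite /cf dot_comb; last exact: phi_L2.
under eq_bigr => j _ do rewrite cf_phi.
case: ifPn => [kn|]; last first.
  rewrite -leqNgt => nk; apply: big1 => j _; case: eqVneq => [e|_]; last by rewrite mulr0.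
  by move: (ltn_ord j); rewrite -e ltnNge nk.
rewrite (bigD1 (Ordinal kn))//= eqxx mulr1 big1 ?addr0// => j jk.
case: eqVneq => [e|_]; last by rewrite mulr0.
by move/eqP: jk => []; apply: val_inj.
Qed.

Lemma normL2_comb b n : normL2 D (comb b n) ^+ 2 = \sum_(k < n) b k ^+ 2.
Proof.
rewrite normL2_sqr dot_comb; last exact: L2_comb.
by apply: eq_bigr => k _; rewrite cf_comb ltn_ord expr2.
Qed.

Lemma comb_cvg f : L2 D f -> normL2 D (fun x => comb (cf f) n x - f x) @[n --> \oo] --> (0 : R).
Proof. by move=> /(eig_basis heig); apply: eq_cvgn => n; exact: normL2BC. Qed.

Lemma parseval f g : L2 D f -> L2 D g -> \sum_(k < n) cf f k * cf g k @[n --> \oo] --> dotL2 D f g.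
Proof.
move=> Lf Lg; have := cvg_dotl mD (L2_comb (cf f)) Lf Lg (comb_cvg Lf).
by apply: eq_cvgn => n; rewrite dot_comb.
Qed.

Lemma parseval_le f g f' g' : L2 D f -> L2 D g -> L2 D f' -> L2 D g' ->
  (forall k, cf f k * cf g k <= cf f' k * cf g' k) -> dotL2 D f g <= dotL2 D f' g'.
Proof.
move=> Lf Lg Lf' Lg' H; have c1 := parseval Lf Lg; have c2 := parseval Lf' Lg'.
rewrite -(cvg_lim _ c1)// -(cvg_lim _ c2)//; apply: ler_lim.
- by apply/cvg_ex; eexists; exact: c1.
- by apply/cvg_ex; eexists; exact: c2.
- by apply: nearW => n; apply: ler_sum => k _; exact: H.
Qed.

Lemma coef_ae f g : L2 D f -> L2 D g -> (forall k, cf f k = cf g k) -> \forall x \ae mu, D x -> f x = g x.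
Proof.
move=> Lf Lg H; have LB := L2B mD Lf Lg.
have Z : normL2 D (fun x => f x - g x) = 0.
  apply/eqP; rewrite -sqrf_eq0 normL2_sqr; apply/eqP.
  apply: (cvg_unique _ (parseval LB LB)) => //.
  apply: (eq_cvgn (b := cst 0)) (cvg_cst _) => n.
  by rewrite big1// => k _; rewrite cfB// H subrr mul0r.
by apply: filterS (normL2_eq0 mD LB Z) => x Zx /Zx /eqP; rewrite subr_eq0 => /eqP.
Qed.

Lemma cauchy_of_sqr (F : nat -> rV -> R) (s : nat -> R) (l K : R) : 0 <= K -> s @ \oo --> l ->
  (forall p q, (p <= q)%N -> normL2 D (fun x => F q x - F p x) ^+ 2 <= K * (s q - s p)) -> cauchyL2 D F.
Proof.
move=> K0 sl H e e0.
have d0 : 0 < e ^+ 2 / (K + 1) / 2 by rewrite !divr_gt0 ?exprn_gt0// ltr_wpDl.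
have /cvgrPdist_lt /(_ _ d0)[N _ HN] := sl.
have key p q : (N <= p)%N -> (p <= q)%N -> normL2 D (fun x => F q x - F p x) <= e.
  move=> Np pq; rewrite -ler_sqr ?nnegrE ?normL2_ge0 ?(ltW e0)//; apply: le_trans (H p q pq) _.
  have Nq := leq_trans Np pq; have := HN p Np; have := HN q Nq => /=.
  set d := _ / 2 in d0 HN *; rewrite !ltr_norml => /andP[? ?] /andP[? ?].
  have sd : s q - s p <= d + d by lra.
  apply: (@le_trans _ _ (K * (d + d))); first by rewrite ler_wpM2l.
  rewrite /d -splitr mulrCA -[leRHS]mulr1 ler_wpM2l ?sqr_ge0// ler_pdivrMr ?mul1r ?lerDl// ltr_wpDl//.
exists N => p q Np Nq; have [pq|/ltnW pq] := leqP p q; last exact: key.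
by rewrite normL2BC; exact: key.
Qed.

Lemma sqr_arith (C x A B T : R) : 0 <= C -> 0 <= x -> 0 <= A -> 0 <= B -> x <= C * (A + B) ->
  B ^+ 2 <= T -> A ^+ 2 <= T -> x ^+ 2 <= C ^+ 2 * 4 * T.
Proof.
move=> C0 x0 A0 B0 Hx HB HA; apply: (@le_trans _ _ ((C * (A + B)) ^+ 2)).
  by rewrite ler_sqr ?nnegrE ?mulr_ge0 ?addr_ge0.
rewrite exprMn -mulrA ler_wpM2l ?sqr_ge0//; have := sqr_ge0 (A - B).
by move: HA HB; rewrite !expr2; nra.
Qed.

(** The source of all H^2 functions below. The bounds on [a k] and [lam k * a k] make the partial
    sums and their Laplacians Cauchy in L^2; [grad_le] and [h2_estimate] extend this to all first
    and second derivatives. *)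
Lemma exists_multiplier a (M : R) f : L2 D f -> (forall k, `|a k| <= M) -> (forall k, `|lam k * a k| <= M) ->
  exists u du ddu, [/\ H2 D u du ddu, H10 D u du & forall k, cf u k = a k * cf f k].
Proof.
move=> Lf aM laM; have [C C0 HC] := h2_estimate oD bD dens m0 sbD.
have M0 : 0 <= M := le_trans (normr_ge0 _) (aM 0%N).
pose b k := a k * cf f k.
(* Coefficients cut off below [p], so that a difference of partial sums is again a partial sum, to
   which the estimates for H^2 functions apply. *)
pose bb p k := if (p <= k)%N then b k else 0.
pose cu (b : nat -> R) n : rV -> R := comb b n.
pose cdu (b : nat -> R) n i x := \sum_(k < n) b k * dphi k i x.
pose cddu (b : nat -> R) n i j x := \sum_(k < n) b k * ddphi k i j x.
have cH2 b' n : H2 D (cu b' n) (cdu b' n) (cddu b' n).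
  by apply: (H2_sum oD bD) => k; apply: (H2Z oD); exact: phi_H2.
have cH10 b' n : H10 D (cu b' n) (cdu b' n).
  by apply: (H10_sum oD bD) => k; apply: (H10Z oD bD); exact: phi_H10.
have clap b' n : \forall x \ae mu, D x -> lap (cddu b' n) x = comb (fun k => - (lam k * b' k)) n x.
  apply: (coef_ae (L2_lap oD (cH2 b' n)) (L2_comb _ _)) => k.
  by rewrite (cf_lap _ (cH2 b' n) (cH10 b' n)) !cf_comb; case: ifP; rewrite ?mulr0 ?oppr0.
pose s n := \sum_(k < n) cf f k ^+ 2.
have sl : s @ \oo --> dotL2 D f f.
  by apply: eq_cvgn (parseval Lf Lf) => n; apply: eq_bigr => k _; rewrite expr2.
have sub p q (F : nat -> R) : (p <= q)%N ->
    \sum_(k < q) (if (p <= k)%N then F k else 0) = \sum_(k < q) F k - \sum_(k < p) F k.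
  move=> pq; apply/eqP; rewrite -subr_eq opprK; apply/eqP.
  rewrite (big_ord_widen q F pq) [X in _ + X]big_mkcond -big_split /=; apply: eq_bigr => k _.
  by rewrite ltnNge; case: leqP => _ /=; rewrite ?addr0 ?add0r.
have tail (b' : nat -> R) p q : (forall k, `|b' k| <= M * `|cf f k|) -> (p <= q)%N ->
    normL2 D (comb (fun k => if (p <= k)%N then b' k else 0) q) ^+ 2 <= M ^+ 2 * (s q - s p).
  move=> Hb pq; rewrite normL2_comb -(sub p q (fun k => cf f k ^+ 2) pq) mulr_sumr; apply: ler_sum => k _.
  case: ifP => _; last by rewrite expr0n /= mulr0.
  by rewrite -exprMn -real_normK ?num_real// -[leRHS]real_normK ?num_real// ler_sqr ?nnegrE// normrM (ger0_norm M0).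
have bM k : `|b k| <= M * `|cf f k| by rewrite normrM ler_wpM2r.
have lbM k : `|- (lam k * b k)| <= M * `|cf f k| by rewrite normrN mulrA normrM ler_wpM2r.
have T1 p q : (p <= q)%N -> normL2 D (cu (bb p) q) ^+ 2 <= M ^+ 2 * (s q - s p) by exact: tail.
have T2 p q : (p <= q)%N -> normL2 D (lap (cddu (bb p) q)) ^+ 2 <= M ^+ 2 * (s q - s p).
  move=> pq; rewrite (normL2_ae mD (L2_lap oD (cH2 _ q)) (L2_comb _ _) (clap (bb p) q)).
  rewrite (_ : comb _ q = comb (fun k => if (p <= k)%N then - (lam k * b k) else 0) q); first exact: tail.
  by congr comb; apply/funext => k; rewrite /bb; case: ifP; rewrite ?mulr0 ?oppr0.
have T3 p q (C' x : R) : (p <= q)%N -> 0 <= C' -> 0 <= x -> x <= C' * (normL2 D (cu (bb p) q) + normL2 D (lap (cddu (bb p) q))) ->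
    x ^+ 2 <= (C' ^+ 2 * 4 * M ^+ 2) * (s q - s p).
  move=> pq C'0 x0 Hx; have := T1 p q pq; have := T2 p q pq.
  by move=> B2 A2; rewrite -(mulrA _ (M ^+ 2)); exact: (sqr_arith C'0 x0 (normL2_ge0 _ _) (normL2_ge0 _ _) Hx B2 A2).
have Ediff (P : nat -> rV -> R) p q : (p <= q)%N ->
    (fun x => \sum_(k < q) b k * P k x - \sum_(k < p) b k * P k x) = (fun x => \sum_(k < q) bb p k * P k x).
  move=> pq; apply/funext => x; rewrite -(sub p q (fun k => b k * P k x) pq).
  by apply: eq_bigr => k _; rewrite /bb; case: ifP; rewrite ?mul0r.
have C1 : cauchyL2 D (cu b).
  apply: (@cauchy_of_sqr _ s _ (M ^+ 2) (sqr_ge0 _) sl) => p q pq.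
  by rewrite /cu /comb (Ediff phi p q pq); exact: T1.
have C2 i : cauchyL2 D (fun n => cdu b n i).
  apply: (@cauchy_of_sqr _ s _ (1 ^+ 2 * 4 * M ^+ 2) _ sl) => [|p q pq]; first by rewrite !mulr_ge0 ?sqr_ge0.
  rewrite /cdu (Ediff (fun k => dphi k i) p q pq); apply: (T3 _ _ _ _ pq) => //; first exact: normL2_ge0.
  by rewrite mul1r; exact: (grad_le oD i (cH2 _ _) (cH10 _ _)).
have C3 i j : cauchyL2 D (fun n => cddu b n i j).
  apply: (@cauchy_of_sqr _ s _ (C ^+ 2 * 4 * M ^+ 2) _ sl) => [|p q pq]; first by rewrite !mulr_ge0 ?sqr_ge0.
  rewrite /cddu (Ediff (fun k => ddphi k i j) p q pq); apply: (T3 _ _ _ _ pq C0); first exact: normL2_ge0.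
  exact: (HC _ _ _ (cH2 _ _) (cH10 _ _)).
have Lcu n : L2 D (cu b n) by have [[]] := cH2 b n.
have Lcdu n i : L2 D (cdu b n i) by have [[]] := cH2 b n.
have Lcddu n i j : L2 D (cddu b n i j) by have [_ /(_ i)[]] := cH2 b n.
have [u Lu cvu] := L2_complete mD Lcu C1.
have /choice[du Hdu] i : exists v, L2 D v /\ normL2 D (fun x => cdu b n i x - v x) @[n --> \oo] --> (0 : R).
  by have [v ? ?] := L2_complete mD (fun n => Lcdu n i) (C2 i); exists v.
have /choice[ddu Hddu] (ij : 'I_m * 'I_m) : exists v, L2 D v /\
    normL2 D (fun x => cddu b n ij.1 ij.2 x - v x) @[n --> \oo] --> (0 : R).
  by have [v ? ?] := L2_complete mD (fun n => Lcddu n ij.1 ij.2) (C3 ij.1 ij.2); exists v.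
exists u, du, (fun i j => ddu (i, j)); split.
- split => [|i].
    apply: (H1_lim oD (u_ := cu b) (du_ := cdu b)) => // [n|i|i]; [by have [] := cH2 b n|by have [] := Hdu i|by have [] := Hdu i].
  apply: (H1_lim oD (u_ := fun n => cdu b n i) (du_ := fun n => cddu b n i)) => [n||j||j].
  + by have [_] := cH2 b n.
  + by have [] := Hdu i.
  + by have [] := Hddu (i, j).
  + by have [] := Hdu i.
  + by have [] := Hddu (i, j).
- by apply: (H10_lim oD bD (cH10 b)) => // i; have [] := Hdu i.
- move=> k; apply: (cvg_unique _ (cvg_dotl mD Lcu Lu (phi_L2 k) cvu)) => //.
  apply/cvgrPdist_le => e e0; exists k.+1 => // n /= kn.
  by have := cf_comb b n k; rewrite /cf kn => ->; rewrite subrr normr0 ltW.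
Qed.

End spectral.

(** * The semilinear equation at a fixed xi *)

Section real_lemmas.
Context {R : realType}.

(** Only [b] is confined to the compact interval; [a] is any real close to it, as needed when one of
    two functions is unbounded. *)
Lemma compact_unif_cont (g : R -> R) (K e : R) : continuous g -> 0 < e ->
  exists2 d : R, 0 < d & forall a b, `|b| <= K -> `|a - b| < d -> `|g a - g b| < e.
Proof.
move=> cg e0; have cK : compact `[- K, K]%classic by exact: segment_compact.
move/compact_near_coveringP: cK => cK.
have H0 := cK R (nbhs (0 : R)) (fun w b => `|g (b + w) - g b| < e) _.
have : \forall w \near nbhs (0 : R), `[- K, K]%classic `<=` (fun b => `|g (b + w) - g b| < e).
  apply: H0 => b _.
  have e2 : 0 < e / 2 by rewrite divr_gt0.
  have /cvgrPdist_lt /(_ _ e2) /nbhs_ballP[r /= r0 Hr] := cg b.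
  have r2 : 0 < r / 2 by rewrite divr_gt0.
  exists (ball b (r / 2), ball (0 : R) (r / 2)); first by split; exact: nbhsx_ballx.
  move=> [c w] [/= bc w0].
  have H1 : `|g b - g c| < e / 2 by apply: Hr; apply: lt_le_trans bc _; rewrite ler_pdivrMr// ler_pMr// ler1n.
  have H2 : `|g b - g (c + w)| < e / 2.
    apply: Hr; rewrite /ball /= opprD addrA (splitr r) (le_lt_trans (ler_normB _ _))//.
    by rewrite ltrD//; move: w0; rewrite /ball /= sub0r normrN.
  rewrite (splitr e) -[X in `|X|](subrKA (g b)) (le_lt_trans (ler_normD _ _))// ltrD//.
  by rewrite distrC.
move=> /nbhs_ballP[d /= d0 Hd]; exists d => // a b bK ab.
have := Hd (a - b) _ b; rewrite subrKC; apply; first by rewrite /ball /= sub0r normrN.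
by rewrite /= in_itv /= -ler_norml.
Qed.

(** * Resolvent and Yosida approximation of a monotone function *)

Section yosida.
Variables (h : R -> R) (gamma : R).
Hypotheses (ch : continuous h) (h0 : h 0 = 0) (hm : forall a b, a <= b -> h a <= h b)
  (hb : forall t, `|h t| <= gamma * `|t|).

Lemma mono_prod a b : 0 <= (h a - h b) * (a - b).
Proof.
have [ab|/ltW ba] := leP a b; last by rewrite mulr_ge0// subr_ge0// hm.
by rewrite mulr_le0// subr_le0// hm.
Qed.

Lemma mono_sgn t : 0 <= t * h t.
Proof. by have := mono_prod t 0; rewrite h0 !subr0 mulrC. Qed.

Lemma resolvent_exists eps y : 0 < eps -> exists t, t + eps * h t = y.
Proof.
move=> e0; have cf : continuous (fun t => t + eps * h t).
  by move=> t; apply: cvgD; [exact: cvg_id|apply: cvgMr; exact: ch].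
have hp : 0 <= h `|y| by rewrite -h0 hm.
have hn : h (- `|y|) <= 0 by rewrite -h0 hm// oppr_le0.
have [|||t _ <-] := @IVT R (fun t => t + eps * h t) (- `|y|) `|y| y; last by exists t.
- by rewrite ge0_cp.
- exact: continuous_subspaceT.
have [y1 y2] : - `|y| <= y /\ y <= `|y| by apply/andP; rewrite -ler_norml.
have A : - `|y| + eps * h (- `|y|) <= y by have := mulr_ge0_le0 (ltW e0) hn; lra.
have B : y <= `|y| + eps * h `|y| by have := mulr_ge0 (ltW e0) hp; lra.
by rewrite ge_min le_max A B orbT.
Qed.

(** The resolvent [J = (1 + eps h)^-1]; the Yosida approximation [h o J] equals [(y - J y) / eps] by
    [resolventE]. *)
Definition resolvent eps y := xget 0 [set t | t + eps * h t = y].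
Definition yosida eps y := h (resolvent eps y).

Variables (eps : R) (eps0 : 0 < eps).
Local Notation J := (resolvent eps).
Local Notation Y := (yosida eps).

Lemma resolventE y : J y + eps * Y y = y.
Proof. exact: (xgetPex 0 (resolvent_exists y eps0)). Qed.

Lemma yosida_mono a b : 0 <= (Y a - Y b) * (J a - J b). Proof. exact: mono_prod. Qed.

Lemma yosida_mono_id a b : 0 <= (Y a - Y b) * (a - b).
Proof.
have := yosida_mono a b; have := mulr_ge0 (ltW eps0) (sqr_ge0 (Y a - Y b)).
move: (resolventE a) (resolventE b); move: (Y a) (Y b) (J a) (J b) => p q r s <- <-; nra.
Qed.

Lemma yosida_le y : `|Y y| <= gamma * `|y|.
Proof.
have g0 : 0 <= gamma by have := le_trans (normr_ge0 _) (hb 1); rewrite normr1 mulr1.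
apply: le_trans (hb _) _; rewrite ler_wpM2l// -ler_sqr ?nnegrE// !real_normK ?num_real//.
rewrite -{2}(resolventE y) sqrrD; have := mono_sgn (J y); rewrite -/(Y y) => H.
have H1 := mulr_ge0 (ltW eps0) H; have H2 := sqr_ge0 (eps * Y y).
move: H1 H2; rewrite mulrCA; move: (J y * (eps * Y y)) (J y ^+ 2) (_ ^+ 2) => a b c; lra.
Qed.

(** The slopes of [Y] lie between 0 and [1 / eps]. Subtracting the middle slope [1 / (2 eps)] leaves
    the Lipschitz constant [1 / (2 eps)], small enough for the map in [lipschitz_sol] to
    contract. *)
Lemma yosida_lip a b : `|(Y a - (2 * eps)^-1 * a) - (Y b - (2 * eps)^-1 * b)| <= (2 * eps)^-1 * `|a - b|.
Proof.
have e2 : 0 < 2 * eps by rewrite mulr_gt0.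
have ei : 0 <= (2 * eps)^-1 by rewrite invr_ge0 ltW.
rewrite -[leLHS](@mulKf _ (2 * eps)) ?gt_eqF// (ler_wpM2l ei)//.
rewrite -{1}(gtr0_norm e2) -normrM.
have M := mulr_ge0 (ltW eps0) (yosida_mono a b); rewrite mulrA in M.
move: (resolventE a) (resolventE b) M; move: (Y a) (Y b) (J a) (J b) => p q r s <- <- M.
rewrite (_ : 2 * eps * _ = eps * (p - q) - (r - s)); last by field; exact: lt0r_neq0.
rewrite (_ : r + _ - _ = eps * (p - q) + (r - s)); last by ring.
move: M; move: (eps * (p - q)) (r - s) => x y M.
by rewrite -ler_sqr ?nnegrE// !real_normK ?num_real// !expr2; nra.
Qed.

Lemma yosida_cont : continuous Y.
Proof.
move=> a; apply/cvgrPdist_le => e e0; have e2 : 0 < 2 * eps by rewrite mulr_gt0.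
have d0 : 0 < e * eps by rewrite mulr_gt0.
apply/nbhs_ballP; exists (e * eps) => //= b ab.
have L := yosida_lip a b.
have : `|Y a - Y b| <= (2 * eps)^-1 * `|a - b| + (2 * eps)^-1 * `|a - b|.
  rewrite (_ : Y a - Y b = ((Y a - (2 * eps)^-1 * a) - (Y b - (2 * eps)^-1 * b)) + (2 * eps)^-1 * (a - b)); last by ring.
  apply: le_trans (ler_normD _ _) _; rewrite lerD//.
  by rewrite normrM gtr0_norm// invr_gt0.
move=> /le_trans; apply; move: ab => /ltW; move: `|_ - b| => X HX.
rewrite (_ : _ + _ = X / eps); last by field; exact: lt0r_neq0.
by rewrite ler_pdivrMr.
Qed.

(* Makes the Yosida approximations a Cauchy sequence as [eps, eps' -> 0]. *)
Lemma yosida_cross eps' a b : 0 < eps' ->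
  - ((Y a - yosida eps' b) * (a - b)) <= 2 * (eps + eps') * (Y a ^+ 2 + yosida eps' b ^+ 2).
Proof.
move=> e'0; have E : b = resolvent eps' b + eps' * yosida eps' b.
  exact/esym/(xgetPex 0 (resolvent_exists b e'0)).
have M : 0 <= (Y a - yosida eps' b) * (J a - resolvent eps' b) by exact: mono_prod.
move: E (resolventE a) M.
move: (Y a) (yosida eps' b) (J a) (resolvent eps' b) => p q r s -> <-.
have := mulr_ge0 (ltW eps0) (sqr_ge0 p); have := mulr_ge0 (ltW eps0) (sqr_ge0 q).
have := mulr_ge0 (ltW e'0) (sqr_ge0 p); have := mulr_ge0 (ltW e'0) (sqr_ge0 q).
have := mulr_ge0 (ltW eps0) (sqr_ge0 (p - q)); have := mulr_ge0 (ltW e'0) (sqr_ge0 (p - q)).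
have := mulr_ge0 (ltW eps0) (sqr_ge0 (p + q)); have := mulr_ge0 (ltW e'0) (sqr_ge0 (p + q)).
rewrite !expr2; nra.
Qed.

End yosida.
End real_lemmas.

(** * Superposition operators on L^2 *)

Section superposition.
Context {R : realType} {m : nat}.
Local Notation mu := (lebesgue_rV R m).
Local Notation rV := 'rV[R]_m.
Local Notation nrm := normL2.
Implicit Types (u v w : rV -> R).
Variables (D : set rV) (mD : measurable D) (fD : (mu D < +oo)%E).

Lemma L2_comp (g : R -> R) (K : R) u : continuous g -> (forall t, `|g t| <= K * `|t|) -> L2 D u ->
  L2 D (fun x => g (u x)) /\ normL2 D (fun x => g (u x)) <= K * normL2 D u.
Proof.
move=> cg gK Lu; have K0 : 0 <= K by have := le_trans (normr_ge0 _) (gK 1); rewrite normr1 mulr1.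
have mg : measurable_fun D (fun x => g (u x)).
  by apply: (measurableT_comp (f := g)); [exact: continuous_measurable_fun|exact: L2_meas].
have le x : `|g (u x)| <= `|K * u x| by rewrite normrM (ger0_norm K0).
have L : L2 D (fun x => g (u x)) by apply: (L2_le mD mg (g := fun x => K * u x)) => //; exact: L2Z.
split => //; rewrite -[X in X * _](ger0_norm K0) -normL2Z//; apply: normL2_le => //; first exact: L2Z.
exact: aeW.
Qed.

Lemma tail_meas w (K : R) : measurable_fun D w -> measurable_fun D (fun x => if `|w x| <= K then 0 else w x ^+ 2).
Proof.
move=> mw; apply: (measurableT_comp (f := fun t : R => if `|t| <= K then 0 else t ^+ 2)) => //.
apply: measurable_fun_ifT => //.
apply: measurable_fun_ler => //; exact: normr_measurable.
Qed.

Lemma L2_tail w (e : R) : L2 D w -> 0 < e -> exists2 K : R, 0 < K &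
  (\int[mu]_(x in D) (if `|w x| <= K then 0 else w x ^+ 2))%R <= e.
Proof.
move=> Lw e0.
have mw := L2_meas Lw.
have mf n := tail_meas n%:R mw.
have C1 : \forall x \ae mu, D x -> (fun n x => if `|w x| <= n%:R :> R then 0 else w x ^+ 2) ^~ x @ \oo --> (0 : R).
  apply: aeW => x _; apply/cvgrPdist_le => d d0; near=> n.
  rewrite ifT; first by rewrite subrr normr0 ltW.
  near: n; exact: nbhs_infty_ger.
have C2 : \forall x \ae mu, forall n, D x -> `|if `|w x| <= n%:R :> R then 0 else w x ^+ 2| <= w x ^+ 2.
  by apply: aeW => x n _; case: ifP => _; [rewrite normr0 sqr_ge0|rewrite ger0_norm ?sqr_ge0].
have mz : measurable_fun D (cst 0 : rV -> R) by exact: measurable_cst.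
have [_] := @dct _ _ _ mD _ _ _ mf mz (L2_itg2 Lw) C1 C2.
rewrite [X in _ --> X](_ : _ = 0); last by rewrite /Rintegral integral0.
move=> /cvgrPdist_le /(_ e e0)[N _ HN]; exists N.+1%:R; first by rewrite ltr0n.
have /= := HN N.+1 (leqnSn _); rewrite sub0r normrN; apply: le_trans; exact: ler_norm.
Unshelve. all: by end_near. Qed.

Lemma frac_le (C x A : R) : 0 <= C -> 0 <= A -> x <= A / (C + 1) -> C * x <= A.
Proof.
move=> C0 A0; rewrite ler_pdivlMr ?ltr_wpDl// => H.
have [x0|/ltW x0] := leP 0 x; first by apply: le_trans H; rewrite mulrC ler_wpM2l// lerDl.
by apply: le_trans A0; rewrite mulr_ge0_le0.
Qed.

(** Three regimes: [b] bounded and [a] close to it, where [om] is the modulus of continuity; [b]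
    bounded and [|a - b| >= d], where [|b| <= K / d * |a - b|]; and [b] large, which is charged to
    the tail of [b ^+ 2]. *)
Lemma superposition_pt (g : R -> R) (gamma K d om a b : R) : 0 <= gamma -> 0 < d -> 0 <= K -> 0 <= om <= 1 ->
  (forall t, `|g t| <= gamma * `|t|) -> (`|b| <= K -> `|a - b| < d -> `|g a - g b| < om) ->
  (g a - g b) ^+ 2 <= om + (2 * gamma ^+ 2 + gamma ^+ 2 * (1 + 2 * K / d) ^+ 2) * (a - b) ^+ 2 +
    8 * gamma ^+ 2 * (if `|b| <= K then 0 else b ^+ 2).
Proof.
move=> g0 d0 K0 /andP[om0 om1] gK H.
have Y : `|g a - g b| <= gamma * (`|a - b| + 2 * `|b|).
  apply: le_trans (ler_normB _ _) _; apply: le_trans (lerD (gK a) (gK b)) _.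
  rewrite -mulrDr ler_wpM2l//; have := ler_normD (a - b) b; rewrite subrK; lra.
have P0 : 0 <= gamma ^+ 2 * (1 + 2 * K / d) ^+ 2 by rewrite mulr_ge0 ?sqr_ge0.
have P1 : 0 <= 2 * gamma ^+ 2 by rewrite mulr_ge0 ?sqr_ge0.
have P2 := mulr_ge0 P0 (sqr_ge0 (a - b)); have P3 := mulr_ge0 P1 (sqr_ge0 (a - b)).
have sq (x y : R) : 0 <= y -> `|x| <= y -> x ^+ 2 <= y ^+ 2.
  by move=> y0 xy; rewrite -real_normK ?num_real// ler_sqr ?nnegrE.
case: ifPn => [bK|_].
  rewrite mulr0 addr0 mulrDl; have [abd|abd] := ltP `|a - b| d.
    have L := H bK abd; have : (g a - g b) ^+ 2 <= om.
      apply: le_trans (sq _ _ om0 (ltW L)) _; by rewrite expr2 ler_piMr.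
    by move: P2 P3; move: ((g a - g b) ^+ 2) (_ * _ ^+ 2) (_ * _ ^+ 2) => *; lra.
  have L : `|g a - g b| <= gamma * (1 + 2 * K / d) * `|a - b|.
    apply: le_trans Y _.
    rewrite (_ : _ * `|a - b| = gamma * (`|a - b| + 2 * (K / d * `|a - b|))); last by ring.
    rewrite ler_wpM2l// lerD2l ler_wpM2l// (le_trans bK)//.
    by rewrite -[leLHS]mulr1 -mulrA ler_wpM2l// mulrC ler_pdivlMr// mul1r.
  have c0 : 0 <= gamma * (1 + 2 * K / d) by rewrite mulr_ge0// addr_ge0// divr_ge0 ?mulr_ge0// ltW.
  have := sq _ _ (mulr_ge0 c0 (normr_ge0 _)) L; rewrite !exprMn (real_normK (num_real _)).
  by move: P3 om0; move: ((g a - g b) ^+ 2) (_ * _ ^+ 2) (_ * _ ^+ 2) => *; lra.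
have := sq _ _ (mulr_ge0 g0 (addr_ge0 (normr_ge0 _) (mulr_ge0 (ler0n _ 2) (normr_ge0 _)))) Y.
rewrite exprMn => L; apply: le_trans L _.
have : (`|a - b| + 2 * `|b|) ^+ 2 <= 2 * (a - b) ^+ 2 + 8 * b ^+ 2.
  rewrite -(real_normK (num_real (a - b))) -(real_normK (num_real b)).
  have := sqr_ge0 (`|a - b| - 2 * `|b|); move: `|a - b| `|b| => p q; rewrite !expr2; nra.
move=> /(ler_wpM2l (sqr_ge0 gamma)) L; apply: le_trans L _.
move: P2 om0; move: (gamma ^+ 2) ((1 + _) ^+ 2) ((a - b) ^+ 2) (b ^+ 2) => A B C E; nra.
Qed.

(** The truncation level [K], then the modulus [om] with its [d], then the final radius are chosen
    in this order, each making one of the three terms of [superposition_pt] at most a third of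
    [e ^+ 2]. *)
Lemma nemytskii (g : R -> R) (gamma : R) w (e : R) : continuous g -> (forall t, `|g t| <= gamma * `|t|) ->
  L2 D w -> 0 < e -> exists2 d : R, 0 < d & forall v, L2 D v -> normL2 D (fun x => v x - w x) <= d ->
  normL2 D (fun x => g (v x) - g (w x)) <= e.
Proof.
move=> cg gK Lw e0.
have g0 : 0 <= gamma by have := le_trans (normr_ge0 _) (gK 1); rewrite normr1 mulr1.
pose M := fine (mu D); have M0 : 0 <= M by rewrite fine_ge0.
have p1 : 0 < e ^+ 2 / 3 / (8 * gamma ^+ 2 + 1).
  by rewrite !divr_gt0 ?exprn_gt0// ltr_wpDl// mulr_ge0 ?sqr_ge0.
have [K K0 HK] := L2_tail Lw p1.
(* The minimum with 1 gives [om ^+ 2 <= om]; in [p3] it does the same for the norm of [v - w]. *)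
have p2 : 0 < Num.min 1 (e ^+ 2 / 3 / (M + 1)).
  by rewrite lt_min ltr01 /= !divr_gt0 ?exprn_gt0// ltr_wpDl.
have [d d0 Hd] := compact_unif_cont K cg p2.
set om := Num.min _ _ in p2 Hd.
pose C := 2 * gamma ^+ 2 + gamma ^+ 2 * (1 + 2 * K / d) ^+ 2.
have C0 : 0 <= C by apply: addr_ge0; apply: mulr_ge0 => //; exact: sqr_ge0.
have p3 : 0 < Num.min 1 (e ^+ 2 / 3 / (C + 1)).
  by rewrite lt_min ltr01 /= !divr_gt0 ?exprn_gt0// ltr_wpDl.
exists (Num.min 1 (e ^+ 2 / 3 / (C + 1))) => // v Lv Hv.
pose T x := if `|w x| <= K then 0 else w x ^+ 2.
have pt x : (g (v x) - g (w x)) ^+ 2 <= om + C * (v x - w x) ^+ 2 + 8 * gamma ^+ 2 * T x.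
  apply: (superposition_pt g0 d0 (ltW K0) _ gK (Hd (v x) (w x))).
  by rewrite (ltW p2) /= /om ge_min lexx.
have IT : itg D T.
  apply: (itg_le mD (tail_meas K (L2_meas Lw)) _ (L2_itg2 Lw)) => x _.
  by rewrite /T; case: ifP => _; [rewrite normr0 sqr_ge0|rewrite ger0_norm ?sqr_ge0].
have [Lgv _] := L2_comp cg gK Lv; have [Lgw _] := L2_comp cg gK Lw.
have Ld := L2B mD Lv Lw.
have Iom : itg D (cst om) by apply: (itg_bounded mD fD (M := `|om|)).
have IC := itgZ mD C (L2_itg2 Ld); have ITT := itgZ mD (8 * gamma ^+ 2) IT.
have IomC := itgD mD Iom IC.
have H1 : nrm D (fun x => g (v x) - g (w x)) ^+ 2 <= om * M + C * nrm D (fun x => v x - w x) ^+ 2 +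
    8 * gamma ^+ 2 * (\int[mu]_(x in D) T x)%R.
  have -> : om * M + C * nrm D (fun x => v x - w x) ^+ 2 + 8 * gamma ^+ 2 * (\int[mu]_(x in D) T x)%R =
      (\int[mu]_(x in D) (om + C * (v x - w x) ^+ 2 + 8 * gamma ^+ 2 * T x))%R.
    rewrite (RintegralD mD IomC ITT) (RintegralD mD Iom IC) (RintegralZl _ mD (L2_itg2 Ld)) (RintegralZl _ mD IT).
    by rewrite Rintegral_cst// normL2_sqr.
  rewrite normL2_sqr; apply: (ae_le_intg mD); [exact: L2_itgM (L2B mD Lgv Lgw) (L2B mD Lgv Lgw)|exact: itgD|].
  by apply: aeW => x _; rewrite -expr2.
rewrite -ler_sqr ?nnegrE ?normL2_ge0 ?(ltW e0)//; apply: le_trans H1 _.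
have e3 : 0 <= e ^+ 2 / 3 by rewrite divr_ge0 ?sqr_ge0.
have B1 : om * M <= e ^+ 2 / 3.
  by rewrite mulrC; apply: frac_le => //; rewrite /om ge_min lexx orbT.
have B3 : 8 * gamma ^+ 2 * (\int[mu]_(x in D) T x)%R <= e ^+ 2 / 3.
  by apply: frac_le => //; rewrite mulr_ge0 ?sqr_ge0.
have B2 : C * nrm D (fun x => v x - w x) ^+ 2 <= e ^+ 2 / 3.
  apply: frac_le => //; set q := Num.min _ _ in p3 Hv.
  have q1 : q <= 1 by rewrite /q ge_min lexx.
  have n1 := le_trans Hv q1; have n0 := normL2_ge0 D (fun x => v x - w x).
  apply: (@le_trans _ _ q); last by rewrite /q ge_min lexx orbT.
  by apply: le_trans Hv; rewrite expr2 ler_piMr.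
by move: B1 B2 B3; move: (om * M) (C * _) (8 * _ * _) (e ^+ 2) => *; lra.
Qed.

End superposition.

(** * The equation projected on the orthogonal of the first eigenfunction *)

Section semilinear.
Context {R : realType} {m : nat}.
Local Notation mu := (lebesgue_rV R m).
Local Notation rV := 'rV[R]_m.
Implicit Types (f u v w U V W : rV -> R) (H : R -> R).
Variables (D : set rV) (oD : open D) (bD : bounded_set D) (m0 : (0 < m)%N) (sbD : smooth_boundary D).
Variables (lam : nat -> R) (phi : nat -> rV -> R).
Hypothesis heig : dirichlet_eigensystem D lam phi.
Let mD : measurable D := measurable_open_rV oD.
Let fD : (mu D < +oo)%E := measurable_bounded_rV_lty mD bD.
Local Notation cf := (cf D phi).
Local Notation nrm := (normL2 D).
Local Notation dot := (dotL2 D).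
Let Lp k : L2 D (phi k) := phi_L2 heig k.
Let delta := lam 1%N - lam 0%N.
Variables (e : rV -> R) (Le : L2 D e).
Variables (gamma : R) (g0 : 0 < gamma) (gd : gamma < delta).

Let kap : 0 < delta - gamma. Proof. by rewrite subr_gt0. Qed.

Lemma nrm_phi k : nrm (phi k) = 1.
Proof. by rewrite /normL2 (eig_orthonormal heig) eqxx sqrtr1. Qed.

(** The equation [- Lap U - lam_0 U = F] modulo [phi 0%N], written in coefficients. It makes sense
    for [U] in L^2; membership in H^2 is recovered in [sol_exists]. *)
Definition proj_sol (F U : rV -> R) : Prop := [/\ L2 D U, cf U 0%N = 0 &
  forall k, (0 < k)%N -> (lam k - lam 0%N) * cf U k = cf F k].

Lemma coercive F U : L2 D F -> proj_sol F U -> delta * nrm U ^+ 2 <= dot F U.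
Proof.
move=> LF [LU U0 HU]; rewrite normL2_sqr -(dotZl mD delta LU LU).
apply: (parseval_le oD heig) => //; first exact: L2Z.
move=> [|k]; first by rewrite U0 !mulr0.
rewrite -HU// (cfZ oD heig)// -!mulrA ler_wpM2r -?expr2 ?sqr_ge0// lerB//.
exact: (eig_mono heig (ltn0Sn k)).
Qed.

Let shift U (xi : R) x := U x + xi * phi 0%N x.
Let L2_shift' U xi : L2 D U -> L2 D (shift U xi).
Proof. by move=> LU; apply: L2D => //; exact: L2Z. Qed.

Let rhs H u x := gamma * u x - H (u x) - e x.

(** Shared by [h] and its Yosida approximations, so that the estimates below hold for all of them
    with the same constants. *)
Definition admissible H := [/\ continuous H, (forall t, `|H t| <= gamma * `|t|) &
  forall a b, 0 <= (H a - H b) * (a - b)].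

Lemma L2_rhs H u : admissible H -> L2 D u -> L2 D (rhs H u).
Proof.
move=> [cH bH _] Lu; have [LH _] := L2_comp mD cH bH Lu.
apply: (L2B mD _ Le); exact: L2B (L2Z mD _ Lu) LH.
Qed.

Lemma energy_arith (dl ga a b c d f : R) : dl * c <= ga * c - a + b -> b <= d -> d <= f ->
  (dl - ga) * c <= - a + f.
Proof. by rewrite mulrBl; move: (dl * c) (ga * c) => ? ? *; lra. Qed.

Lemma bound_arith (dl ga n a a' b c d : R) : dl * n <= ga * n - a - b -> a' <= a -> `|b| <= c -> `|a'| <= d ->
  (dl - ga) * n <= d + c.
Proof.
rewrite !ler_norml mulrBl => H1 H2 /andP[H3 _] /andP[H4 _].
by move: H1 H2 H3 H4; move: (dl * n) (ga * n) => ? ? *; lra.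
Qed.

Lemma limit_arith (L a b r r' ga d eps : R) : L * a = r -> r - r' = ga * (a - b) - d ->
  `|a - b| <= eps -> `|d| <= eps -> 0 <= ga -> `|L * b - r'| <= (`|L| + (ga + 1)) * eps.
Proof.
move=> H E H1 H2 ga0; have -> : L * b - r' = - (L * (a - b)) + (ga * (a - b) - d) by rewrite -E -H; ring.
apply: le_trans (ler_normD _ _) _; rewrite mulrDl lerD//.
  by rewrite normrN normrM ler_wpM2l.
apply: le_trans (ler_normB _ _) _; rewrite mulrDl mul1r lerD// normrM (ger0_norm ga0) ler_wpM2l//.
Qed.

(** Coercivity yields [delta], the linear part of the right-hand side costs [gamma], and the
    monotone term is kept with its sign. Testing with [U - U'] instead of [u - u'] produces the term
    in [|xi - xi'|]. Two different [H] serve to compare Yosida approximations, two different [xi] to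
    obtain continuity. *)
Lemma energy_gap H H' U U' xi xi' : admissible H -> admissible H' ->
  proj_sol (rhs H (shift U xi)) U -> proj_sol (rhs H' (shift U' xi')) U' ->
  (delta - gamma) * nrm (fun x => U x - U' x) ^+ 2 <=
    - dot (fun x => H (shift U xi x) - H' (shift U' xi' x)) (fun x => shift U xi x - shift U' xi' x) +
    `|xi - xi'| * nrm (fun x => H (shift U xi x) - H' (shift U' xi' x)).
Proof.
move=> aH aH' S S'; have [LU U0 HU] := S; have [LU' U'0 HU'] := S'.
have Lu := L2_shift' xi LU; have Lu' := L2_shift' xi' LU'.
have LF := L2_rhs aH Lu; have LF' := L2_rhs aH' Lu'.
have [LH _] : L2 D (fun x => H (shift U xi x)) /\ True by case: aH => cH bH _; split => //; case: (L2_comp mD cH bH Lu).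
have [LH' _] : L2 D (fun x => H' (shift U' xi' x)) /\ True by case: aH' => cH bH _; split => //; case: (L2_comp mD cH bH Lu').
pose W x := U x - U' x; pose N x := H (shift U xi x) - H' (shift U' xi' x).
have LW : L2 D W := L2B mD LU LU'; have LN : L2 D N := L2B mD LH LH'.
have S2 : proj_sol (fun x => rhs H (shift U xi) x - rhs H' (shift U' xi') x) W.
  split => //; first by rewrite (cfB oD heig)// U0 U'0 subrr.
  by move=> k k0; rewrite (cfB oD heig k LU LU') (cfB oD heig k LF LF') mulrBr HU// HU'.
have C := coercive (L2B mD LF LF') S2.
have Wphi : dot W (phi 0%N) = 0 by have := cfB oD heig 0 LU LU'; rewrite /cf -/W => ->; rewrite [dotL2 _ U _]U0 [dotL2 _ U' _]U'0 subrr.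
have E : dot (fun x => rhs H (shift U xi) x - rhs H' (shift U' xi') x) W =
    gamma * nrm W ^+ 2 - dot N (fun x => shift U xi x - shift U' xi' x) + (xi - xi') * dot N (phi 0%N).
  have Lgx := L2Z mD (gamma * (xi - xi')) (Lp 0); have LxN := L2Z mD (xi - xi') (Lp 0).
  have LgW := L2Z mD gamma LW.
  transitivity (dot (fun x => gamma * W x + gamma * (xi - xi') * phi 0%N x) W - dot N W).
    rewrite -(dotBl mD _ LN LW); last exact: L2D.
    by apply: eq_dot => // x _; rewrite /rhs /N /W /shift; ring.
  rewrite (dotDl mD LgW Lgx LW) (dotZl mD _ LW LW) (dotZl mD _ (Lp 0) LW) [dot (phi 0%N) W]dotC Wphi mulr0 addr0.
  rewrite -normL2_sqr -addrA; congr (_ + _).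
  have -> : dot N (fun x => shift U xi x - shift U' xi' x) = dot N (fun x => W x + (xi - xi') * phi 0%N x).
    by apply: eq_dot => // x _; rewrite /W /shift; ring.
  by rewrite (dotDr mD LW LxN LN) (dotZr mD _ (Lp 0) LN) opprD subrK.
rewrite E in C; have := dot_CS mD LN (Lp 0); rewrite nrm_phi mulr1 => CS.
have := ler_norm ((xi - xi') * dot N (phi 0%N)); rewrite normrM => B.
have := ler_wpM2l (normr_ge0 (xi - xi')) CS.
exact: (energy_arith C B).
Qed.

(** Tested with [U], monotonicity allows [H(U + xi phi_0)] to be replaced by [H(xi phi_0)], whose
    norm is at most [gamma |xi|]; the bound is the same for every admissible [H]. *)
Lemma sol_bound H U xi : admissible H -> proj_sol (rhs H (shift U xi)) U ->
  (delta - gamma) * nrm U <= gamma * `|xi| + nrm e.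
Proof.
move=> aH S; have [LU U0 HU] := S; have Lu := L2_shift' xi LU; have LF := L2_rhs aH Lu.
have C := coercive LF S.
have [cH bH mH] := aH; have [LH _] := L2_comp mD cH bH Lu.
have Lx := L2Z mD xi (Lp 0); have [LHx NHx] := L2_comp mD cH bH Lx.
have Uphi : dot U (phi 0%N) = 0 by exact: U0.
have E : dot (rhs H (shift U xi)) U = gamma * nrm U ^+ 2 - dot (fun x => H (shift U xi x)) U - dot e U.
  rewrite /rhs (dotBl mD _ Le LU); last exact: L2B (L2Z mD _ Lu) LH.
  rewrite (dotBl mD (L2Z mD _ Lu) LH LU) (dotZl mD _ Lu LU) /shift (dotDl mD LU Lx LU) (dotZl mD _ (Lp 0) LU).
  by rewrite [dot (phi 0%N) U]dotC Uphi mulr0 addr0 normL2_sqr.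
have M : dot (fun x => H (xi * phi 0%N x)) U <= dot (fun x => H (shift U xi x)) U.
  apply: (ae_le_intg mD); [exact: L2_itgM|exact: L2_itgM|].
  apply: aeW => x _; have := mH (shift U xi x) (xi * phi 0%N x).
  by rewrite /shift addrK mulrBl subr_ge0.
have B1 := dot_CS mD LHx LU; have B2 := dot_CS mD Le LU.
rewrite (normL2Z mD _ (Lp 0)) nrm_phi mulr1 in NHx.
have B3 := le_trans B1 (ler_wpM2r (normL2_ge0 D U) NHx).
have [Z|Up] := eqVneq (nrm U) 0; first by rewrite Z mulr0 addr_ge0 ?normL2_ge0// mulr_ge0// ltW.
have {}Up : 0 < nrm U by rewrite lt_def Up normL2_ge0.
rewrite -(ler_pM2r Up) -mulrA -expr2 [leRHS]mulrDl.
by rewrite E in C; exact: (bound_arith C M B2 B3).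
Qed.

Lemma L2_banach (T : (rV -> R) -> rV -> R) (q : R) : 0 <= q < 1 -> (forall v, L2 D v -> L2 D (T v)) ->
  (forall v w, L2 D v -> L2 D w -> nrm (fun x => T v x - T w x) <= q * nrm (fun x => v x - w x)) ->
  exists2 U, L2 D U & \forall x \ae mu, D x -> T U x = U x.
Proof.
move=> /andP[q0 q1] LT HT; pose F n := iter n T (cst 0).
have LF n : L2 D (F n) by elim: n => [|n IH]; [exact: L20|exact: LT].
pose d := nrm (fun x => F 1%N x - F 0%N x).
have step n : nrm (fun x => F n.+1 x - F n x) <= q ^+ n * d.
  elim: n => [|n IH]; first by rewrite expr0 mul1r.
  have H1 : nrm (fun x => F n.+2 x - F n.+1 x) <= q * nrm (fun x => F n.+1 x - F n x) := HT _ _ (LF n.+1) (LF n).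
  by apply: le_trans H1 _; rewrite exprS -mulrA ler_wpM2l.
have iq : 0 < 1 - q by rewrite subr_gt0.
have d0 : 0 <= d by exact: normL2_ge0.
have far p n : nrm (fun x => F (p + n)%N x - F p x) <= q ^+ p * d / (1 - q).
  have : nrm (fun x => F (p + n)%N x - F p x) <= q ^+ p * d * (1 - q ^+ n) / (1 - q).
    elim: n => [|n IH]; first (have base : 0 <= q ^+ p * d * (1 - q ^+ 0) / (1 - q) by rewrite expr0 subrr mulr0 mul0r);
      first by rewrite addn0 (normL2_subrr oD (F p)); exact: base.
    have -> : (fun x => F (p + n.+1)%N x - F p x) = (fun x => (F (p + n).+1 x - F (p + n)%N x) + (F (p + n)%N x - F p x)).
      by apply/funext => x; rewrite addnS subrKA.
    apply: le_trans (normL2_tri mD (L2B mD (LF _) (LF _)) (L2B mD (LF _) (LF _))) _.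
    apply: le_trans (lerD (step _) IH) _.
    rewrite exprD exprS le_eqVlt; apply/orP; left; apply/eqP.
    by move: (q ^+ p) (q ^+ n) => a b; field; rewrite gt_eqF.
  move=> /le_trans; apply; rewrite ler_pM2r ?invr_gt0// ler_piMr ?mulr_ge0 ?exprn_ge0//.
  by rewrite lerBlDr lerDl exprn_ge0.
have cq : (fun n => q ^+ n * d / (1 - q)) @ \oo --> (0 : R).
  rewrite (_ : (fun n => _) = (fun n => q ^+ n * (d / (1 - q)))); last by apply/funext => n; rewrite mulrA.
  by rewrite -[X in _ --> X](mul0r (d / (1 - q))); apply: cvgMl; apply: cvg_expr; rewrite ger0_norm.
have CF : cauchyL2 D F.
  move=> eps eps0; have e2 : 0 < eps / 2 by rewrite divr_gt0.
  have [N HN] := cvg_bound_ex cq e2; exists N => p r Np Nr.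
  have K s : (N <= s)%N -> nrm (fun x => F s x - F N x) <= eps / 2.
    by move=> Ns; rewrite -(subnKC Ns); apply: le_trans (far _ _) HN.
  have -> : (fun x => F p x - F r x) = (fun x => (F p x - F N x) - (F r x - F N x)).
    by apply/funext => x; rewrite opprB addrA subrK.
  rewrite (splitr eps); apply: le_trans (normL2_triB mD (L2B mD (LF _) (LF _)) (L2B mD (LF _) (LF _))) _.
  by rewrite lerD// K.
have [U LU cU] := L2_complete mD LF CF; exists U => //.
have Z : nrm (fun x => T U x - U x) = 0.
  apply/eqP; rewrite eq_le normL2_ge0 andbT; apply/ler_addgt0Pr => eps eps0; rewrite add0r.
  have e2 : 0 < eps / 2 by rewrite divr_gt0.
  have /cvgrPdist_lt /(_ _ e2)[N _ HN] := cU.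
  have nb n : (N <= n)%N -> nrm (fun x => F n x - U x) < eps / 2.
    by move=> /HN /=; rewrite sub0r normrN ger0_norm ?normL2_ge0.
  have b1 := nb N (leqnn N); have b2 := nb N.+1 (leqnSn N).
  have -> : (fun x => T U x - U x) = (fun x => (T U x - F N.+1 x) + (F N.+1 x - U x)).
    by apply/funext => x; rewrite subrKA.
  apply: le_trans (normL2_tri mD (L2B mD (LT _ LU) (LF _)) (L2B mD (LF _) LU)) _.
  rewrite (splitr eps) lerD// ?(ltW b2)//.
  have H1 : nrm (fun x => T U x - F N.+1 x) <= q * nrm (fun x => U x - F N x) := HT _ _ LU (LF N).
  apply: le_trans H1 _; apply: le_trans (ltW b1); rewrite normL2BC ler_piMl ?normL2_ge0 ?ltW//.
have LTU := LT _ LU.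
by apply: filterS (normL2_eq0 mD (L2B mD LTU LU) Z) => x Zx /Zx /eqP; rewrite subr_eq0 => /eqP.
Qed.

Lemma lam_gap k : (0 < k)%N -> delta <= lam k - lam 0%N.
Proof. by move=> k0; rewrite lerB// (eig_mono heig). Qed.

(* K is the inverse of L - gamma + (2 eps)^-1 on the orthogonal of phi_0. *)
Lemma lipschitz_sol H (c xi : R) : 0 < c -> admissible H ->
  (forall a b, `|(H a - c * a) - (H b - c * b)| <= c * `|a - b|) ->
  exists U, proj_sol (rhs H (shift U xi)) U.
Proof.
move=> c0 aH lip; have [cH bH _] := aH.
pose kp := delta - gamma + c; have kp0 : 0 < kp by rewrite addr_gt0.
(* The value 0 at [k = 0] keeps the iterates orthogonal to [phi 0%N]; the other values invert the
   linear part shifted by [c]. *)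
pose a k := if (0 < k)%N then (lam k - lam 0%N - gamma + c)^-1 else 0.
have den k : (0 < k)%N -> kp <= lam k - lam 0%N - gamma + c.
  by move=> k0; rewrite /kp lerD2r lerD2r; exact: lam_gap.
have akp k : `|a k| <= kp^-1.
  rewrite /a; case: ifPn => [k0|_]; last by rewrite normr0 invr_ge0 ltW.
  have d0 := lt_le_trans kp0 (den k k0).
  by rewrite ger0_norm ?invr_ge0 ?(ltW d0)// lef_pV2 ?posrE// den.
pose M := kp^-1 + (1 + `|lam 0%N + gamma - c| / kp).
have aM k : `|a k| <= M.
  by apply: le_trans (akp k) _; rewrite lerDl addr_ge0// divr_ge0// ltW.
have laM k : `|lam k * a k| <= M.
  apply: (@le_trans _ _ (1 + `|lam 0%N + gamma - c| / kp)); last by rewrite lerDr invr_ge0 ltW.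
  have [k0|k0] := boolP (0 < k)%N; last by rewrite /a (negbTE k0) mulr0 normr0 addr_ge0// divr_ge0// ltW.
  have d0 := lt_le_trans kp0 (den k k0).
  rewrite (_ : lam k * a k = 1 + (lam 0%N + gamma - c) * a k); last first.
    by rewrite /a k0; field; rewrite gt_eqF.
  apply: le_trans (ler_normD _ _) _; rewrite normr1 lerD2l normrM ler_wpM2l//.
pose f v x := c * shift v xi x - H (shift v xi x) - e x.
have Lf v : L2 D v -> L2 D (f v).
  move=> Lv; have Lu := L2_shift' xi Lv; have [LH _] := L2_comp mD cH bH Lu.
  exact: (L2B mD (L2B mD (L2Z mD c Lu) LH) Le).
have /choice[T HT] v : exists u, L2 D v -> L2 D u /\ forall k, cf u k = a k * cf (f v) k.
  have [Lv|?] := pselect (L2 D v); last by exists v.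
  have [u [du [ddu [[[Lu _ _] _] _ Hu]]]] := exists_multiplier oD bD m0 sbD heig (Lf v Lv) aM laM.
  by exists u.
have LT v : L2 D v -> L2 D (T v) by move=> /HT[].
have cont v w : L2 D v -> L2 D w -> nrm (fun x => T v x - T w x) <= (c / kp) * nrm (fun x => v x - w x).
  move=> Lv Lw; have [LTv Tv] := HT v Lv; have [LTw Tw] := HT w Lw.
  have LF := L2B mD (Lf v Lv) (Lf w Lw); have LTT := L2B mD LTv LTw.
  have kpi : 0 <= kp^-1 by rewrite invr_ge0 ltW.
  apply: (@le_trans _ _ (kp^-1 * nrm (fun x => f v x - f w x))).
    rewrite -[X in _ <= X * _](ger0_norm kpi) -(normL2Z mD _ LF) -ler_sqr ?nnegrE ?normL2_ge0// !normL2_sqr.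
    have LkF := L2Z mD kp^-1 LF.
    apply: (parseval_le oD heig) => // k; rewrite -!expr2 (cfZ oD heig _ k LF) (cfB oD heig k (Lf v Lv) (Lf w Lw)) (cfB oD heig k LTv LTw) Tv Tw.
    rewrite -mulrBr !exprMn ler_wpM2r ?sqr_ge0// -real_normK ?num_real// ler_sqr ?nnegrE//; exact: akp.
  rewrite mulrC mulrAC ler_wpM2r//.
  rewrite -[X in _ <= X * _](ger0_norm (ltW c0)) -(normL2Z mD c (L2B mD Lv Lw)).
  apply: (normL2_le mD LF); first exact: L2Z (L2B mD Lv Lw).
  apply: aeW => x _; rewrite normrM (gtr0_norm c0).
  have := lip (shift v xi x) (shift w xi x); rewrite -normrN (_ : shift v xi x - shift w xi x = v x - w x); last by rewrite /shift; ring.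
  have -> : f v x - f w x = - (H (shift v xi x) - c * shift v xi x - (H (shift w xi x) - c * shift w xi x)).
    by rewrite /f; ring.
  exact.
have q01 : 0 <= c / kp < 1.
  by rewrite divr_ge0 ?(ltW c0) ?(ltW kp0)//= ltr_pdivrMr// mul1r /kp ltrDr.
have [U LU HU] := L2_banach q01 LT cont.
have [LTU cT] := HT U LU.
have cU k : cf U k = a k * cf (f U) k by rewrite -cT; apply: (cf_ae oD heig) => //; apply: filterS HU => x Hx /Hx.
exists U; split => //; first by rewrite cU /a mul0r.
move=> k k0; have Lu := L2_shift' xi LU; have [LH _] := L2_comp mD cH bH Lu.
have LcH := L2B mD (L2Z mD c Lu) LH; have LgH := L2B mD (L2Z mD gamma Lu) LH.
have cs : cf (shift U xi) k = cf U k.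
  rewrite /shift (cfD oD heig)//; last exact: L2Z (Lp 0).
  by rewrite (cfZ oD heig)// (cf_phi heig) eq_sym (gtn_eqF k0) mulr0 addr0.
have d0 := lt_le_trans kp0 (den k k0).
have E : (lam k - lam 0%N - gamma + c) * cf U k = cf (f U) k.
  by rewrite cU /a k0 mulrA divff ?mul1r// gt_eqF.
have -> : rhs H (shift U xi) = (fun x => f U x + (gamma - c) * shift U xi x).
  by apply/funext => x; rewrite /rhs /f; ring.
rewrite (cfD oD heig k (Lf U LU) (L2Z mD _ Lu)) (cfZ oD heig _ k Lu) cs -E.
by move: (cf U k) => p; ring.
Qed.

Variables (g : R -> R) (cg : continuous g) (gb : forall t, `|g t| <= gamma * `|t|).
Let h t := gamma * t - g t.
Hypotheses (hm : forall a b, a <= b -> h a <= h b) (hb : forall t, `|h t| <= gamma * `|t|).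

Let ch : continuous h.
Proof. by move=> t; apply: cvgB; [apply: cvgMr; exact: cvg_id|exact: cg]. Qed.

Let h0 : h 0 = 0.
Proof. by apply/eqP; rewrite -normr_le0; apply: le_trans (hb 0) _; rewrite normr0 mulr0. Qed.

Lemma admissible_yosida eps : 0 < eps -> admissible (yosida h eps).
Proof.
move=> e0; split; [exact: yosida_cont|exact: yosida_le|exact: yosida_mono_id].
Qed.

Lemma admissible_h : admissible h.
Proof. by split => //; exact: mono_prod. Qed.

(** The solutions for the Yosida approximations are bounded by [sol_bound]. At equal [xi],
    [energy_gap] and [yosida_cross] bound the squared distance of two of them by a multiple of the
    sum of the two parameters, so they form a Cauchy sequence. *)
Lemma proj_sol_exists xi : exists U, proj_sol (rhs h (shift U xi)) U.
Proof.
pose ep n : R := n.+1%:R^-1; have ep0 n : 0 < ep n by rewrite invr_gt0.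
have aY n := admissible_yosida (ep0 n).
have /choice[U HU] n : exists U, proj_sol (rhs (yosida h (ep n)) (shift U xi)) U.
  have c0 : 0 < (2 * ep n)^-1 by rewrite invr_gt0 mulr_gt0.
  apply: (lipschitz_sol _ c0 (aY n)) => a b; exact: yosida_lip.
pose u n := shift (U n) xi; have LU n : L2 D (U n) by have [] := HU n.
have Lu n : L2 D (u n) := L2_shift' xi (LU n).
pose Y n x := yosida h (ep n) (u n x).
have LY n : L2 D (Y n) /\ nrm (Y n) <= gamma * nrm (u n) by have [c b _] := aY n; exact: (L2_comp mD c b (Lu n)).
pose B := (gamma * `|xi| + nrm e) / (delta - gamma) + `|xi|.
have uB n : nrm (u n) <= B.
  apply: le_trans (normL2_tri mD (LU n) (L2Z mD xi (Lp 0))) _.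
  rewrite (normL2Z mD xi (Lp 0)) nrm_phi mulr1 lerD2r ler_pdivlMr// mulrC.
  exact: (sol_bound (aY n) (HU n)).
have YB n : nrm (Y n) <= gamma * B by apply: le_trans (LY n).2 _; rewrite ler_wpM2l// ltW.
have B0 : 0 <= B := le_trans (normL2_ge0 _ _) (uB 0%N).
pose K := 4 * (gamma * B) ^+ 2 / (delta - gamma).
have K0 : 0 <= K by rewrite divr_ge0 ?(ltW kap)// mulr_ge0 ?sqr_ge0.
have gap n p : nrm (fun x => U n x - U p x) ^+ 2 <= K * (ep n + ep p).
  have := energy_gap (aY n) (aY p) (HU n) (HU p).
  rewrite subrr normr0 mul0r addr0 => G.
  rewrite /K mulrAC ler_pdivlMr// mulrC; apply: le_trans G _.
  have [LYn _] := LY n; have [LYp _] := LY p.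
  have Sq q : (\int[mu]_(x in D) (Y q x ^+ 2))%R = nrm (Y q) ^+ 2 := esym (normL2_sqr D (Y q)).
  have IN : itg D (fun x => (Y n x - Y p x) * (u n x - u p x)) := L2_itgM mD (L2B mD LYn LYp) (L2B mD (Lu n) (Lu p)).
  have IP := itgD mD (L2_itg2 LYn) (L2_itg2 LYp).
  have I2 := itgZ mD (2 * (ep n + ep p)) IP.
  apply: (@le_trans _ _ (\int[mu]_(x in D) (2 * (ep n + ep p) * (Y n x ^+ 2 + Y p x ^+ 2)))%R).
    rewrite /dotL2 -(intgN mD IN); apply: (ae_le_intg mD (itgN mD IN) I2); apply: aeW => x _.
    exact: yosida_cross.
  rewrite (RintegralZl _ mD IP) (RintegralD mD (L2_itg2 LYn) (L2_itg2 LYp)) !Sq.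
  have S q : nrm (Y q) ^+ 2 <= (gamma * B) ^+ 2.
    by rewrite ler_sqr ?nnegrE ?normL2_ge0// mulr_ge0// ltW.
  have E2 : 0 <= 2 * (ep n + ep p) by rewrite mulr_ge0// addr_ge0// ltW.
  apply: le_trans (ler_wpM2l E2 (lerD (S n) (S p))) _.
  by rewrite le_eqVlt; apply/orP; left; apply/eqP; ring.
have CU : cauchyL2 D U.
  move=> eps eps0.
  have cep : (fun n => K * (ep n + ep n)) @ \oo --> (0 : R).
    rewrite -[X in _ --> X](mulr0 K); apply: cvgMr; rewrite -[X in _ --> X](addr0 0).
    by apply: cvgD; exact: cvg_harmonic.
  have [N HN] := cvg_bound_ex cep (exprn_gt0 2 eps0).
  exists N => p q Np Nq; rewrite -ler_sqr ?nnegrE ?normL2_ge0 ?(ltW eps0)//.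
  by apply: le_trans (gap p q) _; apply: le_trans HN; rewrite ler_wpM2l// lerD// /ep lef_pV2 ?posrE// ler_nat ltnS.
have [V LV cV] := L2_complete mD LU CU.
exists V; have Lv := L2_shift' xi LV.
have [LhV _] := L2_comp mD ch hb Lv.
have LrV := L2_rhs admissible_h Lv.
(* [Y n] is [h] evaluated at [J = u n - ep n * Y n]. Since the [Y n] are bounded, [J] converges in
   L^2 to the same limit as [u n], and continuity of the superposition operator is needed for the
   fixed function [h] only. *)
have cY : forall eps, 0 < eps -> exists n, nrm (fun x => Y n x - h (shift V xi x)) <= eps /\ nrm (fun x => U n x - V x) <= eps.
  move=> eps eps0.
  have [d d0 Hd] := nemytskii mD fD ch hb Lv eps0.
  have d2 : 0 < d / 2 by rewrite divr_gt0.
  have cs : (fun n => nrm (fun x => U n x - V x) + ep n * (gamma * B)) @ \oo --> (0 : R).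
    rewrite -[X in _ --> X](addr0 0); apply: cvgD => //; rewrite -[X in _ --> X](mul0r (gamma * B)).
    apply: cvgMl; exact: cvg_harmonic.
  have md : 0 < Num.min d eps by rewrite lt_min d0.
  have [n Hn] := cvg_bound_ex cs md; exists n.
  have [LYn _] := LY n.
  have Hn1 : nrm (fun x => U n x - V x) + ep n * (gamma * B) <= d by apply: le_trans Hn _; rewrite ge_min lexx.
  have Hn2 : nrm (fun x => U n x - V x) + ep n * (gamma * B) <= eps by apply: le_trans Hn _; rewrite ge_min lexx orbT.
  have e1 : 0 <= ep n * (gamma * B) by rewrite !mulr_ge0// ltW.
  split; last by apply: le_trans Hn2; rewrite lerDl.
  pose J x := resolvent h (ep n) (u n x).
  have JE x : J x = u n x - ep n * Y n x.
    by rewrite /J /Y -[X in _ = X - _](resolventE ch h0 hm (ep0 n)) addrK.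
  have LJ : L2 D J by rewrite (_ : J = (fun x => u n x - ep n * Y n x)); [exact: L2B (Lu n) (L2Z mD _ LYn)|apply/funext].
  apply: (Hd J LJ); apply: le_trans Hn1.
  have -> : (fun x => J x - shift V xi x) = (fun x => (U n x - V x) - ep n * Y n x).
    by apply/funext => x; rewrite JE /u /shift; ring.
  apply: le_trans (normL2_triB mD (L2B mD (LU n) LV) (L2Z mD _ LYn)) _.
  by rewrite lerD2l (normL2Z mD _ LYn) gtr0_norm// ler_wpM2l// ltW.
have small (x C : R) : 0 <= C -> (forall eps, 0 < eps -> `|x| <= C * eps) -> x = 0.
  move=> C0 H; apply/eqP; rewrite -normr_eq0 eq_le normr_ge0 andbT; apply/ler_addgt0Pr => z z0; rewrite add0r.
  have C1 : 0 < C + 1 by rewrite ltr_wpDl.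
  apply: le_trans (H _ (divr_gt0 z0 C1)) _; apply: frac_le => //; exact: ltW.
split => //.
  apply: (small _ 1) => // eps eps0; have [n [_ Hn]] := cY eps eps0; rewrite mul1r.
  have [_ Un0 _] := HU n.
  have := dot_CS mD (L2B mD (LU n) LV) (Lp 0); rewrite nrm_phi mulr1 (dotBl mD (LU n) LV (Lp 0)).
  by rewrite [dot (U n) _]Un0 sub0r normrN => /le_trans; apply.
move=> k k0; apply/eqP; rewrite -subr_eq0; apply/eqP.
apply: (small _ (`|lam k - lam 0%N| + (gamma + 1))); first by rewrite !addr_ge0// ltW.
move=> eps eps0; have [n [Hn1 Hn2]] := cY eps eps0.
have [_ _ /(_ k k0) HUn] := HU n; have [LYn _] := LY n.
have Lrn := L2_rhs (aY n) (Lu n).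
have P1 := dot_CS mD (L2B mD (LU n) LV) (Lp k).
have P2 := dot_CS mD (L2B mD LYn LhV) (Lp k).
rewrite nrm_phi mulr1 in P1; rewrite nrm_phi mulr1 in P2.
have E : cf (rhs (yosida h (ep n)) (u n)) k - cf (rhs h (shift V xi)) k =
    gamma * dot (fun x => U n x - V x) (phi k) - dot (fun x => Y n x - h (shift V xi x)) (phi k).
  have LUV := L2B mD (LU n) LV; have LYh := L2B mD LYn LhV.
  rewrite /cf -(dotBl mD Lrn LrV (Lp k)) -(dotZl mD gamma LUV (Lp k)) -(dotBl mD (L2Z mD _ LUV) LYh (Lp k)).
  by apply: eq_dot => // x _; rewrite /rhs /Y /u /shift; ring.
have E3 : dot (fun x => U n x - V x) (phi k) = cf (U n) k - cf V k by rewrite (dotBl mD (LU n) LV (Lp k)).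
rewrite E3 in P1 E; have P1' := le_trans P1 Hn2; have P2' := le_trans P2 Hn1.
exact: (limit_arith HUn E P1' P2' (ltW g0)).
Qed.

End semilinear.

(** * Negative parts of Sobolev functions *)

Section smooth_positive_part.
Context {R : realType}.
Implicit Types s t eps : R.

(** [s exp(-1/s)] is a smooth stand-in for the positive part. Its derivative [sstep], equal to
    [(1 + 1/s) exp(-1/s)], stays in [0, 1] because [1 + t <= exp t], and it differs from the
    positive part by at most 1, which the scaling in [snpart] turns into [eps]. *)
Definition sppart s := s * expinv 1 s.
Definition sstep s := expinv ('X + 1) s.

Lemma sstepE s : 0 < s -> sstep s = (1 + s^-1) * expR (- s^-1).
Proof. by move=> s0; rewrite /sstep expinvE// !hornerE addrC. Qed.

Lemma expinv_next1 : expinv_next (1 : {poly R}) = 'X^2.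
Proof. by rewrite /expinv_next -[1]/(1%:P) derivC subr0 mulr1. Qed.

Lemma expinv_nextX1 : expinv_next ('X + 1 : {poly R}) = 'X^3.
Proof. by rewrite /expinv_next derivD derivX -[1]/(1%:P) derivC addr0 addrK -exprSr. Qed.

Lemma is_derive_sppart s : is_derive s (1 : R) sppart (sstep s).
Proof.
have D := is_derive_expinv 1 s.
have -> : sstep s = s *: expinv (expinv_next 1) s + expinv 1 s *: 1.
  rewrite /GRing.scale /= mulr1 expinv_next1; have [s0|s0] := leP s 0.
    by rewrite /sstep !expinv0// mulr0 addr0.
  rewrite sstepE// expinvE// expinv1E// hornerXn.
  have sn : s != 0 by rewrite gt_eqF.
  by rewrite expr2 !mulrA mulfV// mul1r mulrDl mul1r addrC.
exact: is_deriveM.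
Qed.

Lemma is_derive_sstep s : is_derive s (1 : R) sstep (expinv 'X^3 s).
Proof. by rewrite -expinv_nextX1; exact: is_derive_expinv. Qed.

Lemma smooth1_sppart : smooth1 sppart.
Proof.
have [D [D0 HD]] := smooth1_expinv ('X + 1 : {poly R}).
exists (fun n => if n is k.+1 then D k else sppart); split => // -[|n] t; last exact: HD.
by rewrite D0; exact: is_derive_sppart.
Qed.

Lemma smooth1_sstep : smooth1 sstep. Proof. exact: smooth1_expinv. Qed.

Lemma sppart0 s : s <= 0 -> sppart s = 0.
Proof. by move=> s0; rewrite /sppart expinv0// mulr0. Qed.

Lemma sstep0 s : s <= 0 -> sstep s = 0.
Proof. exact: expinv0. Qed.

Lemma sstep_ge0 s : 0 <= sstep s.
Proof.
have [s0|s0] := leP s 0; first by rewrite sstep0.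
by rewrite sstepE// mulr_ge0 ?expR_ge0// addr_ge0// invr_ge0 ltW.
Qed.

Lemma sstep_le1 s : sstep s <= 1.
Proof.
have [s0|s0] := leP s 0; first by rewrite sstep0.
by rewrite sstepE// expRN ler_pdivrMr ?expR_gt0// mul1r; exact: expR_ge1Dx.
Qed.

Lemma horner_le_coef (p : {poly R}) x : 0 <= x <= 1 -> `|p.[x]| <= \sum_(i < size p) `|p`_i|.
Proof.
move=> /andP[x0 x1]; rewrite horner_coef; apply: le_trans (ler_norm_sum _ _ _) _.
by apply: ler_sum => i _; rewrite normrM ler_piMr// ger0_norm ?exprn_ge0// exprn_ile1.
Qed.

Lemma expinv_bounded (p : {poly R}) : exists2 C : R, 0 <= C & forall s, `|expinv p s| <= C.
Proof.
have [n [C [C0 HC]]] := poly_bound p.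
exists (C * n`!%:R + \sum_(i < size p) `|p`_i|) => [|s].
  by rewrite addr_ge0 ?mulr_ge0 ?sumr_ge0.
have B0 : 0 <= \sum_(i < size p) `|p`_i| by rewrite sumr_ge0.
have A0 : 0 <= C * n`!%:R by rewrite mulr_ge0.
have [s0|s0] := leP s 0; first by rewrite expinv0// normr0 addr_ge0.
rewrite expinvE// normrM [X in _ * X]ger0_norm ?expR_ge0//.
have [t1|t1] := leP s^-1 1.
  have H := horner_le_coef p (_ : 0 <= s^-1 <= 1).
  apply: le_trans (_ : `|p.[s^-1]| <= _).
    rewrite ler_piMr// -expR0 ler_expR oppr_le0 invr_ge0 ltW//.
  apply: le_trans (H _) _; first by rewrite t1 invr_ge0 (ltW s0).
  by rewrite lerDr.
apply: le_trans (_ : C * s^-1 ^+ n * expR (- s^-1) <= _).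
  by rewrite ler_wpM2r ?expR_ge0// HC// ltW.
rewrite -[leLHS]addr0 lerD// -mulrA ler_wpM2l// expRN ler_pdivrMr ?expR_gt0//.
by apply: expR_ge_pow; rewrite invr_ge0 ltW.
Qed.

Lemma sppart_ge0 s : 0 <= sppart s.
Proof.
have [s0|s0] := leP s 0; first by rewrite sppart0.
by rewrite mulr_ge0 ?(ltW s0)// expinv1_ge0.
Qed.

Lemma sppart_le s : sppart s <= Num.max s 0.
Proof.
have [s0|s0] := leP s 0; first by rewrite sppart0// le_max lexx orbT.
by rewrite /sppart ler_piMr ?(ltW s0)// expinv1_le1.
Qed.

Lemma sppart_ge s : Num.max s 0 - 1 <= sppart s.
Proof.
have [s0|s0] := leP s 0; first by rewrite sppart0// sub0r oppr_le0.
rewrite /sppart expinv1E//.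
by have := expR_ge1Dx (- s^-1); rewrite -(ler_pM2l s0) mulrDr mulr1 mulrN mulfV ?gt_eqF.
Qed.

Section negpart.
Variables (eps : R) (e0 : 0 < eps).

Definition npart t := Num.max (- t) 0.
Definition snpart t := eps * sppart (- eps^-1 * t).
Definition sneg t := sstep (- eps^-1 * t).

Lemma is_derive_snpart t : is_derive t (1 : R) snpart (- sneg t).
Proof.
have D : is_derive t (1 : R) (fun t => - eps^-1 * t) (- eps^-1).
  apply: (is_derive_eq (is_deriveZ _ (is_derive_id t (1 : R)))); exact: mulr1.
have D2 := is_derive_sppart (- eps^-1 * t).
have D3 := is_derive1_comp D2 D.
have := is_deriveZ eps D3; congr is_derive; rewrite /sneg /GRing.scale /=.
have en : eps != 0 by rewrite gt_eqF.
by move: (sstep _) => q; field.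
Qed.

Lemma sneg01 t : 0 <= sneg t <= 1. Proof. by rewrite sstep_ge0 sstep_le1. Qed.

Lemma snpart_pos t : 0 <= t -> snpart t = 0.
Proof. by move=> t0; rewrite /snpart sppart0 ?mulr0// mulNr oppr_le0 mulr_ge0// invr_ge0 ltW. Qed.

Lemma sneg_pos t : 0 <= t -> sneg t = 0.
Proof. by move=> t0; rewrite /sneg sstep0// mulNr oppr_le0 mulr_ge0// invr_ge0 ltW. Qed.

Lemma snpart_npart t : `|snpart t - npart t| <= eps.
Proof.
have E : npart t = eps * Num.max (- eps^-1 * t) 0.
  rewrite /npart maxr_pMr ?ltW// mulr0 mulrA mulrN mulfV ?gt_eqF// mulN1r //.
rewrite E -mulrBr normrM gtr0_norm// -[leRHS]mulr1; apply: (ler_wpM2l (ltW e0)).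
have := sppart_le (- eps^-1 * t); have := sppart_ge (- eps^-1 * t).
by move: (sppart _) (Num.max _ _) => p q ? ?; rewrite ler_norml; apply/andP; split; lra.
Qed.

End negpart.

Lemma npart_lip a b : `|npart a - npart b| <= `|a - b|.
Proof.
rewrite /npart; case: (leP (- a) 0) => a0; case: (leP (- b) 0) => b0.
- by rewrite subrr normr0.
- by rewrite sub0r opprK (ltr0_norm (_ : b < 0)); [apply: le_trans (ler_norm _); lra|lra].
- by rewrite subr0 gtr0_norm// distrC; apply: le_trans (ler_norm _); lra.
- by rewrite opprK addrC distrC.
Qed.

Lemma npart_ge0 t : 0 <= npart t. Proof. by rewrite /npart le_max lexx orbT. Qed.

Lemma npart_mul t : npart t * t = - npart t ^+ 2.
Proof. by rewrite /npart; case: leP => _; rewrite ?mul0r ?expr0n ?oppr0//= sqrrN mulNr expr2. Qed.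

Lemma npart_cont : continuous npart.
Proof.
move=> t; apply/cvgrPdist_le => e e0; apply/nbhs_ballP; exists e => //= b tb.
by apply: le_trans (npart_lip _ _) _; exact: ltW.
Qed.

Lemma npart_abs t : `|npart t| <= 1 * `|t|.
Proof.
have E : npart 0 = 0 by rewrite /npart oppr0 maxxx.
by have := npart_lip t 0; rewrite E !subr0 mul1r.
Qed.

End smooth_positive_part.

(** * Energy inequalities and Kato's inequality for negative parts *)

Section negative_part_energy.
Context {R : realType} {m : nat}.
Local Notation mu := (lebesgue_rV R m).
Local Notation rV := 'rV[R]_m.
Implicit Types (f g u v w c z : rV -> R).

Lemma testf_comp (D : set rV) F f : smooth1 F -> F 0 = 0 -> testf D f -> testf D (fun x => F (f x)).
Proof.
move=> sF F0 [sf [K [cK KD f0]]]; split; first exact: smooth_comp.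
by exists K; split => // x Kx; rewrite f0.
Qed.

Lemma smooth1_affine (a b t : R) F : smooth1 F -> smooth1 (fun s => a * F (b * s + t)).
Proof.
move=> [D [<- HD]]; exists (fun n s => a * (b ^+ n * D n (b * s + t))); split.
  by apply/funext => s; rewrite expr0 mul1r.
move=> n s; pose k (r : R) := b * r + t; have D1 : is_derive s (1 : R) k (b * 1 + 0).
  by apply: is_deriveD; exact: is_deriveZ.
have D2 := is_derive1_comp (HD n (k s)) D1.
apply: (is_derive_eq (is_deriveZ a (is_deriveZ (b ^+ n) D2))).
by rewrite /GRing.scale /= exprSr mulr1 addr0; ring.
Qed.

Lemma smooth1_snpart (eps : R) : smooth1 (snpart eps).
Proof.
have := smooth1_affine eps (- eps^-1) 0 (@smooth1_sppart R).
by congr smooth1; apply/funext => s; rewrite addr0.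
Qed.

Lemma smooth1_sneg (eps : R) : smooth1 (sneg eps).
Proof.
have := smooth1_affine 1 (- eps^-1) 0 (@smooth1_sstep R).
by congr smooth1; apply/funext => s; rewrite addr0 mul1r.
Qed.

Lemma is_derive_sneg (eps : R) t : is_derive t (1 : R) (sneg eps) (- (eps^-1 * expinv 'X^3 (- eps^-1 * t))).
Proof.
have D1 := is_deriveZ (- eps^-1) (is_derive_id t (1 : R)).
apply: (is_derive_eq (is_derive1_comp (is_derive_sstep (- eps^-1 * t)) D1)).
by rewrite /GRing.scale /= mulr1 mulrN mulrC.
Qed.

Lemma snpart0 (eps : R) : 0 < eps -> snpart eps 0 = 0. Proof. by move=> e0; exact: snpart_pos. Qed.

Variables (D : set rV) (oD : open D) (bD : bounded_set D).
Let mD : measurable D := measurable_open_rV oD.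
Let fD : (mu D < +oo)%E := measurable_bounded_rV_lty mD bD.
Local Notation dot := (dotL2 D).
Local Notation nrm := (normL2 D).

Lemma L2_cst (a : R) : L2 D (cst a : rV -> R).
Proof. by apply: smooth_L2 => //; exact: smooth_cst. Qed.

Lemma L2_npart u : L2 D u -> L2 D (fun x => npart (u x)).
Proof. by move=> Lu; have [] := L2_comp mD (@npart_cont R) (@npart_abs R) Lu. Qed.

Definition nsnpart (n : nat) : R -> R := snpart n.+1%:R^-1.

Lemma natSinv_gt0 (n : nat) : 0 < n.+1%:R^-1 :> R. Proof. by rewrite invr_gt0. Qed.

Lemma testf_snpart (eps : R) f : 0 < eps -> testf D f -> testf D (fun x => snpart eps (f x)).
Proof. by move=> e0; apply: testf_comp; [exact: smooth1_snpart|exact: snpart0]. Qed.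

Lemma cvg_natSinv (C : R) : (fun n : nat => C * n.+1%:R^-1) @ \oo --> (0 : R).
Proof. by rewrite -[X in _ --> X](mulr0 C); apply: cvgMr; exact: cvg_harmonic. Qed.

Lemma squeeze0 (a b : nat -> R) : (forall n, 0 <= a n <= b n) -> b @ \oo --> (0 : R) -> a @ \oo --> (0 : R).
Proof. by move=> H cb; apply: (squeeze_cvgr _ (cvg_cst 0) cb); apply: nearW. Qed.

Lemma normL2_snpart_npart (eps : R) u : 0 < eps -> L2 D (fun x => snpart eps (u x) - npart (u x)) ->
  nrm (fun x => snpart eps (u x) - npart (u x)) <= nrm (cst 1) * eps.
Proof.
move=> e0 L; have L1 := L2Z mD eps (L2_cst 1).
have -> : nrm (cst 1) * eps = nrm (fun x => eps * (cst 1 : rV -> R) x).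
  by rewrite (normL2Z mD eps (L2_cst 1)) (ger0_norm (ltW e0)) mulrC.
apply: (normL2_le mD L L1); apply: aeW => x _; rewrite /cst mulr1 (ger0_norm (ltW e0)).
exact: snpart_npart.
Qed.

Lemma snpart_cvg (z : nat -> rV -> R) y : (forall n, testf D (z n)) -> L2 D y ->
  nrm (fun x => z n x - y x) @[n --> \oo] --> (0 : R) ->
  nrm (fun x => nsnpart n (z n x) - npart (y x)) @[n --> \oo] --> (0 : R).
Proof.
move=> tz Ly cz.
have c1 : (fun n : nat => nrm (cst 1) * n.+1%:R^-1 + nrm (fun x => z n x - y x)) @ \oo --> (0 : R).
  rewrite -[X in _ --> X]addr0; apply: cvgD => //; exact: cvg_natSinv.
apply: squeeze0 c1 => n; rewrite normL2_ge0 /=.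
have Lz := testf_L2D oD (testf_snpart (natSinv_gt0 n) (tz n)).
have Lzn : L2 D (fun x => z n x - y x) by exact: (L2B mD (testf_L2D oD (tz n)) Ly).
have Lnz := L2_npart (testf_L2D oD (tz n)); have Lny := L2_npart Ly.
have -> : (fun x => nsnpart n (z n x) - npart (y x)) =
  (fun x => (nsnpart n (z n x) - npart (z n x)) + (npart (z n x) - npart (y x))).
  by apply/funext => x; rewrite subrKA.
apply: le_trans (normL2_tri mD (L2B mD Lz Lnz) (L2B mD Lnz Lny)) _.
apply: lerD.
  exact: normL2_snpart_npart (L2B mD Lz Lnz).
apply: (normL2_le mD (L2B mD Lnz Lny) Lzn).
by apply: aeW => x _; exact: npart_lip.
Qed.

(** Test functions close to minus the negative part of [q] are made nonnegative by [snpart]. In the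
    limit the hypothesis is applied to the negative part itself, and its pairing with [q] is minus
    its squared norm. *)
Lemma nonneg_of_test q : (forall f, L2 D f -> forall e, 0 < e ->
    exists2 g, testf D g & nrm (fun x => f x - g x) <= e) ->
  L2 D q -> (forall f, testf D f -> (forall x, 0 <= f x) -> 0 <= dot q f) ->
  \forall x \ae mu, D x -> 0 <= q x.
Proof.
move=> dens Lq H; have Ln := L2_npart Lq.
have LN : L2 D (fun x => - npart (q x)) by exact: L2N.
have dn n : exists g, testf D g /\ nrm (fun x => - npart (q x) - g x) <= n.+1%:R^-1.
  by have [g ? ?] := dens _ LN _ (natSinv_gt0 n); exists g.
have [f Hf] := choice dn.
have cf : nrm (fun x => f n x - - npart (q x)) @[n --> \oo] --> (0 : R).
  apply: cvgL2_le => n; rewrite normL2BC.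
  by have [] := Hf n.
have tf n : testf D (f n) by have [] := Hf n.
have c2 := snpart_cvg tf LN cf.
have E x : npart (- npart (q x)) = npart (q x).
  by rewrite {1}/npart opprK max_l// npart_ge0.
have {}c2 : nrm (fun x => nsnpart n (f n x) - npart (q x)) @[n --> \oo] --> (0 : R).
  by apply: eq_cvgn c2 => n; congr (nrm _); apply/funext => x; rewrite E.
have c3 := cvg_dotl mD (fun n => testf_L2D oD (testf_snpart (natSinv_gt0 n) (tf n))) Ln Lq c2.
have P : 0 <= dot (fun x => npart (q x)) q.
  apply: (ler_cvg_to (cvg_cst (0 : R)) c3); apply: nearW => n; rewrite dotC; apply: H => [|x].
    exact: testf_snpart.
  by rewrite mulr_ge0 ?sppart_ge0// ltW.
have Z : nrm (fun x => npart (q x)) = 0.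
  have : dot (fun x => npart (q x)) q = - nrm (fun x => npart (q x)) ^+ 2.
    rewrite normL2_sqr -(dotNl mD Ln Ln); apply: eq_intg => // x _.
    by rewrite npart_mul mulNr.
  move=> EE; rewrite EE oppr_ge0 in P.
  by apply/eqP; rewrite -sqrf_eq0 eq_le P sqr_ge0.
have := normL2_eq0 mD Ln Z; apply: filterS => x H0 /H0.
rewrite /npart; case: (leP (- q x) 0) => [|h0 h1]; first by rewrite oppr_le0.
by rewrite h1 ltxx in h0.
Qed.

Lemma dot_pderiv_lap y dy ddy f : H2 D y dy ddy -> testf D f ->
  \sum_i dot (dy i) (pderiv i f) = - dot (lap ddy) f.
Proof.
move=> [_ H] tf; rewrite /lap (dot_suml mD).
- by rewrite -sumrN; apply: eq_bigr => i _; rewrite (H1_wd (H i) i tf).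
- by move=> i; exact: (H i).(H1_L2d).
- exact: testf_L2D.
Qed.

Variables (lam : nat -> R) (phi : nat -> rV -> R) (heig : dirichlet_eigensystem D lam phi).
Local Notation cf := (cf D phi).

(* The spectral gap acts only on the component orthogonal to the first eigenfunction. *)
Lemma poincare_gap v : testf D v ->
  lam 1%N * nrm v ^+ 2 - (lam 1%N - lam 0%N) * cf v 0%N ^+ 2 <=
  \sum_i dot (pderiv i v) (pderiv i v).
Proof.
move=> tv; have Hv := H2_smooth oD bD (testf_smooth tv).
have Hv0 := H10_test oD bD tv; have Lv := testf_L2D oD tv.
have Ll := L2_lap oD Hv; have Lp k := phi_L2 heig k.
rewrite (dot_pderiv_lap Hv tv) -[in leRHS](dotNl mD Ll Lv) normL2_sqr.
have L1 : L2 D (fun x => lam 1%N * v x) by exact: L2Z.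
have L2' : L2 D (fun x => (lam 1%N - lam 0%N) * cf v 0%N * phi 0%N x) by exact: L2Z.
have L3 : L2 D (fun x => - lap (fun i j => pderiv j (pderiv i v)) x) by exact: L2N.
have -> : lam 1%N * dot v v - (lam 1%N - lam 0%N) * cf v 0%N ^+ 2 =
  dot (fun x => lam 1%N * v x - (lam 1%N - lam 0%N) * cf v 0%N * phi 0%N x) v.
  rewrite (dotBl mD L1 L2' Lv) (dotZl mD _ Lv Lv) (dotZl mD _ (Lp 0%N) Lv).
  by rewrite [dot (phi _) v]dotC expr2 mulrA.
apply: (parseval_le oD heig) => //; first exact: L2B.
move=> k; rewrite (cfB oD heig _ L1 L2') (cfZ oD heig _ _ Lv) (cfZ oD heig _ _ (Lp 0%N)).
rewrite (cfN oD heig _ Ll) (cf_lap oD bD heig _ Hv Hv0) opprK (cf_phi heig) eq_sym.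
case: k => [|k]; first by rewrite eqxx mulr1 /=; nra.
rewrite mulr0 subr0 -!mulrA; apply: ler_wpM2r; first by rewrite -expr2 sqr_ge0.
exact: eig_mono heig _ _ (ltn0Sn k).
Qed.

Lemma cvg_norm_mul (a b : nat -> R) (M C : R) : (forall n, 0 <= a n) -> (forall n, 0 <= b n <= M + C * a n) ->
  a @ \oo --> (0 : R) -> (fun n => a n * b n) @ \oo --> (0 : R).
Proof.
move=> a0 bM ca; have c : (fun n => a n * (M + C * a n)) @ \oo --> (0 : R).
  rewrite -[X in _ --> X](mul0r (M + C * 0)); apply: cvgM => //.
  by apply: cvgD; [exact: cvg_cst|exact: cvgMr].
apply: squeeze0 c => n; have /andP[b0 bl] := bM n.
by rewrite mulr_ge0 ?a0//= ler_wpM2l.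
Qed.

Lemma pderiv_snpart eps f i x : 0 < eps -> is_smooth f ->
  pderiv i (fun x => snpart eps (f x)) x = - sneg eps (f x) * pderiv i f x.
Proof. by move=> e0 sf; rewrite (pderiv_comp i sf (is_derive_snpart e0 (f x))). Qed.

(** [poincare_gap] is applied to [v n], a smoothed negative part of a test function [z n] near [y].
    As the gradient of [v n] is [- sneg] times that of [z n] with [0 <= sneg <= 1], its square is at
    most minus the product of the two gradients. The passage to the limit needs only that the
    gradients of [v n] are bounded, not that they converge. *)
Lemma negative_energy y dy ddy : H2 D y dy ddy -> H10 D y dy ->
  lam 1%N * nrm (fun x => npart (y x)) ^+ 2 -
    (lam 1%N - lam 0%N) * cf (fun x => npart (y x)) 0%N ^+ 2 <=
  dot (lap ddy) (fun x => npart (y x)).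
Proof.
move=> Hy Hy0; have Ly := (H10_H1 Hy0).(H1_L2); have Ldy := (H10_H1 Hy0).(H1_L2d).
have Ln := L2_npart Ly; have Ll := L2_lap oD Hy; have Lp k := phi_L2 heig k.
have [z [tz cz cdz]] := H10_seq Hy0.
pose v n x := nsnpart n (z n x).
have tv n : testf D (v n) by exact: testf_snpart.
have Lv n := testf_L2D oD (tv n).
have cv := snpart_cvg tz Ly cz.
pose er n := \sum_i nrm (fun x => pderiv i (z n) x - dy i x) * nrm (pderiv i (v n)).
have Lzd n i : L2 D (fun x => pderiv i (z n) x - dy i x).
  by apply: L2B => //; exact: testf_L2d.
have dv n i x : pderiv i (v n) x = - sneg n.+1%:R^-1 (z n x) * pderiv i (z n) x.
  by apply: pderiv_snpart => //; exact: testf_smooth.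
have key n : lam 1%N * nrm (v n) ^+ 2 - (lam 1%N - lam 0%N) * cf (v n) 0%N ^+ 2 <=
    dot (v n) (lap ddy) + er n.
  apply: le_trans (poincare_gap (tv n)) _.
  rewrite -[dot _ (lap ddy)]opprK [dot (v n) _]dotC -(dot_pderiv_lap Hy (tv n)) -sumrN -big_split /=.
  apply: ler_sum => i _.
  have Lzi := testf_L2d oD i (tz n); have Lvi := testf_L2d oD i (tv n).
  apply: (@le_trans _ _ (- dot (pderiv i (z n)) (pderiv i (v n)))).
    rewrite -(dotNl mD Lzi Lvi); apply: ae_le_intg => //.
    - exact: L2_itgM.
    - by apply: L2_itgM => //; exact: L2N.
    - apply: aeW => x _; rewrite dv; have /andP[] := sneg01 n.+1%:R^-1 (z n x).
      move: (sneg _ _) (pderiv _ _ _) => a b a0 a1.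
      have := mulr_ge0 (mulr_ge0 a0 (sqr_ge0 b)) (_ : 0 <= 1 - a); rewrite subr_ge0 => /(_ a1).
      by move=> ?; nra.
  have -> : - dot (pderiv i (z n)) (pderiv i (v n)) =
     - dot (dy i) (pderiv i (v n)) - dot (fun x => pderiv i (z n) x - dy i x) (pderiv i (v n)).
    by rewrite (dotBl mD Lzi (Ldy i) Lvi) opprB addKr.
  rewrite lerD2l; apply: le_trans (ler_norm _) _; rewrite normrN.
  exact: dot_CS.
have cer : er @ \oo --> (0 : R).
  rewrite [X in _ --> X](_ : _ = \sum_(i < m) (0 : R)); last by rewrite big1.
  apply: cvg_bigsum => i.
  apply: (cvg_norm_mul (M := nrm (dy i)) (C := 1)) => [n|n|]; [exact: normL2_ge0| |exact: cdz].
  rewrite normL2_ge0 /=; have Lzi := testf_L2d oD i (tz n).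
  apply: (@le_trans _ _ (nrm (pderiv i (z n)))).
    apply: normL2_le => //; first exact: testf_L2d.
    apply: aeW => x _; rewrite dv normrM normrN ler_piMl//.
    by have /andP[a0 a1] := sneg01 n.+1%:R^-1 (z n x); rewrite ger0_norm.
  rewrite mul1r; have := normL2_tri mD (Ldy i) (Lzd n i); congr (_ <= _).
  by congr (nrm _); apply/funext => x; rewrite addrC subrK.
have c1 : (fun n => lam 1%N * nrm (v n) ^+ 2 - (lam 1%N - lam 0%N) * cf (v n) 0%N ^+ 2) @ \oo -->
   lam 1%N * nrm (fun x => npart (y x)) ^+ 2 - (lam 1%N - lam 0%N) * cf (fun x => npart (y x)) 0%N ^+ 2.
  have A := cvg_normL2 mD Lv Ln cv; have B := cvg_dotl mD Lv Ln (Lp 0%N) cv.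
  by apply: cvgB; apply: cvgMr; apply: cvgM.
have c2 : (fun n => dot (v n) (lap ddy) + er n) @ \oo --> dot (fun x => npart (y x)) (lap ddy) + 0.
  by apply: cvgD => //; exact: cvg_dotl.
rewrite [leRHS]dotC -[leRHS]addr0; apply: (ler_cvg_to c1 c2); exact: nearW.
Qed.

Definition laplace f : rV -> R := fun x => \sum_i pderiv i (pderiv i f) x.

Lemma smooth_laplace f : is_smooth f -> is_smooth (laplace f).
Proof. by move=> sf; apply: smooth_sum => i; do 2!apply: smooth_pderiv. Qed.

Lemma npart_cvg (z : nat -> rV -> R) y : (forall n, L2 D (z n)) -> L2 D y ->
  nrm (fun x => z n x - y x) @[n --> \oo] --> (0 : R) ->
  nrm (fun x => npart (z n x) - npart (y x)) @[n --> \oo] --> (0 : R).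
Proof.
move=> Lz Ly; apply: squeeze0 => n; rewrite normL2_ge0 /=.
apply: (normL2_le mD (L2B mD (L2_npart (Lz n)) (L2_npart Ly)) (L2B mD (Lz n) Ly)).
by apply: aeW => x _; exact: npart_lip.
Qed.

Lemma expinvX3_ge0 (s : R) : 0 <= expinv 'X^3 s.
Proof.
have [s0|s0] := leP s 0; first by rewrite expinv0.
by rewrite expinvE// hornerXn mulr_ge0 ?expR_ge0// exprn_ge0// invr_ge0 ltW.
Qed.

Lemma kato_pt (a s E e lm z y Th : R) : 0 <= lm -> 0 <= s <= 1 -> (0 <= z -> s = 0) -> 0 <= Th -> `|e| <= E ->
  (lm * npart z + E) * Th + lm * (`|z - y| * Th) + - (- (lm * y) + e) * (Th * s) >= 0.
Proof.
move=> l0 /andP[s0 s1] z0 T0 eE.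
have ne : e <= E by apply: le_trans (ler_norm _) eE.
have E0 : 0 <= E by apply: le_trans eE.
have H1 : 0 <= npart z + s * z.
  have [zn|zp] := leP 0 z; first by rewrite (z0 zn) mul0r addr0 npart_ge0.
  by rewrite /npart max_l ?oppr_ge0 ?(ltW zp)//; have zn := ltW zp; nra.
have H2 : 0 <= `|z - y| + s * (y - z).
  have := ler_norm (z - y); have := normr_ge0 (z - y); move: `|z - y| => n n0 nz.
  have := mulr_ge0 (_ : 0 <= 1 - s) n0; have := mulr_ge0 s0 (_ : 0 <= n - (z - y)).
  by rewrite !subr_ge0 => /(_ nz) ? /(_ s1) ?; nra.
have H3 : 0 <= E - e * s by nra.
rewrite (_ : _ + _ = Th * (lm * ((npart z + s * z) + (`|z - y| + s * (y - z))) + (E - e * s))); last by ring.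
by rewrite mulr_ge0// addr_ge0// mulr_ge0// addr_ge0.
Qed.

(* Kato's inequality for the zero extension of [y^-], tested up to the boundary. *)
Lemma kato y dy ddy (lm E : R) e Th : H2 D y dy ddy -> H10 D y dy -> 0 <= lm ->
  (\forall x \ae mu, D x -> lap ddy x = - (lm * y x) + e x) -> L2 D e ->
  (\forall x \ae mu, D x -> `|e x| <= E) -> is_smooth Th -> (forall x, 0 <= Th x) ->
  - dot (fun x => lm * npart (y x) + E) Th <= dot (fun x => npart (y x)) (laplace Th).
Proof.
move=> Hy Hy0 lm0 eqy Le eE sT T0; have Ly := (H10_H1 Hy0).(H1_L2); have Ldy := (H10_H1 Hy0).(H1_L2d).
have Ln := L2_npart Ly; have Ll := L2_lap oD Hy.
have LT := smooth_L2 oD bD sT; have LdT i := smooth_L2 oD bD (smooth_pderiv i sT).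
have LlT := smooth_L2 oD bD (smooth_laplace sT).
have [z [tz cz cdz]] := H10_seq Hy0; have Lz n := testf_L2D oD (tz n).
have Lnz n := L2_npart (Lz n).
have Lf u : L2 D u -> L2 D (fun x => lm * npart (u x) + E).
  by move=> Lu; apply: (L2D mD _ (L2_cst E)); apply: L2Z => //; exact: L2_npart.
have Lzd n i : L2 D (fun x => pderiv i (z n) x - dy i x) by apply: L2B => //; exact: testf_L2d.
(* The order of limits matters: some bounds below grow like [eps^-1], so the approximants [z n]
   converge first, at fixed [eps]. *)
suff step eps : 0 < eps -> - dot (fun x => lm * npart (y x) + E) Th <=
    dot (fun x => npart (y x)) (laplace Th) + (nrm (cst 1) * nrm (laplace Th)) * eps.
  have c : (fun n : nat => dot (fun x => npart (y x)) (laplace Th) + (nrm (cst 1) * nrm (laplace Th)) * n.+1%:R^-1) @ \oo -->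
     dot (fun x => npart (y x)) (laplace Th) + 0.
    by apply: cvgD; [exact: cvg_cst|exact: cvg_natSinv].
  rewrite -[leRHS]addr0; apply: (ler_cvg_to (cvg_cst _) c); apply: nearW => n; exact: step.
(* [w n] is compactly supported in [D] although [Th] is not, because [sneg eps] vanishes at 0. *)
move=> e0; pose v n x := snpart eps (z n x); pose w n x := Th x * sneg eps (z n x).
have tv n : testf D (v n) by exact: testf_snpart.
have tw n : testf D (w n).
  by apply: testfMl => //; apply: testf_comp => //; [exact: smooth1_sneg|exact: sneg_pos].
have Lv n := testf_L2D oD (tv n); have Lw n := testf_L2D oD (tw n).
have dv n i x : pderiv i (v n) x = - sneg eps (z n x) * pderiv i (z n) x.
  by apply: pderiv_snpart => //; exact: testf_smooth.
(* The second derivative of the convex function [snpart eps]; the term containing it has a sign and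
   is dropped in [step1]. *)
pose s' n x := eps^-1 * expinv 'X^3 (- eps^-1 * z n x).
have dw n i x : pderiv i (w n) x = pderiv i Th x * sneg eps (z n x) - Th x * (s' n x * pderiv i (z n) x).
  have sz := testf_smooth (tz n).
  rewrite /w pderivM//; last by apply: smooth_comp => //; exact: smooth1_sneg.
  by rewrite (pderiv_comp i sz (is_derive_sneg eps (z n x))) mulNr mulrN addrC [sneg _ _ * _]mulrC.
pose er n := \sum_i nrm (fun x => pderiv i (z n) x - dy i x) * nrm (pderiv i (w n)).
have step1 n : - dot (lap ddy) (w n) - er n <= dot (v n) (laplace Th).
  have -> : dot (v n) (laplace Th) = \sum_i - dot (pderiv i (v n)) (pderiv i Th).
    rewrite dotC /laplace (dot_suml mD) //; last first.
      by move=> i; apply: smooth_L2 => //; do 2!apply: smooth_pderiv.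
    apply: eq_bigr => i _; have := wd_smooth oD bD i (smooth_pderiv i sT) (tv n).
    by rewrite dotC => ->; rewrite opprK.
  rewrite -(dot_pderiv_lap Hy (tw n)) -sumrB; apply: ler_sum => i _.
  have Lzi := testf_L2d oD i (tz n); have Lvi := testf_L2d oD i (tv n).
  have Lwi := testf_L2d oD i (tw n).
  apply: (@le_trans _ _ (dot (pderiv i (z n)) (pderiv i (w n)))).
    have -> : dot (pderiv i (z n)) (pderiv i (w n)) =
       dot (dy i) (pderiv i (w n)) + dot (fun x => pderiv i (z n) x - dy i x) (pderiv i (w n)).
      by rewrite (dotBl mD Lzi (Ldy i) Lwi) addrC subrK.
    rewrite lerD2l; have := dot_CS mD (Lzd n i) Lwi; rewrite ler_norml => /andP[+ _].
    exact.
  rewrite -(dotNl mD Lvi (LdT i)); apply: ae_le_intg => //; first exact: L2_itgM.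
    by apply: L2_itgM => //; exact: L2N.
  apply: aeW => x _; rewrite dv dw.
  have s0 : 0 <= s' n x by rewrite mulr_ge0 ?expinvX3_ge0// invr_ge0 ltW.
  have := mulr_ge0 (mulr_ge0 (T0 x) s0) (sqr_ge0 (pderiv i (z n) x)).
  by move: (sneg _ _) (pderiv _ _ _) (pderiv _ _ _) (s' n x) (Th x) => a b c d t ?; nra.
have step2 n : - dot (fun x => lm * npart (z n x) + E) Th - lm * (nrm (fun x => z n x - y x) * nrm Th) <=
    - dot (lap ddy) (w n).
  have Ld : L2 D (fun x => `|z n x - y x|).
    apply: (L2_le mD _ _ (L2B mD (Lz n) Ly)).
      by apply: measurableT_comp => //; exact: L2_meas (L2B mD (Lz n) Ly).
    by move=> x _; rewrite normr_id.
  have H1 : - dot (fun x => lm * npart (z n x) + E) Th - lm * dot (fun x => `|z n x - y x|) Th <=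
      - dot (lap ddy) (w n).
    have LA := Lf _ (Lz n); 
    rewrite -(dotZl mD lm Ld LT) -opprD lerN2 -(dotDl mD LA (L2Z mD lm Ld) LT).
    apply: ae_le_intg => //; first exact: L2_itgM.
      by apply: L2_itgM => //; exact: (L2D mD LA (L2Z mD lm Ld)).
    apply: filterS2 eqy eE => x Hx Hex Dx; rewrite Hx// -subr_ge0 mulrDl -[X in _ <= _ + X - _]mulrA -mulNr.
    by apply: kato_pt => //; [exact: sneg01|exact: sneg_pos|exact: Hex].
  apply: le_trans H1; rewrite lerD2l lerN2 ler_wpM2l//.
  have -> : nrm (fun x => z n x - y x) = nrm (fun x => `|z n x - y x|).
    by congr Num.sqrt; apply: eq_intg => // x _; rewrite -!expr2 real_normK ?num_real.
  by apply: le_trans (ler_norm _) _; exact: dot_CS.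
have step3 n : dot (v n) (laplace Th) <= dot (fun x => npart (z n x)) (laplace Th) +
    nrm (cst 1) * nrm (laplace Th) * eps.
  rewrite -lerBlDl -(dotBl mD (Lv n) (Lnz n) LlT); apply: le_trans (ler_norm _) _.
  have Lb : L2 D (fun x => v n x - npart (z n x)) by exact: L2B.
  apply: le_trans (dot_CS mD Lb LlT) _; rewrite mulrAC; apply: ler_wpM2r; first exact: normL2_ge0.
  exact: normL2_snpart_npart Lb.
have cer : er @ \oo --> (0 : R).
  have [MT MT0 HT] := smooth_bounded_on bD sT.
  have [C C0 HC] := expinv_bounded ('X^3 : {poly R}).
  rewrite [X in _ --> X](_ : _ = \sum_(i < m) (0 : R)); last by rewrite big1.
  apply: cvg_bigsum => i; pose B := MT * (eps^-1 * C).
  apply: (cvg_norm_mul (M := nrm (pderiv i Th) + B * nrm (dy i)) (C := B)) => [n|n|]; [exact: normL2_ge0| |exact: cdz].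
  rewrite normL2_ge0 /=; have Lzi := testf_L2d oD i (tz n).
  have B0 : 0 <= B by rewrite mulr_ge0// mulr_ge0// invr_ge0 ltW.
  have Lw' := testf_L2d oD i (tw n).
  have L1 : L2 D (fun x => `|pderiv i Th x|).
    apply: (L2_le mD _ _ (LdT i)) => [|x _]; last by rewrite normr_id.
    by apply: measurableT_comp => //; exact: L2_meas (LdT i).
  have L2' : L2 D (fun x => `|pderiv i (z n) x|).
    apply: (L2_le mD _ _ Lzi) => [|x _]; last by rewrite normr_id.
    by apply: measurableT_comp => //; exact: L2_meas Lzi.
  have nrma u : nrm (fun x => `|u x|) = nrm u.
    by congr Num.sqrt; apply: eq_intg => // x _; rewrite -!expr2 real_normK ?num_real.
  apply: (@le_trans _ _ (nrm (fun x => `|pderiv i Th x| + B * `|pderiv i (z n) x|))).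
    apply: (normL2_le mD Lw' (L2D mD L1 (L2Z mD B L2'))); apply: aeW => x Dx; rewrite dw.
    rewrite [leRHS]ger0_norm; last by rewrite addr_ge0// mulr_ge0.
    apply: le_trans (ler_normB _ _) _; apply: lerD.
      by rewrite normrM ler_piMr//; have /andP[a0 a1] := sneg01 eps (z n x); rewrite ger0_norm.
    rewrite mulrA normrM ler_wpM2r// normrM ler_pM ?HT//.
    rewrite /s' normrM (ger0_norm (_ : 0 <= eps^-1)) ?invr_ge0 ?(ltW e0)//.
    by apply: ler_wpM2l; rewrite ?invr_ge0 ?(ltW e0)// HC.
  apply: le_trans (normL2_tri mD L1 (L2Z mD B L2')) _.
  rewrite (normL2Z mD B L2') (nrma (pderiv i Th)) (nrma (pderiv i (z n))) (ger0_norm B0) -addrA lerD2l -mulrDr ler_wpM2l//.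
  have := normL2_tri mD (Ldy i) (Lzd n i); congr (_ <= _).
  by congr (nrm _); apply/funext => x; rewrite addrC subrK.
have c1 : (fun n => - dot (fun x => lm * npart (z n x) + E) Th - lm * (nrm (fun x => z n x - y x) * nrm Th) - er n) @ \oo -->
    - dot (fun x => lm * npart (y x) + E) Th - lm * (0 * nrm Th) - 0.
  apply: cvgB => //; apply: cvgB; last by apply: cvgMr; exact: cvgMl.
  apply: cvgN; apply: (cvg_dotl mD (fun n => Lf _ (Lz n)) (Lf _ Ly) LT).
  have c : (fun n => `|lm| * nrm (fun x => npart (z n x) - npart (y x))) @ \oo --> (0 : R).
    by rewrite -[X in _ --> X](mulr0 `|lm|); apply: cvgMr; exact: (npart_cvg Lz Ly cz).
  apply: eq_cvgn c => n; rewrite -(normL2Z mD lm (L2B mD (Lnz n) Ln)).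
  by congr (nrm _); apply/funext => x; ring.
have c2 : (fun n => dot (fun x => npart (z n x)) (laplace Th) + nrm (cst 1) * nrm (laplace Th) * eps) @ \oo -->
    dot (fun x => npart (y x)) (laplace Th) + nrm (cst 1) * nrm (laplace Th) * eps.
  by apply: cvgD; [exact: (cvg_dotl mD Lnz Ln LlT (npart_cvg Lz Ly cz))|exact: cvg_cst].
rewrite mul0r mulr0 !subr0 in c1; apply: (ler_cvg_to c1 c2); apply: nearW => n.
apply: le_trans (step3 n); apply: le_trans (step1 n); rewrite lerD2r; exact: step2.
Qed.

End negative_part_energy.

(** * Mean value inequalities *)

Section mean_value_kernel.
Context {R : realType} {m : nat}.
Local Notation mu := (lebesgue_rV R m).
Local Notation rV := 'rV[R]_m.
Implicit Types (f g v psi : rV -> R) (x y w : rV) (r rho s : R).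

Definition kprofile : R -> R := expinv 'X^2.
Definition kprofile' : R -> R := expinv (expinv_next 'X^2).

(* The kernel and its primitive are tied by d/drho kern = rho^(1-m) * Lap theta. *)
Definition kern rho x y : R := 2 * (rho^-1 ^+ m * kprofile (1 - rho^-1 ^+ 2 * sqdist x y)).
Definition theta rho x y : R := expinv 1 (1 - rho^-1 ^+ 2 * sqdist x y).

Lemma is_derive_E1 s : is_derive s (1 : R) (expinv 1) (kprofile s).
Proof. by rewrite /kprofile -expinv_next1; exact: is_derive_expinv. Qed.

Lemma is_derive_kprofile s : is_derive s (1 : R) kprofile (kprofile' s).
Proof. exact: is_derive_expinv. Qed.

Lemma kprofile_ge0 s : 0 <= kprofile s.
Proof.
have [s0|s0] := leP s 0; first by rewrite /kprofile expinv0.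
by rewrite /kprofile expinvE// hornerXn mulr_ge0 ?expR_ge0// exprn_ge0// invr_ge0 ltW.
Qed.

Lemma sqdistC x y : sqdist x y = sqdist y x.
Proof. by apply: eq_bigr => i _; rewrite -sqrrN opprB. Qed.

Lemma sqdist_shift x y : sqdist x (y + x) = sqdist 0 y.
Proof. by apply: eq_bigr => i _; rewrite !mxE addrK subr0. Qed.

Lemma sqdist_ge0 x y : 0 <= sqdist x y.
Proof. by apply: sumr_ge0 => i _; exact: sqr_ge0. Qed.

Lemma pderiv_sqdist i x y : pderiv i (sqdist x) y = 2 * (y ord0 i - x ord0 i).
Proof.
have sk k : is_smooth (fun y : rV => y ord0 k - x ord0 k).
  by apply: smoothB; [exact: smooth_coord|exact: smooth_cst].
rewrite /sqdist pderiv_sum => [|k]; last by under eq_fun do rewrite expr2; exact: smoothM.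
rewrite (bigD1 i)//= big1 => [|k ki]; last first.
  under eq_fun do rewrite expr2.
  rewrite pderivM// pderivB ?pderiv_coord ?pderiv_cst; [|exact: smooth_coord|exact: smooth_cst].
  by rewrite (negPf ki) subr0 !mulr0 addr0.
under eq_fun do rewrite expr2.
rewrite pderivM// pderivB ?pderiv_coord ?pderiv_cst; [|exact: smooth_coord|exact: smooth_cst].
by rewrite eqxx subr0 mulr1 addr0; ring.
Qed.

Lemma smooth_arg rho x : is_smooth (fun y => 1 - rho^-1 ^+ 2 * sqdist x y).
Proof. by apply: smoothB; [exact: smooth_cst|apply: smoothZ; exact: smooth_sqdist]. Qed.

Lemma smooth_theta rho x : is_smooth (theta rho x).
Proof. by apply: smooth_comp (smooth_arg rho x); exact: smooth1_expinv. Qed.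

Lemma smooth_kern rho x : is_smooth (kern rho x).
Proof. by do 2!apply: smoothZ; apply: smooth_comp (smooth_arg rho x); exact: smooth1_expinv. Qed.

Lemma pderiv_arg i rho x y : pderiv i (fun y => 1 - rho^-1 ^+ 2 * sqdist x y) y =
  - (2 * rho^-1 ^+ 2 * (y ord0 i - x ord0 i)).
Proof.
rewrite pderivB ?pderiv_cst ?pderivZ ?pderiv_sqdist; [|exact: smooth_sqdist|exact: smooth_cst|].
  by ring.
by apply: smoothZ; exact: smooth_sqdist.
Qed.

Lemma laplace_theta rho x y : laplace (theta rho x) y =
  rho^-1 ^+ 2 * (4 * (rho^-1 ^+ 2 * sqdist x y) * kprofile' (1 - rho^-1 ^+ 2 * sqdist x y)
    - 2 * m%:R * kprofile (1 - rho^-1 ^+ 2 * sqdist x y)).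
Proof.
have E i : pderiv i (theta rho x) = fun y => kprofile (1 - rho^-1 ^+ 2 * sqdist x y) *
    - (2 * rho^-1 ^+ 2 * (y ord0 i - x ord0 i)).
  apply/funext => z; rewrite -pderiv_arg.
  exact: (pderiv_comp i (smooth_arg rho x) (is_derive_E1 _)).
have sk : is_smooth (fun y => kprofile (1 - rho^-1 ^+ 2 * sqdist x y)).
  by apply: smooth_comp (smooth_arg rho x); exact: smooth1_expinv.
have sl i : is_smooth (fun y : rV => - (2 * rho^-1 ^+ 2 * (y ord0 i - x ord0 i))).
  by apply: smoothN; apply: smoothZ; apply: smoothB; [exact: smooth_coord|exact: smooth_cst].
have T i : pderiv i (pderiv i (theta rho x)) y =
    rho^-1 ^+ 2 * (4 * rho^-1 ^+ 2 * kprofile' (1 - rho^-1 ^+ 2 * sqdist x y)) * (y ord0 i - x ord0 i) ^+ 2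
     - 2 * rho^-1 ^+ 2 * kprofile (1 - rho^-1 ^+ 2 * sqdist x y).
  rewrite E pderivM// (pderiv_comp i (smooth_arg rho x) (is_derive_kprofile _)) pderiv_arg.
  have sb : is_smooth (fun y : rV => y ord0 i - x ord0 i).
    by apply: smoothB; [exact: smooth_coord|exact: smooth_cst].
  rewrite pderivN; last exact: smoothZ.
  rewrite pderivZ// pderivB ?pderiv_coord ?pderiv_cst ?eqxx; [|exact: smooth_coord|exact: smooth_cst].
  by rewrite subr0 /=; move: (kprofile _) (kprofile' _) => a b; ring.
rewrite /laplace (eq_bigr _ (fun i _ => T i)) sumrB -mulr_sumr sumr_const card_ord -/(sqdist x y).
by rewrite -mulr_natr; move: (kprofile _) (kprofile' _) => a b; ring.
Qed.

Lemma is_derive_expn n s : is_derive s (1 : R) (fun s => s ^+ n) (n%:R * s ^+ n.-1).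
Proof.
elim: n => [|n IH].
  by under eq_fun do rewrite expr0; rewrite mul0r; exact: is_derive_cst.
under eq_fun do rewrite exprS.
apply: (is_derive_eq (is_deriveM (is_derive_id s (1 : R)) IH)).
rewrite /GRing.scale /= mulr1; case: n {IH} => [|n] /=; first by rewrite mul0r mulr0 add0r expr0 mul1r.
by rewrite exprS -[n.+2]addn1 natrD; ring.
Qed.

Lemma kern_derive rho x y : 0 < rho ->
  is_derive rho (1 : R) (fun rho => kern rho x y) (rho * (rho^-1 ^+ m * laplace (theta rho x) y)).
Proof.
move=> r0; rewrite laplace_theta; set q := sqdist x y.
have Hi : is_derive rho (1 : R) (fun r : R => r^-1) (- rho ^- 2).
  have H := @is_deriveV R (@id R) rho 1 1 (lt0r_neq0 r0) (is_derive_id _ _).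
  by apply: (is_derive_eq H); rewrite /GRing.scale /= mulr1.
pose P s := 2 * (s ^+ m * kprofile (1 - s ^+ 2 * q)).
have HP s : is_derive s (1 : R) P (2 * (s ^+ m * (kprofile' (1 - s ^+ 2 * q) * - (2 * s * q)) +
    kprofile (1 - s ^+ 2 * q) * (m%:R * s ^+ m.-1))).
  pose k s := 1 - s ^+ 2 * q.
  have Dk : is_derive s (1 : R) k (- (2 * s * q)).
    have D1 := is_deriveM (is_derive_expn 2 s) (is_derive_cst q s (1 : R)).
    apply: (is_derive_eq (is_deriveB (is_derive_cst (1 : R) s (1 : R)) D1)).
    by rewrite /GRing.scale /= expr1; ring.
  have Dc := is_derive1_comp (is_derive_kprofile (k s)) Dk.
  by apply: (is_derive_eq (is_deriveZ (2 : R) (is_deriveM (is_derive_expn m s) Dc))).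
have D := is_derive1_comp (HP rho^-1) Hi; apply: (is_derive_eq D).
have rn : rho != 0 by rewrite gt_eqF.
have [t tr] : exists t, t = rho^-1 by exists rho^-1.
have rt : rho * t = 1 by rewrite tr mulfV.
have Em : m%:R * t ^+ m.-1 = m%:R * (rho * t ^+ m) 
  by case: (m) => [|k]; [rewrite mulr0n !mul0r|rewrite exprS [rho * (t * _)]mulrA rt mul1r].
rewrite -exprVn -tr Em; move: (kprofile _) (kprofile' _) (t ^+ m) => a b c.
have -> : rho * (c * (t ^+ 2 * (4 * (t ^+ 2 * q) * b - 2 * m%:R * a))) =
  c * (4 * t ^+ 2 * q * b) * t * (rho * t) - 2 * m%:R * a * c * rho * t ^+ 2 by ring.
by rewrite rt mulr1 expr2; ring.
Qed.

Lemma theta_ge0 rho x y : 0 <= theta rho x y. Proof. exact: expinv1_ge0. Qed.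

Lemma kern_ge0 rho x y : 0 < rho -> 0 <= kern rho x y.
Proof.
by move=> r0; rewrite mulr_ge0// mulr_ge0 ?kprofile_ge0// exprn_ge0// invr_ge0 ltW.
Qed.

Lemma kernC rho x y : kern rho x y = kern rho y x.
Proof. by rewrite /kern sqdistC. Qed.

Lemma kern_shift rho x y : kern rho x (y + x) = kern rho 0 y.
Proof. by rewrite /kern sqdist_shift. Qed.

Lemma arg_le0 rho x y : 0 < rho -> rho <= `|y - x| -> 1 - rho^-1 ^+ 2 * sqdist x y <= 0.
Proof.
move=> r0 H; have := sqdist_ge r0 H; rewrite subr_le0 => /(ler_wpM2l (sqr_ge0 rho^-1)).
by rewrite -exprMn mulVf ?gt_eqF// expr1n.
Qed.

Lemma kern_out rho x y : 0 < rho -> rho <= `|y - x| -> kern rho x y = 0.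
Proof. by move=> r0 H; rewrite /kern /kprofile expinv0 ?mulr0//; exact: arg_le0. Qed.

Lemma theta_out rho x y : 0 < rho -> rho <= `|y - x| -> theta rho x y = 0.
Proof. by move=> r0 H; rewrite /theta expinv0//; exact: arg_le0. Qed.

Lemma testf_ball (D : set rV) rho x f : 0 < rho -> is_smooth f -> (forall y, rho <= `|y - x| -> f y = 0) ->
  [set y : rV | `|y - x| <= rho] `<=` D -> testf D f.
Proof.
move=> r0 sf f0 HD; split => //; exists [set y : rV | `|y - x| <= rho]; split => //.
  exact: compact_closed_ball.
by move=> y /negP; rewrite -ltNge => /ltW; exact: f0.
Qed.

Lemma testf_theta (D : set rV) rho x : 0 < rho -> [set y : rV | `|y - x| <= rho] `<=` D -> testf D (theta rho x).
Proof. by move=> r0; apply: testf_ball => //; [exact: smooth_theta|move=> y; exact: theta_out]. Qed.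

Lemma testf_kern rho x : 0 < rho -> testf setT (kern rho x).
Proof. by move=> r0; apply: (testf_ball r0) (smooth_kern _ _) _ _ => //; move=> y; exact: kern_out. Qed.

Lemma kprofile_gt s : 3 / 4 <= s <= 1 -> expR (- 2) <= kprofile s.
Proof.
move=> /andP[s1 s2]; have s0 : 0 < s by lra.
rewrite /kprofile expinvE// hornerXn -[leLHS]mul1r ler_pM ?expR_ge0//.
  by rewrite exprn_ege1// invf_ge1.
rewrite ler_expR lerN2 -(ler_pM2r s0) mulVf ?gt_eqF//; lra.
Qed.

(** Turns a pairing with [theta] into an average over twice the radius. On the support of [theta]
    the argument of the profile for radius [2 rho] is at least 3/4, where [kprofile] is at least
    [exp(-2)]; [2 ^+ m * rho ^+ m] undoes the normalization of the kernel. *)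
Lemma theta_le_kern rho x y : 0 < rho -> theta rho x y <= expR 2 * 2 ^+ m * rho ^+ m * kern (2 * rho) x y.
Proof.
move=> r0; have K0 : 0 <= kern (2 * rho) x y by apply: kern_ge0; rewrite mulr_gt0.
have [s0|s0] := leP (1 - rho^-1 ^+ 2 * sqdist x y) 0.
  by rewrite /theta expinv0// mulr_ge0// mulr_ge0 ?exprn_ge0 ?mulr_ge0 ?expR_ge0// ltW.
apply: le_trans (expinv1_le1 _) _.
have q0 : 0 <= rho^-1 ^+ 2 * sqdist x y by rewrite mulr_ge0 ?sqr_ge0 ?sqdist_ge0.
have q1 : (2 * rho)^-1 ^+ 2 * sqdist x y = 4^-1 * (rho^-1 ^+ 2 * sqdist x y).
  by rewrite invfM exprMn (_ : 2^-1 ^+ 2 = 4^-1 :> R) ?mulrA// exprVn -natrX.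
have H : expR (- 2) <= kprofile (1 - (2 * rho)^-1 ^+ 2 * sqdist x y).
  apply: kprofile_gt; rewrite q1; move: (rho^-1 ^+ 2 * _) s0 q0 => q ? ?.
  by apply/andP; split; lra.
have E : 2 ^+ m * rho ^+ m * (2 * rho)^-1 ^+ m = 1.
  by rewrite -!exprMn mulfV ?expr1n// gt_eqF// mulr_gt0.
rewrite /kern; move: H E; move: (kprofile _) ((2 * rho)^-1 ^+ m) (2 ^+ m) (rho ^+ m) => k a b c H E.
have -> : expR 2 * b * c * (2 * (a * k)) = 2 * (expR 2 * k) * (b * c * a) by ring.
rewrite E mulr1; have := ler_wpM2l (expR_ge0 (2 : R)) H.
by rewrite -expRD subrr expR0 => ?; lra.
Qed.

Lemma kern_derive_bound : exists2 C : R, 0 <= C & forall rho x y, 0 < rho ->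
  `|rho * (rho^-1 ^+ m * laplace (theta rho x) y)| <= C * rho^-1 ^+ m.+1.
Proof.
have [C1 C10 H1] := expinv_bounded (expinv_next ('X^2 : {poly R})).
have [C2 C20 H2] := expinv_bounded ('X^2 : {poly R}).
exists (4 * C1 + 2 * m%:R * C2) => [|rho x y r0]; first by rewrite addr_ge0 ?mulr_ge0.
have rn : rho != 0 by rewrite gt_eqF.
have t0 : 0 < rho^-1 by rewrite invr_gt0.
rewrite laplace_theta.
have -> (a : R) : rho * (rho^-1 ^+ m * (rho^-1 ^+ 2 * a)) = rho^-1 ^+ m.+1 * a.
  by rewrite !exprS expr0 mulr1; field.
rewrite normrM ger0_norm ?exprn_ge0 ?(ltW t0)// mulrC ler_wpM2r ?exprn_ge0 ?(ltW t0)//.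
apply: le_trans (ler_normB _ _) _; apply: lerD.
  rewrite normrM normrM ger0_norm// -mulrA ler_wpM2l//.
  have [s0|s0] := leP (1 - rho^-1 ^+ 2 * sqdist x y) 0.
    by rewrite /kprofile' expinv0// normr0 mulr0.
  have q0 : 0 <= rho^-1 ^+ 2 * sqdist x y by rewrite mulr_ge0 ?sqr_ge0 ?sqdist_ge0.
  rewrite ger0_norm// -[leRHS]mul1r ler_pM// ?H1//.
  by move: (_ * sqdist _ _) s0 => q ?; lra.
by rewrite normrM ger0_norm ?mulr_ge0// ler_wpM2l ?mulr_ge0 ?H2.
Qed.

End mean_value_kernel.

(** * Weighted averages over balls *)

Section averages.
Context {R : realType} {m : nat}.
Local Notation mu := (lebesgue_rV R m).
Local Notation rV := 'rV[R]_m.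
Local Notation L2T := (L2 (setT : set rV)).
Local Notation dot := (dotL2 (setT : set rV)).
Local Notation nrm := (normL2 (setT : set rV)).
Implicit Types (f g v psi : rV -> R) (x y w : rV) (r rho s : R).
Let mT : measurable (setT : set rV) := measurableT.

Definition avg v x rho : R := dot v (kern rho x).

Lemma itg_smooth_testM v f : itg setT v -> testf setT f -> itg setT (fun y => v y * f y).
Proof.
move=> Iv tf; have [M M0 HM] := testf_bound tf.
apply: (itg_le mT _ _ (itgZ mT M (itg_abs Iv))) => [|y _].
  by apply: measurable_funM; [exact: itg_meas Iv|exact: smooth_measurable (testf_smooth tf)].
by rewrite normrM mulrC ler_wpM2r.
Qed.

Lemma testf_laplace (D : set rV) f : testf D f -> testf D (laplace f).
Proof. by move=> tf; apply: testf_sum => i; do 2!apply: testf_pderiv. Qed.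

Lemma testf_thetaT rho x : 0 < rho -> testf setT (theta rho x).
Proof. by move=> r0; exact: testf_theta. Qed.

Lemma avg_derive v x r : itg setT v -> 0 < r ->
  is_derive r (1 : R) (avg v x) (r * (r^-1 ^+ m * dot v (laplace (theta r x)))).
Proof.
move=> Iv r0; have [C C0 HC] := @kern_derive_bound R m.
pose F rho y := v y * kern rho x y.
(* On the window []r / 2, 2 * r[] the radius stays away from 0, so a single integrable function
   dominates the derivative of the kernel. *)
have r2 : 0 < r / 2 by rewrite divr_gt0.
pose J : set R := [set` `]r / 2, 2 * r[].
have Ir : J r by rewrite /J /= in_itv /=; apply/andP; split; lra.
have pos rho : J rho -> 0 < rho.
  by rewrite /J /= in_itv /= => /andP[H _]; exact: lt_trans H.
have IF rho : J rho -> itg setT (F rho).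
  by move=> /pos H; apply: itg_smooth_testM => //; exact: testf_kern.
have DF rho y : 0 < rho -> is_derive rho (1 : R) (F ^~ y) (v y * (rho * (rho^-1 ^+ m * laplace (theta rho x) y))).
  by move=> H; exact: (is_deriveZ (v y) (kern_derive x y H)).
have dF rho y : J rho -> setT y -> derivable (F ^~ y) rho 1.
  by move=> /pos H _; have [] := DF rho y H.
have E rho y : 0 < rho -> partial1of2 F rho y = v y * (rho * (rho^-1 ^+ m * laplace (theta rho x) y)).
  by move=> H; rewrite partial1of2E; have [_ ->] := DF rho y H.
pose G y := C * (r / 2)^-1 ^+ m.+1 * `|v y|.
have G0 y : 0 <= G y by rewrite mulr_ge0// mulr_ge0// exprn_ge0// invr_ge0 ltW.
have IG : itg setT G by apply: itgZ => //; exact: itg_abs.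
have GF rho y : J rho -> setT y -> `|partial1of2 F rho y| <= G y.
  move=> Hr _; have H := pos _ Hr; rewrite E// normrM mulrC ler_wpM2r//.
  apply: le_trans (HC _ _ _ H) _; rewrite ler_wpM2l//.
  rewrite lerXn2r ?nnegrE ?invr_ge0 ?(ltW H) ?(ltW r2)//.
  by rewrite lef_pV2 ?posrE//; move: Hr; rewrite /J /= in_itv /= => /andP[/ltW].
have D1 := derivable_under_integral mT Ir IF dF G0 IG GF.
have D2 := differentiation_under_integral mT Ir IF dF G0 IG GF.
apply: DeriveDef; first exact: D1.
rewrite -derive1E [LHS]D2.
have tl := testf_laplace (testf_thetaT x r0).
have Il := itg_smooth_testM Iv tl.
rewrite mulrA -[RHS](RintegralZl _ mT Il); apply: eq_intg => // y _.
by rewrite E//; move: (laplace _ _) (_ ^+ m) => a b; ring.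
Qed.

(** The mean value inequality in integrated form: by [avg_derive] the derivative of the average is
    at least [- k rho], so adding [k rho^2 / 2] makes it nondecreasing. *)
Lemma avg_mono v x r r' k : itg setT v -> 0 < r -> r <= r' ->
  (forall rho, r < rho -> rho < r' -> - k <= rho^-1 ^+ m * dot v (laplace (theta rho x))) ->
  avg v x r <= avg v x r' + k * (r' ^+ 2 - r ^+ 2) / 2.
Proof.
move=> Iv r0; rewrite le_eqVlt => /orP[/eqP <- _|rr H]; first by rewrite subrr mulr0 mul0r addr0.
pose F rho := avg v x rho + k / 2 * (rho ^+ 2).
pose F' rho := rho * (rho^-1 ^+ m * dot v (laplace (theta rho x))) + k * rho.
have DF rho : 0 < rho -> is_derive rho (1 : R) F (F' rho).
  move=> rho0; apply: is_deriveD; first exact: avg_derive.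
  apply: (is_derive_eq (is_deriveZ (k / 2) (is_derive_expn 2 rho))).
  by rewrite /GRing.scale /= expr1; field.
have cF : {within `[r, r'], continuous F}.
  apply: derivable_within_continuous => rho; rewrite in_itv /= => /andP[Hr _].
  by have [] := DF rho (lt_le_trans r0 Hr).
have [c] := MVT rr (fun rho Hr => DF rho (lt_trans r0 (andP Hr).1)) cF.
rewrite in_itv /= => /andP[c1 c2] E.
have c0 := lt_trans r0 c1.
have : 0 <= F' c * (r' - r).
  rewrite mulr_ge0 ?subr_ge0 ?(ltW rr)// /F' [k * c]mulrC -mulrDr mulr_ge0 ?(ltW c0)//.
  by have := H c c1 c2; move: (_ * dot _ _) => a ?; lra.
rewrite -E /F; move: (avg v x r) (avg v x r') => a b ?.
have -> : k * (r' ^+ 2 - r ^+ 2) / 2 = k / 2 * r' ^+ 2 - k / 2 * r ^+ 2 by field.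
by lra.
Qed.

Definition kmass rho : R := (\int[mu]_y kern rho (0 : rV) y)%R.

Lemma intg_kern rho x : 0 < rho -> (\int[mu]_y kern rho x y)%R = kmass rho.
Proof.
move=> r0; rewrite -(intg_shift x (testf_itg (testf_kern x r0))).
by apply: eq_intg => // y _; rewrite kern_shift.
Qed.

(** The mass is not computed; it is constant because Laplacians of test functions have integral 0.
    The constant function 1 is not integrable, so [avg_mono] is applied to plus and minus the
    indicator of a ball containing all supports involved. *)
Lemma kmass_mono r r' : 0 < r -> r <= r' -> kmass r = kmass r'.
Proof.
move=> r0 rr; have r'0 := lt_le_trans r0 rr.
pose B : set rV := ball (0 : rV) (r' + 1).
have r10 : 0 < r' + 1 by rewrite ltr_wpDl// ltW.
have mB : measurable B by exact: measurable_ball_rV.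
have IB : itg setT (\1_B : rV -> R).
  have := @itg_bounded _ _ _ mB (cst 1 : rV -> R) 1.
  rewrite lebesgue_rV_ball// ltry => /(_ isT (measurable_cst _)) H.
  have /(itg_restrict _ mB) : itg B (cst 1 : rV -> R) by apply: H => y _; rewrite normr1.
  by congr itg; apply/funext => y; rewrite patchE indicE; case: ifP.
have out f rho : 0 < rho -> rho <= r' -> (forall y, rho <= `|y - 0| -> f y = 0) ->
    (\int[mu]_y (\1_B y * f y))%R = (\int[mu]_y f y)%R.
  move=> rho0 rr' f0; apply: eq_intg => // y _; rewrite indicE.
  case: (boolP (y \in B)) => [_|/negP yB]; first by rewrite mul1r.
  rewrite mul0r f0// (le_trans rr')// leNgt; apply/negP => H; apply: yB.
  by rewrite inE /B -ball_normE /= distrC (lt_trans H)// ltrDl.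
have A rho : 0 < rho -> rho <= r' -> avg \1_B 0 rho = kmass rho.
  by move=> rho0 H; apply: (out (kern rho 0) rho) => // y; exact: kern_out.
have Z rho : 0 < rho -> rho <= r' -> dot \1_B (laplace (theta rho 0)) = 0.
  move=> rho0 H; have tt := testf_thetaT 0 rho0.
  rewrite [LHS](out (laplace (theta rho 0)) rho)//.
    rewrite /laplace (intg_sum mT) => [|i]; last by apply: testf_itg; do 2!apply: testf_pderiv.
    by rewrite big1// => i _; apply: intg_pderiv0; exact: testf_pderiv.
  move=> y ry; rewrite laplace_theta /kprofile /kprofile' !expinv0 ?mulr0 ?subrr ?mulr0//; exact: arg_le0.
apply/eqP; rewrite eq_le -(A r r0 rr) -(A r' r'0 (lexx _)); apply/andP; split.
  have := @avg_mono \1_B 0 r r' 0 IB r0 rr; rewrite !mul0r addr0; apply => rho h1 h2.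
  by rewrite oppr0 Z ?mulr0// ?(lt_trans r0)// ltW.
have IN : itg setT (fun y => - \1_B y : R) by exact: itgN.
have := @avg_mono (fun y => - \1_B y) 0 r r' 0 IN r0 rr; rewrite !mul0r addr0 => H.
have N f : testf setT f -> dot (fun y => - \1_B y) f = - dot \1_B f.
  move=> tf; have := intgN mT (itg_smooth_testM IB tf) => <-.
  by apply: eq_intg => // y _; rewrite mulNr.
move: H; rewrite /avg !N; [|exact: testf_kern..]; rewrite lerN2; apply => rho h1 h2.
have rho0 := lt_trans r0 h1.
by rewrite oppr0 N ?Z ?oppr0 ?mulr0// ?ltW//; apply: testf_laplace; exact: testf_thetaT.
Qed.

Lemma kmass_const r r' : 0 < r -> 0 < r' -> kmass r = kmass r'.
Proof.
move=> r0 r'0; have [H|/ltW H] := leP r r'; first exact: kmass_mono.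
by apply/esym; exact: kmass_mono.
Qed.

Lemma kern_gt0 rho x y : 0 < rho -> `|y - x| <= rho / m.+1%:R -> 0 < kern rho x y.
Proof.
move=> r0 yx; rewrite /kern mulr_gt0// mulr_gt0 ?exprn_gt0 ?invr_gt0//.
have H : 0 < 1 - rho^-1 ^+ 2 * sqdist x y.
  have := sqdist_le (divr_ge0 (ltW r0) (ler0n _ _)) yx; rewrite subr_gt0 => H.
  apply: (@le_lt_trans _ _ (rho^-1 ^+ 2 * (m%:R * (rho / m.+1%:R) ^+ 2))).
    by rewrite ler_wpM2l ?sqr_ge0.
  have -> : rho^-1 ^+ 2 * (m%:R * (rho / m.+1%:R) ^+ 2) = m%:R / m.+1%:R ^+ 2 :> R.
    by field; rewrite (gt_eqF r0) nat1r pnatr_eq0.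
  rewrite ltr_pdivrMr ?exprn_gt0// mul1r -natrX ltr_nat expnS expn1.
  by apply: leq_trans (ltnSn m) _; exact: leq_pmulr.
rewrite /kprofile expinvE// hornerXn mulr_gt0 ?expR_gt0// exprn_gt0// invr_gt0//.
Qed.

Lemma kmass_gt0 r : 0 < r -> 0 < kmass r.
Proof.
move=> r0; have I := testf_itg (testf_kern (0 : rV) r0).
have k0 y : 0 <= kern r (0 : rV) y by exact: kern_ge0.
rewrite lt_def Rintegral_ge0 ?andbT//; apply/eqP => H.
have r1 : 0 < r / m.+1%:R by rewrite divr_gt0.
have := intg_eq0 mT I (fun y _ => k0 y) H => -[N [mN N0 HN]].
pose B : set rV := ball (0 : rV) (r / m.+1%:R).
have sB : B `<=` N.
  move=> y; rewrite /B -ball_normE /= => yB; apply: HN => /= Hy.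
  have : 0 < kern r (0 : rV) y by apply: kern_gt0 => //; rewrite distrC ltW.
  by rewrite Hy// ltxx.
have : (mu B <= 0)%E.
  by rewrite -N0; apply: le_measure; rewrite ?inE//; exact: measurable_ball_rV.
rewrite /B lebesgue_rV_ball// lee_fin leNgt exprn_gt0//.
by rewrite mulr_gt0.
Qed.

Lemma avg_bound v x r : L2T v -> 0 < r -> `|avg v x r| <= nrm v * nrm (kern r (0 : rV)).
Proof.
move=> Lv r0; have Lk z : L2T (kern r z) by apply: testf_L2 => //; exact: testf_kern.
apply: le_trans (dot_CS mT Lv (Lk x)) _; rewrite -(normL2_shift x (Lk x)).
by under eq_fun do rewrite kern_shift.
Qed.

Lemma avg_continuous v r : L2T v -> 0 < r -> continuous (avg v ^~ r).
Proof.
move=> Lv r0; have Lk z : L2T (kern r z) by apply: testf_L2 => //; exact: testf_kern.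
suff H (x : rV) : avg v z r @[z --> x] --> avg v x r by move=> x; exact: H.
apply: (proj2 (@cvgrPdist_le R R^o rV (nbhs x) (nbhs_filter x) (avg v ^~ r) (avg v x r))) => e e0.
have e1 : 0 < e / (nrm v + 1) by rewrite divr_gt0// ltr_wpDl// normL2_ge0.
have [d d0 Hd] := test_shift_cvg (testf_kern x r0) e1.
apply/nbhs_ballP; exists d => //= z; rewrite -ball_normE /= => xz.
rewrite /avg -(dotBr mT (Lk x) (Lk z) Lv) /=.
have L3 : L2T (fun y => kern r x y - kern r z y) by exact: L2B.
apply: le_trans (dot_CS mT Lv L3) _.
have E : nrm (fun y => kern r x y - kern r z y) <= e / (nrm v + 1).
  have K y : kern r z y = kern r x (y + (x - z)).
    rewrite /kern; suff -> : sqdist z y = sqdist x (y + (x - z)) by [].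
    by apply: eq_bigr => i _; rewrite !mxE; congr (_ ^+ 2); ring.
  have -> : (fun y => kern r x y - kern r z y) = (fun y => - (kern r x (y + (x - z)) - kern r x y)).
    by apply/funext => y; rewrite K opprB.
  by rewrite normL2N; exact: Hd.
exact: (frac_le (normL2_ge0 _ v) (ltW e0) E).
Qed.

Lemma avg_measurable v r : L2T v -> 0 < r -> measurable_fun setT (avg v ^~ r).
Proof. by move=> Lv r0; apply: continuous_measurable_rV; exact: avg_continuous. Qed.

Lemma itg_avgM f v r : itg setT f -> L2T v -> 0 < r -> itg setT (fun x => f x * avg v x r).
Proof.
move=> If Lv r0.
apply: (itg_le mT _ _ (itgZ mT (nrm v * nrm (kern r (0 : rV))) (itg_abs If))) => [|y _].
  by apply: measurable_funM; [exact: itg_meas If|exact: avg_measurable].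
by rewrite normrM mulrC ler_wpM2r// avg_bound.
Qed.

Lemma measurable_rV_sub : measurable_fun setT (fun p : rV * rV => p.1 - p.2).
Proof.
apply: measurable_fun_rV => i.
rewrite [X in measurable_fun _ X](_ : _ = fun p : rV * rV => rV_coord i p.1 - rV_coord i p.2); last first.
  by apply/funext => p; rewrite /= /rV_coord !mxE.
apply: measurable_funB; apply: measurableT_comp => //; exact: measurable_rV_coord.
Qed.

(** Tonelli and the symmetry of the kernel. It moves the average from an L^2 function to a test
    function, whose averages converge at every point. *)
Lemma avg_sym f v r : itg setT f -> itg setT v -> L2T f -> L2T v -> (forall x, 0 <= f x) -> (forall x, 0 <= v x) ->
  0 < r -> (\int[mu]_x (f x * avg v x r) = \int[mu]_x (v x * avg f x r))%R.
Proof.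
move=> If Iv Lf Lv f0 v0 r0; have Lk z : L2T (kern r z) by apply: testf_L2 => //; exact: testf_kern.
pose F (p : rV * rV) : \bar R := (f p.1 * (v p.2 * kern r p.1 p.2))%:E.
have k0 p : 0 <= f p.1 * (v p.2 * kern r p.1 p.2) by rewrite mulr_ge0// mulr_ge0// kern_ge0.
have mF : measurable_fun setT F.
  apply/measurable_EFinP; apply: measurable_funM.
    by apply: (measurableT_comp (itg_meas If)); exact: measurable_fst.
  apply: measurable_funM.
    by apply: (measurableT_comp (itg_meas Iv)); exact: measurable_snd.
  rewrite [X in measurable_fun _ X](_ : _ = kern r (0 : rV) \o (fun p : rV * rV => p.1 - p.2)).
    apply: measurableT_comp measurable_rV_sub.
    by apply: smooth_measurable => //; exact: smooth_kern.
  by apply/funext => p /=; rewrite -(kern_shift r p.2) subrK kernC.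
have /= := fubini_tonelli (m1 := mu) (m2 := mu) F mF (fun p => k0 p).
have I1 x : (\int[mu]_y F (x, y) = (f x * avg v x r)%:E)%E.
  have I := L2_itgM mT Lv (Lk x); rewrite /avg -(RintegralZl _ mT I) /Rintegral fineK//.
  exact: integrable_fin_num (itgZ mT _ I).
have I2 y : (\int[mu]_x F (x, y) = (v y * avg f y r)%:E)%E.
  have I := L2_itgM mT Lf (Lk y); rewrite /avg -(RintegralZl _ mT I) /Rintegral fineK.
    by apply: eq_integral => x _; rewrite /F /= kernC; congr EFin; ring.
  exact: integrable_fin_num (itgZ mT _ I).
have E1 : (\int[mu]_x \int[mu]_y F (x, y) = \int[mu]_x (f x * avg v x r)%:E)%E.
  by apply: eq_integral => x _; exact: I1.
have E2 : (\int[mu]_y \int[mu]_x F (x, y) = \int[mu]_y (v y * avg f y r)%:E)%E.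
  by apply: eq_integral => x _; exact: I2.
by move=> H; congr fine; exact: (etrans (esym E1) (etrans H E2)).
Qed.

Lemma avg_test_cvg psi y r0 : testf setT psi -> 0 < r0 ->
  avg psi y (r0 / n.+1%:R) @[n --> \oo] --> kmass r0 * psi y.
Proof.
move=> tp r00; have sp := testf_smooth tp.
have rn n : 0 < r0 / n.+1%:R by rewrite divr_gt0.
apply/cvgrPdist_le => e e0; have M0 := kmass_gt0 r00.
have e1 : 0 < e / kmass r0 by rewrite divr_gt0.
have cy : psi x @[x --> y] --> psi y by exact: smooth_continuous.
have /cvgrPdist_le/(_ _ e1)/nbhs_ballP[d /= d0 Hd] := cy.
have c : (fun n : nat => r0 * n.+1%:R^-1) @ \oo --> (0 : R) by exact: cvg_natSinv.
move/cvgrPdist_lt : c => /(_ _ d0); apply: filterS => n; rewrite sub0r normrN gtr0_norm// => rd.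
have Lk z : L2T (kern (r0 / n.+1%:R) z) by apply: testf_L2 => //; exact: testf_kern.
have Ik := testf_itg (testf_kern y (rn n)).
have I1 : itg setT (fun x => psi y * kern (r0 / n.+1%:R) y x) by exact: itgZ.
have I2 : itg setT (fun x => psi x * kern (r0 / n.+1%:R) y x).
  by apply: testf_itg; apply: testfMl => //; exact: testf_kern.
have -> : kmass r0 * psi y = (\int[mu]_x (psi y * kern (r0 / n.+1%:R) y x))%R.
  by rewrite RintegralZl// intg_kern// (kmass_const r00 (rn n)) mulrC.
rewrite /avg /dotL2 -RintegralB//; apply: le_trans (le_normr_Rintegral mT _) _; first exact: itgB.
have -> : e = (\int[mu]_x (e / kmass r0 * kern (r0 / n.+1%:R) y x))%R.
  by rewrite RintegralZl// intg_kern// -(kmass_const r00 (rn n)) mulfVK// gt_eqF.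
apply: ae_le_intg => //; [by apply: itg_abs; exact: itgB|exact: itgZ|].
apply: aeW => x _; rewrite -mulrBl normrM (ger0_norm (kern_ge0 _ _ (rn n))).
have [H|H] := leP (r0 / n.+1%:R) `|x - y|; first by rewrite kern_out// !mulr0.
rewrite ler_wpM2r ?kern_ge0//; apply: Hd; rewrite -ball_normE /= distrC; exact: lt_trans rd.
Qed.

(* Averages converge weakly to the function, which is all that is used of Lebesgue differentiation. *)
Lemma avg_weak_cvg v psi r0 : itg setT v -> L2T v -> (forall x, 0 <= v x) -> testf setT psi -> (forall x, 0 <= psi x) ->
  0 < r0 -> (\int[mu]_x (psi x * avg v x (r0 / n.+1%:R)))%R @[n --> \oo] --> kmass r0 * dot v psi.
Proof.
move=> Iv Lv v0 tp p0 r00; have [M M0 HM] := testf_bound tp.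
have rn n : 0 < r0 / n.+1%:R by rewrite divr_gt0.
have Lp : L2T psi by exact: testf_L2 tp.
have Ip := testf_itg tp; have mv := itg_meas Iv.
have mA n : measurable_fun setT (fun x => v x * avg psi x (r0 / n.+1%:R)).
  by apply: measurable_funM => //; exact: avg_measurable.
have mB : measurable_fun setT (fun x => v x * (kmass r0 * psi x)).
  by apply: measurable_funM => //; apply: measurable_funM => //; exact: itg_meas Ip.
have c (x : rV) : (fun n => v x * avg psi x (r0 / n.+1%:R)) @ \oo --> v x * (kmass r0 * psi x).
  by apply: cvgMr; exact: avg_test_cvg.
have b (x : rV) n : `|v x * avg psi x (r0 / n.+1%:R)| <= kmass r0 * M * `|v x|.
  rewrite normrM [leRHS]mulrC ler_wpM2l// (kmass_const r00 (rn n)) -(intg_kern x (rn n)).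
  have Ik := testf_itg (testf_kern x (rn n)).
  have I2 : itg setT (fun y => psi y * kern (r0 / n.+1%:R) x y).
    by apply: testf_itg; apply: testfMl; [case: tp|exact: testf_kern].
  apply: le_trans (le_normr_Rintegral mT I2) _; rewrite [leRHS]mulrC -(RintegralZl M mT Ik).
  apply: ae_le_intg => //; [exact: itg_abs|exact: itgZ|].
  apply: aeW => y _; rewrite normrM (ger0_norm (kern_ge0 _ _ (rn n))).
  by rewrite ler_wpM2r ?kern_ge0.
have [_ H] := @dct R m setT mT (fun n x => v x * avg psi x (r0 / n.+1%:R)) (fun x => v x * (kmass r0 * psi x))
  (fun x => kmass r0 * M * `|v x|) mA mB (itgZ mT _ (itg_abs Iv))
  (aeW _ (fun x _ => c x)) (aeW _ (fun x n _ => b x n)).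
have -> : kmass r0 * dot v psi = (\int[mu]_x (v x * (kmass r0 * psi x)))%R.
  rewrite /dotL2 -(RintegralZl _ mT); last exact: L2_itgM.
  by apply: eq_intg => // x _; ring.
by apply: eq_cvgn H => n; exact: avg_sym.
Qed.

End averages.

(** * Pointwise bounds *)

Section pointwise_bounds.
Context {R : realType} {m : nat}.
Local Notation mu := (lebesgue_rV R m).
Local Notation rV := 'rV[R]_m.
Implicit Types (f g u v w c psi : rV -> R) (x y : rV) (r rho : R).
Variables (D : set rV) (oD : open D) (bD : bounded_set D) (m0 : (0 < m)%N) (sbD : smooth_boundary D).
Variables (lam : nat -> R) (phi : nat -> rV -> R).
Hypothesis heig : dirichlet_eigensystem D lam phi.
Let mD : measurable D := measurable_open_rV oD.
Let fD : (mu D < +oo)%E := measurable_bounded_rV_lty mD bD.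
Let mT : measurable (setT : set rV) := measurableT.
Let dens := eigen_dense oD bD heig.
Local Notation dot := (dotL2 D).
Local Notation nrm := (normL2 D).

Lemma dot_patchT f g : dotL2 setT (f \_ D) g = dot f g.
Proof.
rewrite /dotL2 [RHS]Rintegral_mkcond; apply: eq_intg => // x _; rewrite !patchE.
by case: ifP => // _; rewrite mul0r.
Qed.

Lemma L2_patchT f : L2 D f -> L2 setT (f \_ D).
Proof. by move/(L2_restrict f mD). Qed.

Lemma itg_patchT f : L2 D f -> itg setT (f \_ D).
Proof. by move=> Lf; apply/(itg_restrict f mD); exact: (L2_itg mD fD Lf). Qed.

Lemma patch_ge0 f x : (forall y, 0 <= f y) -> 0 <= (f \_ D) x.
Proof. by move=> f0; rewrite patchE; case: ifP. Qed.

Lemma dot_laplace u du ddu f : H2 D u du ddu -> testf D f -> dot u (laplace f) = dot (lap ddu) f.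
Proof.
move=> Hu tf; have [[Lu _ Wu] Hd] := Hu; rewrite dotC /laplace (dot_suml mD)//; last first.
  by move=> i; apply: testf_L2D => //; do 2!apply: testf_pderiv.
rewrite -[RHS]opprK -(dot_pderiv_lap oD Hu tf) -sumrN; apply: eq_bigr => i _.
by rewrite dotC (Wu i _ (testf_pderiv i tf)).
Qed.

Lemma avg_gt0 u x r : L2 D u -> (\forall y \ae mu, D y -> 0 < u y) -> (forall y, 0 <= u y) ->
  0 < r -> [set y : rV | `|y - x| < r] `<=` D -> 0 < avg (u \_ D) x r.
Proof.
move=> Lu u0 u1 r0 BD; rewrite /avg dot_patchT.
have Lk : L2 D (kern r x) by apply: testf_L2 => //; exact: testf_kern.
have k0 y : D y -> 0 <= u y * kern r x y by rewrite mulr_ge0 ?kern_ge0.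
rewrite lt_def Rintegral_ge0// andbT; apply/eqP => H.
have r1 : 0 < r / m.+1%:R by rewrite divr_gt0.
have H0 := intg_eq0 mD (L2_itgM mD Lu Lk) k0 H.
have [N [mN N0 HN]] : mu.-negligible [set y | `|y - x| < r / m.+1%:R].
  have [N [mN N0 HN]] : \forall y \ae mu, ~ `|y - x| < r / m.+1%:R.
    apply: filterS2 H0 u0 => y Hy uy yx.
    have Dy : D y.
      apply: BD => /=; apply: lt_le_trans yx _.
      by rewrite ler_pdivrMr// ler_peMr ?(ltW r0)// ler1n.
    have := mulr_gt0 (uy Dy) (kern_gt0 r0 (ltW yx)); rewrite Hy// ltxx//.
  by exists N; split => // y /= yx; apply: HN => /= /(_ yx).
pose B : set rV := ball x (r / m.+1%:R).
have sB : B `<=` N by move=> y; rewrite /B -ball_normE /= distrC => ?; apply: HN.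
have : (mu B <= 0)%E.
  by rewrite -N0; apply: le_measure; rewrite ?inE//; exact: measurable_ball_rV.
by rewrite /B lebesgue_rV_ball// lee_fin leNgt exprn_gt0// mulr_gt0.
Qed.

(* The first eigenfunction is superharmonic, so that its averages over small balls are
   at least its averages over larger ones, which are positive and continuous. *)
Lemma phi0_interior_pos K : compact K -> K `<=` D -> exists2 c : R, 0 < c &
  \forall x \ae mu, K x -> c <= phi 0%N x.
Proof.
move=> cK KD; have Lp := phi_L2 heig 0; have Hp := phi_H2 heig 0.
(* The positive part of the first eigenfunction: nonnegative everywhere, and equal to [phi 0%N]
   almost everywhere on [D]. *)
pose p x := npart (- phi 0%N x); have p0 x : 0 <= p x by exact: npart_ge0.
have LP : L2 D p by apply: L2_npart => //; exact: L2N.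
have pphi : \forall x \ae mu, D x -> p x = phi 0%N x.
  apply: filterS (eig_phi1_gt0 heig) => x H Dx.
  by rewrite /p /npart opprK max_l// ltW// H.
have ppos : \forall x \ae mu, D x -> 0 < p x.
  by apply: filterS2 pphi (eig_phi1_gt0 heig) => x H1 H2 Dx; rewrite H1// H2.
have [d d0 Hd] := compact_thick cK oD KD.
have d2 : 0 < d / 2 by rewrite divr_gt0.
have [z [K' [sz z0 zK cK' [zK' K'K]]]] := cutoff cK d2.
have BD x : K' x -> [set y : rV | `|y - x| < d / 2] `<=` D.
  move=> /K'K [k Kk xk] y /= yx; rewrite -(subrKC k y); apply: Hd => //.
  rewrite -(subrKA x) (le_lt_trans (ler_normD _ _))// [ltRHS](splitr d) ltr_leD//.
pose A := p \_ D; have IA := itg_patchT LP; have LA := L2_patchT LP.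
pose r0 := d / 4; have r00 : 0 < r0 by rewrite divr_gt0.
have r0d : r0 < d / 2 by rewrite /r0; lra.
have mono x r : K' x -> 0 < r -> r <= r0 -> avg A x r0 <= avg A x r.
  move=> K'x rp rr.
  have IN : itg setT (fun y => - A y) by exact: itgN.
  have N f : testf setT f -> dotL2 setT (fun y => - A y) f = - dotL2 setT A f.
    by move=> tf; rewrite dotNl//; exact: testf_L2 tf.
  have := @avg_mono _ _ (fun y => - A y) x r r0 0 IN rp rr; rewrite !mul0r addr0 /avg.
  rewrite !N; [|exact: testf_kern..]; rewrite lerN2; apply => rho h1 h2.
  have rho0 := lt_trans rp h1.
  have tt : testf D (theta rho x).
    apply: testf_theta => // y /= yx; apply: (BD x K'x) => /=.
    by apply: le_lt_trans yx _; exact: lt_trans r0d.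
  rewrite N; last by apply: testf_laplace; exact: testf_thetaT.
  rewrite oppr0 mulrN -mulNr mulNr oppr_ge0 mulr_ge0_le0// ?exprn_ge0 ?invr_ge0 ?(ltW rho0)//.
  rewrite dot_patchT.
  have tl := testf_laplace tt.
  rewrite (dot_ae mD LP (testf_L2D oD tl) Lp (testf_L2D oD tl) pphi); last exact: aeW.
  rewrite (dot_laplace Hp tt).
  have LN : L2 D (fun x => - (lam 0%N * phi 0%N x)) by apply: L2N => //; exact: L2Z.
  have Lt := testf_L2D oD tt.
  rewrite (dot_ae mD (L2_lap oD Hp) Lt LN Lt (phi_lap oD bD heig 0)); last exact: aeW.
  rewrite (dotNl mD (L2Z mD _ Lp) Lt) (dotZl mD _ Lp Lt) oppr_le0 mulr_ge0 ?(ltW (eig_gt0 heig))//.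
  rewrite -(dot_ae mD LP Lt Lp Lt pphi); last exact: aeW.
  by apply: Rintegral_ge0 => y _; rewrite mulr_ge0 ?theta_ge0.
have Apos x : K' x -> 0 < avg A x r0.
  by move=> K'x; apply: avg_gt0 => // y /= yx; apply: (BD x K'x) => /=; exact: lt_trans r0d.
have [c c0 Hc] := compact_pos_min cK' (avg_continuous LA r00) Apos.
have M0 := @kmass_gt0 R m r0 r00.
pose M := @kmass R m r0; have {}M0 : 0 < M by exact: M0.
(* The inequality is wanted on [K]; multiplied by the cutoff [z] it becomes one on all of [D], which
   can be checked against nonnegative test functions. *)
pose q x := (M * p x - c) * z x.
have Lc : L2 D (cst c : rV -> R) by exact: L2_cst.
have Lz := smooth_L2 oD bD sz.
have Lq : L2 D q.
  rewrite (_ : q = fun x => z x * (M * p x - c)); last by apply/funext => x; rewrite mulrC.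
  by apply: L2_smoothM => //; apply: (L2B mD _ Lc); exact: L2Z.
have tz : testf setT z by split => //; exists K'; split.
suff q0 : \forall x \ae mu, D x -> 0 <= q x.
  exists (c / M); first by rewrite divr_gt0.
  apply: filterS2 q0 pphi => x qx px Kx; have Dx := KD _ Kx.
  rewrite ler_pdivrMr// -px// mulrC -subr_ge0 -(pmulr_lge0 _ (zK _ Kx)); exact: qx.
apply: (nonneg_of_test oD bD dens Lq) => f tf f0.
have tzf : testf D (fun x => z x * f x) by exact: testfMl.
have zf0 x : 0 <= z x * f x by rewrite mulr_ge0.
have W := avg_weak_cvg IA LA (fun x => patch_ge0 x p0) (testfT tzf) zf0 r00.
have Izf := testf_itg (testfT tzf).
have -> : dot q f = M * dotL2 setT A (fun x => z x * f x) - c * (\int[mu]_x (z x * f x))%R.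
  have Lzf := testf_L2D oD tzf.
  rewrite dot_patchT -(dotZl mD _ LP Lzf) -(@intg_supp _ _ D); last by move=> x /(testf_out tzf).
  have I1 := L2_itgM mD (L2Z mD (M) LP) Lzf.
  have I2 : itg D (fun x => z x * f x) by exact: (L2_itg mD fD).
  rewrite -(RintegralZl c mD I2) -(RintegralB mD I1); last exact: itgZ.
  by apply: eq_intg => // x _; rewrite /q; ring.
rewrite subr_ge0; apply: (ler_cvg_to (cvg_cst _) W); apply: nearW => n.
rewrite -(RintegralZl c mT Izf); apply: ae_le_intg => //; first exact: itgZ.
  by apply: itg_avgM => //; rewrite divr_gt0.
apply: aeW => x _; rewrite mulrC.
have [K'x|K'x] := pselect (K' x); last by rewrite zK'// mul0r !mul0r.
apply: ler_wpM2l => //.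
have rn : 0 < r0 / n.+1%:R by rewrite divr_gt0.
apply: le_trans (Hc _ K'x) _; apply: mono => //.
by rewrite ler_pdivrMr// ler_peMr ?(ltW r00)// ler1n.
Qed.

Lemma absorb_arith (A1 A0 k a r1 r0 S c : R) : A1 <= A0 + k * (r0 ^+ 2 - r1 ^+ 2) / 2 -> A0 <= a -> 0 <= k ->
  k * r0 ^+ 2 <= S + c -> A1 <= a + c / 2 + S / 2.
Proof.
move=> H1 H2 k0 H3; have := mulr_ge0 k0 (sqr_ge0 r1); rewrite mulrBr in H1.
by move: (k * r0 ^+ 2) (k * r1 ^+ 2) H1 H3 => p q *; lra.
Qed.

Lemma le_double (r rho s r0 : R) : r <= rho -> rho <= s -> s <= r0 -> 0 <= s -> r <= 2 * s <= 2 * r0.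
Proof. by move=> *; apply/andP; split; lra. Qed.

Lemma le_double_self (r r0 : R) : r <= r0 -> 0 <= r0 -> r <= r <= 2 * r0.
Proof. by move=> *; apply/andP; split; lra. Qed.

Lemma kern_bound : exists2 C : R, 0 <= C & forall r x y, 0 < r -> `|kern r x y| <= C * r^-1 ^+ m.
Proof.
have [C C0 HC] := expinv_bounded ('X^2 : {poly R}).
exists (2 * C) => [|r x y r0]; first by rewrite mulr_ge0.
have t0 : 0 <= r^-1 ^+ m by rewrite exprn_ge0// invr_ge0 ltW.
rewrite /kern normrM normrM (ger0_norm t0) ger0_norm// -mulrA ler_wpM2l// mulrC ler_wpM2r//.
exact: HC.
Qed.

Lemma avg_le v r : itg setT v -> 0 < r -> exists S, forall x rho, r <= rho -> `|avg v x rho| <= S.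
Proof.
move=> Iv r0; have [C C0 HC] := kern_bound.
exists (C * r^-1 ^+ m * (\int[mu]_x `|v x|)%R) => x rho rr; have rho0 := lt_le_trans r0 rr.
have Ik := itg_smooth_testM Iv (testf_kern x rho0).
apply: le_trans (le_normr_Rintegral mT Ik) _; rewrite -(RintegralZl _ mT (itg_abs Iv)).
apply: ae_le_intg => //; [exact: itg_abs|by apply: itgZ => //; exact: itg_abs|].
apply: aeW => y _; rewrite normrM mulrC ler_wpM2r//.
apply: le_trans (HC _ _ _ rho0) _; rewrite ler_wpM2l// lerXn2r ?nnegrE ?invr_ge0 ?(ltW rho0) ?(ltW r0)//.
by rewrite lef_pV2.
Qed.

(** Iterating the self-improvement from [S] to [b + S / 2] from any finite starting bound [S0] gives
    a bound independent of [S0]. *)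
Lemma halving (I : Type) (P : I -> Prop) (F : I -> R) (b S0 : R) : (forall i, P i -> F i <= S0) -> 0 <= b ->
  (forall S, 0 <= S -> (forall i, P i -> F i <= S) -> forall i, P i -> F i <= b + S / 2) ->
  forall i, P i -> F i <= 2 * b.
Proof.
move=> H0 b0 H; pose T (n : nat) := 2 * b + `|S0| * 2^-1 ^+ n.
have T0 n : 0 <= T n by rewrite addr_ge0 ?mulr_ge0 ?exprn_ge0 ?invr_ge0.
have HT n i : P i -> F i <= T n.
  elim: n i => [i Pi|n IH i Pi].
    rewrite /T expr0 mulr1; apply: le_trans (H0 _ Pi) _; have := ler_norm S0; lra.
  apply: le_trans (H _ (T0 n) IH i Pi) _; rewrite /T exprSr.
  by move: (2^-1 ^+ n) => q; lra.
move=> i Pi; have c : T @ \oo --> 2 * b + `|S0| * 0.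
  apply: cvgD; first exact: cvg_cst.
  apply: cvgMr; apply: cvg_expr; rewrite ger0_norm ?invr_ge0// invf_lt1//; lra.
rewrite -[leRHS]addr0 -(mulr0 `|S0|); apply: (ler_cvg_to (cvg_cst _) c); apply: nearW => n; exact: HT.
Qed.

(* The zero extension of [y^-] is a subsolution on the whole space, so its averages over small
   balls are controlled, after absorption, by averages over balls of a fixed radius. *)
Lemma npart_bounded u du ddu (lm E : R) e : H2 D u du ddu -> H10 D u du -> 0 <= lm -> 0 <= E ->
  (\forall x \ae mu, D x -> lap ddu x = - (lm * u x) + e x) -> L2 D e ->
  (\forall x \ae mu, D x -> `|e x| <= E) ->
  exists2 S : R, 0 <= S & \forall x \ae mu, D x -> npart (u x) <= S.
Proof.
move=> Hu Hu0 lm0 E0 equ Le eE; have Lu := (H10_H1 Hu0).(H1_L2).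
pose p x := npart (u x); have p0 x : 0 <= p x by exact: npart_ge0.
have LP : L2 D p by exact: L2_npart.
pose A := p \_ D; have IA : itg setT A := itg_patchT LP; have LA : L2 setT A := L2_patchT LP.
pose B := expR 2 * 2 ^+ m : R; have B0 : 0 <= B by rewrite mulr_ge0 ?expR_ge0 ?exprn_ge0.
(* Small enough for [B * lm * R0 ^+ 2 <= 1], so that only half of the unknown supremum returns on
   the right. *)
pose R0 := (1 + B * lm)^-1; have BL0 : 0 <= B * lm by rewrite mulr_ge0.
have R00 : 0 < R0 by rewrite invr_gt0 ltr_pwDl.
have M0 := @kmass_gt0 R m R0 R00; pose M := @kmass R m R0.
have low x rho : 0 < rho -> - (B * (lm * avg A x (2 * rho) + E * M)) <=
    rho^-1 ^+ m * dotL2 setT A (laplace (theta rho x)).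
  move=> rho0; have r2 : 0 < 2 * rho by rewrite mulr_gt0.
  have st := smooth_theta rho x; have tt := testf_thetaT x rho0.
  have := kato oD bD Hu Hu0 lm0 equ Le eE st (fun z => theta_ge0 rho x z).
  rewrite dot_patchT => K.
  have tp : 0 <= rho^-1 ^+ m by rewrite exprn_ge0// invr_ge0 ltW.
  apply: le_trans (ler_wpM2l tp K); rewrite mulrN lerN2.
  have Lk : L2 D (kern (2 * rho) x) by apply: testf_L2 => //; exact: testf_kern.
  have Lt : L2 D (theta rho x) by exact: smooth_L2.
  have Lp1 : L2 D (fun z => lm * p z + E) by apply: (L2D mD (L2Z mD lm LP)); exact: L2_cst.
  have H1 : dot (fun z => lm * p z + E) (theta rho x) <=
      B * rho ^+ m * dot (fun z => lm * p z + E) (kern (2 * rho) x).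
    rewrite -(RintegralZl _ mD (L2_itgM mD Lp1 Lk)); apply: ae_le_intg => //.
    - exact: L2_itgM.
    - by apply: itgZ => //; exact: L2_itgM.
    - apply: aeW => z _; rewrite mulrCA ler_wpM2l ?addr_ge0 ?mulr_ge0//.
      by have := theta_le_kern x z rho0; rewrite /B mulrA.
  apply: le_trans (ler_wpM2l tp H1) _.
  have -> (a : R) : rho^-1 ^+ m * (B * rho ^+ m * a) = B * a.
    have := mulVf (lt0r_neq0 rho0) => V.
    have VV : rho^-1 ^+ m * rho ^+ m = 1 by rewrite -exprMn V expr1n.
    rewrite -[in RHS](mul1r (B * a)) -VV; move: (_ ^+ m) (_ ^+ m) => s t; ring.
  apply: (ler_wpM2l B0); have LE : L2 D (cst E : rV -> R) by exact: L2_cst.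
  have -> : dot (fun z => lm * p z + E) (kern (2 * rho) x) =
      lm * dot p (kern (2 * rho) x) + dot (cst E) (kern (2 * rho) x).
    by rewrite -(dotZl mD lm LP Lk); exact: (dotDl mD (L2Z mD lm LP) LE Lk).
  rewrite -(dot_patchT p) lerD2l /dotL2 (RintegralZl E mD (L2_itg mD fD Lk)).
  apply: (ler_wpM2l E0); rewrite /M (kmass_const R00 r2) -(intg_kern x r2) [leLHS]Rintegral_mkcond.
  have Ik := testf_itg (testf_kern x r2).
  apply: ae_le_intg => //; first by apply/(itg_restrict _ mD); exact: L2_itg.
  by apply: aeW => z _; rewrite patchE; case: ifP => // _; exact: kern_ge0.
have [a Ha] := avg_le IA R00.
have aE x : avg A x R0 <= `|a|.
  by apply: le_trans (ler_norm _) _; apply: le_trans (Ha x R0 (lexx _)) (ler_norm a).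
pose b := `|a| + B * E * M * R0 ^+ 2 / 2.
have b0 : 0 <= b.
  by rewrite addr_ge0// mulr_ge0 ?invr_ge0// mulr_ge0 ?sqr_ge0// mulr_ge0 ?(ltW M0)// mulr_ge0.
have bl : B * lm * R0 ^+ 2 <= 1.
  have R1 : R0 <= 1 by rewrite invf_le1 ?ltr_pwDl// lerDl.
  have BR : B * lm * R0 <= 1 by rewrite ler_pdivrMr ?ltr_pwDl// mul1r lerDr.
  by rewrite expr2 mulrA; have := R00; move: (B * lm) BL0 BR R1 => q ? ? ? ?; nra.
have bd r : 0 < r -> r <= R0 -> forall x, avg A x r <= 2 * b.
  move=> r0 rR x; have [S0 HS0] := avg_le IA r0.
  (* The supremum is taken over radii from [r] up to [2 * R0], because [low] bounds what happens at
     radius [s] by an average at radius [2 * s]. *)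
  apply: (@halving (rV * R) (fun q => r <= q.2 <= 2 * R0) (fun q => avg A q.1 q.2) b S0 _ b0 _ (x, r)) => /=.
  - move=> [z rho] /= /andP[h1 _]; apply: le_trans (ler_norm _) _; exact: HS0.
  - move=> S S0' HS [z rho] /= /andP[h1 h2]; have rho0 := lt_le_trans r0 h1.
    have [hR|hR] := leP R0 rho.
      apply: le_trans (ler_norm _) _; apply: le_trans (Ha z rho hR) _.
      apply: le_trans (ler_norm _) _; rewrite /b -addrA lerDl addr_ge0 ?divr_ge0//.
      by rewrite mulr_ge0 ?sqr_ge0// mulr_ge0 ?(ltW M0)// mulr_ge0.
    pose k := B * (lm * S + E * M).
    have AM : avg A z rho <= avg A z R0 + k * (R0 ^+ 2 - rho ^+ 2) / 2.
      apply: (avg_mono IA rho0 (ltW hR)) => s s1 s2.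
      have s0 := lt_trans rho0 s1; apply: le_trans (low z s s0).
      rewrite lerN2 /k; apply: (ler_wpM2l B0); rewrite lerD2r; apply: (ler_wpM2l lm0).
      apply: (HS (z, 2 * s)); exact: le_double h1 (ltW s1) (ltW s2) (ltW s0).
    have k0 : 0 <= k by rewrite mulr_ge0// addr_ge0 ?mulr_ge0 ?(ltW M0).
    have kR : k * R0 ^+ 2 <= S + B * E * M * R0 ^+ 2.
      have -> : k * R0 ^+ 2 = B * lm * R0 ^+ 2 * S + B * E * M * R0 ^+ 2 by rewrite /k; ring.
      by rewrite lerD2r ler_piMl.
    exact: absorb_arith AM (aE z) k0 kR.
  - exact: le_double_self rR (ltW R00).
have LS : L2 D (cst (2 * b) : rV -> R) by exact: L2_cst.
have Lq : L2 D (fun x => 2 * b - M * p x) by apply: (L2B mD LS); exact: L2Z.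
exists (2 * b / M); first by rewrite divr_ge0 ?(ltW M0)// mulr_ge0.
suff : \forall x \ae mu, D x -> 0 <= 2 * b - M * p x.
  by apply: filterS => x H Dx; rewrite ler_pdivlMr// mulrC -subr_ge0 H.
apply: (nonneg_of_test oD bD dens Lq) => f tf f0.
have W := avg_weak_cvg IA LA (fun x => patch_ge0 x p0) (testfT tf) f0 R00.
have If := testf_itg (testfT tf); have Lf := testf_L2D oD tf.
rewrite (dotBl mD LS (L2Z mD M LP) Lf) (dotZl mD M LP Lf) subr_ge0.
have -> : dot (cst (2 * b)) f = (\int[mu]_x (2 * b * f x))%R.
  by apply: intg_supp => x /(testf_out tf) ->; rewrite mulr0.
rewrite -dot_patchT; apply: (ler_cvg_to W (cvg_cst _)); apply: nearW => n.
have rn : 0 < R0 / n.+1%:R by rewrite divr_gt0.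
apply: ae_le_intg => //; [exact: itg_avgM|exact: itgZ|].
apply: aeW => x _; rewrite mulrC ler_wpM2r//; apply: bd => //.
by rewrite ler_pdivrMr// ler_peMr ?(ltW R00)// ler1n.
Qed.

(** In [negative_energy] the squared first coefficient is at most [N ^+ 2], so the left side is at
    least [lam_0 N^2], while the right side is nonpositive. *)
Lemma weak_max u du ddu : H2 D u du ddu -> H10 D u du ->
  (\forall x \ae mu, D x -> lap ddu x <= 0) -> \forall x \ae mu, D x -> 0 <= u x.
Proof.
move=> Hu Hu0 H; have Lu := (H10_H1 Hu0).(H1_L2); have Ln := L2_npart oD Lu.
have Ll := L2_lap oD Hu; have Lp := phi_L2 heig 0%N.
have E := negative_energy oD bD heig Hu Hu0.
pose N := nrm (fun x => npart (u x)).
have N0 : 0 <= N by exact: normL2_ge0.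
have C : cf D phi (fun x => npart (u x)) 0%N ^+ 2 <= N ^+ 2.
  rewrite -[leLHS]real_normK ?num_real// lerXn2r ?nnegrE//.
  by have := dot_CS mD Ln Lp; rewrite (nrm_phi heig) mulr1.
have S : dot (lap ddu) (fun x => npart (u x)) <= 0.
  have -> : 0 = (\int[mu]_(x in D) (0 : R))%R by rewrite Rintegral_cst// mul0r.
  apply: ae_le_intg => //; [exact: L2_itgM|exact: integrable0|].
  by apply: filterS H => x Hx Dx; rewrite mulr_le0_ge0 ?npart_ge0 ?Hx.
have Z : N = 0.
  have l0 := eig_gt0 heig; have l1 := eig_simple heig; have NN := sqr_ge0 N.
  apply/eqP; rewrite -sqrf_eq0 eq_le NN andbT.
  have {}E := le_trans E S; move: l0 l1 NN E C; rewrite -/N.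
  by move: (N ^+ 2) (cf _ _ _ _ ^+ 2) (lam 0%N) (lam 1%N) => a b p q *; nra.
have := normL2_eq0 mD Ln Z; apply: filterS => x H0 /H0.
rewrite /npart; case: (leP (- u x) 0) => [|h0 h1]; first by rewrite oppr_le0.
by rewrite h1 ltxx in h0.
Qed.

Lemma cutoff_one K : compact K -> K `<=` D -> exists2 c, testf D c & forall x, K x -> c x = 1.
Proof.
move=> cK KD; have [d d0 Hd] := compact_thick cK oD KD.
have d2 : 0 < d / 2 by rewrite divr_gt0.
have [z [K' [sz z0 zK cK' [zK' K'K]]]] := cutoff cK d2.
have K'D : K' `<=` D.
  move=> x /K'K [k Kk xk]; rewrite -(subrKC k x); apply: Hd => //.
  by apply: le_lt_trans xk _; lra.
have [c c0 Hc] := compact_pos_min cK (smooth_continuous sz) zK.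
have E0 : 0 < expinv 1 (1 : R) by rewrite expinv1E// expR_gt0.
(* With [E = expinv 1] this is [1 - E(1 - z/c) / E(1)]: it is 0 where [z = 0] and 1 where
   [z >= c]. *)
exists (fun x => 1 - (expinv 1 1)^-1 * expinv 1 (- c^-1 * z x + 1)).
  split.
    apply: smoothB; [exact: smooth_cst|].
    apply: (@smooth_comp _ _ (fun s => (expinv 1 1)^-1 * expinv 1 (- c^-1 * s + 1))) => //.
    by apply: smooth1_affine; exact: smooth1_expinv.
  by exists K'; split => // x /zK' ->; rewrite mulr0 add0r mulVf ?subrr// gt_eqF.
move=> x Kx; have H : - c^-1 * z x + 1 <= 0.
  by rewrite mulNr addrC subr_le0 mulrC ler_pdivlMr// mul1r Hc.
by rewrite (expinv0 _ H) mulr0 subr0.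
Qed.

Lemma sstep_near1 (s : R) : 0 < s -> `|sstep s - 1| <= s^-1.
Proof.
move=> s0; have t0 : 0 < s^-1 by rewrite invr_gt0.
have H1 := sstep_le1 s; rewrite ler0_norm ?subr_le0// opprB.
have := expR_ge1Dx (- s^-1); have := expR_gt0 (- s^-1); rewrite sstepE//.
by move: (s^-1) t0 (expR _) => t t0 E *; nra.
Qed.

Lemma near1_arith (s e : R) : 0 < s -> 2 / s <= e -> 2 / s <= 1 ->
  (forall r, 0 < r -> `|sstep r - 1| <= r^-1) -> `|sstep (s + - 1) - 1| <= e.
Proof.
move=> s0 he; rewrite ler_pdivrMr// mul1r => s2 H; have r0 : 0 < s + - 1 by lra.
apply: le_trans (H _ r0) _; apply: le_trans he.
by rewrite ler_pdivlMr// mulrC ler_pdivrMr//; lra.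
Qed.

(** Zero boundary values become membership in H^1_0 without traces. [F n] is a smoothed
    [(t - 1/(n+1))^+], so on [D] the function [F n (q)] lives on the compact set where
    [(n+1) q >= 1]; dominated convergence gives the limits of functions and gradients. *)
Lemma H10_of_vanishing q : is_smooth q -> (forall x, D x -> 0 < q x) ->
  (forall x, closure D x -> ~ D x -> q x = 0) -> H10 D q (fun i => pderiv i q).
Proof.
move=> sq q0 qb; have Lq := smooth_L2 oD bD sq.
have Ldq i := smooth_L2 oD bD (smooth_pderiv i sq).
pose F (n : nat) (t : R) := n.+1%:R^-1 * sppart (n.+1%:R * t + - 1).
have n0 (n : nat) : 0 < n.+1%:R :> R by [].
have sF n : smooth1 (F n) by apply: smooth1_affine; exact: smooth1_sppart.
have sFq n : is_smooth (fun x => F n (q x)) by exact: smooth_comp.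
have F0 n t : n.+1%:R * t <= 1 -> F n t = 0.
  by move=> H; rewrite /F sppart0 ?mulr0// subr_le0.
have dF n t : is_derive t (1 : R) (F n) (sstep (n.+1%:R * t + - 1)).
  pose k t : R := n.+1%:R * t + - 1.
  have Dk : is_derive t (1 : R) k (n.+1%:R * 1 + 0) by apply: is_deriveD; exact: is_deriveZ.
  apply: (is_derive_eq (is_deriveZ n.+1%:R^-1 (is_derive1_comp (is_derive_sppart (k t)) Dk))).
  by rewrite /GRing.scale /= mulr1 addr0 /k mulrCA mulVf ?mulr1// gt_eqF.
have cK n : compact [set x | closure D x /\ 1 <= n.+1%:R * q x].
  have cl : closed [set x : rV | 1 <= n.+1%:R * q x].
    apply: (@closed_comp _ _ (fun x : rV => n.+1%:R * q x) [set y | 1 <= y]); last exact: closed_ge.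
    by move=> x _; apply: smooth_continuous; exact: smoothZ.
  rewrite (_ : [set x | _] = closure D `&` [set x : rV | 1 <= n.+1%:R * q x])//.
  apply: (subclosed_compact _ (compact_closure_bounded bD)); last by move=> x [].
  by apply: closedI => //; exact: closed_closure.
have KD n : [set x | closure D x /\ 1 <= n.+1%:R * q x] `<=` D.
  move=> x [cx qx]; apply: contrapT => Dx; move: qx; rewrite qb// mulr0.
  by rewrite ler10.
have Hc n : exists c, testf D c /\ forall x, D x -> 1 <= n.+1%:R * q x -> c x = 1.
  have [c tc H] := cutoff_one (cK n) (KD n); exists c; split => // x Dx qx.
  by apply: H; split => //; exact: subset_closure.
have [c {}Hc] := choice Hc.
(* Nothing is known about [q] outside the closure of [D]; the factor [c n] removes these values and
   equals 1 at the points of [D] where [F n (q)] is nonzero. *)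
pose f n x := c n x * F n (q x).
have tf n : testf D (f n) by apply: testfMr => //; have [] := Hc n.
have fE n x : D x -> f n x = F n (q x).
  move=> Dx; rewrite /f; have [H|/ltW H] := leP 1 (n.+1%:R * q x); last by rewrite F0// mulr0.
  by rewrite (Hc n).2// mul1r.
have dfE n i x : D x -> pderiv i (f n) x = sstep (n.+1%:R * q x + - 1) * pderiv i q x.
  move=> Dx; have sf := testf_smooth (tf n).
  rewrite -(pderiv_comp i sq (dF n (q x))); apply/eqP; rewrite -subr_eq0 -pderivB//; apply/eqP.
  apply: pderiv_near0; have : nbhs x D by exact: open_nbhs_nbhs.
  by apply: filterS => y Dy; rewrite fE// subrr.
have Fle n t : 0 <= t -> `|F n t - t| <= 2 * n.+1%:R^-1.
  move=> t0; have p := n0 n; have pi : 0 < n.+1%:R^-1 :> R by rewrite invr_gt0.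
  have -> : F n t - t = n.+1%:R^-1 * (sppart (n.+1%:R * t + - 1) - n.+1%:R * t).
    by rewrite mulrBr mulKf// gt_eqF.
  rewrite normrM gtr0_norm// mulrC ler_wpM2r ?(ltW pi)//.
  have := sppart_le (n.+1%:R * t + - 1); have := sppart_ge (n.+1%:R * t + - 1).
  have := mulr_ge0 (ltW p) t0; move: (sppart _) => a; move: (n.+1%:R * t) => b b0 h1 h2.
  by rewrite ler_norml; move: h1 h2; case: (leP (b + -1) 0) => h h1 h2; apply/andP; split; lra.
have [M M0 HM] := smooth_bounded_on bD sq.
have sm f' : is_smooth f' -> measurable_fun D f' by exact: smooth_measurable.
apply: (@H10_lim _ _ _ oD bD q _ f (fun n i => pderiv i (f n))) => //.
- by move=> n; exact: H10_test.
- apply: (@dct_L2 R m D mD f q (cst (M + 2)) _ _ (L2_cst oD bD (M + 2)) _ _).2.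
  + by move=> n; exact: sm (testf_smooth (tf n)).
  + exact: sm.
  + apply: aeW => x Dx; apply/cvgrPdist_le => e e0.
    have /cvgrPdist_le/(_ _ e0) := @cvg_natSinv R 2; apply: filterS => n.
    rewrite sub0r normrN distrC fE// ger0_norm ?divr_ge0// => H; apply: le_trans H.
    by apply: Fle; exact: ltW (q0 _ Dx).
  + apply: aeW => x n Dx; rewrite fE// /cst.
    have := Fle n _ (ltW (q0 _ Dx)); have : n.+1%:R^-1 <= 1 :> R by rewrite invf_le1// ler1n.
    have := HM _ Dx; have := ler_normD (F n (q x) - q x) (q x); rewrite subrK.
    by move: (`|_|) (`|_|) (`|_|) (_^-1) => a b d e' *; lra.
- move=> i; have [M' M'0 HM'] := smooth_bounded_on bD (smooth_pderiv i sq).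
  apply: (@dct_L2 R m D mD (fun n => pderiv i (f n)) (pderiv i q) (cst M') _ _ (L2_cst oD bD M') _ _).2.
  + by move=> n; exact: sm (smooth_pderiv i (testf_smooth (tf n))).
  + exact: sm (smooth_pderiv i sq).
  + apply: aeW => x Dx; have q1 := q0 _ Dx.
    have c1 : (fun n : nat => sstep (n.+1%:R * q x + - 1)) @ \oo --> (1 : R).
      apply/cvgrPdist_le => e e0; have m0' : 0 < Num.min e 1 by rewrite lt_min e0 ltr01.
      have /cvgrPdist_le/(_ _ m0') := @cvg_natSinv R (2 / q x); apply: filterS => n.
      have s0 : 0 < n.+1%:R * q x by rewrite mulr_gt0.
      have -> : 2 / q x * n.+1%:R^-1 = 2 / (n.+1%:R * q x).
        by rewrite invfM [_^-1 * (q x)^-1]mulrC mulrA.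
      rewrite sub0r normrN ger0_norm ?divr_ge0 ?(ltW s0)// le_min => /andP[he h1].
      rewrite distrC; exact: near1_arith s0 he h1 sstep_near1.
    have c2 : (fun n : nat => sstep (n.+1%:R * q x + - 1) * pderiv i q x) @ \oo --> pderiv i q x.
      by rewrite -[X in _ --> X]mul1r; exact: cvgM c1 (cvg_cst _).
    by apply: eq_cvgn c2 => n; rewrite dfE.
  + apply: aeW => x n Dx; rewrite dfE// normrM /cst; apply: le_trans (HM' _ Dx).
    by rewrite ler_piMl// ger0_norm ?sstep_ge0 ?sstep_le1.
Qed.

(** Strict subharmonicity is asked off a compact subset of [D]; on that subset the first
    eigenfunction, bounded below there, takes over in the comparison. *)
Definition barrier_on (Q : rV -> R) (c : R) (K : set rV) : Prop :=
  [/\ compact K, K `<=` D & forall x, D x -> ~ K x -> c <= laplace Q x].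

(* Near the boundary the square of a local defining function is strictly subharmonic and
   vanishes to second order. *)
Lemma defining_function x0 : closure D x0 -> exists r (g : rV -> R), [/\ 0 < r, is_smooth g,
  forall x, `|x - x0| < r -> (D x <-> 0 < g x) & forall x, 1 <= \sum_i pderiv i g x ^+ 2].
Proof.
move=> cx; have [r [i [s [h [r0 ss sh hi HD]]]]] := patch_exists oD m0 sbD cx.
have sxi : is_smooth (fun x : rV => s * x ord0 i) by apply: smoothZ; exact: smooth_coord.
exists r, (fun x => s * x ord0 i - h x); split => // [|x]; first exact: smoothB.
have hi0 : pderiv i h x = 0.
  apply: pderivE; apply/is_derive_line.
  by rewrite (_ : (fun t => _) = cst (h x)); [exact: is_derive_cst|apply/funext => t; rewrite addrC hi].
rewrite (bigD1 i)//= pderivB// hi0 subr0 pderivZ; last exact: smooth_coord.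
by rewrite pderiv_coord eqxx mulr1 expr2 ss lerDl sumr_ge0// => j _; exact: sqr_ge0.
Qed.

Lemma laplace_mul_sqr c g x : is_smooth c -> is_smooth g -> g x = 0 ->
  laplace (fun x => c x * (g x * g x)) x = 2 * c x * \sum_i pderiv i g x ^+ 2.
Proof.
move=> sc sg gx; rewrite /laplace mulr_sumr; apply: eq_bigr => i _.
have sgg := smoothM sg sg; have dc := smooth_pderiv i sc; have dg := smooth_pderiv i sg.
have -> : pderiv i (fun x => c x * (g x * g x)) = fun x => (c x * (2 * pderiv i g x) + g x * pderiv i c x) * g x.
  by apply/funext => y; rewrite !pderivM//; ring.
have s2 : is_smooth (fun x => c x * (2 * pderiv i g x) + g x * pderiv i c x).
  by apply: smoothD; apply: smoothM => //; exact: smoothZ.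
by rewrite pderivM// gx; ring.
Qed.

(** [expinv] is flat where its argument is nonpositive, so outside its cutoff a patch contributes
    nothing, whatever its defining function does there. *)
Lemma laplace_expinv_out p f x : is_smooth p -> is_smooth f -> p x <= 0 ->
  laplace (fun x => expinv 1 (p x) * f x) x = 0.
Proof.
move=> sp sf px; apply: big1 => i _; have dp := smooth_pderiv i sp; have df := smooth_pderiv i sf.
have sE : is_smooth (fun x => expinv 1 (p x)) by apply: smooth_comp => //; exact: smooth1_expinv.
have sk : is_smooth (fun x => kprofile (p x)) by apply: smooth_comp => //; exact: smooth1_expinv.
have -> : pderiv i (fun x => expinv 1 (p x) * f x) =
    fun x => expinv 1 (p x) * pderiv i f x + kprofile (p x) * (pderiv i p x * f x).
  apply/funext => y; rewrite pderivM// (pderiv_comp i sp (is_derive_E1 (p y))).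
  by move: (kprofile _) => k; ring.
have s1 := smoothM sE df; have s2 := smoothM sk (smoothM dp sf).
rewrite pderivD// !pderivM//; last exact: smoothM.
rewrite (pderiv_comp i sp (is_derive_E1 (p x))) (pderiv_comp i sp (is_derive_kprofile (p x))).
by rewrite /kprofile /kprofile' !expinv0// !(mul0r, mulr0, addr0).
Qed.

Lemma laplace_sum (I : Type) (s : seq I) (F : I -> rV -> R) x : (forall l, is_smooth (F l)) ->
  laplace (fun x => \sum_(l <- s) F l x) x = \sum_(l <- s) laplace (F l) x.
Proof.
move=> sF; rewrite /laplace exchange_big /=; apply: eq_bigr => i _.
have -> : pderiv i (fun x => \sum_(l <- s) F l x) = fun x => \sum_(l <- s) pderiv i (F l) x.
  by apply/funext => y; exact: pderiv_sum.
by rewrite pderiv_sum// => l; exact: smooth_pderiv.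
Qed.

(** [Q] is a sum of terms [z_l g_l^2]. At a boundary point each term has either a flat cutoff or
    [g_l = 0], and in the latter case its Laplacian is [2 z_l |grad g_l|^2 >= 2 z_l]. Hence the
    Laplacian of [Q] is at least [2 c] on the boundary, and the part of the closure where it is at
    most [c] is a compact subset of [D]. *)
Lemma barrier_exists : exists (Q : rV -> R) (c : R) (K : set rV),
  [/\ is_smooth Q, forall x, D x -> 0 < Q x, forall x, closure D x -> ~ D x -> Q x = 0, 0 < c & barrier_on Q c K].
Proof.
have ccD := compact_closure_bounded bD.
have /choice[P HP] : forall x0, exists F : R * (rV -> R), [/\ 0 < F.1, is_smooth F.2 & closure D x0 ->
    (forall x : rV, `|x - x0| < F.1 -> (D x <-> 0 < F.2 x)) /\ forall x, 1 <= \sum_i pderiv i F.2 x ^+ 2].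
  move=> x0; have [cx|cx] := pselect (closure D x0); last first.
    by exists (1, cst 0); split => //; exact: smooth_cst.
  by have [r [g [r0 sg HD dg]]] := defining_function cx; exists (r, g).
pose r l := (P l).1; pose g l := (P l).2; pose z l := bumpf l (r l).
have r0 l : 0 < r l by have [] := HP l.
have sg l : is_smooth (g l) by have [] := HP l.
have sz l : is_smooth (z l) by exact: smooth_bump.
have [s [sD Hs]] := @bump_cover R m (closure D) (fun l => r l / m.+1%:R) ccD
  (fun l _ => divr_gt0 (r0 l) (ltr0Sn _ m)).
pose F l x := z l x * (g l x * g l x).
have sF l : is_smooth (F l) by apply: smoothM => //; exact: smoothM.
have F0 l x : 0 <= F l x by rewrite mulr_ge0 ?bump_ge0// -expr2 sqr_ge0.
pose Q x := \sum_(l <- s) F l x; pose Z x := \sum_(l <- s) z l x.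
have sQ : is_smooth Q by exact: smooth_sum.
have sZ : is_smooth Z by exact: smooth_sum.
have gD l x : l \in s -> D x -> `|x - l| < r l -> 0 < g l x.
  by move=> /sD cl Dx xl; have [_ _ /(_ cl)[/(_ x xl)[+ _] _]] := HP l; apply.
(* At a boundary point in the patch, [g l] is not positive because the point is outside [D], and not
   negative because points of [D] accumulate there. *)
have gb l x : l \in s -> closure D x -> ~ D x -> `|x - l| < r l -> g l x = 0.
  move=> /sD cl cx Dx xl; have [_ _ /(_ cl)[HD _]] := HP l.
  apply/eqP; rewrite eq_le; apply/andP; split.
    by rewrite leNgt; apply/negP => /(HD x xl).
  rewrite leNgt; apply/negP => gx.
  have o1 : open [set y : rV | g l y < 0].
    apply: (@open_comp _ _ (g l) [set y | y < 0]); last exact: open_lt.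
    by move=> y _; exact: smooth_continuous.
  have /cx : nbhs x ([set y : rV | g l y < 0] `&` ball l (r l)).
    apply: filterI; first exact: open_nbhs_nbhs.
    by apply: open_nbhs_nbhs; split; [exact: ball_open|rewrite -ball_normE /= distrC].
  move=> [y [Dy [/= gy]]]; rewrite -ball_normE /= distrC => yl.
  by have := (HD y yl).1 Dy; rewrite ltNge (ltW gy).
have Zpos x : closure D x -> 0 < Z x.
  move=> cx; have [l ls xl] := Hs x cx; rewrite /Z (big_rem l)//= ltr_pwDl//.
    by apply: bump_gt0 => //; exact: ltW.
  by apply: sumr_ge0 => k _; exact: bump_ge0.
have Qpos x : D x -> 0 < Q x.
  move=> Dx; have [l ls xl] := Hs x (subset_closure Dx); rewrite /Q (big_rem l)//= ltr_pwDl//.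
    have zl : 0 < z l x by apply: bump_gt0 => //; exact: ltW.
    have gl : 0 < g l x.
      apply: gD => //; apply: lt_le_trans xl _; rewrite ler_pdivrMr// ler_peMr ?(ltW (r0 l))//.
      by rewrite ler1n.
    by rewrite mulr_gt0// mulr_gt0.
  exact: sumr_ge0.
have zg l x : l \in s -> closure D x -> ~ D x -> z l x = 0 \/ g l x = 0.
  move=> ls cx Dx; have [H|H] := leP (r l) `|x - l|; first by left; exact: bump_out.
  by right; exact: gb.
have Qb x : closure D x -> ~ D x -> Q x = 0.
  move=> cx Dx; rewrite /Q big1_seq// => l /andP[_ ls]; rewrite /F.
  by have [->|->] := zg l x ls cx Dx; rewrite ?mul0r ?mulr0.
have [c c0 Hc] := compact_pos_min ccD (smooth_continuous sZ) Zpos.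
have sL := smooth_laplace sQ.
exists Q, c, (closure D `&` [set x : rV | laplace Q x <= c]); split => //; split.
- apply: (subclosed_compact _ ccD); last by move=> x [].
  apply: closedI; first exact: closed_closure.
  apply: (@closed_comp _ _ (fun x : rV => laplace Q x) [set y | y <= c]); last exact: closed_le.
  by move=> x _; exact: smooth_continuous.
- move=> x [cx /= Lx]; apply: contrapT => Dx; move: Lx; apply/negP; rewrite -ltNge.
  have -> : laplace Q x = \sum_(l <- s) laplace (F l) x by exact: laplace_sum.
  apply: (@lt_le_trans _ _ (2 * Z x)); first by have := Hc x cx; lra.
  rewrite /Z mulr_sumr !big_seq; apply: ler_sum => l ls.
  have [_ _ /(_ (sD l ls))[_ dg]] := HP l.
  have [H|H] := leP (r l) `|x - l|.
    have -> : z l x = 0 by exact: bump_out.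
    rewrite mulr0 /F /z /bumpf laplace_expinv_out//; [|exact: smoothM|].
      by apply: smoothB; [exact: smooth_cst|exact: smooth_sqdist].
    by rewrite subr_le0; exact: sqdist_ge.
  rewrite laplace_mul_sqr ?(gb l x ls cx Dx H)// ler_peMr// mulr_ge0// bump_ge0//.
- by move=> x Dx Kx; rewrite leNgt; apply/negP => /ltW H; apply: Kx; split => //; exact: subset_closure.
Qed.

(** The weak maximum principle is applied to [u + a phi_0 - b Q]. The Laplacian of [u] is at most
    [N = lm S + E]; off [K] this is compensated by the barrier since [b c = N], and on [K] by the
    eigenfunction since [a lam_0 c1 = N + b M]. *)
Lemma hopf_lower_bound u du ddu (lm E : R) e : H2 D u du ddu -> H10 D u du -> 0 <= lm -> 0 <= E ->
  (\forall x \ae mu, D x -> lap ddu x = - (lm * u x) + e x) -> L2 D e ->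
  (\forall x \ae mu, D x -> `|e x| <= E) ->
  exists2 K : R, 0 <= K & \forall x \ae mu, D x -> - (K * phi 0%N x) <= u x.
Proof.
move=> Hu Hu0 lm0 E0 equ Le eE.
have [S S0 HS] := npart_bounded Hu Hu0 lm0 E0 equ Le eE.
have [Q [c [K [sQ Qpos Qb c0 [cK KD HK]]]]] := barrier_exists.
have [c1 c10 Hc1] := phi0_interior_pos cK KD.
have HQ := H2_smooth oD bD sQ; have HQ0 := H10_of_vanishing sQ Qpos Qb.
have Hp := phi_H2 heig 0; have Hp0 := phi_H10 oD bD heig 0.
have [M M0 HM] := smooth_bounded_on bD (smooth_laplace sQ).
have l0 := eig_gt0 heig; pose N := lm * S + E.
have N0 : 0 <= N by rewrite addr_ge0 ?mulr_ge0.
pose b := N / c; have b0 : 0 <= b by rewrite divr_ge0 ?(ltW c0).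
pose a := (N + b * M) / (lam 0%N * c1).
have a0 : 0 <= a by rewrite divr_ge0//; [exact: addr_ge0 N0 (mulr_ge0 b0 M0)|exact: mulr_ge0 (ltW l0) (ltW c10)].
have Hy := H2B oD (H2D oD Hu (H2Z oD a Hp)) (H2Z oD b HQ).
have Hy0 := H10B oD bD (H10D oD bD Hu0 (H10Z oD bD a Hp0)) (H10Z oD bD b HQ0).
have W := weak_max Hy Hy0 _.
exists a => //.
suff V : \forall x \ae mu, D x -> 0 <= u x + a * phi 0%N x - b * Q x.
  apply: filterS V => x H Dx; have := H Dx; have := mulr_ge0 b0 (ltW (Qpos _ Dx)).
  by move: (b * Q x) (a * _) => s t; lra.
apply: W; have L := phi_lap oD bD heig 0; have P := eig_phi1_gt0 heig.
have {}HS : \forall x \ae mu, D x -> npart (u x) <= S by exact: HS.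
have A1 : \forall x \ae mu, D x -> [/\ lap ddu x = - (lm * u x) + e x, `|e x| <= E & npart (u x) <= S].
  by apply: filterS3 equ eE HS => x h1 h2 h3 Dx; split; auto.
have A2 : \forall x \ae mu, D x -> [/\ lap (ddphi D phi 0) x = - (lam 0%N * phi 0%N x), 0 < phi 0%N x & K x -> c1 <= phi 0%N x].
  by apply: filterS3 L P Hc1 => x h1 h2 h3 Dx; split; auto.
apply: filterS2 A1 A2 => x H1x H2x Dx; have [equx ex Sx] := H1x Dx; have [Lx p0 cx] := H2x Dx.
have -> : lap (fun i j x => ddu i j x + a * ddphi D phi 0 i j x - b * pderiv j (pderiv i Q) x) x =
    lap ddu x + a * lap (ddphi D phi 0) x - b * laplace Q x.
  by rewrite /lap /laplace !mulr_sumr -big_split -sumrB.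
rewrite equx Lx.
have e1 : e x <= E by exact: le_trans (ler_norm _) ex.
have u1 : - (lm * u x) <= lm * S.
  rewrite -mulrN; apply: (ler_wpM2l lm0); apply: le_trans Sx.
  by rewrite /npart le_max lexx.
have [Kx|Kx] := pselect (K x).
  have H1 : N + b * M <= a * (lam 0%N * phi 0%N x).
    have -> : N + b * M = a * (lam 0%N * c1) by rewrite /a divfK// mulf_neq0 ?gt_eqF.
    by rewrite (ler_wpM2l a0)// (ler_wpM2l (ltW l0))// cx.
  have H2 : - (b * laplace Q x) <= b * M.
    rewrite -mulrN (ler_wpM2l b0)//; apply: le_trans (HM _ Dx).
    by rewrite -normrN ler_norm.
  by move: H1 H2 u1 e1; rewrite /N mulrN; move: (b * _) (b * _) (lm * _) (lm * _) (a * _) => *; lra.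
have H1 : N <= b * laplace Q x.
  have -> : N = b * c by rewrite /b divfK// gt_eqF.
  by rewrite (ler_wpM2l b0)// HK.
have H2 : 0 <= a * (lam 0%N * phi 0%N x) by rewrite mulr_ge0// mulr_ge0// ltW.
by move: H1 H2 u1 e1; rewrite /N mulrN; move: (b * _) (lm * _) (lm * _) (a * _) => *; lra.
Qed.

End pointwise_bounds.

(** * The solution curve *)

Section solution_curve.
Context {R : realType} {m : nat}.
Local Notation mu := (lebesgue_rV R m).
Local Notation rV := 'rV[R]_m.
Implicit Types (f u v w z U V e : rV -> R) (g : R -> R).
Variables (D : set rV) (oD : open D) (bD : bounded_set D) (m0 : (0 < m)%N) (sbD : smooth_boundary D).
Variables (lam : nat -> R) (phi : nat -> rV -> R).
Hypothesis heig : dirichlet_eigensystem D lam phi.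
Let mD : measurable D := measurable_open_rV oD.
Let fD : (mu D < +oo)%E := measurable_bounded_rV_lty mD bD.
Local Notation cf := (cf D phi).
Local Notation nrm := (normL2 D).
Local Notation dot := (dotL2 D).
Let Lp k : L2 D (phi k) := phi_L2 heig k.
Let delta := lam 1%N - lam 0%N.
Variables (gamma : R) (g0 : 0 < gamma) (gd : gamma < delta).

(** This record and [source] are preserved by the reflection [(g, e) -> (- g(- .), - e)], so the
    sign of [mu1] has to be studied for large positive [xi] only. *)
Record nonlin g : Prop := Nonlin {
  nonlin_cont : continuous g ;
  nonlin_bound : forall t, `|g t| <= gamma * `|t| ;
  nonlin_mono : forall a b, a <= b -> gamma * a - g a <= gamma * b - g b ;
  nonlin_sign : forall t, t != 0 -> 0 < t * g t }.

Record source e : Prop := Source {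
  source_L2 : L2 D e ;
  source_bound : exists2 E : R, 0 <= E & \forall x \ae mu, D x -> `|e x| <= E ;
  source_orth : cf e 0%N = 0 }.

Definition sol g e u (mu1 : R) : Prop := exists du ddu, [/\ H2 D u du ddu, H10 D u du &
  \forall x \ae mu, D x -> lap ddu x + lam 0%N * u x + g (u x) = mu1 * phi 0%N x + e x].

Lemma sol_L2 g e u mu1 : sol g e u mu1 -> L2 D u.
Proof. by move=> [du [ddu [[[]]]]]. Qed.

Lemma nonlin_L2 g u : nonlin g -> L2 D u -> L2 D (fun x => g (u x)).
Proof. by move=> [cg gb _ _] Lu; have [] := L2_comp mD cg gb Lu. Qed.

Lemma nonlin0 g : nonlin g -> g 0 = 0.
Proof. by move=> [_ gb _ _]; apply/eqP; rewrite -normr_le0; apply: le_trans (gb 0) _; rewrite normr0 mulr0. Qed.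

Lemma sol_coef g e u mu1 k : nonlin g -> source e -> sol g e u mu1 ->
  (lam k - lam 0%N) * cf u k = cf (fun x => g (u x)) k - cf e k - mu1 * (k == 0%N)%:R.
Proof.
move=> ng [Le _ _] [du [ddu [Hu Hu0 equ]]]; have [[Lu _ _] _] := Hu.
have LG := nonlin_L2 ng Lu; have Ll := L2_lap oD Hu.
have L1 := L2D mD (L2D mD Ll (L2Z mD (lam 0%N) Lu)) LG.
have L2' := L2D mD (L2Z mD mu1 (Lp 0)) Le.
have := cf_ae oD heig k L1 L2' equ.
rewrite (cfD oD heig k (L2D mD Ll (L2Z mD (lam 0%N) Lu)) LG) (cfD oD heig k Ll (L2Z mD (lam 0%N) Lu)).
rewrite (cfD oD heig k (L2Z mD mu1 (Lp 0)) Le) (cfZ oD heig _ k Lu) (cfZ oD heig _ k (Lp 0)).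
rewrite (cf_lap oD bD heig k Hu Hu0) (cf_phi heig) eq_sym.
by move: (cf u k) (cf e k) (cf _ k) (mu1 * _) => a b c d H; lra.
Qed.

Lemma sol_mu g e u mu1 : nonlin g -> source e -> sol g e u mu1 -> mu1 = cf (fun x => g (u x)) 0%N.
Proof.
move=> ng se S; have := sol_coef 0 ng se S; rewrite subrr mul0r eqxx mulr1 (source_orth se) subr0.
by move/eqP; rewrite eq_sym subr_eq0 => /eqP ->.
Qed.

Lemma nonlin_opp g : nonlin g -> nonlin (fun t => - g (- t)).
Proof.
move=> [cg gb gm gs]; split.
- move=> t; apply: cvgN; apply: continuous_cvg; first exact: cg.
  by apply: cvgN; exact: cvg_id.
- by move=> t; rewrite normrN -[`|t|]normrN.
- move=> a b ab; have := gm (- b) (- a); rewrite lerN2 => /(_ ab).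
  by rewrite !mulrN; lra.
- by move=> t t0; rewrite mulrN -mulNr gs// oppr_eq0.
Qed.

Lemma source_opp e : source e -> source (fun x => - e x).
Proof.
move=> [Le [E E0 HE] He]; split; first exact: L2N.
  by exists E => //; apply: filterS HE => x H Dx; rewrite normrN H.
by rewrite (cfN oD heig _ Le) He oppr0.
Qed.

Lemma sol_opp g e u mu1 : sol g e u mu1 -> sol (fun t => - g (- t)) (fun x => - e x) (fun x => - u x) (- mu1).
Proof.
move=> [du [ddu [Hu Hu0 equ]]].
have H1 := H2Z oD (-1) Hu; have H2 := H10Z oD bD (-1) Hu0.
exists (fun i x => - du i x), (fun i j x => - ddu i j x); split.
- have -> : (fun x => - u x) = (fun x => -1 * u x) by apply/funext => x; rewrite mulN1r.
  have -> : (fun i x => - du i x) = (fun i x => -1 * du i x) by apply/funext => i; apply/funext => x; rewrite mulN1r.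
  have -> // : (fun i j x => - ddu i j x) = (fun i j x => -1 * ddu i j x).
  by apply/funext => i; apply/funext => j; apply/funext => x; rewrite mulN1r.
- have -> : (fun x => - u x) = (fun x => -1 * u x) by apply/funext => x; rewrite mulN1r.
  have -> // : (fun i x => - du i x) = (fun i x => -1 * du i x) by apply/funext => i; apply/funext => x; rewrite mulN1r.
- apply: filterS equ => x H Dx; have := H Dx; rewrite opprK.
  have -> : lap (fun i j x => - ddu i j x) x = - lap ddu x by rewrite /lap -sumrN.
  by rewrite mulrN mulNr; move: (lap _ _) (lam 0%N * _) (mu1 * _) => a b c; lra.
Qed.

Lemma delta_gt0 : 0 < delta. Proof. exact: lt_trans gd. Qed.

Lemma norm_multiplier f w (c : R) : L2 D f -> L2 D w -> 0 <= c -> (forall k, `|cf w k| <= c * `|cf f k|) ->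
  nrm w <= c * nrm f.
Proof.
move=> Lf Lw c0 H; rewrite -ler_sqr ?nnegrE ?mulr_ge0 ?normL2_ge0//.
have := normL2Z mD c Lf; rewrite ger0_norm// => <-; rewrite !normL2_sqr.
have Lc := L2Z mD c Lf; apply: (parseval_le oD heig) => // k; rewrite (cfZ oD heig _ k Lf).
rewrite -!expr2 -[leLHS]real_normK ?num_real// -[leRHS]real_normK ?num_real// lerXn2r ?nnegrE//.
by rewrite normrM (ger0_norm c0).
Qed.

(** Fredholm alternative at the first eigenvalue: the multiplier is [1 / (lam_0 - lam_k)], bounded
    by the spectral gap, and its value 0 at [k = 0] selects the solution orthogonal to [phi 0%N]. *)
Lemma resonance_inverse f : L2 D f -> cf f 0%N = 0 -> exists z dz ddz, [/\ H2 D z dz ddz, H10 D z dz,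
  cf z 0%N = 0 & \forall x \ae mu, D x -> lap ddz x = - (lam 0%N * z x) + f x].
Proof.
move=> Lf f0; have d0 := delta_gt0; have l0 := eig_gt0 heig.
pose a k : R := if k == 0%N then 0 else (lam 0%N - lam k)^-1.
have gap k : (0 < k)%N -> delta <= lam k - lam 0%N by move=> k0; exact: (lam_gap heig).
have an k : (0 < k)%N -> `|a k| = (lam k - lam 0%N)^-1.
  move=> k0; rewrite /a gtn_eqF// normfV distrC ger0_norm//; exact: le_trans (ltW d0) (gap k k0).
have [z [dz [ddz [Hz Hz0 cz]]]] : exists u du ddu, [/\ H2 D u du ddu, H10 D u du & forall k, cf u k = a k * cf f k].
  apply: (exists_multiplier oD bD m0 sbD heig (M := delta^-1 + (1 + lam 0%N / delta))) => //.
  - case=> [|k]; first by rewrite /a eqxx normr0 addr_ge0 ?addr_ge0 ?divr_ge0 ?invr_ge0// ltW.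
    rewrite an// -[leLHS]addr0 lerD ?addr_ge0 ?divr_ge0 ?(ltW d0) ?(ltW l0)//.
    by rewrite lef_pV2 ?posrE ?gap// (lt_le_trans d0) ?gap.
  - case=> [|k]; first by rewrite /a eqxx mulr0 normr0 addr_ge0 ?addr_ge0 ?divr_ge0 ?invr_ge0// ltW.
    have G := gap k.+1 isT; have p := lt_le_trans d0 G.
    have lk : 0 < lam k.+1 by move: p l0; lra.
    rewrite normrM an// gtr0_norm// -[leLHS]add0r lerD ?invr_ge0 ?(ltW d0)//.
    rewrite ler_pdivrMr// mulrDl mul1r -lerBlDl opprB addrC subrK.
    by rewrite mulrAC ler_pdivlMr// ler_wpM2l// ltW.
have [[Lz _ _] _] := Hz; have Ll := L2_lap oD Hz.
have cz0 : cf z 0%N = 0 by rewrite cz /a eqxx mul0r.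
exists z, dz, ddz; split => //.
have L1 : L2 D (fun x => - (lam 0%N * z x) + f x) by apply: (L2D mD _ Lf); apply: L2N => //; exact: L2Z.
apply: (coef_ae oD heig Ll L1) => k.
rewrite (cf_lap oD bD heig k Hz Hz0) (cfD oD heig k (L2N mD (L2Z mD _ Lz)) Lf) (cfN oD heig k (L2Z mD _ Lz)).
rewrite (cfZ oD heig _ k Lz); case: k => [|k]; first by rewrite cz0 f0 !mulr0 oppr0 addr0.
have p := lt_le_trans d0 (gap k.+1 isT).
rewrite cz /a /=; have n : lam 0%N - lam k.+1 != 0 by rewrite -opprB oppr_eq0 gt_eqF.
by move: (cf f _) => c; field.
Qed.

Lemma chain_arith (W S E a b : R) : W <= S + E -> S <= b -> a <= W -> a - b <= E.
Proof. by move=> *; lra. Qed.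

(** The part [U] solves the resonant problem with right-hand side [s + e], so [delta] times its norm
    is at most the norm of [s] plus that of [e]. The point is that [s] has norm at most [gamma]
    times that of [U], with no contribution of [xi]: this is where [mu1 * xi <= 0] is used. *)
Lemma sol_shift_bound g e u mu1 : nonlin g -> source e -> sol g e u mu1 -> mu1 <= 0 -> 0 <= cf u 0%N ->
  (delta - gamma) * nrm (fun x => u x - cf u 0%N * phi 0%N x) <= nrm e.
Proof.
move=> ng se S mu0 xi0; have Lu := sol_L2 S; have LG := nonlin_L2 ng Lu; have [Le _ e0] := se.
have d0 := delta_gt0; set xi := cf u 0%N.
pose U x := u x - xi * phi 0%N x; pose G x := g (u x); pose s x := mu1 * phi 0%N x - G x.
pose w x := s x + e x.
have Lx := L2Z mD xi (Lp 0); have LU : L2 D U := L2B mD Lu Lx.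
have Lm := L2Z mD mu1 (Lp 0); have Ls : L2 D s := L2B mD Lm LG.
have Lw : L2 D w := L2D mD Ls Le.
have smu : cf G 0%N = mu1 := esym (sol_mu ng se S).
have cw k : cf w k = - ((lam k - lam 0%N) * cf u k).
  rewrite (sol_coef k ng se S) (cfD oD heig k Ls Le) (cfB oD heig k Lm LG) (cfZ oD heig _ k (Lp 0)).
  by rewrite (cf_phi heig) eq_sym -/G; move: (cf G k) (cf e k) (mu1 * _) => a b c; ring.
have cs : cf s 0%N = 0.
  by rewrite (cfB oD heig 0 Lm LG) (cfZ oD heig _ 0 (Lp 0)) (cf_phi heig) smu mulr1 subrr.
have cU k : cf U k = cf u k - xi * (0%N == k)%:R.
  by rewrite (cfB oD heig k Lu Lx) (cfZ oD heig _ k (Lp 0)) (cf_phi heig).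
have B1 : nrm U <= delta^-1 * nrm w.
  apply: norm_multiplier => //; first by rewrite invr_ge0 ltW.
  case=> [|k]; first by rewrite cU mulr1 subrr normr0 mulr_ge0// invr_ge0 ltW.
  rewrite cU mulr0 subr0 cw normrN normrM mulrA ler_peMl//.
  rewrite mulrC ler_pdivlMr// mul1r; apply: le_trans (ler_norm _); exact: (lam_gap heig).
have B2 := normL2_tri mD Ls Le.
(* Since [t] and [g t] have the same sign, the linear bound improves to
   [(g t)^2 <= gamma t g(t)]. *)
have gu : nrm G ^+ 2 <= gamma * dot G u.
  rewrite normL2_sqr -(dotZl mD gamma LG Lu); apply: ae_le_intg => //.
  - exact: L2_itgM.
  - by apply: L2_itgM => //; exact: L2Z.
  - apply: aeW => x _; rewrite /G; have [->|t0] := eqVneq (u x) 0.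
      by rewrite (nonlin0 ng) !mulr0.
    have := nonlin_bound ng (u x); have := nonlin_sign ng t0; move: (u x) (g (u x)) => t q p b.
    rewrite -mulrA; have -> : q * q = `|q| * `|q| by rewrite -!expr2 real_normK ?num_real.
    have -> : gamma * (q * t) = `|q| * (gamma * `|t|) by rewrite [RHS]mulrCA -normrM [q * t]mulrC gtr0_norm.
    by rewrite ler_wpM2l.
(* As [s] is orthogonal to [phi 0%N], the pairing of [G] with [u] is [mu1 * xi] minus that of [s]
   with [U]; the first term is nonpositive and is dropped. *)
have ss : nrm s ^+ 2 <= gamma * (nrm s * nrm U).
  have E1 : nrm s ^+ 2 = nrm G ^+ 2 - mu1 ^+ 2.
    rewrite !normL2_sqr /s (dotBl mD Lm LG Ls) (dotZl mD _ (Lp 0) Ls) [dot (phi 0%N) _]dotC [dot _ (phi 0%N)]cs mulr0.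
    rewrite (dotBr mD Lm LG LG) (dotZr mD _ (Lp 0) LG) [dot G (phi 0%N)]smu.
    by rewrite sub0r opprB expr2.
  have E2 : dot G u = mu1 * xi - dot s U.
    have -> : dot s U = dot s u.
      by rewrite (dotBr mD Lu Lx Ls) (dotZr mD _ (Lp 0) Ls) [dot s (phi 0%N)]cs mulr0 subr0.
    by rewrite (dotBl mD Lm LG Lu) (dotZl mD _ (Lp 0) Lu) [dot (phi 0%N) u]dotC -/(cf u 0%N) -/xi; ring.
  have mx : mu1 * xi <= 0 by rewrite mulr_le0_ge0.
  have C := dot_CS mD Ls LU; have C' := ler_norm (- dot s U); rewrite normrN in C'.
  have H : dot G u <= nrm s * nrm U by rewrite E2; move: C C' mx; move: (dot s U) (mu1 * xi) => a b; lra.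
  rewrite E1; have := sqr_ge0 mu1; have := ler_wpM2l (ltW g0) H; move: gu.
  by move: (nrm G ^+ 2) (mu1 ^+ 2) (gamma * _) (gamma * _) => a b c d; lra.
have sU : nrm s <= gamma * nrm U.
  have [->|s0] := eqVneq (nrm s) 0; first by rewrite mulr_ge0 ?normL2_ge0// ltW.
  have s1 : 0 < nrm s by rewrite lt_def s0 normL2_ge0.
  by rewrite -(ler_pM2l s1) -expr2 mulrCA.
have : delta * nrm U <= nrm w by rewrite -ler_pdivlMl.
by move=> H; rewrite mulrBl; exact: chain_arith B2 sU H.
Qed.

(** Where the comparison function [y] is negative, [g(u)] may be negative too, but it is then
    controlled by [y] itself rather than by [u]. *)
Lemma nonlin_ge g (y t : R) : nonlin g -> y <= t -> y < 0 -> gamma * y <= g t.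
Proof.
move=> ng yt y0; have [t0|t0] := leP 0 t.
  apply: (@le_trans _ _ 0); first by rewrite pmulr_rle0// ltW.
  move: t0; rewrite le_eqVlt => /orP[/eqP <-|t0]; first by rewrite (nonlin0 ng).
  by have := nonlin_sign ng (lt0r_neq0 t0); rewrite pmulr_rgt0// => /ltW.
have := nonlin_bound ng t; rewrite (ltr0_norm t0) ler_norml => /andP[+ _].
by rewrite mulrN opprK; apply: le_trans; rewrite ler_wpM2l// ltW.
Qed.

Lemma gap_arith (l1 l0 ga nn cc : R) : l1 * nn - (l1 - l0) * cc <= (l0 + ga) * nn ->
  (l1 - l0 - ga) * nn <= (l1 - l0) * cc.
Proof.
rewrite -subr_ge0 => H; rewrite -subr_ge0.
by have -> : (l1 - l0) * cc - (l1 - l0 - ga) * nn = (l0 + ga) * nn - (l1 * nn - (l1 - l0) * cc) by ring.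
Qed.

(** If [n] were positive, the two quadratic inequalities would combine to [X ^+ 2 <= d B^2 / k],
    which is below [X], although [X > 1]. *)
Lemma vanish_arith (k d n c B X : R) : 0 < k -> 0 <= d -> 0 <= n -> 0 <= c -> 0 <= B -> 1 + d * B ^+ 2 / k < X ->
  X * c <= n * B -> k * n ^+ 2 <= d * c ^+ 2 -> n = 0.
Proof.
move=> k0 d0 n0 c0 B0 HX Hc Hn; apply/eqP; apply: contraT => nz.
have {nz} np : 0 < n by rewrite lt_def nz.
have q0 : 0 <= d * B ^+ 2 / k by rewrite divr_ge0 ?(ltW k0)// mulr_ge0 ?sqr_ge0.
have X1 : 1 < X by lra.
have s1 : (X * c) ^+ 2 <= (n * B) ^+ 2 by rewrite lerXn2r ?nnegrE ?mulr_ge0// ltW// (lt_trans ltr01).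
have s2 : X ^+ 2 * (k * n ^+ 2) <= X ^+ 2 * (d * c ^+ 2) by rewrite ler_wpM2l ?sqr_ge0.
have s3 := ler_wpM2l d0 s1.
have s4 : (X ^+ 2 * k) * n ^+ 2 <= (d * B ^+ 2) * n ^+ 2.
  have e1 : X ^+ 2 * (d * c ^+ 2) = d * (X * c) ^+ 2 by ring.
  have e2 : d * (n * B) ^+ 2 = d * B ^+ 2 * n ^+ 2 by ring.
  by rewrite -e2 -mulrA; apply: le_trans s2 _; rewrite e1.
move: s4; rewrite ler_pM2r ?exprn_gt0// -ler_pdivlMr// => s4.
have : X < X ^+ 2 by rewrite expr2 ltr_pMl// (lt_trans ltr01).
by move: s4 HX; move: (_ / k) (X ^+ 2) => a b *; lra.
Qed.

Lemma orth_phi0_pos G : L2 D G -> (\forall x \ae mu, D x -> 0 <= G x) -> 0 <= cf G 0%N /\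
  (cf G 0%N = 0 -> \forall x \ae mu, D x -> G x = 0).
Proof.
move=> LG G0; have P := eig_phi1_gt0 heig; have I := L2_itgM mD LG (Lp 0).
have E : cf G 0%N = (\int[mu]_(x in D) `|G x * phi 0%N x|)%R.
  apply: ae_eq_intg => //; [exact: itg_meas I|by apply: itg_meas; exact: itg_abs|].
  apply: filterS2 G0 P => x h1 h2 Dx; rewrite ger0_norm// mulr_ge0 ?h1// ltW// h2//.
split; first by rewrite E Rintegral_ge0.
move=> Z; rewrite Z in E; have := intg_eq0 mD (itg_abs I) (fun x _ => normr_ge0 _) (esym E).
apply: filterS2 P => x h1 h2 Dx; have := h2 Dx; move/eqP; rewrite normr_eq0 mulf_eq0.
by rewrite (gt_eqF (h1 Dx)) orbF => /eqP.
Qed.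

Lemma sol_mu_pos g e : nonlin g -> source e -> exists X, forall u mu1, sol g e u mu1 -> X < cf u 0%N -> 0 < mu1.
Proof.
move=> ng se; have [Le [E E0 eE] e0] := se.
have [z [dz [ddz [Hz Hz0 z0 eqz]]]] := resonance_inverse Le e0.
have l0 := eig_gt0 heig; have d0 := delta_gt0.
have [K K0 HK] := hopf_lower_bound oD bD m0 sbD heig Hz Hz0 (ltW l0) E0 eqz Le eE.
have [[Lz _ _] _] := Hz; have kap : 0 < delta - gamma by rewrite subr_gt0.
pose B := nrm e / (delta - gamma) + nrm z.
(* Beyond this threshold [xi - K] satisfies the requirement on [X] in [vanish_arith]; [B] bounds [V]
   uniformly in [xi]. *)
exists (K + 1 + delta * B ^+ 2 / (delta - gamma)) => u mu1 S X; rewrite ltNge; apply/negP => mu0.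
have B0 : 0 <= B by rewrite addr_ge0 ?divr_ge0 ?normL2_ge0// ltW.
have C0 : 0 <= delta * B ^+ 2 / (delta - gamma) by rewrite divr_ge0 ?(ltW kap)// mulr_ge0 ?sqr_ge0// ltW.
set xi := cf u 0%N in X; have [xi0 xiK] : 0 < xi /\ 1 + delta * B ^+ 2 / (delta - gamma) < xi - K.
  by move: X C0 K0; move: (_ / _) => c *; split; lra.
have [du [ddu [Hu Hu0 equ]]] := S; have Lu := sol_L2 S; have LG := nonlin_L2 ng Lu.
have UB := sol_shift_bound ng se S mu0 (ltW xi0).
have Lx := L2Z mD xi (Lp 0); have LU : L2 D (fun x => u x - xi * phi 0%N x) := L2B mD Lu Lx.
pose V x := (u x - xi * phi 0%N x) - z x; have LV : L2 D V := L2B mD LU Lz.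
have VB : nrm V <= B.
  apply: le_trans (normL2_triB mD LU Lz) _; rewrite lerD2r ler_pdivlMr// mulrC; exact: UB.
have Hp := phi_H2 heig 0; have Hp0 := phi_H10 oD bD heig 0.
have Hy := H2B oD (H2B oD Hu Hz) (H2Z oD K Hp); have Hy0 := H10B oD bD (H10B oD bD Hu0 Hz0) (H10Z oD bD K Hp0).
pose y x := u x - z x - K * phi 0%N x; have Ly : L2 D y := L2B mD (L2B mD Lu Lz) (L2Z mD K (Lp 0)).
have Ln := L2_npart oD Ly; pose n := nrm (fun x => npart (y x)); have n0 : 0 <= n := normL2_ge0 _ _.
have NE := negative_energy oD bD heig Hy Hy0.
have yu : \forall x \ae mu, D x -> y x <= u x.
  by apply: filterS HK => x H Dx; rewrite /y; have := H Dx; move: (K * _) => k; lra.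
have L := phi_lap oD bD heig 0; have P := eig_phi1_gt0 heig.
(* The source [e] cancels between [u] and [z], and the Laplacian of [y] becomes
   [mu1 phi_0 - g(u) - lam_0 y]. Where [y < 0] the first term is nonpositive and
   [- g(u) <= - gamma y]. *)
have R1 : dot (lap (fun i j x => ddu i j x - ddz i j x - K * ddphi D phi 0 i j x)) (fun x => npart (y x)) <=
    (lam 0%N + gamma) * n ^+ 2.
  rewrite /n normL2_sqr -(dotZl mD _ Ln Ln); have Ll := L2_lap oD Hy.
  apply: ae_le_intg => //; [exact: L2_itgM|by apply: L2_itgM => //; exact: L2Z|].
  have A1 : \forall x \ae mu, D x -> [/\ lap ddu x + lam 0%N * u x + g (u x) = mu1 * phi 0%N x + e x,
      lap ddz x = - (lam 0%N * z x) + e x & y x <= u x].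
    by apply: filterS3 equ eqz yu => x h1 h2 h3 Dx; split; auto.
  apply: filterS3 A1 L P => x H1 H2 H3 Dx; have [h1 h2 h3] := H1 Dx; have {}H2 := H2 Dx; have {}H3 := H3 Dx.
  have -> : lap (fun i j x => ddu i j x - ddz i j x - K * ddphi D phi 0 i j x) x =
      lap ddu x - lap ddz x - K * lap (ddphi D phi 0) x.
    by rewrite /lap !mulr_sumr -!sumrB.
  rewrite /npart; case: (leP (- y x) 0) => [|yn]; first by rewrite !mulr0.
  rewrite ler_wpM2r ?(ltW yn)//; have := nonlin_ge ng h3 (_ : y x < 0); rewrite -oppr_gt0 => /(_ yn).
  have : mu1 * phi 0%N x <= 0 by rewrite mulr_le0_ge0// ltW.
  have -> : lap ddu x = mu1 * phi 0%N x + e x - lam 0%N * u x - g (u x) by rewrite -h1; ring.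
  rewrite h2 H2 => q1 q2.
  have -> : mu1 * phi 0%N x + e x - lam 0%N * u x - g (u x) - (- (lam 0%N * z x) + e x) - K * - (lam 0%N * phi 0%N x) = mu1 * phi 0%N x - g (u x) - lam 0%N * y x by rewrite /y; ring.
  rewrite mulrDl !mulrN; move: q1 q2; move: (mu1 * _) (g _) (lam 0%N * _) (gamma * _) => a b c d; lra.
(* [y] equals [V + (xi - K) phi_0], so [(xi - K) phi_0 <= |V|] wherever [y] is negative. This makes
   the first coefficient of the negative part small when [xi] is large, which is what
   [negative_energy] cannot see. *)
have R2 : (xi - K) * cf (fun x => npart (y x)) 0%N <= n * nrm V.
  have LaV : L2 D (fun x => `|V x|).
    apply: (L2_le mD _ _ LV) => [|x _]; last by rewrite normr_id.
    by apply: measurableT_comp => //; exact: L2_meas LV.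
  have -> : nrm V = nrm (fun x => `|V x|).
    by congr Num.sqrt; apply: eq_intg => // x _; rewrite -!expr2 real_normK ?num_real.
  apply: le_trans (le_trans (ler_norm _) (dot_CS mD Ln LaV)).
  rewrite -(RintegralZl _ mD (L2_itgM mD Ln (Lp 0))); apply: ae_le_intg => //.
  - by apply: itgZ => //; exact: L2_itgM.
  - exact: L2_itgM.
  - apply: aeW => x _; rewrite mulrCA /npart; case: (leP (- y x) 0) => [|yn]; first by rewrite !mul0r.
    rewrite ler_wpM2l ?(ltW yn)//.
    have := ler_norm (- V x); rewrite normrN /V; move: yn; rewrite /y mulrBl.
    by move: (K * _) (xi * _) => a b *; lra.
have c0 : 0 <= cf (fun x => npart (y x)) 0%N.
  by apply: (orth_phi0_pos Ln _).1; apply: aeW => x _; exact: npart_ge0.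
have npos : n = 0.
  have q := le_trans NE R1; have R3 := le_trans R2 (ler_wpM2l n0 VB).
  have q' : (delta - gamma) * n ^+ 2 <= delta * cf (fun x => npart (y x)) 0%N ^+ 2.
    exact: gap_arith q.
  exact: vanish_arith kap (ltW d0) n0 c0 B0 xiK R3 q'.
have y0 : \forall x \ae mu, D x -> 0 <= y x.
  have := normL2_eq0 mD Ln npos; apply: filterS => x h /h.
  rewrite /npart; case: (leP (- y x) 0) => [|h0 h1]; first by rewrite oppr_le0.
  by rewrite h1 ltxx in h0.
have u0 : \forall x \ae mu, D x -> 0 <= u x.
  by apply: filterS2 yu y0 => x h1 h2 Dx; exact: le_trans (h2 Dx) (h1 Dx).
have G0 : \forall x \ae mu, D x -> 0 <= g (u x).
  apply: filterS u0 => x h Dx; have := h Dx; rewrite le_eqVlt => /orP[/eqP <-|ux]; first by rewrite (nonlin0 ng).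
  by have := nonlin_sign ng (lt0r_neq0 ux); rewrite pmulr_rgt0// => /ltW.
(* Now [mu1] is the pairing of a nonnegative function with [phi 0%N]; being nonpositive it is 0,
   which forces [g(u) = 0], hence [u = 0] and [xi = 0]. *)
have [mu_ge mu_eq] := orth_phi0_pos LG G0; rewrite -(sol_mu ng se S) in mu_ge mu_eq.
have muz : mu1 = 0 by apply/eqP; rewrite eq_le mu0 mu_ge.
have Z : \forall x \ae mu, D x -> u x = 0.
  apply: filterS (mu_eq muz) => x h Dx; apply/eqP; apply: contraT => ux.
  by have := nonlin_sign ng ux; rewrite h// mulr0 ltxx.
have : cf u 0%N = 0.
  rewrite (cf_ae oD heig 0 Lu (L20 mD) Z) /cf /dotL2.
  by under eq_intg do rewrite /cst mul0r; rewrite Rintegral_cst// mul0r.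
by rewrite -/xi => xz; rewrite xz ltxx in xi0.
Qed.

Lemma nonlin_hb g t : nonlin g -> `|gamma * t - g t| <= gamma * `|t|.
Proof.
move=> ng; have gb := nonlin_bound ng t; have [->|t0] := eqVneq t 0.
  by rewrite (nonlin0 ng) mulr0 subrr !normr0 mulr0.
have gs := nonlin_sign ng t0; have [tp|tn] := ltP 0 t.
  have gp : 0 < g t by rewrite -(pmulr_rgt0 _ tp).
  move: gb; rewrite !(gtr0_norm tp) (gtr0_norm gp) => gb.
  by rewrite ger0_norm ?subr_ge0// lerBlDr lerDl ltW.
have {}tn : t < 0 by rewrite lt_neqAle t0.
have gn : g t < 0 by rewrite -(nmulr_rgt0 _ tn).
move: gb; rewrite !(ltr0_norm tn) (ltr0_norm gn) => gb.
by rewrite ler0_norm; lra.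
Qed.

Lemma nonlin_admissible g : nonlin g -> admissible gamma (fun t => gamma * t - g t).
Proof.
move=> ng; apply: admissible_h => //; [exact: nonlin_cont|exact: nonlin_mono|].
by move=> t; exact: nonlin_hb.
Qed.

Lemma rhs_nonlin g e u : (fun x => gamma * u x - (gamma * u x - g (u x)) - e x) = (fun x => g (u x) - e x).
Proof. by apply/funext => x; rewrite opprB addrCA subrr addr0. Qed.

Lemma sol_proj g e u mu1 : nonlin g -> source e -> sol g e u mu1 ->
  proj_sol D lam phi (fun x => g (u x) - e x) (fun x => u x - cf u 0%N * phi 0%N x).
Proof.
move=> ng se S; have Lu := sol_L2 S; have LG := nonlin_L2 ng Lu; have Le := source_L2 se.
have Lx := L2Z mD (cf u 0%N) (Lp 0).
have cU k : cf (fun x => u x - cf u 0%N * phi 0%N x) k = cf u k - cf u 0%N * (0%N == k)%:R.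
  by rewrite (cfB oD heig k Lu Lx) (cfZ oD heig _ k (Lp 0)) (cf_phi heig).
split; [exact: L2B|by rewrite cU mulr1 subrr|].
case=> // k _; rewrite cU mulr0 subr0 (sol_coef k.+1 ng se S) mulr0 subr0.
by rewrite (cfB oD heig _ LG Le).
Qed.

(** The projected problem yields [U] in L^2 only. Once [mu1] is chosen to make the right-hand side
    orthogonal to [phi 0%N], [resonance_inverse] provides an H^2 function [z] with the same
    coefficients as [U]. *)
Lemma sol_exists g e xi : nonlin g -> source e -> exists u mu1, sol g e u mu1 /\ cf u 0%N = xi.
Proof.
move=> ng se; have Le := source_L2 se.
have [U [LU U0 HU]] := proj_sol_exists oD bD m0 sbD heig Le g0 gd (nonlin_cont ng)
  (nonlin_mono ng) (fun t => nonlin_hb t ng) xi.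
rewrite rhs_nonlin in HU.
have Lx := L2Z mD xi (Lp 0); have Lu' := L2D mD LU Lx; have LG' := nonlin_L2 ng Lu'.
pose f x := g (U x + xi * phi 0%N x) - e x; have Lf : L2 D f := L2B mD LG' Le.
pose mu1 := cf f 0%N; have Lm := L2Z mD mu1 (Lp 0).
have Lf' : L2 D (fun x => mu1 * phi 0%N x - f x) := L2B mD Lm Lf.
have cf' k : cf (fun x => mu1 * phi 0%N x - f x) k = mu1 * (0%N == k)%:R - cf f k.
  by rewrite (cfB oD heig k Lm Lf) (cfZ oD heig _ k (Lp 0)) (cf_phi heig).
have f'0 : cf (fun x => mu1 * phi 0%N x - f x) 0%N = 0 by rewrite cf' mulr1 subrr.
have [z [dz [ddz [Hz Hz0 z0 eqz]]]] := resonance_inverse Lf' f'0.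
have [[Lz _ _] _] := Hz; have Ll := L2_lap oD Hz.
have zU : \forall x \ae mu, D x -> z x = U x.
  apply: (coef_ae oD heig Lz LU); case=> [|k]; first by rewrite z0 U0.
  have := cf_ae oD heig k.+1 Ll (L2D mD (L2N mD (L2Z mD (lam 0%N) Lz)) Lf') eqz.
  rewrite (cf_lap oD bD heig _ Hz Hz0) (cfD oD heig _ (L2N mD (L2Z mD _ Lz)) Lf') (cfN oD heig _ (L2Z mD _ Lz)).
  rewrite (cfZ oD heig _ _ Lz) cf' mulr0 sub0r -(HU k.+1 isT) => E.
  have p := lt_le_trans delta_gt0 (lam_gap heig (ltn0Sn k)).
  apply: (mulfI (lt0r_neq0 p)); move: E; move: (cf z _) (cf U _) => a b E.
  by rewrite !mulrBl; move: E; rewrite mulrBl; move: (lam _ * a) (lam _ * a) (lam _ * b) (lam _ * b) => *; lra.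
have Hp := phi_H2 heig 0; have Hp0 := phi_H10 oD bD heig 0.
exists (fun x => z x + xi * phi 0%N x), mu1; split; last first.
  by rewrite (cfD oD heig 0 Lz Lx) z0 add0r (cfZ oD heig _ 0 (Lp 0)) (cf_phi heig) mulr1.
have H2u := H2D oD Hz (H2Z oD xi Hp); have H10u := H10D oD bD Hz0 (H10Z oD bD xi Hp0).
exists (fun i x => dz i x + xi * dphi D phi 0 i x), (fun i j x => ddz i j x + xi * ddphi D phi 0 i j x); split => //.
apply: filterS3 eqz zU (phi_lap oD bD heig 0) => x h1 h2 h3 Dx.
have -> : lap (fun i j x => ddz i j x + xi * ddphi D phi 0 i j x) x = lap ddz x + xi * lap (ddphi D phi 0) x.
  by rewrite /lap mulr_sumr -big_split.
by rewrite h1// h3// /f h2//; ring.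
Qed.

(* Strong monotonicity of [-Lap - lam_0 - gamma] on the orthogonal of [phi_0] against the
   monotone part [gamma t - g t]. *)
Lemma sol_gap g e u u' mu1 mu1' : nonlin g -> source e -> sol g e u mu1 -> sol g e u' mu1' ->
  (delta - gamma) * nrm (fun x => (u x - cf u 0%N * phi 0%N x) - (u' x - cf u' 0%N * phi 0%N x)) ^+ 2 <=
  `|cf u 0%N - cf u' 0%N| * (gamma * (nrm u + nrm u')).
Proof.
move=> ng se S S'; have Lu := sol_L2 S; have Lu' := sol_L2 S'.
have E v (a : R) : (fun x => v x - a * phi 0%N x + a * phi 0%N x) = v by apply/funext => x; rewrite subrK.
have A := nonlin_admissible ng; have [cH bH mH] := A; pose h t := gamma * t - g t.
have Q v nu : sol g e v nu -> proj_sol D lam phi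
   (fun x => gamma * (v x - cf v 0%N * phi 0%N x + cf v 0%N * phi 0%N x) -
      h (v x - cf v 0%N * phi 0%N x + cf v 0%N * phi 0%N x) - e x) (fun x => v x - cf v 0%N * phi 0%N x).
  move=> Sv; have := sol_proj ng se Sv; congr proj_sol; apply/funext => x.
  by rewrite /h subrK opprB addrCA subrr addr0.
have G := energy_gap oD heig (source_L2 se) A A (Q _ _ S) (Q _ _ S').
have Lh v : L2 D v -> L2 D (fun x => h (v x)) /\ nrm (fun x => h (v x)) <= gamma * nrm v.
  by move=> Lv; exact: (L2_comp mD cH bH Lv).
have [L1 N1] := Lh u Lu; have [L2' N2] := Lh u' Lu'.
have Ex (v : rV -> R) (a : R) x : v x - a * phi 0%N x + a * phi 0%N x = v x by rewrite subrK.
apply: le_trans G _.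
have -> : (fun x => gamma * (u x - cf u 0%N * phi 0%N x + cf u 0%N * phi 0%N x) - g (u x - cf u 0%N * phi 0%N x + cf u 0%N * phi 0%N x) -
   (gamma * (u' x - cf u' 0%N * phi 0%N x + cf u' 0%N * phi 0%N x) - g (u' x - cf u' 0%N * phi 0%N x + cf u' 0%N * phi 0%N x))) =
   (fun x => h (u x) - h (u' x)) by apply/funext => x; rewrite !Ex.
have -> : (fun x => u x - cf u 0%N * phi 0%N x + cf u 0%N * phi 0%N x - (u' x - cf u' 0%N * phi 0%N x + cf u' 0%N * phi 0%N x)) =
   (fun x => u x - u' x) by apply/funext => x; rewrite !Ex.
have D0 : 0 <= dot (fun x => h (u x) - h (u' x)) (fun x => u x - u' x) by apply: Rintegral_ge0 => x _; exact: mH.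
have NN : nrm (fun x => h (u x) - h (u' x)) <= gamma * (nrm u + nrm u').
  by apply: le_trans (normL2_triB mD L1 L2') _; rewrite mulrDr lerD.
have := ler_wpM2l (normr_ge0 (cf u 0%N - cf u' 0%N)) NN.
by move: D0; move: (dot _ _) (_ * nrm _) => a b; lra.
Qed.

Lemma sol_unique g e u u' mu1 mu1' : nonlin g -> source e -> sol g e u mu1 -> sol g e u' mu1' ->
  cf u 0%N = cf u' 0%N -> mu1 = mu1' /\ \forall x \ae mu, D x -> u x = u' x.
Proof.
move=> ng se S S' E; have Lu := sol_L2 S; have Lu' := sol_L2 S'.
have LU := L2B mD Lu (L2Z mD (cf u 0%N) (Lp 0)); have LU' := L2B mD Lu' (L2Z mD (cf u' 0%N) (Lp 0)).
have G := sol_gap ng se S S'; rewrite [X in `|X|](_ : _ = 0) ?E ?subrr// normr0 mul0r in G.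
have kap : 0 < delta - gamma by rewrite subr_gt0.
have Z : nrm (fun x => (u x - cf u 0%N * phi 0%N x) - (u' x - cf u' 0%N * phi 0%N x)) = 0.
  by apply/eqP; rewrite -sqrf_eq0 eq_le sqr_ge0 andbT -(pmulr_rle0 _ kap) E.
have uu : \forall x \ae mu, D x -> u x = u' x.
  have := normL2_eq0 mD (L2B mD LU LU') Z; apply: filterS => x H Dx; have := H Dx.
  by rewrite E => /subr0_eq /addIr.
split => //; rewrite (sol_mu ng se S) (sol_mu ng se S').
apply: (cf_ae oD heig 0 (nonlin_L2 ng Lu) (nonlin_L2 ng Lu')).
by apply: filterS uu => x H Dx; rewrite H.
Qed.

Lemma normH2_bound : exists2 C : R, 0 <= C & forall u du ddu, H2 D u du ddu -> H10 D u du ->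
  normH D 2 u <= C * (nrm u + nrm (lap ddu)).
Proof.
have [C C0 HC] := h2_estimate oD bD (eigen_dense oD bD heig) m0 sbD.
have [C' C'0 HC'] := normH_le D 2.
exists (C' * (1 + C)) => [|u du ddu Hu Hu0]; first by rewrite mulr_ge0// addr_ge0.
have [[Lu Ldu _] Hd] := Hu; have Ldd i j : L2 D (ddu i j) by have [] := Hd i.
have B0 : 0 <= nrm u + nrm (lap ddu) by rewrite addr_ge0 ?normL2_ge0.
rewrite -mulrA; apply: HC' => [|s ss]; first by rewrite mulr_ge0// addr_ge0.
have lb a : a <= nrm u + nrm (lap ddu) -> a <= (1 + C) * (nrm u + nrm (lap ddu)).
  by move=> h; apply: le_trans h _; rewrite ler_peMl// lerDl.
case: s ss => [|i [|j [|//]]] _.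
- have [L W] := weak_deriv0_ae oD bD Lu; rewrite (normL2_ae mD L Lu W).
  by apply: lb; rewrite lerDl normL2_ge0.
- have [L W] := weak_deriv1_ae oD bD i (H2_H1 Hu); rewrite (normL2_ae mD L (Ldu i) W).
  by apply: lb; exact: (grad_le oD i Hu Hu0).
- have [L W] := weak_deriv2_ae oD bD i j Hu; rewrite (normL2_ae mD L (Ldd i j) W).
  by apply: le_trans (HC _ _ _ Hu Hu0 i j) _; rewrite ler_wpM2r// lerDr.
Qed.

(** Makes the gap inequality quantitative: for [r] small the term in [s] on the right is absorbed,
    leaving [s ^+ 2 <= M * r], a modulus of continuity of order one half. *)
Lemma modulus (k ga n t : R) : 0 < k -> 0 < ga -> 0 <= n -> 0 < t -> exists2 d : R, 0 < d &
  forall s r, 0 <= s -> 0 <= r -> r < d -> k * s ^+ 2 <= r * (ga * (2 * n + s + r)) -> s + r <= t.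
Proof.
move=> k0 ga0 n0 t0; pose M := 2 * (ga * (2 * n + 2)) / k.
have M0 : 0 <= M by rewrite divr_ge0 ?(ltW k0)// mulr_ge0// mulr_ge0 ?addr_ge0 ?mulr_ge0// ltW.
have p1 : 0 < k / (2 * ga) by rewrite divr_gt0// mulr_gt0.
have p2 : 0 < t / 2 by rewrite divr_gt0.
have p3 : 0 < (t / 2) ^+ 2 / (M + 1) by rewrite divr_gt0 ?exprn_gt0// ltr_wpDl.
exists (Num.min (Num.min 1 (k / (2 * ga))) (Num.min (t / 2) ((t / 2) ^+ 2 / (M + 1)))).
  by rewrite !lt_min ltr01 p1 p2 p3.
move=> s r s0 r0; rewrite !lt_min => /andP[/andP[r1 r2] /andP[r3 r4]] H.
have r2' : r * ga <= k / 2.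
  have E : r * (2 * ga) = 2 * (r * ga) by ring.
  by move: r2; rewrite ltr_pdivlMr ?mulr_gt0// E; move: (r * ga) => q; lra.
have q0 : 0 <= r * ga by rewrite mulr_ge0// ltW.
have ss : s <= 1 + s ^+ 2 by rewrite expr2; nra.
have H1 : k * s ^+ 2 <= r * ga * (2 * n + 2) + k / 2 * s ^+ 2.
  apply: le_trans H _; rewrite mulrA.
  apply: (@le_trans _ _ (r * ga * (2 * n + 2 + s ^+ 2))).
    rewrite ler_wpM2l//; move: r1 ss; move: (s ^+ 2) => q *; lra.
  by rewrite mulrDr lerD2l ler_wpM2r ?sqr_ge0.
have H2 : s ^+ 2 <= M * r.
  rewrite /M mulrAC ler_pdivlMr// mulrC.
  have -> : 2 * (ga * (2 * n + 2)) * r = 2 * (r * ga * (2 * n + 2)) by ring.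
  by move: H1; move: (r * ga * _) => q; rewrite [k / 2 * _]mulrAC; move: (k * s ^+ 2) => q'; lra.
have H3 : s ^+ 2 <= (t / 2) ^+ 2.
  by apply: le_trans H2 _; apply: frac_le => //; [exact: sqr_ge0|exact: ltW].
have : s <= t / 2 by move: H3; rewrite ler_sqr ?nnegrE// ltW.
by move: r3 => *; lra.
Qed.

(** [sol_gap] and [modulus] give continuity in L^2. Continuity of the superposition operator passes
    it on to [g(u)], hence to [mu1]; the equation then controls the Laplacian, and [normH2_bound]
    the full H^2 norm. *)
Lemma sol_continuous g e u mu1 eps : nonlin g -> source e -> sol g e u mu1 -> 0 < eps -> exists2 d : R, 0 < d &
  forall u' mu1', sol g e u' mu1' -> `|cf u' 0%N - cf u 0%N| < d ->
  normH D 2 (u' \- u) <= eps /\ `|mu1' - mu1| <= eps.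
Proof.
move=> ng se S eps0; have [C C0 HC] := normH2_bound; have l0 := eig_gt0 heig.
have Lu := sol_L2 S; have LG := nonlin_L2 ng Lu.
(* The bound for the H^2 norm adds the norm of [u' - u], [lam 0%N] times it, the difference of the
   nonlinear terms and that of the multipliers, each factor being at most [eta]. *)
pose A := C * (3 + lam 0%N); have A0 : 0 <= A by rewrite mulr_ge0// addr_ge0// ltW.
pose eta := eps / (A + 1); have eta0 : 0 < eta by rewrite divr_gt0// ltr_wpDl.
have eta1 : eta <= eps by rewrite ler_pdivrMr ?ltr_wpDl// ler_peMr ?(ltW eps0)// lerDr.
have [d1 d10 Hd1] := nemytskii mD fD (nonlin_cont ng) (nonlin_bound ng) Lu eta0.
have kap : 0 < delta - gamma by rewrite subr_gt0.
have t0 : 0 < Num.min eta d1 by rewrite lt_min eta0.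
have [d d0 Hd] := modulus kap g0 (normL2_ge0 D u) t0.
exists d => // u' mu1' S' du'; have Lu' := sol_L2 S'; have LG' := nonlin_L2 ng Lu'.
have Lw := L2B mD Lu' Lu.
have LU := L2B mD Lu (L2Z mD (cf u 0%N) (Lp 0)); have LU' := L2B mD Lu' (L2Z mD (cf u' 0%N) (Lp 0)).
pose s := nrm (fun x => (u' x - cf u' 0%N * phi 0%N x) - (u x - cf u 0%N * phi 0%N x)).
pose r := `|cf u' 0%N - cf u 0%N|.
have wsr : nrm (fun x => u' x - u x) <= s + r.
  have -> : (fun x => u' x - u x) = (fun x => ((u' x - cf u' 0%N * phi 0%N x) - (u x - cf u 0%N * phi 0%N x)) +
     (cf u' 0%N - cf u 0%N) * phi 0%N x) by apply/funext => x; ring.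
  apply: le_trans (normL2_tri mD (L2B mD LU' LU) (L2Z mD _ (Lp 0))) _.
  by rewrite (normL2Z mD _ (Lp 0)) (nrm_phi heig) mulr1.
have u's : nrm u' <= nrm u + (s + r).
  have -> : u' = (fun x => u x + (u' x - u x)) by apply/funext => x; rewrite addrC subrK.
  by apply: le_trans (normL2_tri mD Lu Lw) _; rewrite lerD2l.
have G := sol_gap ng se S' S.
have w_le : nrm (fun x => u' x - u x) <= Num.min eta d1.
  apply: le_trans wsr _; apply: Hd => //; [exact: normL2_ge0|exact: normr_ge0|].
  apply: le_trans G _; rewrite ler_wpM2l// (ler_wpM2l (ltW g0))//.
  by move: u's; move: (nrm u) (nrm u') => a b; lra.
move: w_le; rewrite le_min => /andP[w1 w2].
have Gle := Hd1 _ Lu' w2; have LdG := L2B mD LG' LG.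
have mle : `|mu1' - mu1| <= eta.
  rewrite (sol_mu ng se S) (sol_mu ng se S') -(cfB oD heig 0 LG' LG); apply: le_trans Gle.
  by have := dot_CS mD LdG (Lp 0); rewrite (nrm_phi heig) mulr1.
split; last exact: le_trans eta1.
have [dv [ddv [Hu Hu0 equ]]] := S; have [dv' [ddv' [Hu' Hu0' equ']]] := S'.
have HH := H2B oD Hu' Hu; have HH0 := H10B oD bD Hu0' Hu0; have Ll := L2_lap oD HH.
apply: le_trans (HC _ _ _ HH HH0) _.
have ll : nrm (lap (fun i j x => ddv' i j x - ddv i j x)) <= lam 0%N * nrm (fun x => u' x - u x) +
    (nrm (fun x => g (u' x) - g (u x)) + `|mu1' - mu1|).
  have L1 := L2Z mD (- lam 0%N) Lw; have L2' := L2N mD LdG; have L3 := L2Z mD (mu1' - mu1) (Lp 0).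
  have -> : lam 0%N * nrm (fun x => u' x - u x) = nrm (fun x => - lam 0%N * (u' x - u x)).
    by rewrite (normL2Z mD _ Lw) normrN gtr0_norm.
  rewrite -(normL2N D (fun x => g (u' x) - g (u x))).
  have -> : `|mu1' - mu1| = nrm (fun x => (mu1' - mu1) * phi 0%N x).
    by rewrite (normL2Z mD _ (Lp 0)) (nrm_phi heig) mulr1.
  apply: le_trans (lerD (lexx _) (normL2_tri mD L2' L3)).
  apply: le_trans (normL2_tri mD L1 (L2D mD L2' L3)).
  rewrite le_eqVlt; apply/orP; left; apply/eqP; apply: (normL2_ae mD Ll (L2D mD L1 (L2D mD L2' L3))).
  apply: filterS2 equ equ' => x h h' Dx.
  have -> : lap (fun i j x => ddv' i j x - ddv i j x) x = lap ddv' x - lap ddv x by rewrite /lap -sumrB.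
  have -> : lap ddv x = mu1 * phi 0%N x + e x - lam 0%N * u x - g (u x) by rewrite -h//; ring.
  have -> : lap ddv' x = mu1' * phi 0%N x + e x - lam 0%N * u' x - g (u' x) by rewrite -h'//; ring.
  by ring.
apply: (@le_trans _ _ (C * ((3 + lam 0%N) * eta))).
  rewrite (ler_wpM2l C0)//; have := ler_wpM2l (ltW l0) w1; move: ll w1 Gle mle; rewrite mulrDl.
  by move: (nrm _) (nrm _) (nrm _) (lam 0%N * _) (lam 0%N * _) (`|_|) => *; lra.
by rewrite mulrA; apply: frac_le => //; exact: ltW.
Qed.

End solution_curve.

(** * From the hypotheses on [g] and [e] to [nonlin] and [source] *)

Section data.
Context {R : realType}.

Lemma C1_lipschitz_right (g : R -> R) (gamma a b : R) : C1 g -> (forall t, derive1 g t <= gamma) -> a <= b ->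
  g b - g a <= gamma * (b - a).
Proof.
move=> [dg _] gg; rewrite le_eqVlt => /orP[/eqP <-|ab]; first by rewrite !subrr mulr0.
have D x : is_derive x (1 : R) g (derive1 g x) by apply: DeriveDef; [exact: dg|rewrite derive1E].
have cg : {within `[a, b], continuous g} by apply: derivable_within_continuous => x _; exact: dg.
have [c _ ->] := MVT ab (fun x _ => D x) cg.
by rewrite ler_wpM2r// subr_ge0 ltW.
Qed.

Lemma C1_continuous (g : R -> R) : C1 g -> continuous g.
Proof. by move=> [dg _] x; apply: differentiable_continuous; apply/derivable1_diffP; exact: dg. Qed.

Lemma sign_zero (g : R -> R) : continuous g -> (forall t, t != 0 -> 0 < t * g t) -> g 0 = 0.
Proof.
move=> cg gs; pose a (n : nat) : R := n.+1%:R^-1; have a0 n : 0 < a n by rewrite invr_gt0.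
have ca : a @ \oo --> (0 : R) by exact: cvg_harmonic.
have c1 : (fun n => g (a n)) @ \oo --> g 0 by apply: continuous_cvg; [exact: cg|exact: ca].
have c2 : (fun n => g (- a n)) @ \oo --> g 0.
  apply: continuous_cvg; first exact: cg.
  by rewrite -[X in _ --> X]oppr0; exact: cvgN.
apply/eqP; rewrite eq_le; apply/andP; split.
  apply: (ler_cvg_to c2 (cvg_cst (0 : R))); apply: nearW => n.
  have := gs (- a n); rewrite oppr_eq0 (gt_eqF (a0 n)) => /(_ isT).
  by rewrite nmulr_rgt0 ?oppr_lt0// => /ltW.
apply: (ler_cvg_to (cvg_cst (0 : R)) c1); apply: nearW => n.
by have := gs (a n) (lt0r_neq0 (a0 n)); rewrite pmulr_rgt0// => /ltW.
Qed.

(** As [g 0 = 0] and [g] has the sign of its argument, the one-sided slope bound becomes the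
    two-sided bound [|g t| <= gamma |t|]; [gamma] is positive because [g 1] is. *)
Lemma nonlin_of_C1 (g : R -> R) (gamma : R) : C1 g -> (forall t, t != 0 -> 0 < t * g t) ->
  (forall t, derive1 g t <= gamma) -> 0 < gamma /\ nonlin gamma g.
Proof.
move=> hg gs gg; have cg := C1_continuous hg; have gz := sign_zero cg gs.
have L a b := @C1_lipschitz_right g gamma a b hg gg.
have gam0 : 0 < gamma.
  have := L 0 1 ler01; rewrite gz !subr0 mulr1; apply: lt_le_trans.
  by have := gs 1 (oner_neq0 _); rewrite mul1r.
split => //; split => // [t|a b ab]; last by have := L a b ab; rewrite mulrBr; lra.
have [->|t0] := eqVneq t 0; first by rewrite gz !normr0 mulr0.
have st := gs t t0; have [tp|tn] := ltP 0 t.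
  have gp : 0 < g t by rewrite -(pmulr_rgt0 _ tp).
  by have := L 0 t (ltW tp); rewrite gz !subr0 !gtr0_norm.
have {}tn : t < 0 by rewrite lt_neqAle t0.
have gn : g t < 0 by rewrite -(nmulr_rgt0 _ tn).
by have := L t 0 (ltW tn); rewrite gz !sub0r !ltr0_norm.
Qed.

Context {m : nat}.
Local Notation rV := 'rV[R]_m.

Lemma source_of_Linfty (D : set rV) (phi : nat -> rV -> R) (e : rV -> R) : open D -> bounded_set D ->
  Linfty D e -> dotL2 D e (phi 0%N) = 0 -> source D phi e.
Proof.
move=> oD bD [me [M HM]] e0; have mD := measurable_open_rV oD.
have fD := measurable_bounded_rV_lty mD bD.
split => //; last by exists `|M| => //; apply: filterS HM => x H Dx; apply: le_trans (H Dx) (ler_norm M).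
split => //; apply/integrableP; split; first by apply/measurable_EFinP; exact: measurable_funX.
have mI : (lebesgue_rV R m).-integrable D (EFin \o cst (M ^+ 2)).
  by apply: measurable_bounded_integrable => //; exact: bounded_cst.
have [mc] := integrableP _ _ _ mI; apply: le_lt_trans; apply: ae_ge0_le_integral => //.
- by apply: measurableT_comp => //; apply/measurable_EFinP; exact: measurable_funX.
- exact: measurableT_comp.
- apply: filterS HM => x H Dx; rewrite lee_fin !normrX lerXn2r ?nnegrE// .
  exact: le_trans (H Dx) (ler_norm M).
Qed.

End data.

Theorem theorem4p1 (R : realType) (m : nat) (hm : (0 < m)%N)
    (Omega : set 'rV[R]_m) (hOmega : smooth_bounded_domain Omega)
    (lam : nat -> R) (phi : nat -> 'rV[R]_m -> R)
    (heig : dirichlet_eigensystem Omega lam phi)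
    (e : 'rV[R]_m -> R) (he : Linfty Omega e)
    (he1 : dotL2 Omega e (phi 0%N) = 0)
    (g : R -> R) (gamma : R) (hg : C1 g)
    (hsign : forall t : R, t != 0 -> 0 < t * g t)
    (hg' : forall t : R, derive1 g t <= gamma)
    (hgamma : gamma < lam 1%N - lam 0%N) :
  exists (u : R -> 'rV[R]_m -> R) (mu1 : R -> R),
    [/\ (forall xi,
           dirichlet_solution Omega (lam 0%N) g
             (fun x => mu1 xi * phi 0%N x + e x) (u xi) /\
           dotL2 Omega (u xi) (phi 0%N) = xi),
        ((forall xi, normH Omega 2 (u eta \- u xi) @[eta --> xi] --> (0 : R)) /\
         continuous mu1),
        (forall (v : 'rV[R]_m -> R) (mu : R),
           dirichlet_solution Omega (lam 0%N) g
             (fun x => mu * phi 0%N x + e x) v ->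
           exists xi, mu = mu1 xi /\
             (\forall x \ae lebesgue_rV R m, Omega x -> v x = u xi x)),
        ((\forall xi \near +oo, 0 < mu1 xi) /\
         (\forall xi \near -oo, mu1 xi < 0)) &
        (exists xi0, mu1 xi0 = 0 /\
           dirichlet_solution Omega (lam 0%N) g e (u xi0))].
Proof.
have [oD cD nD bD sbD] := hOmega.
have [g0 ng] := nonlin_of_C1 hg hsign hg'.
have se := source_of_Linfty oD bD he he1.
have solE v nu : sol Omega lam phi g e v nu <->
    dirichlet_solution Omega (lam 0%N) g (fun x => nu * phi 0%N x + e x) v.
  split=> [[dv [ddv [Hv Hv0 eqv]]]|[Hv Hv0 eqv]].
    split; [exact: H2_sobolevH Hv|exact: (H10_sobolevH10 _ _ Hv0)|].
    by apply: filterS2 eqv (laplacian_ae oD bD Hv) => x h1 h2 Dx; rewrite h2// h1.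
  have Hv2 := sobolevH_H2 Hv; exists (fun i => weak_deriv Omega [:: i] v), (fun i j => weak_deriv Omega [:: i; j] v).
  split => //; exact: (sobolevH10_H10 oD bD Hv0).
have ex xi := sol_exists oD bD hm sbD heig g0 hgamma xi ng se.
have [u Hu] := choice ex; have [mu1 Hs] := choice Hu.
have S xi : sol Omega lam phi g e (u xi) (mu1 xi) by have [] := Hs xi.
have C xi : cf Omega phi (u xi) 0%N = xi by have [] := Hs xi.
(* Choosing the solutions arbitrarily does no harm: [sol_continuous] compares any two solutions
   through their first coefficients. *)
have cont xi eps : 0 < eps -> exists2 d : R, 0 < d & forall eta, `|eta - xi| < d ->
    normH Omega 2 (u eta \- u xi) <= eps /\ `|mu1 eta - mu1 xi| <= eps.
  move=> eps0; have [d d0 Hd] := sol_continuous oD bD hm sbD heig g0 hgamma ng se (S xi) eps0.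
  by exists d => // eta H; apply: (Hd _ _ (S eta)); rewrite !C.
have cmu : continuous mu1.
  move=> xi; apply/cvgrPdist_le => eps eps0; have [d d0 Hd] := cont xi eps eps0.
  apply/nbhs_ballP; exists d => // eta xe.
  have /Hd[_] : `|eta - xi| < d by rewrite distrC; exact: xe.
  by rewrite distrC.
have [X HX] := sol_mu_pos oD bD hm sbD heig g0 hgamma ng se.
(* The reflected problem has first coefficient [- xi] and multiplier [- mu1], so its threshold [Y]
   governs [xi < - Y]. *)
have [Y HY] := sol_mu_pos oD bD hm sbD heig g0 hgamma (nonlin_opp ng) (source_opp oD heig se).
have pos xi : X < xi -> 0 < mu1 xi by move=> H; apply: (HX _ _ (S xi)); rewrite C.
have neg xi : xi < - Y -> mu1 xi < 0.
  move=> H; rewrite -oppr_gt0; apply: (HY _ _ (sol_opp oD bD (S xi))).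
  by rewrite (cfN oD heig _ (sol_L2 (S xi))) C ltrNr.
exists u, mu1; split.
- by move=> xi; split; [exact/solE|exact: C].
- split => // xi; apply/cvgrPdist_le => eps eps0; have [d d0 Hd] := cont xi eps eps0.
  apply/nbhs_ballP; exists d => // eta xe.
  have /Hd[H _] : `|eta - xi| < d by rewrite distrC; exact: xe.
  by rewrite sub0r normrN ger0_norm// sqrtr_ge0.
- move=> v nu /solE Sv; exists (cf Omega phi v 0%N).
  have Q := sol_unique oD bD heig hgamma ng se Sv (S (cf Omega phi v 0%N)).
  by apply: Q; rewrite C.
- split.
    by apply: filterS (nbhs_pinfty_gt (num_real X)) => xi; exact: pos.
  by apply: filterS (nbhs_ninfty_lt (num_real (- Y))) => xi; exact: neg.
(* Taking the minimum with [X] ensures [a <= b] whatever the relative position of the two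
   thresholds. *)
pose a := Num.min (- Y) X - 1; pose b := X + 1.
have aX : Num.min (- Y) X <= X by rewrite ge_min lexx orbT.
have aY : Num.min (- Y) X <= - Y by rewrite ge_min lexx.
have ab : a <= b by rewrite /a /b; lra.
have ma : mu1 a < 0 by apply: neg; rewrite /a; lra.
have mb : 0 < mu1 b by apply: pos; rewrite /b ltrDl.
have [xi0 _ Hxi] : exists2 c, c \in `[a, b] & mu1 c = 0.
  apply: IVT => //; first exact: continuous_subspaceT.
  by rewrite ge_min le_max (ltW ma) (ltW mb) orbT.
exists xi0; split => //; have /solE[h1 h2 h3] := S xi0; split => //.
by apply: filterS h3 => x H Dx; rewrite H// Hxi mul0r add0r.
Qed.
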